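(* Let $M=C\varepsilon^{-\sigma}$ with $\sigma\in(0,1)$ and $C>0$ a constant (with $\varepsilon\to0$ through values for which $M$ is a positive integer), and let $f\in L^2(D)$. Assume that the coefficient field $A(y,\omega)$ satisfies the ellipticity bounds with constants $0<\alpha\le\beta$, is stationary, i.e. $A(y+\mathbf{k},\omega)=A(y,\tau_{\mathbf{k}}\omega)$ for every $\mathbf{k}\in\mathbb{Z}^d$, a.e. $y$ and $\mathbb{P}$-a.s., has a uniform mixing coefficient $\gamma$ satisfying $\gamma(s)\le c(1+s)^{-\theta}$ for all $s>0$ and some constants $c,\theta>0$, and that $A(\cdot,\omega)$ is $\mathcal Q_M$-periodic (i.e. $M\mathbb Z^d$-periodic) for $\mathbb P$-a.e. $\omega\in\Omega$. Let $u^\varepsilon(\cdot,\omega)\in H_0^1(D)$ be the weak solution of $$-\mathrm{div}\big(A(\tfrac x\varepsilon,\omega)\nabla u^\varepsilon(x,\omega)\big)=f(x)\ \text{ in }D,\qquad u^\varepsilon=0\ \text{ on }\partial D,$$ and let $u^0_0\in H_0^1(D)$ be the weak solution of $$-\mathrm{div}\big(\mathbb E[\hat A^0]\nabla u_0^0(x)\big)=f(x)\ \text{ in }D,\qquad u_0^0=0\ \text{ on }\partial D,$$ where $\hat A^0$ is the equivalent matrix on the cell $\mathcal Q_M$. Then $$\lim_{\varepsilon\to0}\mathbb E\big(\|u^\varepsilon(\cdot,\omega)-u_0^0\|^2_{L^2(D)}\big)=0.$$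
   Context: Let $d\in\{1,2,3\}$, $D\subset\mathbb{R}^d$ a bounded domain, $(\Omega,\mathcal F,\mathbb P)$ a probability space with expectation $\mathbb E$. For an integer $M\ge 1$ let $\mathcal Q_M=(0,M)^d$. $\{e_i\}_{i=1}^d$ is the canonical basis of $\mathbb R^d$. $f$ is deterministic. The coefficient field $A(y,\omega)=(a_{ij}(y,\omega))$, $y\in\mathbb R^d$, is a random field of invertible real $d\times d$ matrices with $L^\infty$ entries; the ellipticity bounds are $\alpha|\xi|^2\le (A(y,\omega)\xi,\xi)\le\beta|\xi|^2$ for all $\xi\in\mathbb R^d$, a.e. $y$, $\mathbb P$-a.s. $(\tau_{\mathbf k})_{\mathbf k\in\mathbb Z^d}$ is an action of $\mathbb Z^d$ on $\Omega$ that preserves $\mathbb P$ and is ergodic (if $E\in\mathcal F$ satisfies $\tau_{\mathbf k}E=E$ for all $\mathbf k$, then $\mathbb P(E)\in\{0,1\}$). Equivalent matrix on $\mathcal Q_M$: let $\mathbb N^{0}_{e_i}(\cdot,\omega)$ be the $\mathcal Q_M$-periodic (i.e. $M\mathbb Z^d$-periodic) $H^1_{loc}$ weak solution, unique up to an additive constant, of $-\mathrm{div}[A(y,\omega)(e_i+\nabla\mathbb N^{0}_{e_i}(y,\omega))]=0$ in $\mathcal Q_M$ (with periodic boundary conditions). Then $\hat A^0(\omega)=(\hat a^0_{ij}(\omega))$ with $$\hat a^{0}_{ij}(\omega)=\frac1{|\mathcal Q_M|}\int_{\mathcal Q_M}(e_i+\nabla\mathbb N^{0}_{e_i}(y,\omega))^TA(y,\omega)(e_j+\nabla\mathbb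 N^{0}_{e_j}(y,\omega))\,dy.$$ Uniform mixing coefficient of a random field $B(y,\omega)$, $y\in\mathbb R^d$: for $G\subset\mathbb R^d$ let $\mathcal F_G=\sigma\{B(y):y\in G\}$; then $$\gamma(s)=\sup_{G_1,G_2\subset\mathbb R^d,\ \mathrm{dist}(G_1,G_2)\ge s}\ \sup_{E_1\in\mathcal F_{G_1},\,E_2\in\mathcal F_{G_2}}|\mathbb P(E_1\cap E_2)-\mathbb P(E_1)\mathbb P(E_2)|.$$ *)

(* Defs.v *)
From HB Require Import structures.
From mathcomp Require Import all_boot all_order all_algebra.
From mathcomp Require Import all_classical all_reals all_analysis.
Set Implicit Arguments.
Unset Strict Implicit.
Unset Printing Implicit Defensive.
Import Order.TTheory GRing.Theory Num.Theory.
Import numFieldNormedType.Exports.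
Local Open Scope classical_set_scope.
Local Open Scope ring_scope.

(* Points of R^d are row vectors 'rV[R]_d; gradients, and the vectors that    *)
(* coefficient matrices act on, are column vectors 'cV[R]_d.                  *)

(* Matrices carry the sigma-algebra generated by the entries, i.e. the Borel  *)
(* sigma-algebra of R^(m * n).                                                *)
Section matrix_measurable.
Context {R : realType} {m n : nat}.

Definition matrix_cylinder : set (set 'M[R]_(m, n)) :=
  [set X | exists i j (B : set R),
    measurable B /\ X = (fun A : 'M[R]_(m, n) => A i j) @^-1` B].

Let measurable0 : <<s matrix_cylinder >> set0.
Proof. exact: sigma_algebra0. Qed.

Let measurableC X : <<s matrix_cylinder >> X -> <<s matrix_cylinder >> (~` X).
Proof. exact: sigma_algebraC. Qed.

Let measurable_bigcup (F : (set 'M[R]_(m, n))^nat) :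
  (forall i, <<s matrix_cylinder >> (F i)) ->
  <<s matrix_cylinder >> (\bigcup_i F i).
Proof. exact: sigma_algebra_bigcup. Qed.

HB.instance Definition _ := @isMeasurable.Build (sigma_display matrix_cylinder)
  'M[R]_(m, n) <<s matrix_cylinder >> measurable0 measurableC measurable_bigcup.

Lemma measurable_coord i j :
  measurable_fun setT (fun A : 'M[R]_(m, n) => A i j : R).
Proof.
by move=> _ B mB; rewrite setTI; apply: sub_sigma_algebra; exists i, j, B.
Qed.

Lemma measurable_fun_matrixP d (T : measurableType d) (f : T -> 'M[R]_(m, n)) :
  (forall i j, measurable_fun setT (fun t => f t i j : R)) ->
  measurable_fun setT f.
Proof.
move=> mf; apply: (@measurability _ _ _ _ _ _ matrix_cylinder) => //.
by move=> _ [_ [i [j [B [mB ->]]]] <-]; exact: mf.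
Qed.

End matrix_measurable.

Section lebesgue_rV.
Context {R : realType}.

Section step.
Context {d : nat} (mu : {sigma_finite_measure set 'rV[R]_d -> \bar R}).

Let glue (p : measurableTypeR R * 'rV[R]_d) : 'rV[R]_d.+1 :=
  row_mx (p.1 : R)%:M p.2.

Let unglue (x : 'rV[R]_d.+1) : measurableTypeR R * 'rV[R]_d :=
  (x 0 0, \row_i x 0 (lift 0 i)).

Let glue0 p : glue p 0 0 = p.1.
Proof.
have e : ((p.1 : R)%:M : 'M[R]_1) 0 0 = p.1 by rewrite mxE mulr1n.
rewrite -[RHS]e -[RHS](row_mxEl _ p.2).
by congr (row_mx _ _ _ _); exact/val_inj.
Qed.

Let glue_lift p i : glue p 0 (lift 0 i) = p.2 0 i.
Proof.
rewrite -[RHS](row_mxEr (p.1 : R)%:M).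
by congr (row_mx _ _ _ _); exact/val_inj.
Qed.

Let glueK : cancel glue unglue.
Proof.
move=> [t v]; congr pair; first exact: glue0.
by apply/rowP => i; rewrite mxE glue_lift.
Qed.

Let measurable_glue : measurable_fun setT glue.
Proof.
apply: measurable_fun_matrixP => i j; rewrite ord1.
case: (unliftP 0 j) => [k|] ->.
  rewrite (_ : (fun _ => _) = (fun v : 'rV[R]_d => v 0 k : R) \o snd).
    by apply: measurableT_comp => //; exact: measurable_coord.
  by apply/funext => p; rewrite glue_lift.
rewrite (_ : (fun _ => _) = fst); first exact: measurable_fst.
by apply/funext => p; rewrite glue0.
Qed.

Let measurable_unglue : measurable_fun setT unglue.
Proof.
apply/measurable_fun_pairP; split; first exact: measurable_coord.
apply: measurable_fun_matrixP => i j.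
rewrite (_ : (fun _ => _) = (fun x : 'rV[R]_d.+1 => x 0 (lift 0 j) : R)).
  exact: measurable_coord.
by apply/funext => x; rewrite /= mxE.
Qed.

(* Lebesgue measure in the first coordinate times mu in the others. *)
Definition lebesgue_rV_step : set 'rV[R]_d.+1 -> \bar R :=
  pushforward (lebesgue_measure \x mu)%E glue.

Let step0 : lebesgue_rV_step set0 = 0%E.
Proof. by rewrite /lebesgue_rV_step /pushforward preimage_set0 measure0. Qed.

Let step_ge0 A : (0 <= lebesgue_rV_step A)%E.
Proof. exact: measure_ge0. Qed.

Let step_sigma_additive : semi_sigma_additive lebesgue_rV_step.
Proof.
have mpre (A : set 'rV[R]_d.+1) : measurable A -> measurable (glue @^-1` A).
  by move=> mA; rewrite -[X in measurable X]setTI; exact: measurable_glue.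
move=> F mF tF mUF; rewrite /lebesgue_rV_step /pushforward preimage_bigcup.
apply: measure_semi_sigma_additive.
- by move=> n; exact: mpre.
- apply/trivIsetP => /= i j _ _ ij; rewrite -preimage_setI.
  by move/trivIsetP : tF => /(_ _ _ _ _ ij) ->//; rewrite preimage_set0.
- by rewrite -preimage_bigcup; exact: mpre.
Qed.

HB.instance Definition _ := isMeasure.Build _ _ _ lebesgue_rV_step
  step0 step_ge0 step_sigma_additive.

Lemma lebesgue_rV_stepE (A : set R) (B : set 'rV[R]_d) :
  measurable A -> measurable B ->
  lebesgue_rV_step [set x | A (x 0 0) /\ B (\row_i x 0 (lift 0 i))] =
  (lebesgue_measure A * mu B)%E.
Proof.
move=> mA mB; rewrite -product_measure1E//= /lebesgue_rV_step /pushforward.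
by congr (_ _); apply/seteqP; split=> -[t v]; rewrite /= glue0;
  rewrite (_ : \row_i _ = v)//; apply/rowP => i; rewrite mxE glue_lift.
Qed.

Let step_sigma_finite : sigma_finite setT lebesgue_rV_step.
Proof.
have /sigma_finiteP[F [FT ndF Foo]] := sigma_finiteT (@lebesgue_measure R).
have /sigma_finiteP[G [GT ndG Goo]] := sigma_finiteT mu.
exists (fun k => [set x : 'rV[R]_d.+1 | F k (x 0 0) /\ G k (\row_i x 0 (lift 0 i))]).
  apply/seteqP; split=> // x _.
  have [n _ Fn] : (\bigcup_n F n) (x 0 0) by rewrite -FT.
  have [k _ Gk] : (\bigcup_n G n) (\row_i x 0 (lift 0 i)) by rewrite -GT.
  exists (maxn n k) => //; split.
    by move: Fn; exact/subsetPset/ndF/leq_maxl.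
  by move: Gk; exact/subsetPset/ndG/leq_maxr.
move=> k; have [mF Fk] := Foo k; have [mG Gk] := Goo k; split.
  rewrite (_ : mkset _ = unglue @^-1` (F k `*` G k))//.
  rewrite -[X in measurable X]setTI; apply: measurable_unglue => //.
  exact: measurableX.
by rewrite lebesgue_rV_stepE// lte_mul_pinfty// ge0_fin_numE.
Qed.

HB.instance Definition _ := Measure_isSigmaFinite.Build _ _ _ lebesgue_rV_step
  step_sigma_finite.

End step.

Fixpoint lebesgue_rV (d : nat) : {sigma_finite_measure set 'rV[R]_d -> \bar R} :=
  match d with
  | 0 => dirac (0 : 'rV[R]_0)
  | d'.+1 => lebesgue_rV_step (lebesgue_rV d')
  end.

Lemma lebesgue_rV_box d (a b : 'I_d -> R) : (forall i, a i <= b i) ->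
  lebesgue_rV d [set x | forall i, a i < x 0 i < b i] =
  (\prod_(i < d) (b i - a i))%:E.
Proof.
elim: d a b => [|d IH] a b ab.
  rewrite big_ord0 /= /dirac indicE mem_set//; by case.
rewrite big_ord_recl EFinM -(IH (fun i => a (lift 0 i)))//.
have -> : (b 0 - a 0)%:E = lebesgue_measure (`]a 0, b 0[ : set R).
  rewrite lebesgue_measure_itv/= lte_fin; case: ltP => // ba.
  by rewrite (_ : a 0 = b 0) ?subrr//; apply/le_anti; rewrite ab.
set B := (X in (_ * lebesgue_rV d X)%E).
have mB : measurable B.
  rewrite (_ : B = \bigcap_(i in [set: 'I_d])
    ((fun v : 'rV[R]_d => v 0 i) @^-1` `]a (lift 0 i), b (lift 0 i)[)).
    apply: fin_bigcap_measurable => // i _.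
    by rewrite -[X in measurable X]setTI; exact: measurable_coord.
  apply/seteqP; split=> v /= H i; first by move=> _; rewrite /= in_itv; exact: H.
  by have := H i I; rewrite /= in_itv.
rewrite -lebesgue_rV_stepE//.
congr (_ _); apply/seteqP; split=> x /= H.
  by split=> [|i]; [rewrite in_itv; exact: H|rewrite mxE; exact: H].
case: H; rewrite in_itv/= => H0 H i; case: (unliftP 0 i) => [j|] -> //.
by have := H j; rewrite mxE.
Qed.

End lebesgue_rV.

Section sobolev.
Context {R : realType} {d : nat}.
Local Notation leb := (lebesgue_rV (R := R) d).
Implicit Types (D U : set 'rV[R]_d) (u v f : 'rV[R]_d -> R)
  (g h : 'rV[R]_d -> 'cV[R]_d) (A : 'rV[R]_d -> 'M[R]_d).

Definition partial (i : 'I_d) u : 'rV[R]_d -> R := 'D_(delta_mx 0 i) u.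

Definition grad u : 'rV[R]_d -> 'cV[R]_d := fun x => \col_i partial i u x.

Definition smooth u := forall s : seq 'I_d,
  let w := foldr partial u s in
  continuous w /\ forall i x, derivable w x (delta_mx 0 i).

(* C_c^oo(U) *)
Definition test_function U u :=
  [/\ smooth u, compact (closure [set x | u x != 0]) &
      closure [set x | u x != 0] `<=` U].

Definition sqL2 D u : \bar R := (\int[leb]_(x in D) ((u x) ^+ 2)%:E)%E.

Definition L2 D u := measurable_fun D u /\ (sqL2 D u < +oo)%E.

Definition weak_gradient U u g := forall phi, test_function U phi -> forall i,
  \int[leb]_(x in U) (u x * partial i phi x) =
  - \int[leb]_(x in U) (g x i 0 * phi x).

(* u is in H^1(D), with weak gradient g *)
Definition H1 D u g :=
  [/\ L2 D u, forall i, L2 D (fun x => g x i 0) & weak_gradient D u g].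

Definition sqH1 D u g : \bar R :=
  (sqL2 D u + \sum_(i < d) sqL2 D (fun x => g x i 0%R))%E.

(* H^1_0(D) is the closure of C_c^oo(D) in H^1(D) *)
Definition H10 D u g := H1 D u g /\
  exists2 phi : nat -> 'rV[R]_d -> R, forall n, test_function D (phi n) &
    sqH1 D (fun x => phi n x - u x) (fun x => grad (phi n) x - g x)
      @[n --> \oo] --> 0%E.

Definition H1loc u g :=
  [/\ forall K, compact K -> L2 K u,
      forall K i, compact K -> L2 K (fun x => g x i 0) &
      weak_gradient setT u g].

Definition dotv (xi zeta : 'cV[R]_d) : R := \sum_i xi i 0 * zeta i 0.

(* u in H^1_0(D) and -div (A grad u) = f weakly in D *)
Definition dirichlet_solution D A f u := exists2 g, H10 D u g &
  forall v h, H10 D v h ->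
    \int[leb]_(x in D) dotv (A x *m g x) (h x) = \int[leb]_(x in D) (f x * v x).

Definition shift_vec (k : 'rV[int]_d) : 'rV[R]_d := map_mx intr k.

Definition cell_periodic (T : Type) (M : nat) (w : 'rV[R]_d -> T) :=
  forall k : 'rV[int]_d,
    {ae leb, forall y, w (y + M%:R *: shift_vec k) = w y}.

Definition cell (M : nat) : set 'rV[R]_d :=
  [set y | forall i, 0 < y 0 i < M%:R].

Definition basis_vec (i : 'I_d) : 'cV[R]_d := delta_mx i 0.

(* N, with weak gradient g, solves -div (A (e_i + grad N)) = 0 in Q_M with    *)
(* periodic boundary conditions                                               *)
Definition corrector (M : nat) A (i : 'I_d) (N : 'rV[R]_d -> R) g :=
  [/\ H1loc N g, cell_periodic M N &
      forall v h, H1loc v h -> cell_periodic M v ->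
        \int[leb]_(y in cell M) dotv (A y *m (basis_vec i + g y)) (h y) = 0].

(* The gradients of the correctors, hence Ahat, are unique. *)
Definition equivalent_matrix (M : nat) A (Ahat : 'M[R]_d) :=
  exists N : 'I_d -> 'rV[R]_d -> R, exists g : 'I_d -> 'rV[R]_d -> 'cV[R]_d,
    (forall i, corrector M A i (N i) (g i)) /\
    forall i j, Ahat i j = (fine (leb (cell M)))^-1 *
      \int[leb]_(y in cell M)
        ((basis_vec i + g i y)^T *m A y *m (basis_vec j + g j y)) 0 0.

Definition enorm (x : 'rV[R]_d) : R := Num.sqrt (\sum_i x 0 i ^+ 2).

Definition set_dist (G1 G2 : set 'rV[R]_d) : \bar R :=
  ereal_inf [set (enorm (x.1 - x.2))%:E | x in G1 `*` G2].

End sobolev.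

Section random_fields.
Context {R : realType} {d : nat} {dO : measure_display}
  {Omega : measurableType dO} (P : probability Omega R).
Local Notation leb := (lebesgue_rV (R := R) d).
Implicit Types (A : 'rV[R]_d -> Omega -> 'M[R]_d) (G : set 'rV[R]_d).

(* Random field of invertible matrices with entries in L^oo, bounded by L *)
Definition random_coefficient (L : R) A :=
  [/\ measurable_fun setT (fun p : 'rV[R]_d * Omega => A p.1 p.2),
      {ae P, forall w, {ae leb, forall y, A y w \in unitmx}} &
      {ae P, forall w, {ae leb, forall y, forall i j, `|A y w i j| <= L}}].

Definition elliptic (alpha beta : R) A :=
  {ae P, forall w, {ae leb, forall y, forall xi : 'cV[R]_d,
    alpha * dotv xi xi <= dotv (A y w *m xi) xi <= beta * dotv xi xi}}.

Definition ergodic_action (tau : 'rV[int]_d -> Omega -> Omega) :=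
  [/\ tau 0 = id, forall k l, tau (k + l) = tau k \o tau l,
      forall k, measurable_fun setT (tau k),
      forall k E, measurable E -> P (tau k @^-1` E) = P E &
      forall E, measurable E -> (forall k, tau k @` E = E) ->
        P E = 0%E \/ P E = 1%E].

Definition stationary (tau : 'rV[int]_d -> Omega -> Omega) A :=
  forall k : 'rV[int]_d, {ae P, forall w, {ae leb, forall y,
    A (y + shift_vec k) w = A y (tau k w)}}.

(* sigma(A(y) : y in G) *)
Definition field_sigma_algebra A G : set (set Omega) :=
  <<s [set E | exists y (B : set 'M[R]_d),
         [/\ G y, measurable B & E = A y @^-1` B]] >>.

(* The uniform mixing coefficient gamma(s). *)
Definition mixing_coefficient A (s : R) : \bar R :=
  ereal_sup [set r | exists G1 G2 E1 E2,
    [/\ (s%:E <= set_dist G1 G2)%E,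
        field_sigma_algebra A G1 E1, field_sigma_algebra A G2 E2 &
        r = `|P (E1 `&` E2) - P E1 * P E2|%E]].

Definition expected_matrix (B : Omega -> 'M[R]_d) : 'M[R]_d :=
  \matrix_(i, j) fine ('E_P[fun w => B w i j])%E.

End random_fields.

(* M = C eps^(-sigma) is a positive integer. *)
Definition cell_size {R : realType} (C sigma eps : R) (M : nat) :=
  [/\ 0 < eps, (0 < M)%N & M%:R = C * eps `^ (- sigma)].

(* Main.v *)
(* Periodicity with period M and decay of the mixing coefficient force A(y, .) to be almost surely
   constant: events depending on A(y) and on A(y + M k e) coincide, yet become independent as k grows.
   Hence Ahat is almost surely equal to its expectation, and the problem is one of periodic
   homogenization with period delta = eps M = C eps^(1 - sigma) -> 0, uniformly over coefficient fields
   with the same ellipticity bounds.  The two-scale expansion is carried out with test functions: for V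
   close to u^eps, U close to the homogenized solution and P_j smooth and close to the rescaled
   correctors, the energy of V - U - sum_j P_j d_j U is estimated; the mean-zero divergence-free periodic
   flux pairs with a test function h up to O(delta |grad h|), and the correctors are O(delta).
   Since Ahat depends on eps, uniformity comes from splitting the bounded set of matrices into
   finitely many small classes and fixing U on each class; the same estimate with the constant
   coefficient Ahat compares u_0^0 with U. *)
Require Import Defs.
From HB Require Import structures.
From mathcomp Require Import all_boot all_order all_algebra.
From mathcomp Require Import all_classical all_reals all_analysis.
From mathcomp Require Import measurable_realfun zify ring lra.
Import Order.TTheory GRing.Theory Num.Theory.
Import numFieldNormedType.Exports.
Local Open Scope classical_set_scope.
Local Open Scope ring_scope.
Set Implicit Arguments.
Unset Strict Implicit.
Unset Printing Implicit Defensive.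

(** * Square-integrable functions *)

(** Only smooth functions and test functions get multiplied: u^eps and the correctors are merely
    weakly differentiable, and products such as N_j d_j U would call for a product rule in H^1_0.
    Approximating them within [delta] costs no more than the error being estimated. No vector
    potential of the flux is built: since the flux is divergence free, the derivative falling on w
    is moved onto d_j U, and the mean-zero flux then meets h = w d_k d_j U, which is O(delta) away
    from its averages over cells. Hence third derivatives of U enter the constant, and U must be
    frozen before eps varies: bounds on the matrix control the gradient of U, not its third
    derivatives. The events used for mixing live at a fixed point y, whereas periodicity holds
    almost surely at almost every y; exchanging null sets by Fubini, once in each direction, bridges
    the two. Neither [Ahat] nor u^eps is known to depend measurably on the random parameter, so
    integrals over it are handled through almost sure bounds. *)

Section l2.
Context {dT : measure_display} {T : measurableType dT} {R : realType}
  (mu : {measure set T -> \bar R}).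
Implicit Types (F G H : T -> R).

Definition inL2 F :=
  measurable_fun setT F /\ (\int[mu]_x ((F x) ^+ 2)%:E < +oo)%E.

Definition ip F G : R := \int[mu]_x (F x * G x).

(** A real number, which reads 0 when the integral of the square is infinite; estimates on [nrm]
    therefore travel with a membership in [inL2]. *)
Definition nrm F : R := Num.sqrt (ip F F).

Lemma inL2_sqr_integrable F : inL2 F ->
  mu.-integrable setT (EFin \o (fun x => F x ^+ 2)).
Proof.
move=> [mF Foo]; apply/integrableP; split.
  by apply/measurable_EFinP; exact: measurable_funX.
rewrite (eq_integral (fun x => ((F x) ^+ 2)%:E))// => x _ /=.
by rewrite ger0_norm// sqr_ge0.
Qed.

Lemma sqr_integrable_inL2 F : measurable_fun setT F ->
  mu.-integrable setT (EFin \o (fun x => F x ^+ 2)) -> inL2 F.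
Proof. by move=> mF iF; split => //; apply: integrable_lty. Qed.

Lemma integrable_le F G : measurable_fun setT F ->
  (forall x, `|F x| <= G x) -> mu.-integrable setT (EFin \o G) ->
  mu.-integrable setT (EFin \o F).
Proof.
move=> mF FG iG; apply: (le_integrable _ _ _ iG) => //.
  exact/measurable_EFinP.
by move=> x _ /=; rewrite lee_fin (le_trans (FG x))// ler_norm.
Qed.

Lemma integrable_addr F G : mu.-integrable setT (EFin \o F) ->
  mu.-integrable setT (EFin \o G) ->
  mu.-integrable setT (EFin \o (fun x => F x + G x)).
Proof. by move=> iF iG; have := integrableD measurableT iF iG. Qed.

Lemma integrable_scaler k F : mu.-integrable setT (EFin \o F) ->
  mu.-integrable setT (EFin \o (fun x => k * F x)).
Proof. by move=> iF; have := integrableZl measurableT k iF. Qed.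

Lemma inL2_integrableM F G : inL2 F -> inL2 G ->
  mu.-integrable setT (EFin \o (fun x => F x * G x)).
Proof.
move=> lF lG; apply: (@integrable_le _ (fun x => F x ^+ 2 + G x ^+ 2)).
- by apply: measurable_funM; [exact: lF.1|exact: lG.1].
- move=> x; rewrite ler_norml; apply/andP; split.
    by have := sqr_ge0 (F x + G x); have := sqr_ge0 (F x);
      have := sqr_ge0 (G x); nra.
  by have := sqr_ge0 (F x - G x); have := sqr_ge0 (F x);
      have := sqr_ge0 (G x); nra.
- by apply: integrable_addr => //; exact: inL2_sqr_integrable.
Qed.

Lemma inL2D F G : inL2 F -> inL2 G -> inL2 (fun x => F x + G x).
Proof.
move=> lF lG; apply: sqr_integrable_inL2.
  by apply: measurable_funD; [exact: lF.1|exact: lG.1].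
apply: (@integrable_le _ (fun x => 2 * F x ^+ 2 + 2 * G x ^+ 2)).
- by apply: measurable_funX; apply: measurable_funD; [exact: lF.1|exact: lG.1].
- move=> x; rewrite ger0_norm ?sqr_ge0//.
  by have := sqr_ge0 (F x - G x); nra.
- by apply: integrable_addr; apply: integrable_scaler; exact: inL2_sqr_integrable.
Qed.

Lemma inL2Z (k : R) F : inL2 F -> inL2 (fun x => k * F x).
Proof.
move=> lF; apply: sqr_integrable_inL2.
  by apply: measurable_funM => //; exact: lF.1.
rewrite (_ : (fun _ => _) = (fun x => k ^+ 2 * F x ^+ 2)).
  by apply: integrable_scaler; exact: inL2_sqr_integrable.
by apply/funext => x; rewrite exprMn.
Qed.

Lemma inL2N F : inL2 F -> inL2 (fun x => - F x).
Proof.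
move=> /(inL2Z (-1)); rewrite (_ : (fun _ => _) = (fun x => - F x))//.
by apply/funext => x; rewrite mulN1r.
Qed.

Lemma inL2B F G : inL2 F -> inL2 G -> inL2 (fun x => F x - G x).
Proof. by move=> lF lG; apply: inL2D => //; exact: inL2N. Qed.

Lemma inL20 : inL2 (fun=> 0).
Proof.
split; first exact: measurable_cst.
by rewrite expr0n/= integral0.
Qed.

Lemma inL2_sum (I : Type) (r : seq I) (p : pred I) (F : I -> T -> R) :
  (forall i, p i -> inL2 (F i)) -> inL2 (fun x => \sum_(i <- r | p i) F i x).
Proof.
move=> lF; elim: r => [|i r IH].
  by rewrite (_ : (fun _ => _) = (fun=> 0)); [exact: inL20|
    apply/funext => x; rewrite big_nil].
have [pi|pi] := boolP (p i); last first.
  rewrite (_ : (fun _ => _) = (fun x => \sum_(i <- r | p i) F i x))//.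
  by apply/funext => x; rewrite big_cons (negbTE pi).
rewrite (_ : (fun _ => _) = (fun x => F i x + \sum_(i <- r | p i) F i x)).
  by apply: inL2D => //; exact: lF.
by apply/funext => x; rewrite big_cons pi.
Qed.

Lemma ipC F G : ip F G = ip G F.
Proof. by rewrite /ip; congr Rintegral; apply/funext => x; rewrite mulrC. Qed.

Lemma ipDl F G H : inL2 F -> inL2 G -> inL2 H ->
  ip (fun x => F x + G x) H = ip F H + ip G H.
Proof.
move=> lF lG lH; rewrite /ip -RintegralD//; try exact: inL2_integrableM.
by congr Rintegral; apply/funext => x; rewrite mulrDl.
Qed.

Lemma ipZl k F G : inL2 F -> inL2 G -> ip (fun x => k * F x) G = k * ip F G.
Proof.
move=> lF lG; rewrite /ip -RintegralZl//; try exact: inL2_integrableM.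
by congr Rintegral; apply/funext => x; rewrite mulrA.
Qed.

Lemma ipNl F G : inL2 F -> inL2 G -> ip (fun x => - F x) G = - ip F G.
Proof.
move=> lF lG; rewrite -mulN1r -ipZl//; congr ip.
by apply/funext => x; rewrite mulN1r.
Qed.

Lemma ipBl F G H : inL2 F -> inL2 G -> inL2 H ->
  ip (fun x => F x - G x) H = ip F H - ip G H.
Proof. by move=> lF lG lH; rewrite ipDl ?ipNl//; exact: inL2N. Qed.

Lemma ip_suml (I : Type) (r : seq I) (p : pred I) (F : I -> T -> R) G :
  (forall i, p i -> inL2 (F i)) -> inL2 G ->
  ip (fun x => \sum_(i <- r | p i) F i x) G = \sum_(i <- r | p i) ip (F i) G.
Proof.
move=> lF lG; elim: r => [|i r IH].
  rewrite big_nil /ip (_ : (fun _ => _) = (fun=> 0)).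
    by rewrite /Rintegral integral0.
  by apply/funext => x; rewrite big_nil mul0r.
rewrite big_cons -IH; have [pi|pi] := boolP (p i); last first.
  by congr ip; apply/funext => x; rewrite big_cons (negbTE pi).
rewrite -ipDl//; [|exact: lF|exact: inL2_sum].
by congr ip; apply/funext => x; rewrite big_cons pi.
Qed.

Lemma ip_sumr (I : Type) (r : seq I) (p : pred I) (F : I -> T -> R) G :
  (forall i, p i -> inL2 (F i)) -> inL2 G ->
  ip G (fun x => \sum_(i <- r | p i) F i x) = \sum_(i <- r | p i) ip G (F i).
Proof.
move=> lF lG; rewrite ipC ip_suml//; apply: eq_bigr => i _; exact: ipC.
Qed.

Lemma ipDr F G H : inL2 F -> inL2 G -> inL2 H ->
  ip H (fun x => F x + G x) = ip H F + ip H G.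
Proof. by move=> lF lG lH; rewrite ipC ipDl// ipC (ipC G). Qed.

Lemma ipZr k F G : inL2 F -> inL2 G -> ip G (fun x => k * F x) = k * ip G F.
Proof. by move=> lF lG; rewrite ipC ipZl// ipC. Qed.

Lemma ipBr F G H : inL2 F -> inL2 G -> inL2 H ->
  ip H (fun x => F x - G x) = ip H F - ip H G.
Proof. by move=> lF lG lH; rewrite ipC ipBl// ipC (ipC G). Qed.

Lemma ip_ge0 F : 0 <= ip F F.
Proof. by apply: Rintegral_ge0 => x _; rewrite -expr2 sqr_ge0. Qed.

Lemma nrm_ge0 F : 0 <= nrm F.
Proof. exact: sqrtr_ge0. Qed.

Lemma sqr_nrm F : nrm F ^+ 2 = ip F F.
Proof. by rewrite sqr_sqrtr// ip_ge0. Qed.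

Lemma integral_sqrE F : inL2 F ->
  (\int[mu]_x ((F x) ^+ 2)%:E)%E = (nrm F ^+ 2)%:E.
Proof.
move=> lF; rewrite sqr_nrm /ip /Rintegral fineK//.
by apply: integrable_fin_num => //; exact: inL2_sqr_integrable.
Qed.

Lemma ip_sqr_le F G : inL2 F -> inL2 G -> ip F G ^+ 2 <= ip F F * ip G G.
Proof.
move=> lF lG; set a := ip F F; set b := ip F G; set c := ip G G.
have q s : 0 <= a + 2 * s * b + s ^+ 2 * c.
  have := ip_ge0 (fun x => F x + s * G x).
  have lsG := inL2Z s lG.
  rewrite ipDl ?ipDr ?ipZl ?ipZr//; try exact: inL2D.
  by rewrite (ipC G F) -/a -/b -/c (_ : _ + _ = a + 2 * s * b + s ^+ 2 * c)//; ring.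
have c0 : 0 <= c by exact: ip_ge0.
(* If c = 0 the quadratic [q] is affine, and s = -(a + 1)/(2b) would make it equal to -1 unless b =
   0. Otherwise its minimum, at s = -b/c, gives the discriminant inequality. *)
have [c0'|cn0] := eqVneq c 0.
  have [->|b0] := eqVneq b 0; first by rewrite c0' expr0n/= mulr0.
  have := q (- (a + 1) / (2 * b)); rewrite c0' mulr0 addr0.
  rewrite (_ : 2 * _ * b = - (a + 1)); first by lra.
  by field; rewrite b0.
have := q (- b / c); rewrite (_ : a + _ + _ = (a * c - b ^+ 2) / c); last first.
  by field.
by rewrite pmulr_lge0 ?subr_ge0// invr_gt0 lt_neqAle eq_sym cn0.
Qed.

Lemma ip_le F G : inL2 F -> inL2 G -> `|ip F G| <= nrm F * nrm G.
Proof.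
move=> lF lG; rewrite -sqrtr_sqr -sqrtrM ?ip_ge0//.
by rewrite ler_sqrt ?ip_sqr_le// mulr_ge0// ip_ge0.
Qed.

Lemma nrmD_le F G : inL2 F -> inL2 G -> nrm (fun x => F x + G x) <= nrm F + nrm G.
Proof.
move=> lF lG; rewrite -(@ler_pXn2r _ 2)// ?nnegrE ?addr_ge0 ?nrm_ge0//.
rewrite sqr_nrm sqrrD !sqr_nrm ipDl ?ipDr//; try exact: inL2D.
rewrite (ipC G F); have /ler_normlP[_] := ip_le lF lG.
by lra.
Qed.

Lemma nrmZ k F : inL2 F -> nrm (fun x => k * F x) = `|k| * nrm F.
Proof.
move=> lF; rewrite /nrm ipZl ?ipZr//; try exact: inL2Z.
by rewrite mulrA -expr2 sqrtrM ?sqr_ge0// sqrtr_sqr.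
Qed.

Lemma nrmN F : nrm (fun x => - F x) = nrm F.
Proof.
by congr Num.sqrt; congr Rintegral; apply/funext => x; rewrite mulrNN.
Qed.

Lemma nrm0 : nrm (fun=> 0) = 0.
Proof.
rewrite /nrm /ip (_ : (fun _ => _) = (fun=> 0)).
  by rewrite /Rintegral integral0 sqrtr0.
by apply/funext => x; rewrite mulr0.
Qed.

Lemma nrmB_le F G : inL2 F -> inL2 G -> nrm (fun x => F x - G x) <= nrm F + nrm G.
Proof. by move=> lF lG; rewrite -(nrmN G) nrmD_le//; exact: inL2N. Qed.

Lemma nrm_sum_le (I : Type) (r : seq I) (p : pred I) (F : I -> T -> R) :
  (forall i, p i -> inL2 (F i)) ->
  nrm (fun x => \sum_(i <- r | p i) F i x) <= \sum_(i <- r | p i) nrm (F i).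
Proof.
move=> lF; elim: r => [|i r IH].
  rewrite big_nil (_ : (fun _ => _) = (fun=> 0)) ?nrm0//.
  by apply/funext => x; rewrite big_nil.
rewrite big_cons; have [pi|pi] := boolP (p i); last first.
  by rewrite (_ : (fun _ => _) = (fun x => \sum_(i <- r | p i) F i x))//;
    apply/funext => x; rewrite big_cons (negbTE pi).
rewrite (_ : (fun _ => _) = (fun x => F i x + \sum_(i <- r | p i) F i x)).
  apply: (le_trans (nrmD_le _ _)); [exact: lF|exact: inL2_sum|].
  by rewrite lerD2l.
by apply/funext => x; rewrite big_cons pi.
Qed.

Lemma inL2_ae_le F G : measurable_fun setT F -> inL2 G ->
  {ae mu, forall x, `|F x| <= `|G x|} -> inL2 F /\ nrm F <= nrm G.
Proof.
move=> mF lG FG.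
have le : (\int[mu]_x ((F x) ^+ 2)%:E <= \int[mu]_x ((G x) ^+ 2)%:E)%E.
  apply: ae_ge0_le_integral => //.
  - by move=> x _; rewrite lee_fin sqr_ge0.
  - by apply/measurable_EFinP; exact: measurable_funX.
  - by move=> x _; rewrite lee_fin sqr_ge0.
  - by apply/measurable_EFinP; apply: measurable_funX; exact: lG.1.
  apply: filterS FG => x FG _; rewrite lee_fin.
  by rewrite -(real_normK (num_real (F x))) -(real_normK (num_real (G x))) lerXn2r.
have lF : inL2 F by split => //; exact: le_lt_trans le lG.2.
split => //; move: le; rewrite !integral_sqrE// lee_fin.
by rewrite ler_pXn2r// nnegrE nrm_ge0.
Qed.

Lemma inL2_le F G : measurable_fun setT F -> inL2 G ->
  (forall x, `|F x| <= `|G x|) -> inL2 F.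
Proof. by move=> mF lG FG; apply: (inL2_ae_le mF lG _).1; exact: aeW. Qed.

Lemma nrm_le F G : measurable_fun setT F -> inL2 G ->
  (forall x, `|F x| <= `|G x|) -> nrm F <= nrm G.
Proof. by move=> mF lG FG; apply: (inL2_ae_le mF lG _).2; exact: aeW. Qed.

Lemma inL2_bounded (K : R) (b : T -> R) F : measurable_fun setT b -> 
  {ae mu, forall x, `|b x| <= K} -> 0 <= K -> inL2 F ->
  inL2 (fun x => b x * F x) /\ nrm (fun x => b x * F x) <= K * nrm F.
Proof.
move=> mb bK K0 lF; rewrite -(ger0_norm K0) -nrmZ//.
apply: inL2_ae_le; last 1 first.
- by apply: filterS bK => x bK; rewrite !normrM (ger0_norm K0) ler_wpM2r.
- by apply: measurable_funM => //; exact: lF.1.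
- exact: inL2Z.
Qed.

Lemma ae_eq_Rintegral (D : set T) F G : measurable D ->
  measurable_fun D F -> measurable_fun D G ->
  {ae mu, forall x, D x -> F x = G x} ->
  \int[mu]_(x in D) F x = \int[mu]_(x in D) G x.
Proof.
move=> mD mF mG FG; rewrite /Rintegral; congr fine.
apply: ae_eq_integral => //; try exact/measurable_EFinP.
by apply: filterS FG => x FG /FG ->.
Qed.

End l2.

(** * Lebesgue measure on R^d *)

Section lebesgue_affine.
Context {R : realType}.

Lemma measurable_affine1 (r t : R) :
  measurable_fun setT ((fun x => r * x + t) : measurableTypeR R -> measurableTypeR R).
Proof. by apply: measurable_funD => //; exact: measurable_funM. Qed.

(** The scaled image measure agrees with Lebesgue measure on half-open intervals, so uniqueness of
    the extension gives all measurable sets. *)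
Lemma lebesgue_affine (r t : R) (A : set R) : 0 < r -> measurable A ->
  (r%:E * lebesgue_measure ((fun x : R => r * x + t)%R @^-1` A))%E =
  lebesgue_measure A.
Proof.
move=> r0 mA; have r0' := ltW r0; pose rn := NngNum r0'.
pose nu := mscale rn (pushforward (@lebesgue_measure R)
  ((fun x => r * x + t) : measurableTypeR R -> measurableTypeR R)).
have m := measurable_affine1 r t.
have h : forall X, ocitv X -> lebesgue_measure X = nu m X.
  move=> X; rewrite /ocitv/= => -[[a b] /= ab <-].
  rewrite /nu /mscale/= [pushforward _ _ _](_ : _ =
      lebesgue_measure (`](a - t) / r, (b - t) / r] : set R)); last first.
    rewrite /pushforward; congr (lebesgue_measure _).
    apply/seteqP; split => x /=; rewrite !in_itv/= ltr_pdivrMr// ler_pdivlMr//;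
      by move=> /andP[? ?]; apply/andP; split; lra.
  rewrite !lebesgue_measure_itv/= !lte_fin ltr_pM2r ?invr_gt0// ltrD2r.
  case: ifP => // _; last by rewrite mule0.
  rewrite -!EFinB -EFinM; congr EFin; field; exact: lt0r_neq0.
by rewrite (lebesgue_measure_unique (mu := nu m) h mA).
Qed.

End lebesgue_affine.

Section lebesgue_affine_integral.
Context {R : realType}.

Lemma integral_affine1 (r t : R) (F : measurableTypeR R -> \bar R) : 0 < r ->
  measurable_fun setT F -> (forall x, 0 <= F x)%E ->
  (r%:E * \int[@lebesgue_measure R]_x F (r * x + t)%R)%E =
  (\int[@lebesgue_measure R]_x F x)%E.
Proof.
move=> r0 mF F0; have r0' := ltW r0; pose rn := NngNum r0'.
pose nu := mscale rn (pushforward (@lebesgue_measure R)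
  ((fun x => r * x + t) : measurableTypeR R -> measurableTypeR R)).
have m := @measurable_affine1 R r t.
transitivity (\int[nu m]_x F x)%E.
  rewrite ge0_integral_mscale// ge0_integral_pushforward//.
apply: eq_measure_integral => A mA _.
by rewrite /nu /mscale/=; exact: lebesgue_affine.
Qed.

Lemma row_mx_0 d (a : R) (v : 'rV[R]_d) : (row_mx a%:M v : 'rV[R]_d.+1) 0 0 = a.
Proof.
have e : (a%:M : 'M[R]_1) 0 0 = a by rewrite mxE mulr1n.
rewrite -[RHS]e -[RHS](row_mxEl _ v).
by congr (row_mx _ _ _ _); exact/val_inj.
Qed.

Lemma row_mx_lift d (a : R) (v : 'rV[R]_d) i :
  (row_mx a%:M v : 'rV[R]_d.+1) 0 (lift 0 i) = v 0 i.
Proof.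
rewrite -[RHS](row_mxEr a%:M).
by congr (row_mx _ _ _ _); exact/val_inj.
Qed.

Lemma measurable_row_mx d :
  measurable_fun setT (fun p : measurableTypeR R * 'rV[R]_d =>
    row_mx (p.1 : R)%:M p.2 : 'rV[R]_d.+1).
Proof.
apply: measurable_fun_matrixP => i j; rewrite ord1.
case: (unliftP 0 j) => [k|] ->.
  rewrite (_ : (fun _ => _) = (fun v : 'rV[R]_d => v 0 k : R) \o snd).
    by apply: measurableT_comp => //; exact: measurable_coord.
  by apply/funext => p; rewrite row_mx_lift.
rewrite (_ : (fun _ => _) = fst); first exact: measurable_fst.
by apply/funext => p; rewrite row_mx_0.
Qed.

Lemma integral_lebesgue_rVS d (F : 'rV[R]_d.+1 -> \bar R) :
  measurable_fun setT F -> (forall x, 0 <= F x)%E ->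
  (\int[lebesgue_rV d.+1]_x F x)%E =
  (\int[@lebesgue_measure R]_a \int[lebesgue_rV d]_v
     F (row_mx (a : R)%:M v : 'rV[R]_d.+1))%E.
Proof.
move=> mF F0.
have mg := @measurable_row_mx d.
transitivity (\int[(@lebesgue_measure R \x @lebesgue_rV R d)%E]_p
    F (row_mx (p.1 : R)%:M p.2 : 'rV[R]_d.+1))%E.
  exact: (ge0_integral_pushforward mg (@lebesgue_measure R \x @lebesgue_rV R d)%E measurableT mF).
rewrite fubini_tonelli1//.
exact: measurableT_comp.
Qed.

Lemma measurable_affine d (r : R) (t : 'rV[R]_d) :
  measurable_fun setT (fun x : 'rV[R]_d => r *: x + t).
Proof.
apply: measurable_fun_matrixP => i j.
rewrite (_ : (fun _ => _) = (fun x : 'rV[R]_d => r * x i j + t i j)).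
  apply: measurable_funD => //; apply: measurable_funM => //.
  exact: measurable_coord.
by apply/funext => x; rewrite !mxE.
Qed.

(** Induction on the dimension: a dilation followed by a translation acts on the first coordinate
    and on the remaining ones by maps of the same kind, so Tonelli reduces the claim to the line. *)
Lemma ge0_integral_affine d (r : R) (t : 'rV[R]_d) (F : 'rV[R]_d -> \bar R) :
  0 < r -> measurable_fun setT F -> (forall x, 0 <= F x)%E ->
  ((r ^+ d)%:E * \int[lebesgue_rV d]_x F (r *: x + t)%R)%E =
  (\int[lebesgue_rV d]_x F x)%E.
Proof.
move=> r0; elim: d t F => [|d IH] t F mF F0.
  rewrite expr0 mul1e; apply: eq_integral => x _.
  by rewrite [_ + _]thinmx0 [x]thinmx0.
rewrite integral_lebesgue_rVS//; last first.
  by apply: measurableT_comp => //; exact: measurable_affine.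
pose t0 := t 0 0; pose t' : 'rV[R]_d := \row_i t 0 (lift 0 i).
have E a v : r *: (row_mx (a : R)%:M v : 'rV[R]_d.+1) + t =
    (row_mx (r * a + t0)%:M (r *: v + t') : 'rV[R]_d.+1).
  have ax n (w s : 'rV[R]_n) i : (r *: w + s) 0 i = r * w 0 i + s 0 i.
    by rewrite 2!mxE.
  apply/rowP => i; rewrite ax; case: (unliftP 0 i) => [k|] ->.
    apply: (etrans _ (esym (row_mx_lift _ _ k))); rewrite ax [t' 0 k]mxE.
    by congr (_ * _ + _); exact: row_mx_lift.
  apply: (etrans _ (esym (row_mx_0 _ _))).
  by congr (_ * _ + _); exact: row_mx_0.
rewrite integral_lebesgue_rVS//.
pose G (a : measurableTypeR R) : \bar R := (\int[lebesgue_rV d]_v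
     F (row_mx (a : R)%:M v : 'rV[R]_d.+1))%E.
have mFa : measurable_fun setT (fun p : measurableTypeR R * 'rV[R]_d =>
    F (row_mx (p.1 : R)%:M p.2 : 'rV[R]_d.+1)).
  by apply: measurableT_comp => //; exact: measurable_row_mx.
have mG : measurable_fun setT G.
  exact: (@measurable_fun_fubini_tonelli_F _ _ _ _ _ (lebesgue_rV d) _ mFa).
have G0 a : (0 <= G a)%E by exact: integral_ge0.
rewrite -(@integral_affine1 r t0 G)//.
rewrite exprS EFinM -muleA; congr (_ * _)%E.
rewrite -ge0_integralZl//.
- apply: eq_integral => a _.
  pose Fa (v : 'rV[R]_d) := F (row_mx (r * a + t0)%:M v : 'rV[R]_d.+1).
  have mF1 : measurable_fun setT Fa.
    exact: (measurableT_comp mFa (pair1_measurable (r * a + t0 : measurableTypeR R))).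
  apply: (etrans _ (IH t' Fa mF1 (fun v => F0 _))).
  by congr (_ * _)%E; apply: eq_integral => v _; rewrite E.
- have m : measurable_fun setT (fun p : measurableTypeR R * 'rV[R]_d =>
      F (r *: (row_mx (p.1 : R)%:M p.2 : 'rV[R]_d.+1) + t)).
    apply: (measurableT_comp mF).
    apply: (measurableT_comp (measurable_affine r t)).
    exact: measurable_row_mx.
  exact: (@measurable_fun_fubini_tonelli_F _ _ _ _ _ (lebesgue_rV d) _ m).
- by move=> a _; exact: integral_ge0.
- by rewrite lee_fin exprn_ge0// ltW.
Qed.

End lebesgue_affine_integral.

Section rV_measure.
Context {R : realType} {d : nat}.
Local Notation V := 'rV[R]_d.
Local Notation leb := (lebesgue_rV (R := R) d).

Lemma rV_norm_leP (x : V) (r : R) : 0 <= r ->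
  (`|x| <= r) <-> (forall i, `|x 0 i| <= r).
Proof.
move=> r0; rewrite (_ : `|x| = mx_norm x)// mx_normrE; split.
  by move=> /bigmax_leP[_ h] i; exact: (h (0, i)).
by move=> h; apply/bigmax_leP; split => // -[i j] _ /=; rewrite ord1.
Qed.

Lemma rV_norm_ltP (x : V) (r : R) : 0 < r ->
  (`|x| < r) <-> (forall i, `|x 0 i| < r).
Proof.
move=> r0; rewrite (_ : `|x| = mx_norm x)// mx_normrE; split.
  by move=> /bigmax_ltP[_ h] i; exact: (h (0, i)).
by move=> h; apply/bigmax_ltP; split => // -[i j] _ /=; rewrite ord1.
Qed.

Lemma rV_coord_le (x : V) i : `|x 0 i| <= `|x|.
Proof. exact: (rV_norm_leP x (normr_ge0 x)).1. Qed.

Lemma measurable_forall_coord (B : 'I_d -> set R) : (forall i, measurable (B i)) ->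
  measurable [set x : V | forall i, B i (x 0 i)].
Proof.
move=> mB; rewrite (_ : mkset _ = \bigcap_(i in [set: 'I_d])
    ((fun v : V => v 0 i) @^-1` B i)).
  apply: fin_bigcap_measurable => // i _.
  by rewrite -[X in measurable X]setTI; exact: measurable_coord.
by apply/seteqP; split => x /= h i; [move=> _; exact: h|exact: (h i I)].
Qed.

Lemma measurable_norm_le (r : R) : measurable [set x : V | `|x| <= r].
Proof.
have [r0|r0] := leP 0 r; last first.
  rewrite (_ : mkset _ = set0)//; apply/seteqP; split=> // x /= h.
  by have := le_lt_trans (normr_ge0 x) (le_lt_trans h r0); rewrite ltxx.
rewrite (_ : mkset _ = [set x : V | forall i, [set t | `|t| <= r] (x 0 i)]).
  apply: (measurable_forall_coord (B := fun=> [set t | `|t| <= r])) => i.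
  rewrite (_ : mkset _ = `[-r, r]%classic)//.
  by apply/seteqP; split=> t /=; rewrite in_itv/= ler_norml.
by apply/seteqP; split=> x /= /(rV_norm_leP x r0).
Qed.

Lemma measurable_rat_box (q : 'rV[rat]_d) (r : R) : 0 < r ->
  measurable [set x : V | `|x - map_mx ratr q| < r].
Proof.
move=> r0; rewrite (_ : mkset _ =
    [set x : V | forall i, [set t | `|t - ratr (q 0 i)| < r] (x 0 i)]).
  apply: (measurable_forall_coord (B := fun i => [set t | `|t - ratr (q 0 i)| < r])) => i.
  rewrite (_ : mkset _ = `]ratr (q 0 i) - r, ratr (q 0 i) + r[%classic)//.
  by apply/seteqP; split=> t /=; rewrite in_itv/= ltr_distl.
by apply/seteqP; split=> x /= => [/(rV_norm_ltP _ r0)|h];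
  [move=> h i; have := h i; rewrite !mxE|
   apply/(rV_norm_ltP _ r0) => i; rewrite !mxE].
Qed.

(** The sigma-algebra is generated by the entries, not by the open sets, so U has to be exhibited as
    a countable union of boxes with rational centres. *)
Lemma open_measurable_rV (U : set V) : open U -> measurable U.
Proof.
move=> oU.
pose box (p : 'rV[rat]_d * nat) := [set x : V | `|x - map_mx ratr p.1| < (p.2.+1%:R)^-1].
pose F p := if `[< box p `<=` U >] then box p else set0.
rewrite (_ : U = \bigcup_(p : 'rV[rat]_d * nat) F p).
  apply: countable_bigcupT_measurable; first exact: countableP.
  move=> p; rewrite /F; case: ifP => // _; apply: measurable_rat_box.
  by rewrite invr_gt0.
apply/seteqP; split=> [x Ux|x [p _]]; last first.
  by rewrite /F; case: asboolP => // h; exact: h.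
have /nbhs_ballP[e /= e0 eU] : nbhs x U by exact: open_nbhs_nbhs.
have [n ne] : exists n : nat, (n.+1%:R)^-1 < e / 2.
  have e20 : 0 < e / 2 by rewrite divr_gt0.
  exists (Num.truncn (e / 2)^-1).
  rewrite invf_plt ?posrE//; exact: truncnS_gt.
have n0 : 0 < (n.+1%:R : R)^-1 by rewrite invr_gt0.
have rx i : exists q : rat, `|x 0 i - ratr q| < (n.+1%:R)^-1.
  have : x 0 i - (n.+1%:R)^-1 < x 0 i + (n.+1%:R)^-1 by rewrite ltrBlDr -addrA ltrDl addr_gt0.
  move=> /rat_in_itvoo[q] /itvP h.
  by exists q; rewrite distrC ltr_distl !h.
have /choice[q hq] := rx.
exists (\row_i q i, n) => //; rewrite /F.
have hx : box (\row_i q i, n) x.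
  by apply/(rV_norm_ltP _ n0) => i; rewrite !mxE.
rewrite asboolT// => y hy; apply: eU; rewrite -ball_normE/=.
rewrite (_ : x - y = (x - map_mx ratr (\row_i q i)) - (y - map_mx ratr (\row_i q i))).
  by apply: (le_lt_trans (ler_normB _ _)); rewrite (lt_trans (ltrD hx hy))// (splitr e) ltrD.
by rewrite opprB addrA subrK.
Qed.

Lemma continuous_measurable_rV (f : V -> R) : continuous f -> measurable_fun setT f.
Proof.
move=> /continuousP cf; apply: (measurability _ (RGenOpens.measurableE R)).
move=> _ [_ [a [b ->] <-]]; rewrite setTI; apply: open_measurable_rV.
exact/cf/interval_open.
Qed.

Lemma lebesgue_norm_le_fin (r : R) : (leb [set x : V | (`|x| <= r)%R] < +oo)%E.
Proof.
have [r0|r0] := leP 0 r; last first.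
  rewrite (_ : mkset _ = set0) ?measure0//; apply/seteqP; split=> // x /= h.
  by have := le_lt_trans (normr_ge0 x) (le_lt_trans h r0); rewrite ltxx.
have lb : (leb [set x : V | forall i, (- (r + 1) < x 0 i < r + 1)%R] < +oo)%E.
  rewrite lebesgue_rV_box ?ltry// => i; lra.
apply: le_lt_trans lb; apply: le_measure; rewrite ?inE.
- exact: measurable_norm_le.
- rewrite (_ : mkset _ = [set x : V | forall i, `]-(r+1), r+1[%classic (x 0 i)]).
    by apply: (measurable_forall_coord (B := fun=> `]-(r+1), r+1[%classic)) => i.
  by apply/seteqP; split=> x /= h i; have := h i; rewrite in_itv.
- move=> x /= /(rV_norm_leP _ r0) h i; have := h i; rewrite ler_norml.
  by move=> /andP[? ?]; apply/andP; split; lra.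
Qed.

(** Infinite values are included: multiplication by k > 0 keeps them infinite and [fine] sends them
    to 0. This lets [Rintegral_affine] cover every measurable function. *)
Lemma mulr_fineB (k : R) (a b : \bar R) : 0 < k -> (0 <= a)%E -> (0 <= b)%E ->
  k * fine (a - b)%E = fine (k%:E * a - k%:E * b)%E.
Proof.
move=> k0; case: a => [a| |]//; case: b => [b| |]// _ _ /=.
- by rewrite mulrBr.
- by rewrite gt0_muley ?lte_fin//= mulr0.
- by rewrite gt0_muley ?lte_fin//= mulr0.
- by rewrite gt0_muley ?lte_fin//= mulr0.
Qed.

Lemma Rintegral_affine (r : R) (t : V) (F : V -> R) : 0 < r ->
  measurable_fun setT F ->
  r ^+ d * \int[leb]_x F (r *: x + t) = \int[leb]_x F x.
Proof.
move=> r0 mF; rewrite /Rintegral.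
have mE : measurable_fun setT (EFin \o F) by exact/measurable_EFinP.
have hp := @ge0_integral_affine R d r t _ r0 (measurable_funepos mE) (fun x => funepos_ge0 _ x).
have hn := @ge0_integral_affine R d r t _ r0 (measurable_funeneg mE) (fun x => funeneg_ge0 _ x).
rewrite [in RHS]integralE -hp -hn [in LHS]integralE mulr_fineB ?exprn_gt0//.
- congr (fine (_ - _)); congr (_ * _)%E; apply: eq_integral => x _;
    by rewrite ?funeposE ?funenegE.
- exact: integral_ge0.
- exact: integral_ge0.
Qed.

Lemma integrable_affine (r : R) (t : V) (F : V -> R) : 0 < r ->
  leb.-integrable setT (EFin \o F) ->
  leb.-integrable setT (EFin \o (fun x => F (r *: x + t))).
Proof.
move=> r0 /integrableP[mF Foo]; apply/integrableP; split.
  by have := measurableT_comp mF (measurable_affine r t).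
rewrite ltey_eq; apply/orP; left; rewrite ge0_fin_numE ?integral_ge0//.
have h := @ge0_integral_affine R d r t (abse \o (EFin \o F)) r0
  (measurableT_comp (@abse_measurable R setT) mF) (fun x => abse_ge0 _).
rewrite -h in Foo; rewrite ltNge leye_eq; apply/negP => /eqP E.
by move: Foo; rewrite /= E gt0_muley// lte_fin exprn_gt0.
Qed.

Lemma ae_affine (r : R) (t : V) (Q : V -> Prop) : 0 < r ->
  {ae leb, forall x, Q x} -> {ae leb, forall x, Q (r *: x + t)}.
Proof.
move=> r0 [N [mN N0 QN]].
exists ((fun x => r *: x + t) @^-1` N); split.
- by rewrite -[X in measurable X]setTI; exact: measurable_affine.
- have mf : measurable_fun setT (EFin \o (\1_N : V -> R)).
    by apply/measurable_EFinP.
  have mN' : measurable ((fun x => r *: x + t) @^-1` N).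
    by rewrite -[X in measurable X]setTI; exact: measurable_affine.
  have e1 : (\int[leb]_x (\1_N x)%:E = 0)%E by rewrite integral_indic// setIT.
  have e2 : (\int[leb]_x (\1_N (r *: x + t)%R)%:E)%E =
      leb ((fun x => r *: x + t) @^-1` N).
    by rewrite -[in RHS](setIT (_ @^-1` _)) -integral_indic.
  have := @ge0_integral_affine R d r t (EFin \o \1_N) r0 mf.
  rewrite /comp e1 e2 => /(_ (fun x => ltac:(by rewrite lee_fin)))/eqP.
  by rewrite mule_eq0 eqe expf_eq0 (gt_eqF r0) andbF/= => /eqP.
- by move=> x /= h; exact: QN.
Qed.

Lemma measurable_addv : measurable_fun setT (fun p : V * V => p.1 + p.2).
Proof.
apply: measurable_fun_matrixP => i j.
rewrite (_ : (fun _ => _) = (fun p : V * V => p.1 i j + p.2 i j)); last first.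
  by apply/funext => p; rewrite mxE.
apply: measurable_funD.
  exact: (measurableT_comp (measurable_coord i j) measurable_fst).
exact: (measurableT_comp (measurable_coord i j) measurable_snd).
Qed.

Lemma inL2_translate (F : V -> R) (t : V) : inL2 leb F ->
  inL2 leb (fun x => F (x + t)) /\ nrm leb (fun x => F (x + t)) = nrm leb F.
Proof.
move=> [mF Foo].
have m : measurable_fun setT (fun x : V => F (x + t)).
  rewrite (_ : (fun _ => _) = F \o (fun x => 1 *: x + t)).
    exact: measurableT_comp mF (measurable_affine 1 t).
  by apply/funext => x; rewrite /= scale1r.
have e : (\int[leb]_x ((F (x + t)%R) ^+ 2)%:E = \int[leb]_x ((F x) ^+ 2)%:E)%E.
  have := @ge0_integral_affine R d 1 t (fun x => ((F x) ^+ 2)%:E) ltr01.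
  rewrite expr1n mul1e => <-.
  - by apply: eq_integral => x _; rewrite scale1r.
  - by apply/measurable_EFinP; exact: measurable_funX.
  - by move=> x; rewrite lee_fin sqr_ge0.
by split; [split => //; rewrite e|congr Num.sqrt; rewrite /ip /Rintegral e].
Qed.

End rV_measure.

Lemma lebesgue_hyperplane (R : realType) d (i : 'I_d) (c : R) :
  lebesgue_rV d [set x : 'rV[R]_d | x 0 i = c] = 0%E.
Proof.
elim: d i => [[]//|d IH] i.
have mc : measurable ([set c] : set (measurableTypeR R)) by exact: measurable_set1.
case: (unliftP 0 i) => [k|] ->.
  have mk : measurable [set x : 'rV[R]_d | x 0 k = c].
    rewrite (_ : mkset _ = (fun x : 'rV[R]_d => x 0 k) @^-1` [set c])//.
    by rewrite -[X in measurable X]setTI; exact: measurable_coord.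
  have := lebesgue_rV_stepE (lebesgue_rV d) (@measurableT _ (measurableTypeR R)) mk.
  rewrite IH mule0 => <-; congr (_ _); apply/seteqP; split=> x /=.
    by move=> h; split=> //; rewrite mxE.
  by rewrite mxE => -[].
have := lebesgue_rV_stepE (lebesgue_rV d) mc measurableT.
rewrite lebesgue_measure_set1 mul0e => <-; congr (_ _).
by apply/seteqP; split=> x /=; [move=> ->|case].
Qed.

(** * Smooth and test functions *)

Section smooth_calculus.
Context {R : realType} {d : nat}.
Local Notation V := 'rV[R]_d.
Implicit Types (u v : V -> R).

Local Notation e_ i := (delta_mx 0 i : V).

Definition pderivable u := forall i x, derivable u x (e_ i).

(** The recursive counterpart of [smooth], which quantifies over sequences of derivatives; the
    product and chain rules need an induction on the order. *)
Fixpoint Ck n u : Prop :=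
  if n is n'.+1 then
    [/\ continuous u, pderivable u & forall i, Ck n' (partial i u)]
  else continuous u.

Lemma smooth_continuous u : smooth u -> continuous u.
Proof. by move=> /(_ [::])[]. Qed.

Lemma smooth_pderivable u : smooth u -> pderivable u.
Proof. by move=> /(_ [::])[]. Qed.

Lemma smooth_partial i u : smooth u -> smooth (partial i u).
Proof. by move=> su s; have := su (rcons s i); rewrite -cats1 foldr_cat. Qed.

Lemma smoothP u : smooth u <-> forall n, Ck n u.
Proof.
split=> [su n|h].
  elim: n u su => [|n IH] u su; first exact: smooth_continuous.
  split; [exact: smooth_continuous|exact: smooth_pderivable|] => i.
  exact/IH/smooth_partial.
move=> s; elim/last_ind: s u h => [|s i IH] u h.
  by have /= [cu du _] := h 1%N.
by rewrite -cats1 foldr_cat; apply: IH => n; have /= [_ _] := h n.+1.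
Qed.

Lemma CkW n u : Ck n.+1 u -> Ck n u.
Proof.
elim: n u => [|n IH] u /= [cu du pu] //; split => // i; exact/IH/pu.
Qed.

Lemma partialD i u v : pderivable u -> pderivable v ->
  partial i (fun x => u x + v x) = (fun x => partial i u x + partial i v x).
Proof. by move=> du dv; apply/funext => x; exact: deriveD. Qed.

Lemma partialM i u v : pderivable u -> pderivable v ->
  partial i (fun x => u x * v x) =
  (fun x => u x * partial i v x + v x * partial i u x).
Proof. by move=> du dv; apply/funext => x; exact: deriveM. Qed.

Lemma CkD n u v : Ck n u -> Ck n v -> Ck n (fun x => u x + v x).
Proof.
elim: n u v => [|n IH] u v /=.
  by move=> cu cv x; apply: continuousD; [exact: cu|exact: cv].
move=> [cu du pu] [cv dv pv]; split.
- by move=> x; apply: continuousD; [exact: cu|exact: cv].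
- by move=> i x; apply: derivableD.
- by move=> i; rewrite partialD//; exact: IH.
Qed.

Lemma CkM n u v : Ck n u -> Ck n v -> Ck n (fun x => u x * v x).
Proof.
elim: n u v => [|n IH] u v.
  by move=> cu cv x; apply: continuousM; [exact: cu|exact: cv].
move=> cku ckv; have := cku; have := ckv.
move=> /= [cv dv pv] [cu du pu]; split.
- by move=> x; apply: continuousM; [exact: cu|exact: cv].
- by move=> i x; apply: derivableM.
- by move=> i; rewrite partialM//; apply: CkD; apply: IH => //; exact: CkW.
Qed.

Lemma partial_cst i (k : R) : partial i (fun _ : V => k) = fun=> 0.
Proof. by apply/funext => x; exact: derive_cst. Qed.

Lemma Ck_cst n (k : R) : Ck n (fun _ : V => k).
Proof.
elim: n k => [|n IH] k /=; first exact: cst_continuous.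
split; [exact: cst_continuous|by move=> i x; exact: derivable_cst|] => i.
by rewrite partial_cst.
Qed.

Lemma smooth_cst (k : R) : smooth (fun _ : V => k).
Proof. by apply/smoothP => n; exact: Ck_cst. Qed.

Lemma smoothD u v : smooth u -> smooth v -> smooth (fun x => u x + v x).
Proof. by move=> /smoothP su /smoothP sv; apply/smoothP => n; exact: CkD. Qed.

Lemma smoothM u v : smooth u -> smooth v -> smooth (fun x => u x * v x).
Proof. by move=> /smoothP su /smoothP sv; apply/smoothP => n; exact: CkM. Qed.

Lemma smoothZ k u : smooth u -> smooth (fun x => k * u x).
Proof. exact: (smoothM (smooth_cst k)). Qed.

Lemma smooth_sum (I : Type) (r : seq I) (F : I -> V -> R) :
  (forall i, smooth (F i)) -> smooth (fun x => \sum_(i <- r) F i x).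
Proof.
move=> sF; elim: r => [|i r IH].
  rewrite (_ : (fun _ => _) = (fun=> 0)); first exact: smooth_cst.
  by apply/funext => x; rewrite big_nil.
rewrite (_ : (fun _ => _) = (fun x => F i x + \sum_(i <- r) F i x)).
  exact: (smoothD (sF i) IH).
by apply/funext => x; rewrite big_cons.
Qed.

Lemma smooth_prod (I : Type) (r : seq I) (F : I -> V -> R) :
  (forall i, smooth (F i)) -> smooth (fun x => \prod_(i <- r) F i x).
Proof.
move=> sF; elim: r => [|i r IH].
  rewrite (_ : (fun _ => _) = (fun=> 1)); first exact: smooth_cst.
  by apply/funext => x; rewrite big_nil.
rewrite (_ : (fun _ => _) = (fun x => F i x * \prod_(i <- r) F i x)).
  exact: (smoothM (sF i) IH).
by apply/funext => x; rewrite big_cons.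
Qed.

Lemma partial_sum j (I : Type) (r : seq I) (F : I -> V -> R) :
  (forall i, smooth (F i)) ->
  partial j (fun x => \sum_(i <- r) F i x) = (fun x => \sum_(i <- r) partial j (F i) x).
Proof.
move=> sF; elim: r => [|i r IH].
  rewrite (_ : (fun _ => _) = (fun=> 0)) ?partial_cst.
    by apply/funext => x; rewrite big_nil.
  by apply/funext => x; rewrite big_nil.
rewrite (_ : (fun _ => _) = (fun x => F i x + \sum_(i <- r) F i x)).
  rewrite partialD ?IH//; first by apply/funext => x; rewrite big_cons.
  - exact: smooth_pderivable.
  - by apply: smooth_pderivable; exact: smooth_sum.
by apply/funext => x; rewrite big_cons.
Qed.

Lemma partialZ i k u : pderivable u ->
  partial i (fun x => k * u x) = (fun x => k * partial i u x).
Proof.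
move=> du; rewrite (@partialM i (fun=> k) u)//.
by rewrite partial_cst; apply/funext => x; rewrite mulr0 addr0.
Qed.

Lemma partialN i u : pderivable u ->
  partial i (fun x => - u x) = (fun x => - partial i u x).
Proof.
move=> du; rewrite (_ : (fun _ => _) = (fun x => -1 * u x)).
  by rewrite partialZ//; apply/funext => x; rewrite mulN1r.
by apply/funext => x; rewrite mulN1r.
Qed.

Lemma partialB i u v : pderivable u -> pderivable v ->
  partial i (fun x => u x - v x) = (fun x => partial i u x - partial i v x).
Proof.
move=> du dv; rewrite (@partialD i u (fun x => - v x)) ?partialN//.
by move=> j x; exact/derivableN/dv.
Qed.

Lemma is_derive_line u x i (s : R) : derivable u (x + s *: e_ i) (e_ i) ->
  is_derive s (1 : R) (fun s : R => u (x + s *: e_ i)) (partial i u (x + s *: e_ i)).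
Proof.
have E : (fun h : R => h^-1 *: (((fun s : R => u (x + s *: e_ i)) \o shift s) (h *: (1 : R)) -
      u (x + s *: e_ i))) =
    (fun h => h^-1 *: ((u \o shift (x + s *: e_ i)) (h *: (e_ i)) - u (x + s *: e_ i))).
  apply/funext => h /=; congr (_ *: (u _ - _)).
  by rewrite scalerDl addrCA /GRing.scale/= mulr1.
by move=> du; split; rewrite /derivable /derive E.
Qed.

Lemma continuous_affine (r : R) (t : V) : continuous (fun x : V => r *: x + t).
Proof.
move=> x; apply: continuousD; last exact: cst_continuous.
by apply: continuousZr; exact: cvg_id.
Qed.

(** Only directional derivatives are at hand, so the chain rule is applied on the line through r x +
    t, where it is one-dimensional. *)
Lemma is_derive_affine (r : R) (t : V) u i x : derivable u (r *: x + t) (e_ i) ->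
  is_derive x (e_ i) (fun x => u (r *: x + t)) (partial i u (r *: x + t) * r).
Proof.
move=> du.
have := is_derive_line (s := 0) (u := u) (x := r *: x + t) (i := i).
rewrite scale0r addr0 => /(_ du) h.
have h1 : is_derive (0 : R) (1 : R) (fun s : R => r * s) r.
  apply: (is_derive_eq (@is_deriveZ R _ _ (@id R) r 0 1 1 _)).
  by rewrite /GRing.scale/= mulr1.
have h' : is_derive (r * 0) 1 (fun s => u (r *: x + t + s *: e_ i))
    (partial i u (r *: x + t)) by rewrite mulr0.
have [] := @is_derive1_comp R _ _ 0 _ _ h' h1.
have E : (fun k : R => k^-1 *: (((fun s => u (r *: x + t + s *: e_ i)) \o
      (fun s : R => r * s) \o shift 0) (k *: (1 : R)) -
      ((fun s => u (r *: x + t + s *: e_ i)) \o (fun s : R => r * s)) 0)) =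
    (fun k => k^-1 *: (((fun x => u (r *: x + t)) \o shift x) (k *: (e_ i)) - u (r *: x + t))).
  apply/funext => k /=; rewrite mulr0 scale0r !addr0; congr (_ *: (u _ - _)).
  by rewrite scalerDr scalerA [k%:A]mulr1 addrC addrA.
by rewrite /derivable /derive E => d1 d2; split.
Qed.

Lemma pderivable_affine (r : R) (t : V) u : pderivable u ->
  pderivable (fun x => u (r *: x + t)).
Proof. by move=> du i x; have [] := is_derive_affine (du i (r *: x + t)). Qed.

Lemma partial_affine (r : R) (t : V) u i : pderivable u ->
  partial i (fun x => u (r *: x + t)) = (fun x => r * partial i u (r *: x + t)).
Proof.
move=> du; apply/funext => x; rewrite mulrC.
by have [_] := is_derive_affine (du i (r *: x + t)).
Qed.

Lemma smooth_affine (r : R) (t : V) u : smooth u -> smooth (fun x => u (r *: x + t)).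
Proof.
have ca (v : V -> R) : continuous v -> continuous (fun x : V => v (r *: x + t)).
  by move=> cv x; apply: (continuous_comp (@continuous_affine r t x) (cv _)).
move=> su; apply/smoothP => n; elim: n u su => [|n IH] u su.
  exact/ca/smooth_continuous.
split; first exact/ca/smooth_continuous.
  exact/pderivable_affine/smooth_pderivable.
move=> i; rewrite partial_affine; last exact: smooth_pderivable.
by apply: CkM; [exact: Ck_cst|exact/IH/smooth_partial].
Qed.

End smooth_calculus.

(** * A smooth bump supported in the unit cube *)

Section flat.
Context {R : realType}.

(** The functions s^-n exp(-1/s), extended by 0. Their span is closed under differentiation, so
    smoothness of exp(-1/s) follows by treating all n at once. *)
Definition flat (n : nat) (s : R) : R :=
  if 0 < s then (s^-1) ^+ n * expR (- s^-1) else 0.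

Lemma flat_ge0 n s : 0 <= flat n s.
Proof.
rewrite /flat; case: ifPn => // s0.
by rewrite mulr_ge0 ?expR_ge0// exprn_ge0// invr_ge0 ltW.
Qed.

Lemma flat_shift n s : s * flat n.+1 s = flat n s.
Proof.
rewrite /flat; case: ifPn => s0; last by rewrite mulr0.
by rewrite mulrA exprS mulrA divff ?mul1r// gt_eqF.
Qed.

(** With y = 1/s, a single term of the exponential series dominates y^n up to a factorial. *)
Lemma flat_bounded n s : flat n s <= n.+1`!%:R.
Proof.
rewrite /flat; case: ifPn => // s0.
have y0 : 0 <= s^-1 by rewrite invr_ge0 ltW.
case: n => [|n].
  by rewrite expr0 mul1r -expR0 ler_expR oppr_le0.
rewrite expRN ler_pdivrMr ?expR_gt0//.
have := expR_ge1Dxn n y0; set y := s^-1 => h.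
have f0 : 0 < (n.+1`!%:R : R) by rewrite ltr0n fact_gt0.
have : y ^+ n.+1 <= expR y * n.+1`!%:R.
  by rewrite -ler_pdivrMr// (le_trans _ h)// lerDr.
move=> /le_trans; apply; rewrite mulrC ler_wpM2r ?expR_ge0// ler_nat.
by rewrite [leqRHS]factS leq_pmull.
Qed.

Lemma is_derive_flat n (s : R) :
  is_derive s (1 : R) (flat n) (flat n.+2 s - n%:R * flat n.+1 s).
Proof.
have [s0|s0|->] := ltgtP s 0.
- rewrite {2 3}/flat !(lt_gtF s0)/= mulr0 subr0.
  apply: (@near_eq_is_derive _ _ _ (cst 0)).
  near=> t; rewrite /flat ifF//; apply: lt_gtF; near: t.
  exact: lt_nbhsl.
- rewrite {2 3}/flat !s0.
  apply: (@near_eq_is_derive _ _ _ (fun t : R => (t^-1) ^+ n * expR (- t^-1))).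
    near=> t; rewrite /flat ifT//; near: t; exact: lt_nbhsr.
  have sn0 : s != 0 by rewrite gt_eqF.
  have di : is_derive s 1 (fun t : R => t^-1) (- s ^- 2).
    apply: (is_derive_eq (@is_deriveV R id s 1 1 sn0 _)).
    by rewrite /GRing.scale/= mulr1.
  have dx : is_derive s 1 (fun t : R => (t^-1) ^+ n) (n%:R * s^-1 ^+ n.-1 * (- s ^- 2)).
    by have := @is_deriveX R _ _ n s 1 _ di; rewrite exprfctE.
  have de : is_derive s 1 (fun t : R => expR (- t^-1)) (expR (- s^-1) * - (- s ^- 2)).
    exact: (@is_derive1_comp R expR (fun t => - t^-1) s _ _ (is_derive_expR _) (is_deriveN di)).
  apply: (is_derive_eq (is_deriveM dx de)).
  rewrite /GRing.scale/=; case: n {dx} => [|n].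
    by rewrite !expr0 mul0r !mul0r mulr0 addr0 subr0 mul1r; field.
  by rewrite /= !exprS; field.
- rewrite {2 3}/flat ltxx mulr0 subr0.
  (* At the origin, [flat_shift] used twice turns the difference quotient flat n k / k into k times
     flat (n + 2) k, which is O(k) because every [flat] is bounded. *)
  have h : (fun k : R => k^-1 *: ((flat n \o shift 0) (k *: (1 : R)) - flat n 0)) @ 0^' --> (0 : R).
    apply/cvgrPdist_le => e e0.
    have f0 : 0 < (n.+3`!%:R : R) by rewrite ltr0n fact_gt0.
    exists (e / n.+3`!%:R) => /=; first by rewrite divr_gt0.
    move=> k /=; rewrite sub0r normrN => ke k0.
    have -> : flat n 0 = 0 by rewrite /flat ltxx.
    rewrite sub0r normrN addr0 subr0 /GRing.scale/= mulr1.
    rewrite -(flat_shift n) mulKf// -flat_shift normrM (ger0_norm (flat_ge0 _ _)).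
    rewrite -(divfK (lt0r_neq0 f0) e) ler_pM ?flat_ge0 ?flat_bounded//.
    exact: ltW.
  apply: DeriveDef; first by apply/cvg_ex; exists 0.
  exact: cvg_lim.
Unshelve. all: by end_near. Qed.

Lemma flat_continuous n : continuous (flat n).
Proof.
move=> s; apply/differentiable_continuous/derivable1_diffP.
by have [] := is_derive_flat n s.
Qed.

End flat.

Section cube_bump.
Context {R : realType} {d : nat}.
Local Notation V := 'rV[R]_d.
Local Notation e_ i := (delta_mx 0 i : V).

Lemma is_derive_coord (f : R -> R) (df : R) (x : V) (i j : 'I_d) :
  is_derive (x 0 i) 1 f df ->
  is_derive x (e_ j) (fun x : V => f (x 0 i)) ((i == j)%:R * df).
Proof.
have [->|ij] := eqVneq i j => hf.
  rewrite mul1r; case: hf; rewrite /derivable /derive.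
  have -> : (fun h : R => h^-1 *: ((f \o shift (x 0 j)) (h *: (1 : R)) - f (x 0 j))) =
      (fun h => h^-1 *: (((fun x : V => f (x 0 j)) \o shift x) (h *: (e_ j)) - f (x 0 j))).
    by apply/funext => h /=; rewrite !mxE !eqxx.
  by move=> d1 d2; split.
rewrite mul0r.
have E : (fun h : R => h^-1 *: (((fun x : V => f (x 0 i)) \o shift x) (h *: (e_ j)) - f (x 0 i)))
    = cst 0.
  apply/funext => h /=; rewrite !mxE (negbTE ij) andbF.
  by rewrite mulr0 add0r subrr scaler0.
apply: DeriveDef; rewrite /derivable /derive E; first exact: is_cvg_cst.
exact: lim_cst.
Qed.

Lemma Ck_flat_coord k n (i : 'I_d) : Ck k (fun x : V => flat n (x 0 i)).
Proof.
have c m : continuous (fun x : V => flat m (x 0 i)).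
  by move=> x; apply: continuous_comp; [exact: coord_continuous|exact: flat_continuous].
elim: k n => [|k IH] n; first exact: c.
have dv j (x : V) := is_derive_coord (x := x) (i := i) j (is_derive_flat n (x 0 i)).
split; [exact: c|by move=> j x; have [] := dv j x|] => j.
rewrite (_ : partial j _ = fun x : V => (i == j)%:R *
    (flat n.+2 (x 0 i) + (- n%:R) * flat n.+1 (x 0 i))).
  apply: CkM; first exact: Ck_cst.
  apply: CkD; first exact: IH.
  by apply: CkM; [exact: Ck_cst|exact: IH].
by apply/funext => x; have [_] := dv j x; rewrite mulNr.
Qed.

Lemma smooth_flat_coord n (i : 'I_d) : smooth (fun x : V => flat n (x 0 i)).
Proof. by apply/smoothP => k; exact: Ck_flat_coord. Qed.

Definition cube_bump (x : V) : R := \prod_(i < d) (flat 0 (x 0 i) * flat 0 (1 - x 0 i)).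

Lemma smooth_cube_bump : smooth cube_bump.
Proof.
apply: smooth_prod => i; apply: smoothM; first exact: smooth_flat_coord.
have := smooth_affine (-1) (const_mx 1) (smooth_flat_coord 0 i).
rewrite (_ : (fun _ => _) = (fun x : V => flat 0 (1 - x 0 i)))//.
by apply/funext => x; rewrite !mxE mulN1r addrC.
Qed.

Lemma cube_bump_ge0 x : 0 <= cube_bump x.
Proof. by apply: prodr_ge0 => i _; rewrite mulr_ge0 ?flat_ge0. Qed.

Lemma cube_bump_neq0 x : cube_bump x != 0 -> forall i, 0 < x 0 i < 1.
Proof.
move=> b i; move: b; rewrite /cube_bump (bigD1 i)//= mulf_eq0 negb_or => /andP[+ _].
rewrite mulf_eq0 negb_or /flat subr_gt0; case: (0 < x 0 i) => /=; last by rewrite eqxx.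
by case: (x 0 i < 1); rewrite // eqxx andbF.
Qed.

Lemma cube_bump_gt0 (x : V) : (forall i, 0 < x 0 i < 1) -> 0 < cube_bump x.
Proof.
move=> h; apply: prodr_gt0 => i _; have /andP[h1 h2] := h i.
by rewrite /flat h1 subr_gt0 h2 !expr0 !mul1r mulr_gt0 ?expR_gt0.
Qed.

End cube_bump.

Section test_functions.
Context {R : realType} {d : nat}.
Local Notation V := 'rV[R]_d.
Local Notation leb := (lebesgue_rV (R := R) d).
Implicit Types (phi psi : V -> R) (D : set V).

Lemma integrable_norm_le (K r : R) :
  leb.-integrable setT (EFin \o (fun x : V => K * \1_[set x : V | `|x| <= r] x)).
Proof.
apply: integrable_scaler.
have mB := @measurable_norm_le R d r.
apply/integrableP; split; first exact/measurable_EFinP.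
rewrite (eq_integral (fun x => (\1_[set x : V | `|x| <= r] x)%:E)).
  by rewrite integral_indic// setIT; exact: lebesgue_norm_le_fin.
by move=> x _; rewrite gee0_abs// lee_fin.
Qed.

Lemma bounded_support_integrable (K r : R) (F : V -> R) : measurable_fun setT F ->
  (forall x, `|F x| <= K) -> (forall x, F x != 0 -> `|x| <= r) ->
  leb.-integrable setT (EFin \o F).
Proof.
move=> mF FK Fr; apply: (integrable_le (G := fun x : V => K * \1_[set x : V | `|x| <= r] x)) => //.
  move=> x; have [->|Fx0] := eqVneq (F x) 0.
    by rewrite normr0 mulr_ge0// (le_trans _ (FK 0)).
  by rewrite indicE mem_set ?mulr1//; exact: Fr.
exact: integrable_norm_le.
Qed.

Lemma bounded_support_inL2 (K r : R) (F : V -> R) : measurable_fun setT F ->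
  (forall x, `|F x| <= K) -> (forall x, F x != 0 -> `|x| <= r) -> inL2 leb F.
Proof.
move=> mF FK Fr; apply: sqr_integrable_inL2 => //.
apply: (@bounded_support_integrable (K ^+ 2) r); first exact: measurable_funX.
  by move=> x; rewrite normrX lerXn2r// nnegrE (le_trans _ (FK x)).
by move=> x; rewrite expf_eq0/= => /Fr.
Qed.

Lemma test_smooth D phi : test_function D phi -> smooth phi.
Proof. by case. Qed.

Lemma test_support D phi : test_function D phi ->
  exists2 r, 0 < r & forall x, phi x != 0 -> `|x| <= r.
Proof.
move=> [_ /compact_bounded [M [_ hM]] _].
exists (`|M| + 1); first by rewrite ltr_pwDr.
move=> x px; apply: hM; first by rewrite ltr_pwDr// ler_norm.
exact: subset_closure.
Qed.

Lemma closed_norm_le (r : R) : closed [set x : V | `|x| <= r].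
Proof.
rewrite (_ : mkset _ = (fun x : V => `|x|) @^-1` [set t | t <= r])//.
apply: closed_comp; first by move=> x _; exact: norm_continuous.
exact: closed_le.
Qed.

Lemma compact_norm_le (r : R) : compact [set x : V | `|x| <= r].
Proof.
apply: bounded_closed_compact; last exact: closed_norm_le.
exists r; split; first exact: num_real.
by move=> M rM x /= xr; rewrite (le_trans xr)// ltW.
Qed.

Lemma closure_sub_closed (A B : set V) : closed B -> A `<=` B -> closure A `<=` B.
Proof. by move=> /closure_id cB AB; rewrite cB; exact: closure_subset. Qed.

Lemma test_intro phi (r : R) : smooth phi -> (forall x, phi x != 0 -> `|x| <= r) ->
  test_function setT phi.
Proof.
move=> sphi sr; split => //.
apply: (@subclosed_compact _ _ [set x : V | `|x| <= r]).
- exact: closed_closure.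
- exact: compact_norm_le.
- by apply: closure_sub_closed => //; exact: closed_norm_le.
Qed.

Lemma test_sub D phi psi : test_function D phi -> smooth psi ->
  (forall x, psi x != 0 -> closure [set x | phi x != 0] x) -> test_function D psi.
Proof.
move=> [_ cphi sD] spsi h.
have cc : closure [set x | psi x != 0] `<=` closure [set x | phi x != 0].
  by apply: closure_sub_closed => //; exact: closed_closure.
split => //; last exact: subset_trans sD.
by apply: (subclosed_compact _ cphi) => //; exact: closed_closure.
Qed.

Lemma testM D phi psi : test_function D phi -> smooth psi ->
  test_function D (fun x => phi x * psi x).
Proof.
move=> tphi spsi; apply: (test_sub tphi).
  exact: (smoothM (test_smooth tphi) spsi).
by move=> x; rewrite mulf_eq0 negb_or => /andP[h _]; exact: subset_closure.
Qed.

Lemma testZ D k phi : test_function D phi -> test_function D (fun x => k * phi x).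
Proof.
move=> tphi; apply: (test_sub tphi); first exact: (smoothZ k (test_smooth tphi)).
by move=> x; rewrite mulf_eq0 negb_or => /andP[_ h]; exact: subset_closure.
Qed.

Lemma testD D phi psi : test_function D phi -> test_function D psi ->
  test_function D (fun x => phi x + psi x).
Proof.
move=> [s1 c1 d1] [s2 c2 d2].
have cc : closure [set x | phi x + psi x != 0] `<=`
    closure [set x | phi x != 0] `|` closure [set x | psi x != 0].
  rewrite -closureU; apply: closure_subset => x /= h.
  have [p0|] := eqVneq (phi x) 0; last by left.
  by right; move: h; rewrite p0 add0r.
split; first exact: (smoothD s1 s2).
  apply: (@subclosed_compact _ _ (closure [set x | phi x != 0] `|` closure [set x | psi x != 0])) => //.
    exact: closed_closure.
  exact: compactU.
by apply: (subset_trans cc) => x [/d1|/d2].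
Qed.

Lemma testN D phi : test_function D phi -> test_function D (fun x => - phi x).
Proof.
move=> /(testZ (-1)); rewrite (_ : (fun _ => _) = (fun x => - phi x))//.
by apply/funext => x; rewrite mulN1r.
Qed.

Lemma testB D phi psi : test_function D phi -> test_function D psi ->
  test_function D (fun x => phi x - psi x).
Proof. by move=> tphi tpsi; exact: (testD tphi (testN tpsi)). Qed.

Lemma test0 D : test_function D (fun=> 0).
Proof.
have E : [set x : V | (0 : R) != 0] = set0.
  by apply/seteqP; split => // x /=; rewrite eqxx.
by split; [exact: smooth_cst|rewrite E closure0; exact: compact0|rewrite E closure0].
Qed.

Lemma test_sum D (I : Type) (r : seq I) (F : I -> V -> R) :
  (forall i, test_function D (F i)) -> test_function D (fun x => \sum_(i <- r) F i x).
Proof.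
move=> tF; elim: r => [|i r IH].
  rewrite (_ : (fun _ => _) = (fun=> 0)); first exact: test0.
  by apply/funext => x; rewrite big_nil.
rewrite (_ : (fun _ => _) = (fun x => F i x + \sum_(i <- r) F i x)).
  exact: (testD (tF i) IH).
by apply/funext => x; rewrite big_cons.
Qed.

Lemma test_setT D phi : test_function D phi -> test_function setT phi.
Proof. by case. Qed.

Lemma partial_support i phi x :
  partial i phi x != 0 -> closure [set x | phi x != 0] x.
Proof.
move=> h; apply: contrapT => nc; move/eqP: h; apply.
have : nbhs x (~` closure [set x | phi x != 0]).
  by apply: open_nbhs_nbhs; split => //; apply: closed_openC; exact: closed_closure.
move=> nb; rewrite /partial (@near_eq_derive R V R phi (cst 0)) ?derive_cst//.
apply: filterS nb => y /= hy; apply: contrapT => h.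
by apply: hy; apply: subset_closure => /=; apply/eqP.
Qed.

Lemma test_partial D i phi : test_function D phi -> test_function D (partial i phi).
Proof.
move=> tphi; apply: (test_sub tphi); first exact/smooth_partial/(test_smooth tphi).
exact: partial_support.
Qed.

Lemma test_in D phi x : test_function D phi -> phi x != 0 -> D x.
Proof. by move=> [_ _ h] px; apply/h/subset_closure. Qed.

Lemma test_measurable D phi : test_function D phi -> measurable_fun setT phi.
Proof. by move=> [/smooth_continuous/continuous_measurable_rV]. Qed.

Lemma test_bounded D phi : test_function D phi -> exists2 K, 0 < K & forall x, `|phi x| <= K.
Proof.
move=> tphi; have [r r0 hr] := test_support tphi.
have cphi := smooth_continuous (test_smooth tphi).
have : compact (phi @` [set x : V | `|x| <= r]).
  apply: continuous_compact; last exact: compact_norm_le.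
  exact: continuous_subspaceT.
move=> /compact_bounded [M [_ hM]]; exists (`|M| + 1); first by rewrite ltr_pwDr.
move=> x; have [->|px0] := eqVneq (phi x) 0; first by rewrite normr0 addr_ge0.
by apply: hM; [rewrite ltr_pwDr// ler_norm|exists x => //; exact: hr].
Qed.

Lemma test_inL2 D phi : test_function D phi -> inL2 leb phi.
Proof.
move=> tphi; have [r _ hr] := test_support tphi; have [K _ hK] := test_bounded tphi.
by apply: bounded_support_inL2 hK hr; exact: test_measurable tphi.
Qed.

Lemma test_integrable D phi : test_function D phi -> leb.-integrable setT (EFin \o phi).
Proof.
move=> tphi; have [r _ hr] := test_support tphi; have [K _ hK] := test_bounded tphi.
by apply: bounded_support_integrable hK hr; exact: test_measurable tphi.
Qed.

Lemma test_affine (r : R) (t : V) phi : r != 0 -> test_function setT phi ->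
  test_function setT (fun x => phi (r *: x + t)).
Proof.
move=> r0 tphi; have [M M0 hM] := test_support tphi.
apply: (@test_intro _ (`|r|^-1 * (M + `|t|))).
  exact: smooth_affine (test_smooth tphi).
move=> x /hM h; rewrite -ler_pdivrMl ?invr_gt0 ?normr_gt0// invrK -normrZ.
rewrite -[X in `|X|](addrK t).
by rewrite (le_trans (ler_normB _ _))// lerD2r.
Qed.

End test_functions.

Section real_fubini.
Context {R : realType} {d1 d2 : measure_display} {T1 : measurableType d1}
  {T2 : measurableType d2}
  (m1 : {sigma_finite_measure set T1 -> \bar R})
  (m2 : {sigma_finite_measure set T2 -> \bar R}).

(** Integrability is asked of every section, not of almost every one, because the inner integrals
    are real numbers obtained through [fine]. *)
Lemma Rintegral_fubini (f : T1 * T2 -> R) :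
  (m1 \x m2)%E.-integrable setT (EFin \o f) ->
  (forall x, m2.-integrable setT (EFin \o (fun y => f (x, y)))) ->
  (forall y, m1.-integrable setT (EFin \o (fun x => f (x, y)))) ->
  \int[m1]_x \int[m2]_y f (x, y) = \int[m2]_y \int[m1]_x f (x, y).
Proof.
move=> imf i2 i1; rewrite /Rintegral.
rewrite (eq_integral (fun x => \int[m2]_y (f (x, y))%:E)%E); last first.
  by move=> x _; rewrite fineK//; exact: (integrable_fin_num measurableT (i2 x)).
rewrite (Fubini (f := EFin \o f))//; congr fine; apply: eq_integral => y _.
by rewrite fineK//; exact: (integrable_fin_num measurableT (i1 y)).
Qed.

End real_fubini.

(** * Increments along segments, integration by parts, Poincare inequality *)

Section translation.
Context {R : realType} {d : nat}.
Local Notation V := 'rV[R]_d.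
Local Notation leb := (lebesgue_rV (R := R) d).
Local Notation e_ i := (delta_mx 0 i : V).
Local Notation lam := (@lebesgue_measure R).

Lemma continuous_line (x : V) (i : 'I_d) (p : V -> R) : continuous p ->
  continuous (fun s : R => p (x + s *: e_ i)).
Proof.
move=> cp s; apply: continuous_comp; last exact: cp.
apply: continuousD; first exact: cst_continuous.
by apply: continuousZl; exact: cvg_id.
Qed.

Lemma measurable_line (i : 'I_d) :
  measurable_fun setT (fun z : V * measurableTypeR R => z.1 + (z.2 : R) *: e_ i).
Proof.
apply: measurable_fun_matrixP => k j.
rewrite (_ : (fun _ => _) = (fun z : V * measurableTypeR R =>
    z.1 k j + (z.2 : R) * (e_ i k j))); last first.
  by apply/funext => z; rewrite !mxE.
apply: measurable_funD.
  exact: (measurableT_comp (measurable_coord k j) measurable_fst).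
by apply: measurable_funM => //; exact: measurable_snd.
Qed.

Lemma inL2_line (x : V) (i : 'I_d) (p : V -> R) (t : R) : continuous p ->
  inL2 lam (fun s : measurableTypeR R => \1_(`[0, t]%classic) s * p (x + (s : R) *: e_ i)).
Proof.
move=> cp; have cl := @continuous_line x i p cp.
have ml : measurable_fun setT (fun s : measurableTypeR R => p (x + (s : R) *: e_ i)).
  exact: continuous_measurable_fun.
apply: sqr_integrable_inL2.
  by apply: measurable_funM => //; exact: measurable_indic.
have : lam.-integrable `[0, t] (EFin \o (fun s : R => p (x + s *: e_ i) ^+ 2)).
  apply: continuous_compact_integrable; first exact: segment_compact.
  have c2 : continuous (fun s : R => p (x + s *: e_ i) * p (x + s *: e_ i)).
    by move=> s; apply: continuousM; exact: cl.
  exact: (continuous_subspaceT c2).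
have mI : measurable (`[0, t]%classic : set (measurableTypeR R)).
  exact: measurable_itv.
move=> h; have {h} := (integrable_mkcond _ mI).1 h.
apply: eq_integrable => // s _ /=; rewrite /patch; case: ifPn => h.
  by rewrite indicE h mul1r.
by rewrite indicE (negbTE h) mul0r expr0n.
Qed.

(** The fundamental theorem of calculus, with the indicator of the segment in both factors so that
    Cauchy-Schwarz in s applies at once; the square of that indicator integrates to t. *)
Lemma smooth_increment (psi : V -> R) (x : V) (i : 'I_d) (t : R) : smooth psi -> 0 < t ->
  psi (x + t *: e_ i) - psi x =
  ip lam (fun s : measurableTypeR R => \1_(`[0, t]%classic) s)
         (fun s : measurableTypeR R => \1_(`[0, t]%classic) s * partial i psi (x + (s : R) *: e_ i)).
Proof.
move=> spsi t0.
have cp := smooth_continuous (smooth_partial i spsi).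
have cl := @continuous_line x i _ cp.
have dl s := is_derive_line (@smooth_pderivable R d psi spsi i (x + s *: e_ i)).
have := @continuous_FTC2 R (fun s => partial i psi (x + s *: e_ i))
  (fun s => psi (x + s *: e_ i)) 0 t t0.
rewrite scale0r addr0 => h.
transitivity (fine (\int[lam]_(s in `[0, t]) (partial i psi (x + s *: e_ i))%:E)).
  rewrite h//.
  - exact: continuous_subspaceT.
  - have cpsi (s : R) : psi (x + y *: e_ i) @[y --> s] --> psi (x + s *: e_ i).
      exact: (continuous_line (smooth_continuous spsi)).
    split => [s _| |].
    + by have [] := dl s.
    + exact: (cvg_at_right_filter (cpsi 0)).
    + exact: (cvg_at_left_filter (cpsi t)).
  - by move=> s _; rewrite derive1E; have [_] := dl s.
rewrite integral_mkcond; congr fine; apply: eq_integral => s _.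
rewrite /patch; case: ifPn => hs; first by rewrite indicE hs !mul1r.
by rewrite indicE (negbTE hs) !mul0r.
Qed.

Lemma lebesgue_measure_segment0 (t : R) : 0 <= t ->
  lam (`[0, t]%classic : set R) = t%:E.
Proof.
rewrite le_eqVlt lebesgue_measure_itv/= lte_fin => /predU1P[<-|->].
  by rewrite ltxx.
by rewrite -EFinB subr0.
Qed.

Lemma integral_line_mass (t : R) : 0 <= t ->
  ip lam (fun s : measurableTypeR R => \1_(`[0, t]%classic) s)
         (fun s : measurableTypeR R => \1_(`[0, t]%classic) s) = t.
Proof.
move=> t0; rewrite /ip /Rintegral.
rewrite (eq_integral (EFin \o \1_(`[0, t]%classic : set (measurableTypeR R)))); last first.
  by move=> s _; rewrite /= !indicE; case: (s \in _); rewrite ?mulr1 ?mulr0.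
rewrite integral_indic ?setIT; last 2 first.
- exact: measurableT.
- exact: measurable_itv.
transitivity (fine t%:E) => //; congr fine.
exact: (lebesgue_measure_segment0 t0).
Qed.

(** One factor t comes from Cauchy-Schwarz on the segment. After exchanging the integrals, each s
    contributes at most the integral over B, since translation by s e_i carries A into B; the length
    of the segment is the second factor t. *)
Lemma integral_sqr_increment (psi : V -> R) (i : 'I_d) (t : R) (A B : set V) :
  smooth psi -> 0 <= t -> measurable A -> measurable B ->
  (forall x s, A x -> 0 <= s <= t -> B (x + s *: e_ i)) ->
  (\int[leb]_x ((\1_A x * (psi (x + t *: e_ i)%R - psi x)) ^+ 2)%:E <=
   (t ^+ 2)%:E * \int[leb]_x ((\1_B x * partial i psi x) ^+ 2)%:E)%E.
Proof.
rewrite le_eqVlt => spsi /orP[/eqP<-|t0] mA mB AB.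
  rewrite expr0n/= mul0e integral0_eq// => x _.
  by rewrite scale0r addr0 subrr mulr0 expr0n.
set p := partial i psi.
have cp : continuous p := smooth_continuous (smooth_partial i spsi).
have mp := continuous_measurable_rV cp.
pose f (z : V * measurableTypeR R) : R :=
  \1_A z.1 * (\1_(`[0, t]%classic) z.2 * p (z.1 + (z.2 : R) *: e_ i)) ^+ 2.
have mI : measurable (`[0, t]%classic : set (measurableTypeR R)) by exact: measurable_itv.
have m1A : measurable_fun setT (\1_A : V -> R) by exact: measurable_indic.
have m1I : measurable_fun setT (\1_(`[0, t]%classic) : measurableTypeR R -> R).
  exact: measurable_indic.
have mf : measurable_fun setT f.
  apply: measurable_funM; first exact: (measurableT_comp m1A measurable_fst).
  apply: measurable_funX; apply: measurable_funM.
    exact: (measurableT_comp m1I measurable_snd).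
  exact: (measurableT_comp mp (measurable_line i)).
have mEf : measurable_fun setT (EFin \o f) by exact/measurable_EFinP.
have f0 z : 0 <= f z by rewrite mulr_ge0 ?sqr_ge0.
have mpsi := continuous_measurable_rV (smooth_continuous spsi).
(* Cauchy-Schwarz on the segment from x to x + t e_i. *)
have cs x : (((\1_A x * (psi (x + t *: e_ i)%R - psi x)) ^+ 2)%:E <=
    t%:E * \int[lam]_s (f (x, s))%:E)%E.
  have [xA|xA] := boolP (x \in A); last first.
    rewrite indicE (negbTE xA) mul0r expr0n/=.
    apply: mule_ge0; first by rewrite lee_fin ltW.
    by apply: integral_ge0 => s _; rewrite lee_fin.
  have lp := @inL2_line x i p t cp.
  have l1 : inL2 lam (fun s : measurableTypeR R => \1_(`[0, t]%classic) s : R).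
    have := @inL2_line x i (fun=> 1) t (@cst_continuous _ _ _).
    by under eq_fun do rewrite mulr1.
  rewrite (eq_integral (fun s : measurableTypeR R =>
    ((\1_(`[0, t]%classic) s * p (x + (s : R) *: e_ i)) ^+ 2)%:E)); last first.
    by move=> s _; rewrite /f/= indicE xA mul1r.
  rewrite integral_sqrE// -EFinM lee_fin indicE xA mul1r (smooth_increment _ _ spsi t0).
  rewrite (le_trans (ip_sqr_le l1 lp))// sqr_nrm ler_wpM2r ?ip_ge0//.
  by rewrite (integral_line_mass (ltW t0)).
apply: (@le_trans _ _ (\int[leb]_x (t%:E * \int[lam]_s (f (x, s))%:E)))%E.
  apply: ge0_le_integral => //.
  - by move=> x _; rewrite lee_fin sqr_ge0.
  - apply/measurable_EFinP; apply: measurable_funX; apply: measurable_funM.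
      exact: measurable_indic.
    apply: measurable_funB => //.
    have := measurableT_comp mpsi (measurable_affine 1 (t *: e_ i)).
    by under eq_fun do rewrite /= scale1r.
  - apply: measurable_funeM.
    exact: (@measurable_fun_fubini_tonelli_F _ _ _ _ _ lam _ mEf).
have t0e : (0 <= t%:E)%E by rewrite lee_fin ltW.
rewrite ge0_integralZl//; last 2 first.
- exact: (@measurable_fun_fubini_tonelli_F _ _ _ _ _ lam _ mEf).
- by move=> x _; apply: integral_ge0 => s _; rewrite lee_fin.
rewrite expr2 EFinM -muleA; apply: lee_wpmul2l => //.
rewrite (fubini_tonelli (EFin \o f))//.
set J := (\int[leb]_x ((\1_B x * p x) ^+ 2)%:E)%E.
have J0 : (0 <= J)%E by apply: integral_ge0 => x _; rewrite lee_fin sqr_ge0.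
apply: (@le_trans _ _ (\int[lam]_s ((\1_(`[0, t]%classic) s)%:E * J)))%E.
  apply: ge0_le_integral => //.
  - by move=> s _; apply: integral_ge0 => x _; rewrite lee_fin.
  - exact: (@measurable_fun_fubini_tonelli_G _ _ _ _ _ leb _ mEf).
  - apply: emeasurable_funM => //; apply/measurable_EFinP; exact: measurable_indic.
  move=> s _; rewrite indicE; case: (boolP (s \in _)) => hs; last first.
    rewrite mul0e integral0_eq// => x _.
    by rewrite /f/= !indicE (negbTE hs) mul0r expr0n mulr0.
  rewrite mul1e.
  have mBp : measurable_fun setT (fun x => (\1_B x * p x) ^+ 2).
    by apply: measurable_funX; apply: measurable_funM => //; exact: measurable_indic.
  have mEBp : measurable_fun setT (EFin \o (fun x => (\1_B x * p x) ^+ 2)).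
    exact/measurable_EFinP.
  have pos (x : V) : (0 <= (((\1_B x * p x) ^+ 2)%R)%:E)%E.
    by rewrite lee_fin sqr_ge0.
  have eJ := @ge0_integral_affine R d 1 (s *: e_ i) _ ltr01 mEBp pos.
  rewrite expr1n mul1e -/J in eJ; rewrite -eJ.
  apply: ge0_le_integral.
  - exact: measurableT.
  - by move=> x _; rewrite lee_fin.
  - exact: (measurableT_comp mEf (pair2_measurable (s : measurableTypeR R))).
  - exact: (measurableT_comp mEBp (measurable_affine 1 (s *: e_ i))).
  - move=> x _; rewrite lee_fin /f/= scale1r !indicE hs mul1r.
    have [xA|xA] := boolP (x \in A); last by rewrite mul0r sqr_ge0.
    have xB : x + s *: e_ i \in B.
      rewrite inE; apply: AB; first by move: xA; rewrite inE.
      by move: hs; rewrite inE/= in_itv.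
    by rewrite xB 2!mul1r lexx.
have mE1I : measurable_fun setT (EFin \o (\1_(`[0, t]%classic) : measurableTypeR R -> R)).
  exact/measurable_EFinP.
rewrite (@ge0_integralZr _ _ _ lam _ measurableT _ mE1I J) => [|s _|//]; last by rewrite lee_fin.
apply: lee_wpmul2r => //; rewrite integral_indic//= setIT.
by rewrite le_eqVlt; apply/orP; left; apply/eqP; exact: (lebesgue_measure_segment0 (ltW t0)).
Qed.

End translation.

Section poincare.
Context {R : realType} {d : nat}.
Local Notation V := 'rV[R]_d.
Local Notation leb := (lebesgue_rV (R := R) d).
Local Notation e_ i := (delta_mx 0 i : V).
Local Notation lam := (@lebesgue_measure R).

Lemma measurable_translate (f : V -> R) (t : V) : measurable_fun setT f ->
  measurable_fun setT (fun x : V => f (x + t)).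
Proof.
move=> mf; have := measurableT_comp mf (measurable_affine 1 t).
by rewrite (_ : _ \o _ = fun x : V => f (x + t))//; apply/funext => x /=; rewrite scale1r.
Qed.

Lemma smooth_translate (f : V -> R) (t : V) : smooth f -> smooth (fun x : V => f (x + t)).
Proof.
move=> sf; have := smooth_affine 1 t sf.
by rewrite (_ : (fun _ => _) = fun x : V => f (x + t))//; apply/funext => x; rewrite scale1r.
Qed.

Lemma partial_translate (f : V -> R) (t : V) i : smooth f ->
  partial i (fun x : V => f (x + t)) = (fun x : V => partial i f (x + t)).
Proof.
move=> sf; have := partial_affine 1 t i (smooth_pderivable sf).
rewrite (_ : (fun x : V => f (1 *: x + t)) = fun x : V => f (x + t)); last first.
  by apply/funext => x; rewrite scale1r.
by move=> ->; apply/funext => x; rewrite scale1r mul1r.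
Qed.

Lemma smooth_measurable (f : V -> R) : smooth f -> measurable_fun setT f.
Proof. by move=> /smooth_continuous/continuous_measurable_rV. Qed.

Lemma nrm_increment1 (psi : V -> R) (i : 'I_d) (t : R) (A B : set V) :
  smooth psi -> 0 <= t -> measurable A -> measurable B ->
  (forall x s, A x -> 0 <= s <= t -> B (x + s *: e_ i)) ->
  inL2 leb (fun x : V => \1_B x * partial i psi x) ->
  let F := fun x : V => \1_A x * (psi (x + t *: e_ i) - psi x) in
  inL2 leb F /\ nrm leb F <= t * nrm leb (fun x : V => \1_B x * partial i psi x).
Proof.
move=> spsi t0 mA mB AB lB F.
have mpsi := smooth_measurable spsi.
have mF : measurable_fun setT F.
  apply: measurable_funM; first exact: measurable_indic.
  by apply: measurable_funB => //; exact: measurable_translate.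
have le := integral_sqr_increment spsi t0 mA mB AB.
have lF : inL2 leb F.
  split => //; apply: (le_lt_trans le).
  by rewrite integral_sqrE// -EFinM ltry.
split => //; move: le; rewrite !integral_sqrE// -EFinM lee_fin -exprMn.
by rewrite ler_pXn2r// nnegrE ?nrm_ge0// mulr_ge0 ?nrm_ge0.
Qed.

(** Corners of the path from 0 to t that follows one axis at a time; along each edge the increment
    is governed by a single partial derivative. *)
Definition trunc_vec (t : V) (k : nat) : V := \row_j (if (j < k)%N then t 0 j else 0).
Local Notation tau := trunc_vec.

Lemma trunc_vecS (t : V) (i : 'I_d) : tau t i.+1 = tau t i + t 0 i *: e_ i.
Proof.
apply/rowP => j; rewrite !mxE eqxx/= ltnS leq_eqVlt.
have [->|ji] := eqVneq j i; first by rewrite ltnn eqxx add0r mulr1.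
by rewrite (_ : (j == i :> nat) = false) ?mulr0 ?addr0//; apply/negbTE.
Qed.

Lemma increment_telescope (psi : V -> R) (x t : V) : psi (x + t) - psi x =
  \sum_(i < d) (psi (x + tau t i + t 0 i *: e_ i) - psi (x + tau t i)).
Proof.
have := telescope_sumr (fun k => psi (x + tau t k)) (leq0n d).
rewrite big_mkord (_ : tau t d = t); last first.
  by apply/rowP => j; rewrite mxE ltn_ord.
rewrite (_ : tau t 0 = 0) ?addr0; last by apply/rowP => j; rewrite !mxE.
by move=> <-; apply: eq_bigr => i _; rewrite trunc_vecS addrA.
Qed.

Lemma nrm_increment (psi : V -> R) (t : V) (delta : R) (A B : set V) :
  smooth psi -> 0 <= delta -> (forall i, 0 <= t 0 i <= delta) ->
  measurable A -> measurable B ->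
  (forall x s : V, A x -> (forall i, 0 <= s 0 i <= delta) -> B (x + s)) ->
  (forall i, inL2 leb (fun x : V => \1_B x * partial i psi x)) ->
  let F := fun x : V => \1_A x * (psi (x + t) - psi x) in
  inL2 leb F /\
  nrm leb F <= delta * \sum_(i < d) nrm leb (fun x : V => \1_B x * partial i psi x).
Proof.
move=> spsi delta0 t0 mA mB AB lB F.
pose Fi (i : 'I_d) (x : V) := \1_A x * (psi (x + tau t i + t 0 i *: e_ i) - psi (x + tau t i)).
have FE : F = fun x : V => \sum_(i < d) Fi i x.
  by apply/funext => x; rewrite /F /Fi -mulr_sumr -increment_telescope.
have hi i : inL2 leb (Fi i) /\
    nrm leb (Fi i) <= delta * nrm leb (fun x : V => \1_B x * partial i psi x).
  have /andP[ti0 tid] := t0 i.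
  pose Bi : set V := [set x | B (x + tau t i)].
  have mBi : measurable Bi.
    rewrite -[Bi]setTI; have := @measurable_affine R d 1 (tau t i) measurableT _ mB.
    by rewrite (_ : _ @^-1` _ = Bi)//; apply/seteqP; split=> x /=; rewrite scale1r.
  have Ei : (fun x : V => \1_Bi x * partial i (fun x : V => psi (x + tau t i)) x) =
      (fun x : V => (fun y : V => \1_B y * partial i psi y) (x + tau t i)).
    by apply/funext => x; rewrite partial_translate.
  have [lT nT] := inL2_translate (tau t i) (lB i).
  have := @nrm_increment1 (fun x : V => psi (x + tau t i)) i (t 0 i) A Bi
    (smooth_translate (tau t i) spsi) ti0 mA mBi.
  rewrite Ei nT => h.
  have E : Fi i = fun x : V => \1_A x * (psi (x + t 0 i *: e_ i + tau t i) - psi (x + tau t i)).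
    by apply/funext => x; rewrite /Fi addrAC.
  rewrite E; have [|//|l1 n1] := h.
    move=> x s Ax /andP[s0 st].
    have := AB x (s *: e_ i + tau t i) Ax; rewrite addrA; apply => j.
    rewrite 3!mxE eqxx/= mxE.
    have [->|ji] := eqVneq j i.
      by rewrite ltnn mulr1 addr0 s0 (le_trans st).
    by rewrite mulr0 add0r; case: ifP => _; rewrite ?lexx.
  split; first exact: l1.
  by apply: (le_trans n1); apply: ler_wpM2r; first exact: nrm_ge0.
have lFi i : true -> inL2 leb (Fi i) by move=> _; exact: (hi i).1.
rewrite FE; split; first exact: inL2_sum.
apply: (le_trans (nrm_sum_le _ lFi)); rewrite mulr_sumr.
by apply: ler_sum => i _; exact: (hi i).2.
Qed.

Lemma test_nrm_increment (h : V -> R) (t : V) (delta : R) :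
  test_function setT h -> (forall i, 0 <= t 0 i <= delta) -> 0 <= delta ->
  nrm leb (fun x : V => h (x + t) - h x) <= delta * \sum_(i < d) nrm leb (partial i h).
Proof.
move=> th tb delta0.
have E (F : V -> R) : (fun x : V => \1_(@setT V) x * F x) = F.
  by apply/funext => x; rewrite indicT mul1r.
have := @nrm_increment h t delta setT setT (test_smooth th) delta0 tb measurableT measurableT.
rewrite E (eq_bigr (fun i => nrm leb (partial i h))) => [|i _]; last by rewrite E.
move=> /(_ (fun _ _ _ _ => I))[|//] i.
by rewrite E; exact: test_inL2 (test_partial i th).
Qed.

Lemma Rintegral_translate (F : V -> R) (t : V) : measurable_fun setT F ->
  \int[leb]_x F (x + t) = \int[leb]_x F x.
Proof.
move=> mF; rewrite -(Rintegral_affine t ltr01 mF) expr1n mul1r.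
by congr Rintegral; apply/funext => x; rewrite scale1r.
Qed.

Lemma integrable_translate (F : V -> R) (t : V) :
  leb.-integrable setT (EFin \o F) -> leb.-integrable setT (EFin \o (fun x : V => F (x + t))).
Proof.
move=> iF; have := integrable_affine t ltr01 iF.
by apply: eq_integrable => // x _ /=; rewrite scale1r.
Qed.

(** Integrate p(x + s e_i) over all x and over s in [0, 1] in both orders. Integrating in s first
    gives psi(x + e_i) - psi(x), whose integral vanishes; integrating in x first gives the integral
    of p, by translation invariance. *)
Lemma integral_partial (psi : V -> R) i : test_function setT psi ->
  \int[leb]_x partial i psi x = 0.
Proof.
move=> tpsi; set p := partial i psi.
have tp : test_function setT p := test_partial i tpsi.
have cp := smooth_continuous (test_smooth tp).
have mp := continuous_measurable_rV cp.
have ip := test_integrable tp.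
pose I1 : set (measurableTypeR R) := `[0, 1]%classic.
have mI1 : measurable I1 by exact: measurable_itv.
pose f (z : V * measurableTypeR R) : R := \1_I1 z.2 * p (z.1 + (z.2 : R) *: e_ i).
have m1I : measurable_fun setT (\1_I1 : measurableTypeR R -> R) by exact: measurable_indic.
have mf : measurable_fun setT f.
  apply: measurable_funM; first exact: (measurableT_comp m1I measurable_snd).
  exact: (measurableT_comp mp (measurable_line i)).
have mEf : measurable_fun setT (EFin \o f) by exact/measurable_EFinP.
have iabs : leb.-integrable setT (EFin \o (fun x : V => `|p x|)).
  by have := integrable_norm ip.
have mabs : measurable_fun setT (fun x : V => (`|p x|)%:E) by have [] := integrableP _ _ _ iabs.
set K := (\int[leb]_x (`|p x|)%:E)%E.
have Kfin : K \is a fin_num by exact: (integrable_fin_num measurableT iabs).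
have K0 : (0 <= K)%E by apply: integral_ge0 => x _; rewrite lee_fin.
have imf : (leb \x lam)%E.-integrable setT (EFin \o f).
  apply: (@integrable21ltyP _ _ _ _ _ leb lam _ mEf).2.
  rewrite (_ : (fun s : measurableTypeR R => \int[leb]_x `|(EFin \o f) (x, s)|)%E =
      (fun s => (\1_I1 s)%:E * K)%E); last first.
    apply/funext => s; have pos (x : V) : (0 <= (`|p x|)%:E)%E by rewrite lee_fin.
    have := @ge0_integral_affine R d 1 (s *: e_ i) _ ltr01 mabs pos.
    rewrite expr1n mul1e -/K => <-.
    rewrite -ge0_integralZl_EFin//; last first.
      exact: (measurableT_comp mabs (measurable_affine 1 (s *: e_ i))).
    apply: eq_integral => x _.
    by rewrite /f/= scale1r normrM ger0_norm// EFinM.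
  have mE1I : measurable_fun setT (EFin \o (\1_I1 : measurableTypeR R -> R)).
    exact/measurable_EFinP.
  rewrite (@ge0_integralZr _ _ _ lam _ measurableT _ mE1I K) => [|s _|//]; last by rewrite lee_fin.
  rewrite integral_indic//= setIT.
  have -> : lam I1 = 1%:E by exact: (lebesgue_measure_segment0 ler01).
  by rewrite mul1e ltey_eq Kfin.
have l1 : inL2 lam (fun s : measurableTypeR R => \1_I1 s : R).
  have := @inL2_line R d 0 i (fun=> 1) 1 (@cst_continuous _ _ _).
  by under eq_fun do rewrite mulr1.
have idem (s : measurableTypeR R) (r : R) : \1_I1 s * (\1_I1 s * r) = \1_I1 s * r.
  by rewrite indicE; case: (s \in _); rewrite ?mul1r ?mul0r.
have i2 x : lam.-integrable setT (EFin \o (fun s => f (x, s))).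
  have := inL2_integrableM l1 (@inL2_line R d x i p 1 cp).
  by apply: eq_integrable => // s _ /=; rewrite idem.
have i1 s : leb.-integrable setT (EFin \o (fun x => f (x, s))).
  exact: (integrable_scaler (\1_I1 s) (integrable_translate (s *: e_ i) ip)).
have := Rintegral_fubini imf i2 i1.
have -> : \int[leb]_x \int[lam]_s f (x, s) = 0.
  have E (x : V) : \int[lam]_s f (x, s) = psi (x + 1 *: e_ i) - psi x.
    rewrite (smooth_increment _ _ (test_smooth tpsi) ltr01) /ip.
    by congr Rintegral; apply/funext => s; rewrite idem.
  under eq_Rintegral do rewrite E.
  rewrite RintegralB//; last 2 first.
  - exact: (integrable_translate (1 *: e_ i) (test_integrable tpsi)).
  - exact: (test_integrable tpsi).
  by rewrite Rintegral_translate ?subrr//; exact: test_measurable tpsi.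
have E (s : measurableTypeR R) : \int[leb]_x f (x, s) = \1_I1 s * \int[leb]_x p x.
  rewrite /f/= RintegralZl ?Rintegral_translate//.
  exact: (integrable_translate (s *: e_ i) ip).
under eq_Rintegral do rewrite E.
rewrite (_ : (fun s : measurableTypeR R => \1_I1 s * \int[leb]_x p x) =
    (fun s : measurableTypeR R => (\int[leb]_x p x) * (\1_I1 s * \1_I1 s))); last first.
  apply/funext => s; rewrite mulrC indicE; congr (_ * _).
  by case: (s \in _); rewrite ?mulr1 ?mulr0.
rewrite RintegralZl//; last exact: (inL2_integrableM l1 l1).
have e : \int[lam]_s (\1_I1 s * \1_I1 s) = 1 := integral_line_mass (@ler01 R).
by rewrite e mulr1 => <-.
Qed.

Lemma integration_by_parts_rV (phi psi : V -> R) i : test_function setT phi -> smooth psi ->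
  \int[leb]_x (psi x * partial i phi x) = - \int[leb]_x (partial i psi x * phi x).
Proof.
move=> tphi spsi.
have := integral_partial i (testM tphi spsi).
rewrite partialM; [|exact/smooth_pderivable/(test_smooth tphi)|exact: smooth_pderivable].
rewrite RintegralD//; last 2 first.
- exact: (test_integrable (testM tphi (smooth_partial i spsi))).
- have := test_integrable (testM (test_partial i tphi) spsi).
  by apply: eq_integrable => // x _ /=; rewrite mulrC.
move=> /eqP; rewrite addr_eq0 => /eqP h.
rewrite -[LHS]opprK -h; congr (- _).
by congr Rintegral; apply/funext => x; rewrite mulrC.
Qed.

(** A shift by 2 r + 1 moves the support off itself, so phi and its translate are orthogonal and the
    increment is at least as large as phi in norm; the increment is in turn bounded by the
    gradient. *)
Lemma poincare (phi : V -> R) (r : R) (i : 'I_d) : test_function setT phi -> 0 <= r ->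
  (forall x, phi x != 0 -> `|x| <= r) ->
  nrm leb phi <= (2 * r + 1) * \sum_(i < d) nrm leb (partial i phi).
Proof.
move=> tphi r0 hr; set t := 2 * r + 1; have t0 : 0 <= t by rewrite /t; lra.
have tb j : 0 <= (t *: e_ i) 0 j <= t.
  rewrite !mxE eqxx/=; case: (j == i); rewrite ?mulr1 ?mulr0 ?lexx ?t0//.
apply: le_trans (test_nrm_increment tphi tb t0).
have lphi := test_inL2 tphi.
have [lt nt] := inL2_translate (t *: e_ i) lphi.
rewrite -(@ler_pXn2r _ 2)// ?nnegrE ?nrm_ge0// !sqr_nrm.
rewrite ipBl ?ipBr//; try exact: inL2B.
have ip0 : ip leb (fun x : V => phi (x + t *: e_ i)) phi = 0.
  rewrite /ip (_ : (fun _ => _) = (fun=> 0)); first by rewrite /Rintegral integral0.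
  apply/funext => x; have [->|p1] := eqVneq (phi x) 0; first by rewrite mulr0.
  have [->|p2] := eqVneq (phi (x + t *: e_ i)) 0; first by rewrite mul0r.
  have := le_trans (rV_coord_le _ i) (hr _ p2).
  have := le_trans (rV_coord_le _ i) (hr _ p1).
  rewrite !mxE !eqxx/= mulr1 !ler_norml /t => /andP[? ?] /andP[? ?].
  by exfalso; lra.
rewrite ip0 (ipC leb phi) ip0 !subr0 sub0r opprK.
by rewrite lerDr ip_ge0.
Qed.

End poincare.

(** * Continuity of translations in L^2 *)

Section l2_dominated.
Context {dT : measure_display} {T : measurableType dT} {R : realType}
  (mu : {measure set T -> \bar R}).

Lemma nrm_dominated (f : nat -> T -> R) (G : T -> R) :
  (forall n, measurable_fun setT (f n)) -> inL2 mu G ->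
  (forall n x, `|f n x| <= `|G x|) ->
  {ae mu, forall x, f n x @[n --> \oo] --> 0} ->
  forall e, 0 < e -> exists n, nrm mu (f n) <= e.
Proof.
move=> mf lG fG f0 e e0.
have lf n : inL2 mu (f n) by apply: (inL2_le (mf n) lG).
have mf2 n : measurable_fun setT (fun x => ((f n x) ^+ 2)%:E).
  by apply/measurable_EFinP; apply: measurable_funX.
have [] := @dominated_convergence _ _ _ mu setT measurableT
  (fun n x => ((f n x) ^+ 2)%:E) (cst 0%E) (fun x => ((G x) ^+ 2)%:E) mf2 (@measurable_cst _ _ _ _ _ _).
- apply: filterS f0 => x fx _ /=; apply: cvg_EFin; first exact: nearW.
  rewrite /comp/= -[X in _ --> X](expr0n R 2)/=.
  by under eq_fun do rewrite expr2; rewrite expr2; apply: cvgM.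
- exact: (inL2_sqr_integrable lG).
- apply: aeW => x n _; rewrite /= lee_fin ger0_norm ?sqr_ge0//.
  by rewrite -(real_normK (num_real (f n x))) -(real_normK (num_real (G x))) lerXn2r// nnegrE.
move=> _ _; rewrite integral0 => h.
have e20 : 0 < e ^+ 2 by rewrite exprn_gt0.
have : \forall n \near \oo, ([sequence (\int[mu]_x ((f n x) ^+ 2)%:E)%E]_n n < (e ^+ 2)%:E)%E.
  apply: (h [set y | (y < (e ^+ 2)%:E)%E]); apply: open_nbhs_nbhs.
  by split; [exact: open_ereal_lt_ereal|rewrite /= lte_fin].
move=> [n _ /(_ n (leqnn n))]; rewrite /= integral_sqrE// lte_fin => hn.
exists n; by rewrite -(@ler_pXn2r _ 2)// ?nnegrE ?nrm_ge0// ltW.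
Qed.

End l2_dominated.

Section l2_translation.
Context {R : realType} {d : nat}.
Local Notation V := 'rV[R]_d.
Local Notation leb := (lebesgue_rV (R := R) d).

Definition L2c (F : V -> R) := inL2 leb F /\
  forall e, 0 < e -> exists2 eta, 0 < eta &
    forall t : V, `|t| <= eta -> nrm leb (fun x : V => F (x + t) - F x) <= e.

(** The class is closed in L^2, by a three-epsilon argument. This closure is what carries it from
    half-spaces to measurable sets, then to bounded functions, then to all of L^2. *)
Lemma L2c_approx (F : V -> R) : inL2 leb F ->
  (forall e, 0 < e -> exists2 G, L2c G & nrm leb (fun x => F x - G x) <= e) -> L2c F.
Proof.
move=> lF h; split => // e e0.
have e30 : 0 < e / 3 by rewrite divr_gt0.
have [G [lG cG] FG] := h _ e30; have [eta eta0 heta] := cG _ e30.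
exists eta => // t /heta teta.
have [lFt _] := inL2_translate t lF; have [lGt _] := inL2_translate t lG.
have [l1 n1] := inL2_translate t (inL2B lF lG).
rewrite (_ : (fun x => _) = (fun x : V => (F (x + t) - G (x + t)) +
    ((G (x + t) - G x) - (F x - G x)))); last first.
  by apply/funext => x; ring.
have h1 := nrmD_le l1 (inL2B (inL2B lGt lG) (inL2B lF lG)).
have h2 := nrmB_le (inL2B lGt lG) (inL2B lF lG).
apply: (le_trans h1); rewrite n1 -[e](divfK (lt0r_neq0 (ltr0Sn R 2))) mulr_natr mulrSr mulr2n.
rewrite -addrA lerD// (le_trans h2)// lerD//.
Qed.

Lemma L2cD (F G : V -> R) : L2c F -> L2c G -> L2c (fun x => F x + G x).
Proof.
move=> [lF cF] [lG cG]; split; first exact: inL2D.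
move=> e e0; have e20 : 0 < e / 2 by rewrite divr_gt0.
have [eta1 h1 H1] := cF _ e20; have [eta2 h2 H2] := cG _ e20.
exists (Num.min eta1 eta2); first by rewrite lt_min h1.
move=> t; rewrite le_min => /andP[/H1 t1 /H2 t2].
have [lFt _] := inL2_translate t lF; have [lGt _] := inL2_translate t lG.
rewrite (_ : (fun x => _) = (fun x : V => (F (x + t) - F x) + (G (x + t) - G x))); last first.
  by apply/funext => x; ring.
apply: (le_trans (nrmD_le (inL2B lFt lF) (inL2B lGt lG))).
by rewrite (splitr e) lerD.
Qed.

Lemma L2cZ k (F : V -> R) : L2c F -> L2c (fun x => k * F x).
Proof.
move=> [lF cF]; split; first exact: inL2Z.
move=> e e0; have k0 : 0 < `|k| + 1 by rewrite ltr_pwDr.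
have [eta h H] := cF (e / (`|k| + 1)) (divr_gt0 e0 k0); exists eta => // t /H tH.
have [lFt _] := inL2_translate t lF.
rewrite (_ : (fun x => _) = (fun x : V => k * (F (x + t) - F x))); last first.
  by apply/funext => x; ring.
rewrite (nrmZ k (inL2B lFt lF)).
rewrite (le_trans (ler_wpM2l (normr_ge0 _) tH))// mulrCA ler_piMr ?(ltW e0)//.
by rewrite ler_pdivrMr// mul1r lerDl.
Qed.

Lemma L2cB (F G : V -> R) : L2c F -> L2c G -> L2c (fun x => F x - G x).
Proof.
move=> cF cG; rewrite (_ : (fun x => _) = (fun x : V => F x + (-1) * G x)).
  exact: (L2cD cF (L2cZ (-1) cG)).
by apply/funext => x; rewrite mulN1r.
Qed.

Lemma L2cM (F G : V -> R) : (forall x, `|F x| <= 1) -> (forall x, `|G x| <= 1) ->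
  L2c F -> L2c G -> L2c (fun x => F x * G x).
Proof.
move=> F1 G1 [lF cF] [lG cG].
have mFG : measurable_fun setT (fun x => F x * G x).
  by apply: measurable_funM; [exact: lF.1|exact: lG.1].
split.
  by apply: (inL2_le mFG lF) => x; rewrite normrM ler_piMr.
move=> e e0; have e20 : 0 < e / 2 by rewrite divr_gt0.
have [eta1 h1 H1] := cF _ e20; have [eta2 h2 H2] := cG _ e20.
exists (Num.min eta1 eta2); first by rewrite lt_min h1.
move=> t; rewrite le_min => /andP[/H1 t1 /H2 t2].
have [lFt _] := inL2_translate t lF; have [lGt _] := inL2_translate t lG.
rewrite (_ : (fun x => _) = (fun x : V => F (x + t) * (G (x + t) - G x) +
   G x * (F (x + t) - F x))); last first.
  by apply/funext => x; ring.
have F1' : {ae leb, forall x : V, `|F (x + t)| <= 1} by exact: aeW.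
have G1' : {ae leb, forall x : V, `|G x| <= 1} by exact: aeW.
have [l1 n1] := inL2_bounded lFt.1 F1' ler01 (inL2B lGt lG).
have [l2 n2] := inL2_bounded lG.1 G1' ler01 (inL2B lFt lF).
apply: (le_trans (nrmD_le l1 l2)); rewrite mul1r in n1; rewrite mul1r in n2.
by rewrite (splitr e); apply: lerD; [exact: le_trans n1 _|exact: le_trans n2 _].
Qed.

(** By contradiction: a sequence of translations tending to 0 with large increments would violate
    dominated convergence, since the increments are eventually 0 at almost every point. *)
Lemma L2c_ae_cont (F : V -> R) (r : R) : measurable_fun setT F ->
  (forall x, `|F x| <= 1) -> (forall x, F x != 0 -> `|x| <= r) ->
  {ae leb, forall x, \forall y \near x, F y = F x} -> L2c F.
Proof.
move=> mF F1 Fr Fae; have lF := bounded_support_inL2 mF F1 Fr.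
split => // e e0; apply: contrapT => nex.
have bad (n : nat) : exists t : V, `|t| <= n.+1%:R^-1 /\ e < nrm leb (fun x => F (x + t) - F x).
  apply: contrapT => nt; apply: nex; exists (n.+1%:R^-1); first by rewrite invr_gt0.
  move=> t tn; rewrite leNgt; apply/negP => h; apply: nt; by exists t.
have [t ht] := choice bad.
(* The translations have norm at most 1, so the increments of a function bounded by 1 and supported
   in the ball of radius r are bounded by 2 and live in the ball of radius r + 1. *)
pose G (x : V) : R := 2 * \1_[set x : V | `|x| <= r + 1] x.
have lG : inL2 leb G.
  apply: (@bounded_support_inL2 R d 2 (r + 1)).
  - by apply: measurable_funM => //; apply: measurable_indic; exact: measurable_norm_le.
  - by move=> x; rewrite /G indicE; case: (x \in _); rewrite ?mulr1 ?mulr0 ger0_norm.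
  - by move=> x; rewrite /G indicE mulf_eq0 negb_or => /andP[_]; case: (boolP (x \in _));
      rewrite ?eqxx// inE.
have [] := @nrm_dominated _ _ R leb (fun n x => F (x + t n) - F x) G _ lG _ _ e e0.
- by move=> n; apply: measurable_funB => //; exact: measurable_translate.
- move=> n x; have [tn _] := ht n.
  have t1 : `|t n| <= 1 by rewrite (le_trans tn)// invf_le1// ler1n.
  have [xr|xr] := leP `|x| (r + 1).
    rewrite [X in _ <= X]ger0_norm; last by rewrite mulr_ge0.
    rewrite /G indicE mem_set// mulr1 (le_trans (ler_normB _ _))//.
    exact: (lerD (F1 _) (F1 _)).
  have -> : F x = 0.
    by apply/eqP; apply: contraTT xr => /Fr h; rewrite -leNgt (le_trans h)// lerDl.
  have -> : F (x + t n) = 0; last by rewrite subrr normr0.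
  apply/eqP; apply: contraTT xr => /Fr h; rewrite -leNgt.
  rewrite -[X in `|X|](addrK (t n)) (le_trans (ler_normB _ _))//.
  exact: lerD.
- apply: filterS Fae => x /nbhs_ballP[eps /= eps0 hx].
  apply: cvg_near_cst.
  have : \forall n \near \oo, n.+1%:R^-1 < eps :> R by exact: near_infty_natSinv_lt (PosNum eps0).
  apply: filterS => n hn; have [tn _] := ht n.
  rewrite hx ?subrr// -ball_normE/= opprD addrA subrr sub0r normrN.
  exact: le_lt_trans tn hn.
- move=> n; have [_] := ht n; by rewrite ltNge => /negP.
Qed.

End l2_translation.

Section good_sets.
Context {R : realType} {d : nat}.
Local Notation V := 'rV[R]_d.
Local Notation leb := (lebesgue_rV (R := R) d).
Local Notation B_ r := [set x : V | `|x| <= r].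

Lemma ae_coord_neq (j : 'I_d) (c : R) : {ae leb, forall x : V, x 0 j != c}.
Proof.
exists [set x : V | x 0 j = c]; split.
- rewrite (_ : mkset _ = (fun x : V => x 0 j) @^-1` [set c])//.
  by rewrite -[X in measurable X]setTI; exact: measurable_coord.
- exact: lebesgue_hyperplane.
- by move=> x /= /negP; rewrite negbK => /eqP.
Qed.

Lemma ae_sphere (r : R) : 0 < r ->
  {ae leb, forall x : V, \forall y \near x, (`|y| <= r) = (`|x| <= r)}.
Proof.
move=> r0.
have h : {ae leb, forall x : V, forall j, x 0 j != r /\ x 0 j != - r}.
  apply: filter_forall => j.
  by apply: filterS2 (ae_coord_neq j r) (ae_coord_neq j (- r)) => x.
apply: filterS h => x hx; apply/nbhs_ballP.
have [xr|xr] := leP `|x| r.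
  have {}xr : `|x| < r.
    apply/(rV_norm_ltP x r0) => j; have [h1 h2] := hx j.
    rewrite lt_neqAle (rV_norm_leP x (ltW r0)).1// andbT.
    by have [x0|x0] := leP 0 (x 0 j); [rewrite ger0_norm|rewrite ltr0_norm// eqr_oppLR].
  exists (r - `|x|); rewrite /= ?subr_gt0// => y; rewrite -ball_normE/= => xy.
  rewrite -(subrK x y) (le_trans (ler_normD _ _))// -lerBrDr distrC.
  exact: ltW.
exists (`|x| - r); rewrite /= ?subr_gt0// => y; rewrite -ball_normE/= => xy.
apply/negbTE; rewrite -ltNge.
have := ler_normD (x - y) y; rewrite subrK => h'.
by move: xy; rewrite ltrBrDr => /(fun z => lt_le_trans z h'); rewrite ltrD2l.
Qed.

Lemma near_coord_gt (x : V) (j : 'I_d) (a : R) : x 0 j != a ->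
  \forall y \near x, (a < (y : V) 0 j) = (a < x 0 j).
Proof.
move=> xa; apply/nbhs_ballP; exists `|x 0 j - a|; rewrite /= ?normr_gt0 ?subr_eq0//.
move=> y; rewrite -ball_normE/= => xy.
have {xy} := le_lt_trans (rV_coord_le (x - y) j) xy; rewrite !mxE.
have [ax|] := ltP a (x 0 j).
  by rewrite (@gtr0_norm _ (x 0 j - a)) ?subr_gt0// ltr_norml => /andP[_ h]; lra.
rewrite le_eqVlt (negbTE xa)/= => ax.
rewrite (@ltr0_norm _ (x 0 j - a)) ?subr_lt0// ltr_norml => /andP[h _].
by apply/negbTE; rewrite -leNgt; lra.
Qed.

(** Intersecting with balls makes the indicators square integrable. These sets form a sigma-algebra
    containing the coordinate half-spaces, hence exhaust the measurable sets. *)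
Definition good (E : set V) := measurable E /\
  forall r, 0 < r -> L2c (fun x : V => \1_(B_ r) x * \1_E x).

Lemma ind_le1 (A : set V) x : `|\1_A x : R| <= 1.
Proof. by rewrite indicE; case: (x \in A); rewrite ?normr0 ?normr1. Qed.

Lemma ind2_le1 (A B : set V) x : `|\1_A x * \1_B x : R| <= 1.
Proof. by rewrite normrM mulr_ile1// ind_le1. Qed.

Lemma measurable_indB (r : R) (E : set V) : measurable E ->
  measurable_fun setT (fun x : V => \1_(B_ r) x * \1_E x : R).
Proof.
move=> mE; apply: measurable_funM; apply: measurable_indic => //.
exact: measurable_norm_le.
Qed.

Lemma indB_support (r : R) (G : V -> R) x : \1_(B_ r) x * G x != 0 -> `|x| <= r.
Proof.
rewrite indicE mulf_eq0 negb_or => /andP[+ _].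
by case: (boolP (x \in _)); rewrite ?eqxx// inE.
Qed.

Lemma good_coord_gt (j : 'I_d) (a : R) : good [set x : V | a < x 0 j].
Proof.
have mE : measurable [set x : V | a < x 0 j].
  rewrite (_ : mkset _ = (fun x : V => x 0 j) @^-1` `]a, +oo[); last first.
    by apply/seteqP; split=> x; rewrite /= in_itv/= andbT.
  by rewrite -[X in measurable X]setTI; exact: measurable_coord.
split => // r r0; apply: (@L2c_ae_cont _ _ _ r).
- exact: measurable_indB.
- by move=> x; exact: ind2_le1.
- by move=> x; exact: indB_support.
- apply: filterS2 (ae_sphere r0) (ae_coord_neq j a) => x h /near_coord_gt.
  move: h; apply: filterS2 => y h1 h2; rewrite !indicE.
  congr (_%:R * _%:R); [congr nat_of_bool|congr nat_of_bool].
    by apply/idP/idP; rewrite !inE/= h1.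
  by apply/idP/idP; rewrite !inE/= h2.
Qed.

Lemma good_setT : good setT.
Proof.
split => // r r0; apply: (@L2c_ae_cont _ _ _ r).
- exact: measurable_indB.
- by move=> x; exact: ind2_le1.
- by move=> x; exact: indB_support.
- apply: filterS (ae_sphere r0) => x; apply: filterS => y h1; rewrite !indicT !mulr1 !indicE.
  by congr (_%:R); congr nat_of_bool; apply/idP/idP; rewrite !inE/= h1.
Qed.

Lemma goodC (E : set V) : good E -> good (~` E).
Proof.
move=> [mE gE]; split; first exact: measurableC.
move=> r r0; rewrite (_ : (fun x => _) = (fun x : V => \1_(B_ r) x * \1_setT x - \1_(B_ r) x * \1_E x)).
  by apply: L2cB; [exact: good_setT.2|exact: gE].
apply/funext => x; rewrite indicT -mulrBr; congr (_ * _); rewrite !indicE in_setC.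
by case: (x \in E); rewrite ?subr0 ?subrr.
Qed.

Lemma goodI (E F : set V) : good E -> good F -> good (E `&` F).
Proof.
move=> [mE gE] [mF gF]; split; first exact: measurableI.
move=> r r0; rewrite (_ : (fun x => _) = (fun x : V => (\1_(B_ r) x * \1_E x) * (\1_(B_ r) x * \1_F x))).
  by apply: L2cM (gE _ r0) (gF _ r0) => x; exact: ind2_le1.
apply/funext => x; rewrite indicI/= mulrACA; congr (_ * _).
by rewrite indicE; case: (x \in _); rewrite ?mulr1 ?mulr0.
Qed.

Lemma good0 : good set0.
Proof. by rewrite -setCT; exact/goodC/good_setT. Qed.

Lemma goodU (E F : set V) : good E -> good F -> good (E `|` F).
Proof. by move=> gE gF; rewrite -[_ `|` _]setCK setCU; apply/goodC/goodI; exact: goodC. Qed.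

(** Finite unions are good by the Boolean operations; inside a ball their indicators converge in L^2
    by domination, and [L2c_approx] passes to the limit. *)
Lemma good_bigcup (E : (set V)^nat) : (forall n, good (E n)) -> good (\bigcup_n E n).
Proof.
move=> gE.
have gU n : good (\bigcup_(i in `I_n) E i).
  elim: n => [|n IH]; first by rewrite II0 bigcup_set0; exact: good0.
  by rewrite IIS bigcup_setU bigcup_set1; apply: goodU.
have mU : measurable (\bigcup_n E n) by apply: bigcup_measurable => n _; exact: (gE n).1.
split => // r r0; apply: L2c_approx.
  apply: (bounded_support_inL2 (K := 1) (r := r)).
  - exact: measurable_indB.
  - by move=> x; exact: ind2_le1.
  - by move=> x; exact: indB_support.
have lB : inL2 leb (\1_(B_ r) : V -> R).
  have [l _] := good_setT.2 r r0.
  by move: l; rewrite (_ : (fun x => _) = \1_(B_ r))//; apply/funext => x; rewrite indicT mulr1.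
have h : forall e, 0 < e -> exists n, nrm leb (fun x : V => \1_(B_ r) x * \1_(\bigcup_n E n) x -
  \1_(B_ r) x * \1_(\bigcup_(i in `I_n) E i) x) <= e.
  apply: (@nrm_dominated _ _ R leb _ (\1_(B_ r)) _ lB).
  - move=> n; apply: measurable_funB; apply: measurable_indB => //; exact: (gU n).1.
  - move=> n x; rewrite -mulrBr normrM ler_piMr// ler_norml !indicE.
    by case: (x \in _); case: (x \in _) => /=; apply/andP; split; lra.
  - apply: aeW => x; apply: cvg_near_cst.
    have [[n _ Enx]|nx] := pselect ((\bigcup_n E n) x).
      exists n.+1 => // m /= nm; apply/eqP; rewrite -mulrBr mulf_eq0; apply/orP; right.
      have U1 : (\bigcup_n E n) x by exists n.
      have U2 : (\bigcup_(i in `I_m) E i) x by exists n.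
      by rewrite !indicE (mem_set U1) (mem_set U2) subrr.
    apply: nearW => m.
    have nU : ~ (\bigcup_(i in `I_m) E i) x by move=> [i _ Ei]; apply: nx; exists i.
    by rewrite !indicE (memNset nx) (memNset nU) subrr.
move=> e /h[n hn]; exists (fun x => \1_(B_ r) x * \1_(\bigcup_(i in `I_n) E i) x) => //.
exact: (gU n).2.
Qed.

Lemma measurable_good (E : set V) : measurable E -> good E.
Proof.
apply: smallest_sub.
  split; [exact: good0|move=> A gA; rewrite setTD; exact: goodC|exact: good_bigcup].
move=> _ [i [j [B [mB ->]]]]; rewrite ord1 {i}.
have : (@RGenOInfty.G R).-sigma.-measurable B by rewrite -RGenOInfty.measurableE.
apply: (@smallest_sub _ _ _ [set B : set R | good ((fun x : V => x 0 j) @^-1` B)]).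
  split => /=.
  - by rewrite preimage_set0; exact: good0.
  - by move=> A gA; rewrite setTD; exact: goodC.
  - by move=> F gF; rewrite preimage_bigcup; exact: good_bigcup.
move=> _ [a ->] /=; rewrite (_ : _ @^-1` _ = [set x : V | a < x 0 j]).
  exact: good_coord_gt.
by apply/seteqP; split=> x; rewrite /= in_itv/= andbT.
Qed.

End good_sets.

Section l2_translation_continuity.
Context {R : realType} {d : nat}.
Local Notation V := 'rV[R]_d.
Local Notation leb := (lebesgue_rV (R := R) d).
Local Notation B_ r := [set x : V | `|x| <= r].

Lemma L2c_sum (n : nat) (F : 'I_n -> V -> R) : (forall i, L2c (F i)) ->
  L2c (fun x => \sum_(i < n) F i x).
Proof.
elim: n F => [|n IH] F cF.
  rewrite (_ : (fun x => _) = (fun x : V => 0 * \1_(B_ 1) x * \1_setT x)).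
    have := L2cZ 0 ((@good_setT R d).2 _ ltr01).
    by rewrite (_ : (fun x => _) = (fun x : V => 0 * \1_(B_ 1) x * \1_setT x))//; apply/funext => x; rewrite mulrA.
  by apply/funext => x; rewrite big_ord0 !mul0r.
rewrite (_ : (fun x => _) = (fun x : V => F 0 x + \sum_(i < n) F (lift 0 i) x)).
  by apply: L2cD => //; exact: IH.
by apply/funext => x; rewrite big_ord_recl.
Qed.

Lemma sum_ltn (K T : nat) : (T <= K)%N -> \sum_(k < K) (k < T)%N%:R = T%:R :> R.
Proof.
move=> TK; suff -> : \sum_(k < K) (k < T)%N%:R = (minn K T)%:R :> R by rewrite (minn_idPr TK).
elim: K {TK} => [|K IH]; first by rewrite big_ord0 min0n.
rewrite big_ord_recr/= IH; case: (ltnP K T) => KT.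
  by rewrite (minn_idPl KT) -natr1.
by rewrite addr0 (minn_idPr (leq_trans KT (leqnSn _))).
Qed.

(** F + M is approximated by the staircase floor(n (F + M)) / n, a finite combination of indicators
    of its superlevel sets. *)
Lemma L2c_bounded (F : V -> R) (M r : R) : 0 < M -> 0 < r -> measurable_fun setT F ->
  (forall x, `|F x| <= M) -> (forall x, F x != 0 -> `|x| <= r) -> L2c F.
Proof.
move=> M0 r0 mF FM Fr.
have cB : L2c (\1_(B_ r) : V -> R).
  have := (@good_setT R d).2 _ r0.
  by rewrite (_ : (fun x => _) = \1_(B_ r))//; apply/funext => x; rewrite indicT mulr1.
apply: L2c_approx; first exact: bounded_support_inL2 mF FM Fr.
move=> e e0; set c := nrm leb (\1_(B_ r) : V -> R).
(* The staircase errs by at most 1/n on the ball, hence by c/n in norm, which is at most e; K levels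
   suffice because F + M does not exceed 2 M. *)
pose n : nat := (Num.truncn (c / e)).+1.
have n0 : 0 < n%:R :> R by rewrite ltr0n.
pose K : nat := (Num.truncn (n%:R * (2 * M))).+1.
(* Starting at level k + 1 makes the number of k with x in E k equal to the integer part of n (F x +
   M). *)
pose E (k : nat) : set V := [set x | k.+1%:R <= n%:R * (F x + M)].
have mE k : measurable (E k).
  rewrite (_ : E k = (fun x => n%:R * (F x + M)) @^-1` `[k.+1%:R, +oo[); last first.
    by apply/seteqP; split => x; rewrite /= in_itv/= andbT.
  rewrite -[X in measurable X]setTI.
  have mm : measurable_fun setT (fun x => n%:R * (F x + M)).
    by apply: measurable_funM => //; exact: measurable_funD.
  exact: mm.
pose G (x : V) : R := n%:R^-1 * (\sum_(k < K) \1_(B_ r) x * \1_(E k) x) - M * \1_(B_ r) x.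
exists G.
  apply: L2cB; last exact: L2cZ.
  apply: L2cZ; apply: L2c_sum => k; exact: (measurable_good (mE k)).2.
have FG x : `|F x - G x| <= `|n%:R^-1 * \1_(B_ r) x|.
  rewrite /G; have [xB|xB] := boolP (x \in B_ r); last first.
    rewrite !indicE (negbTE xB) !mulr0 big1; last by move=> k _; rewrite mul0r.
    have -> : F x = 0 by apply/eqP; apply: contraNT xB => /Fr h; rewrite inE.
    by rewrite mulr0 !subr0.
  rewrite !indicE xB !mulr1; under eq_bigr do rewrite mul1r indicE.
  have s0 : 0 <= n%:R * (F x + M).
    by rewrite mulr_ge0// ?ler0n//; move: (FM x); rewrite ler_norml; lra.
  have -> : \sum_(k < K) (x \in E k)%:R = \sum_(k < K) (k < Num.truncn (n%:R * (F x + M)))%N%:R :> R.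
    apply: eq_bigr => k _; congr (_%:R); congr nat_of_bool.
    by rewrite truncn_gt_nat; apply/idP/idP; rewrite inE.
  rewrite sum_ltn; last first.
    rewrite /K leqW// le_truncn// ler_pM2l//.
    by move: (FM x); rewrite ler_norml; lra.
  have /andP[h1 h2] := truncn_itv s0.
  set T := (Num.truncn _)%:R in h1 *; rewrite -natr1 -/T in h2.
  rewrite [leRHS]ger0_norm ?invr_ge0 ?ler0n//.
  have -> : F x - (n%:R^-1 * T - M) = n%:R^-1 * (n%:R * (F x + M) - T).
    by field; rewrite gt_eqF.
  rewrite normrM ger0_norm ?invr_ge0 ?ler0n// ler_piMr ?invr_ge0 ?ler0n//.
  by rewrite ger0_norm ?subr_ge0//; lra.
have lnB : inL2 leb (fun x => n%:R^-1 * \1_(B_ r) x) by apply: inL2Z; exact: cB.1.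
have mFG : measurable_fun setT (fun x => F x - G x).
  apply: measurable_funB => //; apply: measurable_funB; last exact: (inL2Z M cB.1).1.
  apply: measurable_funM => //; apply: (inL2_sum (mu := leb) _ _).1 => k _.
  exact: ((measurable_good (mE k)).2 _ r0).1.
apply: (le_trans (nrm_le mFG lnB FG)); rewrite (nrmZ _ cB.1) -/c.
rewrite ger0_norm ?invr_ge0 ?ler0n// ler_pdivrMl// -ler_pdivrMr// ltW//.
exact: truncnS_gt.
Qed.

Theorem inL2_L2c (F : V -> R) : inL2 leb F -> L2c F.
Proof.
move=> lF; have mF := lF.1; apply: L2c_approx => // e e0.
pose E (n : nat) : set V := B_ n.+1%:R `&` [set x | `|F x| <= n%:R].
have mE n : measurable (E n).
  apply: measurableI; first exact: measurable_norm_le.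
  rewrite (_ : mkset _ = F @^-1` `[- n%:R, n%:R]); last first.
    by apply/seteqP; split => x; rewrite /= in_itv/= ler_norml.
  by rewrite -[X in measurable X]setTI; exact: mF.
have mf n : measurable_fun setT (fun x => F x * \1_(E n) x).
  by apply: measurable_funM => //; exact: measurable_indic.
have cG n : L2c (fun x => F x * \1_(E n) x).
  apply: (@L2c_bounded _ n.+1%:R n.+1%:R) => //.
  - move=> x; rewrite indicE; have [|] := boolP (x \in _); last by rewrite mulr0 normr0 ler0n.
    by rewrite inE mulr1 => -[_ /= h]; rewrite (le_trans h)// ler_nat.
  - move=> x; rewrite indicE; have [|] := boolP (x \in _); last by rewrite mulr0 eqxx.
    by rewrite inE => -[/= h _] _.
have [] := @nrm_dominated _ _ R leb (fun n x => F x - F x * \1_(E n) x) F _ lF _ _ e e0.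
- by move=> n; apply: measurable_funB.
- move=> n x; rewrite indicE; case: (x \in _); rewrite ?mulr1 ?subrr ?normr0//.
  by rewrite mulr0 subr0.
- apply: aeW => x; apply: cvg_near_cst.
  exists (Num.truncn (`|x| + `|F x|)).+1 => // n /= hn.
  have hn' : `|x| + `|F x| <= n%:R.
    by rewrite (le_trans (ltW (truncnS_gt _)))// ler_nat.
  rewrite indicE mem_set ?mulr1 ?subrr//; split => /=.
    rewrite (@le_trans _ _ n%:R) ?ler_nat//; apply: le_trans hn'.
    by rewrite lerDl.
  by apply: le_trans hn'; rewrite lerDr.
- by move=> n hn; exists (fun x => F x * \1_(E n) x).
Qed.

End l2_translation_continuity.

(** * Convolution and mollification *)

Section convolution.
Context {R : realType} {d : nat}.
Local Notation V := 'rV[R]_d.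
Local Notation leb := (lebesgue_rV (R := R) d).
Local Notation e_ i := (delta_mx 0 i : V).

Lemma mean_value (psi : V -> R) (x : V) (i : 'I_d) (s : R) : smooth psi ->
  exists2 c, `|c| <= `|s| & psi (x + s *: e_ i) - psi x = s * partial i psi (x + c *: e_ i).
Proof.
move=> spsi.
have dl s' := is_derive_line (@smooth_pderivable R d psi spsi i (x + s' *: e_ i)).
have cl := @continuous_line R d x i _ (smooth_continuous spsi).
have [s0|s0] := leP 0 s.
  have [|c] := @MVT_segment R (fun s => psi (x + s *: e_ i))
    (fun s => partial i psi (x + s *: e_ i)) 0 s s0; first exact: continuous_subspaceT.
  rewrite in_itv/= scale0r addr0 subr0 => /andP[c0 cs] ->.
  by exists c; [rewrite !ger0_norm|rewrite mulrC].
have [|c] := @MVT_segment R (fun s => psi (x + s *: e_ i))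
    (fun s => partial i psi (x + s *: e_ i)) s 0 (ltW s0); first exact: continuous_subspaceT.
rewrite in_itv/= scale0r addr0 sub0r => /andP[cs c0] h.
exists c; first by rewrite ler0_norm// ltr0_norm// lerN2.
by rewrite -opprB h mulrN opprK mulrC.
Qed.

Lemma test_lipschitz (kappa : V -> R) : test_function setT kappa ->
  exists2 L, 0 <= L & forall x t : V, `|kappa (x + t) - kappa x| <= L * `|t|.
Proof.
move=> tk.
have /choice[K hK] : forall i, exists K, 0 < K /\ forall x, `|partial i kappa x| <= K.
  by move=> i; have [K K0 h] := test_bounded (test_partial i tk); exists K.
exists (\sum_i K i); first by apply: sumr_ge0 => i _; have [/ltW] := hK i.
move=> x t; rewrite increment_telescope mulr_suml.
apply: (le_trans (ler_norm_sum _ _ _)); apply: ler_sum => i _.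
have [c _ ->] := mean_value (x + trunc_vec t i) i (t 0 i) (test_smooth tk).
by rewrite normrM mulrC ler_pM// ?(hK i).2// rV_coord_le.
Qed.

Lemma test_taylor (kappa : V -> R) (i : 'I_d) : test_function setT kappa ->
  exists2 L, 0 <= L & forall (x : V) (s : R),
    `|kappa (x + s *: e_ i) - kappa x - s * partial i kappa x| <= L * s ^+ 2.
Proof.
move=> tk; have [L L0 hL] := test_lipschitz (test_partial i tk).
exists L => // x s; have [c cs ->] := mean_value x i s (test_smooth tk).
rewrite -mulrBr normrM -(real_normK (num_real s)) expr2 mulrCA ler_wpM2l//.
apply: (le_trans (hL _ _)); rewrite ler_wpM2l// normrZ.
apply: le_trans cs; rewrite ler_piMr//.
apply/(rV_norm_leP _ ler01) => j; rewrite mxE eqxx/=.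
by case: (j == i); rewrite ?normr1 ?normr0.
Qed.

Lemma integrable_boundedM (K : R) (b F : V -> R) : measurable_fun setT b ->
  (forall x, `|b x| <= K) -> leb.-integrable setT (EFin \o F) ->
  leb.-integrable setT (EFin \o (fun x => b x * F x)).
Proof.
move=> mb bK iF; have mF : measurable_fun setT F by have [/measurable_EFinP] := integrableP _ _ _ iF.
apply: (integrable_le (G := fun x => K * `|F x|)).
- exact: measurable_funM.
- by move=> x; rewrite normrM ler_wpM2r.
- by apply: integrable_scaler; have := integrable_norm iF.
Qed.

Lemma le_norm_integralM (K : R) (b F : V -> R) : measurable_fun setT b ->
  (forall x, `|b x| <= K) -> leb.-integrable setT (EFin \o F) ->
  `|\int[leb]_x (b x * F x)| <= K * \int[leb]_x `|F x|.
Proof.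
move=> mb bK iF; have ibF := integrable_boundedM mb bK iF.
apply: (le_trans (le_normr_Rintegral measurableT ibF)).
rewrite -RintegralZl//; last by have := integrable_norm iF.
apply: le_Rintegral => //.
- by have := integrable_norm ibF.
- by apply: integrable_scaler; have := integrable_norm iF.
- by move=> x _; rewrite normrM ler_wpM2r.
Qed.

(** The kernel enters reflected. This costs the sign in [partial_conv], but makes [kconv] an average
    of F (x + t) against kappa t, and matches the test function y -> kappa (y - x) in the definition
    of weak gradient. *)
Definition kconv (kappa F : V -> R) (x : V) : R := \int[leb]_y (kappa (y - x) * F y).

Lemma test_shift_bounded (kappa : V -> R) (x : V) : test_function setT kappa ->
  measurable_fun setT (fun y : V => kappa (y - x)).
Proof. by move=> tk; apply: measurable_translate; exact: test_measurable tk. Qed.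

Lemma conv_integrable (kappa F : V -> R) (x : V) : test_function setT kappa ->
  leb.-integrable setT (EFin \o F) ->
  leb.-integrable setT (EFin \o (fun y : V => kappa (y - x) * F y)).
Proof.
move=> tk iF; have [K _ hK] := test_bounded tk.
by apply: (integrable_boundedM (K := K)) => //; exact: test_shift_bounded.
Qed.

Lemma conv_continuous (kappa F : V -> R) : test_function setT kappa ->
  leb.-integrable setT (EFin \o F) -> continuous (kconv kappa F).
Proof.
move=> tk iF x; have [L L0 hL] := test_lipschitz tk.
set I := \int[leb]_y `|F y|; have I0 : 0 <= I by apply: Rintegral_ge0.
apply/(@cvgrPdist_le R R V (nbhs x) (nbhs_filter x) (kconv kappa F)) => e e0.
apply/nbhs_ballP.
have LI : 0 < L * I + 1 by rewrite ltr_wpDl ?mulr_ge0.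
exists (e / (L * I + 1)); first by rewrite /= divr_gt0.
move=> x'; rewrite -ball_normE/= => xx'.
rewrite /kconv -RintegralB//; try exact: conv_integrable.
under eq_Rintegral do rewrite -mulrBl.
apply: (@le_trans _ _ ((L * `|x - x'|) * I)).
  apply: le_norm_integralM => //.
    by apply: measurable_funB; exact: test_shift_bounded.
  move=> y; rewrite distrC; have := hL (y - x) (x - x').
  by rewrite addrA subrK.
rewrite mulrAC; apply: (@le_trans _ _ ((L * I + 1) * `|x - x'|)).
  by rewrite ler_wpM2r// lerDl.
by rewrite mulrC -ler_pdivlMr// ltW.
Qed.

(** The second-order Taylor remainder of kappa is bounded uniformly in the base point, so it can be
    integrated against F and the error of the difference quotient is O(h). *)
Lemma is_derive_conv (kappa F : V -> R) (i : 'I_d) (x : V) : test_function setT kappa ->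
  leb.-integrable setT (EFin \o F) ->
  is_derive x (e_ i) (kconv kappa F) (- kconv (partial i kappa) F x).
Proof.
move=> tk iF; have [L L0 hL] := test_taylor i tk.
set I := \int[leb]_y `|F y|; have I0 : 0 <= I by apply: Rintegral_ge0.
have LI : 0 < L * I + 1 by rewrite ltr_wpDl ?mulr_ge0.
have tp := test_partial i tk.
have bound h : `|kconv kappa F (x + h *: e_ i) - kconv kappa F x + h * kconv (partial i kappa) F x|
    <= L * h ^+ 2 * I.
  rewrite /kconv -RintegralB//; try exact: conv_integrable.
  rewrite -RintegralZl//; last exact: conv_integrable.
  rewrite -RintegralD//; last 2 first.
  - have := integrableB measurableT (conv_integrable (x + h *: e_ i) tk iF) (conv_integrable x tk iF).
    by apply: eq_integrable.
  - exact: (integrable_scaler h (conv_integrable x tp iF)).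
  rewrite (_ : (fun y => _) = (fun y => (kappa (y - (x + h *: e_ i)) - kappa (y - x) +
      h * partial i kappa (y - x)) * F y)); last by apply/funext => y; ring.
  apply: le_norm_integralM => //.
    apply: measurable_funD; first by apply: measurable_funB; exact: test_shift_bounded.
    by apply: measurable_funM => //; exact: test_shift_bounded.
  move=> y; have := hL (y - x) (- h).
  by rewrite sqrrN mulNr opprK scaleNr opprD addrA.
have h : (fun h : R => h^-1 *: ((kconv kappa F \o shift x) (h *: e_ i) - kconv kappa F x)) @ 0^' -->
    - kconv (partial i kappa) F x.
  apply/cvgrPdist_le => e e0; exists (e / (L * I + 1)); first by rewrite /= divr_gt0.
  move=> h /=; rewrite sub0r normrN => he h0.
  rewrite -[X in X - _](mulKf h0) -[_^-1 *: _]/(_^-1 * _) -mulrBr normrM normfV.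
  rewrite ler_pdivrMl ?normr_gt0//.
  rewrite -normrN opprB mulrN opprK [h *: _ + x]addrC (le_trans (bound h))//.
  rewrite -(real_normK (num_real h)) expr2 mulrA mulrAC [leRHS]mulrC ler_wpM2r//.
  move/ltW in he; apply: (@le_trans _ _ ((L * I + 1) * `|h|)).
    by rewrite mulrAC ler_wpM2r// lerDl.
  by rewrite mulrC -ler_pdivlMr.
apply: DeriveDef; first by apply/cvg_ex; eexists; exact: h.
exact: cvg_lim h.
Qed.

Lemma partial_conv (kappa F : V -> R) (i : 'I_d) : test_function setT kappa ->
  leb.-integrable setT (EFin \o F) ->
  partial i (kconv kappa F) = kconv (fun x => - partial i kappa x) F.
Proof.
move=> tk iF; apply/funext => x.
have [_] := is_derive_conv i x tk iF; rewrite /partial => ->.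
rewrite /kconv -mulN1r -RintegralZl//; last exact: (conv_integrable x (test_partial i tk) iF).
by congr Rintegral; apply/funext => y; rewrite mulN1r mulNr.
Qed.

Lemma smooth_conv (kappa F : V -> R) : test_function setT kappa ->
  leb.-integrable setT (EFin \o F) -> smooth (kconv kappa F).
Proof.
move=> tk iF; apply/smoothP => n; elim: n kappa tk => [|n IH] kappa tk.
  exact: conv_continuous.
split; first exact: conv_continuous.
  by move=> i x; have [] := is_derive_conv i x tk iF.
by move=> i; rewrite partial_conv//; apply: IH; exact/testN/test_partial.
Qed.

Lemma conv_avg (kappa F : V -> R) (x : V) : test_function setT kappa ->
  measurable_fun setT F ->
  kconv kappa F x = \int[leb]_t (kappa t * F (t + x)).
Proof.
move=> tk mF; rewrite /kconv -(Rintegral_translate x).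
  by congr Rintegral; apply/funext => y; rewrite addrK.
by apply: measurable_funM => //; exact: test_shift_bounded.
Qed.

End convolution.

Section averaging.
Context {R : realType} {d : nat}.
Local Notation V := 'rV[R]_d.
Local Notation leb := (lebesgue_rV (R := R) d).
Local Notation e_ i := (delta_mx 0 i : V).
Local Notation B_ r := [set x : V | `|x| <= r].

(** Kept apart from [kconv] because the weight may be discontinuous: it serves both for mollifiers
    and for the normalized indicator of a period cell. *)
Definition avg (kappa F : V -> R) (x : V) : R := \int[leb]_t (kappa t * F (x + t)).

Section weight.
Variables (kappa F : V -> R) (K r : R).
Hypotheses (mk : measurable_fun setT kappa) (k0 : forall t, 0 <= kappa t)
  (kK : forall t, `|kappa t| <= K) (kr : forall t, kappa t != 0 -> `|t| <= r).
Hypotheses (k1 : \int[leb]_t kappa t = 1).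
Hypotheses (lF : inL2 leb F) (iF : leb.-integrable setT (EFin \o F)).

Let mF : measurable_fun setT F. Proof. exact: lF.1. Qed.

Let ik : leb.-integrable setT (EFin \o kappa).
Proof. exact: bounded_support_integrable mk kK kr. Qed.

Let k0e t : setT t -> (0 <= (EFin \o kappa) t)%E.
Proof. by move=> _; rewrite lee_fin. Qed.

Let mEk : measurable_fun setT (EFin \o kappa).
Proof. exact/measurable_EFinP. Qed.

Let intk : (\int[leb]_t (kappa t)%:E)%E = 1%:E.
Proof. by rewrite -k1 fineK//; exact: (integrable_fin_num measurableT ik). Qed.

Lemma translate_integrable (x : V) : leb.-integrable setT (EFin \o (fun t : V => F (x + t))).
Proof.
have := integrable_translate x iF.
by apply: eq_integrable => // t _ /=; rewrite addrC.
Qed.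

Lemma measurable_addvC (G : V -> R) (x : V) : measurable_fun setT G ->
  measurable_fun setT (fun t : V => G (x + t)).
Proof.
move=> mG; have := measurable_translate x mG.
by rewrite (_ : (fun t => _) = (fun t : V => G (t + x)))//; apply/funext => t; rewrite addrC.
Qed.

Lemma avg_integrand_integrable (x : V) :
  leb.-integrable setT (EFin \o (fun t : V => kappa t * F (x + t))).
Proof. by apply: (integrable_boundedM (K := K)) => //; exact: translate_integrable. Qed.

Lemma measurable_avg_integrand :
  measurable_fun setT (fun z : V * V => kappa z.2 * F (z.1 + z.2)).
Proof.
apply: measurable_funM; first exact: (measurableT_comp mk measurable_snd).
exact: (measurableT_comp mF measurable_addv).
Qed.

Lemma measurable_avg : measurable_fun setT (avg kappa F).
Proof.
have mE : measurable_fun setT (EFin \o (fun z : V * V => kappa z.2 * F (z.1 + z.2))).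
  by apply/measurable_EFinP; exact: measurable_avg_integrand.
have iP : (leb \x leb)%E.-integrable setT (EFin \o (fun z : V * V => kappa z.2 * F (z.1 + z.2))).
  apply: (@integrable21ltyP _ _ _ _ _ leb leb _ mE).2.
  have iabs := integrable_norm iF.
  have mabs : measurable_fun setT (fun x => (`|F x|)%:E) by have [] := integrableP _ _ _ iabs.
  set N := (\int[leb]_x (`|F x|)%:E)%E.
  have Nfin : N \is a fin_num by exact: (integrable_fin_num measurableT iabs).
  rewrite (eq_integral (fun t => (fine N)%:E * (kappa t)%:E)%E); last first.
    move=> t _; have pos (x : V) : (0 <= (`|F x|)%:E)%E by rewrite lee_fin.
    have := @ge0_integral_affine R d 1 t _ ltr01 mabs pos.
    rewrite expr1n mul1e -/N fineK// muleC => <-.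
    rewrite -ge0_integralZl_EFin//; last first.
      exact: (measurableT_comp mabs (measurable_affine 1 t)).
    by apply: eq_integral => x _; rewrite /= scale1r normrM ger0_norm// EFinM.
  have N0 : 0 <= fine N by apply/fine_ge0/integral_ge0 => x _; rewrite lee_fin.
  rewrite (@ge0_integralZl_EFin _ _ _ leb setT measurableT (EFin \o kappa) k0e mEk _ N0).
  by rewrite /= intk mule1 ltry.
have := @measurable_fubini_F _ _ _ _ _ leb leb _ iP.
by move=> /(measurableT_comp (@fine_measurable R setT measurableT)).
Qed.

(* Jensen's inequality for the probability density kappa. *)
Lemma sqr_avg_le (x : V) :
  (((avg kappa F x - F x) ^+ 2)%:E <= \int[leb]_t (kappa t * (F (x + t) - F x) ^+ 2)%:E)%E.
Proof.
set m := avg kappa F x - F x.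
have i1 := avg_integrand_integrable x.
have lT : inL2 leb (fun t : V => F (x + t)).
  have [l _] := inL2_translate x lF.
  by move: l; rewrite (_ : (fun t => _) = (fun t : V => F (x + t)))//; apply/funext => t; rewrite addrC.
have i2 : leb.-integrable setT (EFin \o (fun t : V => kappa t * F (x + t) ^+ 2)).
  by apply: (integrable_boundedM (K := K)) => //; exact: inL2_sqr_integrable.
have i3 : leb.-integrable setT (EFin \o (fun t : V => kappa t * (F (x + t) - F x) ^+ 2)).
  have := integrable_addr i2 (integrable_addr (integrable_scaler (- 2 * F x) i1) (integrable_scaler (F x ^+ 2) ik)).
  by apply: eq_integrable => // t _ /=; congr EFin; ring.
have i4 : leb.-integrable setT (EFin \o (fun t : V => kappa t * (F (x + t) - F x))).
  have := integrable_addr i1 (integrable_scaler (- F x) ik).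
  by apply: eq_integrable => // t _ /=; congr EFin; ring.
have m4 : \int[leb]_t (kappa t * (F (x + t) - F x)) = m.
  rewrite (_ : (fun t => _) = (fun t : V => kappa t * F (x + t) + (- F x) * kappa t)); last first.
    by apply/funext => t; ring.
  rewrite RintegralD//; last exact: integrable_scaler.
  by rewrite RintegralZl// k1 mulr1.
have : 0 <= \int[leb]_t (kappa t * (F (x + t) - F x - m) ^+ 2).
  by apply: Rintegral_ge0 => t _; rewrite mulr_ge0 ?sqr_ge0.
rewrite (_ : (fun t => _) = (fun t : V => kappa t * (F (x + t) - F x) ^+ 2 +
    ((- 2 * m) * (kappa t * (F (x + t) - F x)) + m ^+ 2 * kappa t))); last first.
  by apply/funext => t; ring.
have i5 := integrable_scaler (- 2 * m) i4; have i6 := integrable_scaler (m ^+ 2) ik.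
rewrite RintegralD//; last exact: integrable_addr.
rewrite RintegralD// !RintegralZl// m4 k1 mulr1 => h.
have -> : (\int[leb]_t (kappa t * (F (x + t) - F x) ^+ 2)%:E)%E =
    (\int[leb]_t (kappa t * (F (x + t) - F x) ^+ 2))%:E.
  by rewrite fineK//; exact: (integrable_fin_num measurableT i3).
rewrite lee_fin; move: h; set J := Rintegral _ _ _; lra.
Qed.

(** After the pointwise inequality [sqr_avg_le], Tonelli bounds the squared norm of the deviation by
    an average of squared norms of increments. Only translations in the support of kappa matter. *)
Lemma nrm_avg_le (A : set V) (eta : R) : measurable A -> 0 <= eta ->
  (forall t, kappa t != 0 -> nrm leb (fun x => \1_A x * (F (x + t) - F x)) <= eta) ->
  inL2 leb (fun x => \1_A x * (avg kappa F x - F x)) /\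
  nrm leb (fun x => \1_A x * (avg kappa F x - F x)) <= eta.
Proof.
move=> mA eta0 heta.
have m1A : measurable_fun setT (\1_A : V -> R) by exact: measurable_indic.
pose f (z : V * V) : R := kappa z.2 * (\1_A z.1 * (F (z.1 + z.2) - F z.1)) ^+ 2.
have f0 z : 0 <= f z by rewrite mulr_ge0 ?sqr_ge0.
have mf : measurable_fun setT f.
  apply: measurable_funM; first exact: (measurableT_comp mk measurable_snd).
  apply: measurable_funX; apply: measurable_funM.
    exact: (measurableT_comp m1A measurable_fst).
  apply: measurable_funB; first exact: (measurableT_comp mF measurable_addv).
  exact: (measurableT_comp mF measurable_fst).
have mEf : measurable_fun setT (EFin \o f) by exact/measurable_EFinP.
have mD : measurable_fun setT (fun x => \1_A x * (avg kappa F x - F x)).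
  by apply: measurable_funM => //; apply: measurable_funB => //; exact: measurable_avg.
have lt t : inL2 leb (fun x => \1_A x * (F (x + t) - F x)).
  have [l _] := inL2_translate t lF.
  have h1 : {ae leb, forall x : V, `|\1_A x : R| <= 1} by apply: aeW => x; exact: ind_le1.
  exact: (inL2_bounded m1A h1 ler01 (inL2B l lF)).1.
have le : (\int[leb]_x ((\1_A x * (avg kappa F x - F x)) ^+ 2)%:E <= (eta ^+ 2)%:E)%E.
  apply: (@le_trans _ _ (\int[leb]_x \int[leb]_t (f (x, t))%:E)%E).
    apply: ge0_le_integral => //.
    - by move=> x _; rewrite lee_fin sqr_ge0.
    - by apply/measurable_EFinP; exact: measurable_funX.
    - exact: (@measurable_fun_fubini_tonelli_F _ _ _ _ _ leb _ mEf).
    move=> x _; rewrite /f/= indicE; case: (x \in A).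
      rewrite mul1r; apply: (le_trans (sqr_avg_le x)).
      by under [leRHS]eq_integral do rewrite mul1r.
    by rewrite mul0r expr0n/=; apply: integral_ge0 => t _; rewrite lee_fin mulr_ge0 ?sqr_ge0.
  rewrite (fubini_tonelli (EFin \o f))//.
  apply: (@le_trans _ _ (\int[leb]_t ((eta ^+ 2)%:E * (kappa t)%:E))%E).
    apply: ge0_le_integral => //.
    - by move=> t _; apply: integral_ge0 => x _; rewrite lee_fin.
    - exact: (@measurable_fun_fubini_tonelli_G _ _ _ _ _ leb _ mEf).
    - by apply: measurable_funeM; exact/measurable_EFinP.
    move=> t _; rewrite /f/=.
    under eq_integral do rewrite EFinM.
    rewrite ge0_integralZl_EFin//; last 2 first.
    - by move=> x _; rewrite lee_fin sqr_ge0.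
    - by apply/measurable_EFinP; apply: measurable_funX; exact: (lt t).1.
    rewrite integral_sqrE// -!EFinM lee_fin [leRHS]mulrC.
    have [->|kt] := eqVneq (kappa t) 0; first by rewrite !mul0r.
    by rewrite ler_wpM2l// ler_pXn2r// ?nnegrE ?nrm_ge0// heta.
  rewrite (@ge0_integralZl_EFin _ _ _ leb setT measurableT (EFin \o kappa) k0e mEk _ (sqr_ge0 _)).
  by rewrite /= intk mule1.
have lD : inL2 leb (fun x => \1_A x * (avg kappa F x - F x)).
  by split => //; apply: (le_lt_trans le); rewrite ltry.
split => //; move: le; rewrite integral_sqrE// lee_fin.
by rewrite ler_pXn2r// nnegrE nrm_ge0.
Qed.

End weight.

End averaging.

Section mollification.
Context {R : realType} {d : nat}.
Local Notation V := 'rV[R]_d.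
Local Notation leb := (lebesgue_rV (R := R) d).
Local Notation B_ r := [set x : V | `|x| <= r].

Lemma cube_bump_support (x : V) : cube_bump x != 0 -> `|x| <= 1.
Proof.
move=> /cube_bump_neq0 h; apply/(rV_norm_leP _ ler01) => i.
by have /andP[h1 h2] := h i; rewrite ger0_norm ?ltW.
Qed.

Lemma test_cube_bump : test_function setT (cube_bump : V -> R).
Proof. by apply: (@test_intro _ _ _ 1); [exact: smooth_cube_bump|exact: cube_bump_support]. Qed.

Lemma cube_bump_integral_gt0 : 0 < \int[leb]_x (cube_bump x : R).
Proof.
rewrite lt_neqAle Rintegral_ge0 ?andbT; last by move=> x _; exact: cube_bump_ge0.
apply/eqP => I0.
have ib := test_integrable test_cube_bump.
have I0' : (\int[leb]_x `|(cube_bump x)%:E| = 0)%E.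
  rewrite (eq_integral (fun x => (cube_bump x)%:E)); last first.
    by move=> x _; rewrite gee0_abs// lee_fin cube_bump_ge0.
  have := fineK (integrable_fin_num measurableT ib); rewrite /= => <-.
  by move: I0; rewrite /Rintegral => <-.
have mb : measurable_fun setT (EFin \o (cube_bump : V -> R)).
  by apply/measurable_EFinP; exact: test_measurable test_cube_bump.
have /(ae_eq_integral_abs _ measurableT mb).1 [N [mN N0 hN]] := I0'.
have mbox : measurable [set x : V | forall i, 0 < x 0 i < 1].
  rewrite (_ : mkset _ = [set x : V | forall i, `]0, 1[%classic (x 0 i)]).
    by apply: (measurable_forall_coord (B := fun=> `]0, 1[%classic)) => i.
  by apply/seteqP; split=> x /= h i; have := h i; rewrite in_itv.
have : (leb [set x : V | forall i, (0 < x 0 i < 1)%R] <= leb N)%E.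
  apply: le_measure; rewrite ?inE//.
  move=> x /= /cube_bump_gt0 b; apply: hN => /= /(_ I) [].
  by apply/eqP; rewrite gt_eqF.
rewrite N0 (@lebesgue_rV_box R d (fun=> 0) (fun=> 1)) => [|i]; last exact: ler01.
by rewrite big1 => [|i _]; rewrite ?lee_fin ?ler10 ?subr0.
Qed.

Lemma mollifier (eta : R) : 0 < eta -> exists kappa : V -> R,
  [/\ test_function setT kappa, forall t, 0 <= kappa t,
      forall t, kappa t != 0 -> `|t| <= eta & \int[leb]_t kappa t = 1].
Proof.
move=> eta0; have ei0 : 0 < eta^-1 by rewrite invr_gt0.
have tk := test_affine 0 (lt0r_neq0 ei0) test_cube_bump.
pose k0 (x : V) : R := cube_bump (eta^-1 *: x + 0).
have I0 : 0 < \int[leb]_x k0 x.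
  rewrite -(pmulr_rgt0 _ (exprn_gt0 d ei0)) Rintegral_affine//; last first.
    exact: test_measurable test_cube_bump.
  exact: cube_bump_integral_gt0.
exists (fun x => (\int[leb]_x k0 x)^-1 * k0 x); split.
- exact: testZ.
- by move=> t; rewrite mulr_ge0 ?cube_bump_ge0// invr_ge0 ltW.
- move=> t; rewrite mulf_eq0 negb_or => /andP[_ /cube_bump_support].
  by rewrite addr0 normrZ gtr0_norm// ler_pdivrMl// mulr1.
- rewrite RintegralZl ?mulVf ?gt_eqF//; exact: test_integrable tk.
Qed.

(** Functions on D are extended by zero through the indicator, so that a single norm, on the whole
    space, serves throughout. *)
Lemma L2_inL2 (D : set V) (u : V -> R) : measurable D -> L2 D u ->
  inL2 leb (fun x => \1_D x * u x).
Proof.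
move=> mD [mu uoo].
have E : (fun x => \1_D x * u x) = u \_ D.
  by apply/funext => x; rewrite /patch indicE; case: (x \in D); rewrite ?mul1r ?mul0r.
split; first by rewrite E; exact: (measurable_restrictT _ mD).1 mu.
suff -> : (\int[leb]_x ((\1_D x * u x) ^+ 2)%:E = sqL2 D u)%E by [].
rewrite /sqL2 [RHS]integral_mkcond; apply: eq_integral => x _.
rewrite /patch indicE; case: (x \in D); rewrite ?mul1r// mul0r expr0n//.
Qed.

Lemma closure_norm_le (A : set V) (r : R) x : (forall y, A y -> `|y| <= r) ->
  closure A x -> `|x| <= r.
Proof. by move=> h; exact: (closure_sub_closed (@closed_norm_le R d r) h). Qed.

Lemma ball_L2_integrable (r : R) (u : V -> R) : inL2 leb (fun x => \1_(B_ r) x * u x) ->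
  leb.-integrable setT (EFin \o (fun x => \1_(B_ r) x * u x)).
Proof.
move=> lu.
have l1 : inL2 leb (\1_(B_ r) : V -> R).
  apply: (@bounded_support_inL2 R d 1 r).
  - by apply: measurable_indic; exact: measurable_norm_le.
  - by move=> x; exact: ind_le1.
  - by move=> x; rewrite indicE; case: (boolP (x \in _)); rewrite ?eqxx// inE.
have := inL2_integrableM l1 lu; apply: eq_integrable => // x _ /=.
by rewrite indicE; case: (x \in _); rewrite ?mul1r ?mul0r.
Qed.

Lemma nrm_indic_le (A : set V) (F : V -> R) : measurable A -> inL2 leb F ->
  inL2 leb (fun x => \1_A x * F x) /\ nrm leb (fun x => \1_A x * F x) <= nrm leb F.
Proof.
move=> mA lF; have h1 : {ae leb, forall x : V, `|\1_A x : R| <= 1}.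
  by apply: aeW => x; exact: ind_le1.
have m1 : measurable_fun setT (\1_A : V -> R) by exact: measurable_indic.
have [] := inL2_bounded m1 h1 ler01 lF.
by rewrite mul1r.
Qed.

(** Mollification of N cut off to the ball of radius r + 1. The mollifier has radius at most 1, so
    inside the ball of radius r the cut-off is invisible, and the weak gradient tested against
    translates of the kernel identifies the derivative of the mollification. *)
Theorem H1loc_approx (N : V -> R) (g : V -> 'cV[R]_d) (r e : R) :
  H1loc N g -> 0 < r -> 0 < e -> exists P : V -> R,
  [/\ smooth P,
      inL2 leb (fun x => \1_(B_ r) x * (P x - N x)),
      nrm leb (fun x => \1_(B_ r) x * (P x - N x)) <= e,
      forall i, inL2 leb (fun x => \1_(B_ r) x * (partial i P x - g x i 0)) &
      forall i, nrm leb (fun x => \1_(B_ r) x * (partial i P x - g x i 0)) <= e].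
Proof.
move=> [hN hg wg] r0 e0.
have mB s := @measurable_norm_le R d s.
pose F (u : V -> R) x := \1_(B_ (r + 1)) x * u x.
have lN : inL2 leb (F N) by apply: L2_inL2 => //; apply: hN; exact: compact_norm_le.
have lg i : inL2 leb (F (fun x => g x i 0)).
  by apply: L2_inL2 => //; apply: hg; exact: compact_norm_le.
have iN := ball_L2_integrable lN; have ig i := ball_L2_integrable (lg i).
have [etaN etaN0 HN] := (inL2_L2c lN).2 e e0.
have /choice[etag Hg] : forall i, exists eta, 0 < eta /\ forall t : V, `|t| <= eta ->
    nrm leb (fun x : V => F (fun x => g x i 0) (x + t) - F (fun x => g x i 0) x) <= e.
  by move=> i; have [eta h1 h2] := (inL2_L2c (lg i)).2 e e0; exists eta.
(* One radius for N and all components of g: below each modulus of continuity in L^2, and at most 1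
   because of the cut-off. *)
pose eta := Num.min (Num.min 1 etaN) (\big[Num.min/1]_i etag i).
have eta0 : 0 < eta.
  rewrite !lt_min ltr01 etaN0/=; apply/bigmin_gtP; split => // i _.
  exact: (Hg i).1.
have eta1 : eta <= 1 by rewrite !ge_min lexx.
have etaN' : eta <= etaN by rewrite !ge_min lexx orbT.
have etag' i : eta <= etag i by rewrite ge_min; apply/orP; right; exact: bigmin_le.
have [kappa [tk k0 kr k1]] := mollifier eta0.
have [K _ kK] := test_bounded tk; have mk := test_measurable tk.
have convE (u : V -> R) (x : V) : inL2 leb (F u) -> kconv kappa (F u) x = avg kappa (F u) x.
  move=> lu; rewrite (conv_avg _ tk lu.1); congr Rintegral; apply/funext => t.
  by rewrite addrC.
have main (u : V -> R) (etau : R) : eta <= etau -> inL2 leb (F u) ->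
    leb.-integrable setT (EFin \o F u) ->
    (forall t : V, `|t| <= etau -> nrm leb (fun x : V => F u (x + t) - F u x) <= e) ->
    inL2 leb (fun x => \1_(B_ r) x * (kconv kappa (F u) x - u x)) /\
    nrm leb (fun x => \1_(B_ r) x * (kconv kappa (F u) x - u x)) <= e.
  move=> etau0 lu iu Hu.
  have := @nrm_avg_le R d kappa (F u) K eta mk k0 kK kr k1 lu iu (B_ r) e (mB r) (ltW e0).
  rewrite (_ : (fun x => _) = (fun x : V => \1_(B_ r) x * (kconv kappa (F u) x - u x))); last first.
    apply/funext => x; rewrite convE// indicE; case: (boolP (x \in _)); last by rewrite !mul0r.
    rewrite inE/= => xr; congr (_ * (_ - _)); rewrite /F indicE mem_set ?mul1r//=.
    by rewrite (le_trans xr)// lerDl.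
  apply => t kt; have [lt _] := inL2_translate t lu.
  apply: le_trans (nrm_indic_le (mB r) (inL2B lt lu)).2 _; apply: Hu.
  exact: le_trans (kr t kt) etau0.
have dP i (x : V) : `|x| <= r ->
    partial i (kconv kappa (F N)) x = kconv kappa (F (fun x => g x i 0)) x.
  move=> xr; rewrite (partial_conv i tk iN).
  have tx : test_function setT (fun y : V => kappa (y - x)).
    have := test_affine (- x) (@oner_neq0 R) tk.
    by rewrite (_ : (fun y => _) = (fun y : V => kappa (y - x)))//; apply/funext => y; rewrite scale1r.
  have inB y : `|y - x| <= eta -> y \in B_ (r + 1).
    move=> h; rewrite inE/= -(subrK x y) addrC (le_trans (ler_normD _ _))// lerD//.
    exact: le_trans eta1.
  have := wg _ tx i; rewrite partial_translate; last exact: test_smooth tk.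
  move=> h; rewrite /kconv; rewrite [RHS](_ : _ = \int[leb]_y (g y i 0 * kappa (y - x))); last first.
    congr Rintegral; apply/funext => y; rewrite mulrC /F indicE.
    have [->|kn] := eqVneq (kappa (y - x)) 0; first by rewrite !mulr0.
    by rewrite inB ?mul1r//; exact: kr.
  rewrite -[RHS]opprK -h -mulN1r -RintegralZl//; last first.
    have := conv_integrable x (test_partial i tk) iN.
    apply: eq_integrable => // y _ /=; congr EFin; rewrite /F indicE mulrC.
    have [->|kn] := eqVneq (partial i kappa (y - x)) 0; first by rewrite !mulr0.
    rewrite inB ?mul1r//; move/partial_support : kn; exact: closure_norm_le.
  congr Rintegral; apply/funext => y; rewrite /F indicE.
  have [->|kn] := eqVneq (partial i kappa (y - x)) 0; first by rewrite oppr0 !mulr0 mul0r.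
  rewrite inB ?mul1r; first by ring.
  move/partial_support : kn; exact: closure_norm_le.
exists (kconv kappa (F N)); split.
- exact: smooth_conv.
- by have [] := main N etaN etaN' lN iN HN.
- by have [] := main N etaN etaN' lN iN HN.
- move=> i; have [l _] := main (fun x => g x i 0) (etag i) (etag' i) (lg i) (ig i) (Hg i).2.
  move: l; congr inL2; apply/funext => x; rewrite indicE; case: (boolP (x \in _)); last by rewrite !mul0r.
  by rewrite inE/= => /dP ->.
- move=> i; have [_ l] := main (fun x => g x i 0) (etag i) (etag' i) (lg i) (ig i) (Hg i).2.
  apply: le_trans l; rewrite le_eqVlt; apply/orP; left; apply/eqP; congr nrm.
  apply/funext => x; rewrite indicE; case: (boolP (x \in _)); last by rewrite !mul0r.
  by rewrite inE/= => /dP ->.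
Qed.

End mollification.

(** * Periodic functions *)

Section lattice.
Context {R : realType} {d : nat}.
Local Notation V := 'rV[R]_d.
Local Notation leb := (lebesgue_rV (R := R) d).
Local Notation B_ r := [set x : V | `|x| <= r].
Local Notation L := 'rV[int]_d.

(** The range -n, ..., n - 1 is half-open in each coordinate, so it is indexed by a finite function
    type and the sums of [ind_co] telescope. *)
Definition lbox (n : nat) : seq L :=
  [seq \row_i ((m i : nat)%:Z - n%:Z) | m : {ffun 'I_d -> 'I_(n.*2)}].

(** Half-open, unlike [cell], so that its lattice translates tile the space exactly; the two differ
    by a null set. *)
Definition hcell (delta : R) : set V := [set x | forall i, 0 <= x 0 i < delta].

Definition ind_co (delta s : R) : R := (0 <= s < delta)%R%:R.

Lemma hcellE (delta : R) (x : V) : \1_(hcell delta) x = \prod_i ind_co delta (x 0 i) :> R.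
Proof.
rewrite indicE; have [|] := boolP (x \in _).
  by rewrite inE => h; rewrite big1// => i _; rewrite /ind_co h.
move=> /negP h; have /existsP[i hi] : [exists i, ~~ (0 <= x 0 i < delta)].
  rewrite -negb_forall; apply/negP => /forallP hx; apply: h.
  by rewrite inE => i; exact: hx.
by rewrite (bigD1 i)//= /ind_co (negbTE hi) mul0r.
Qed.

Lemma measurable_hcell (delta : R) : measurable (hcell delta).
Proof.
rewrite (_ : hcell delta = [set x : V | forall i, `[0, delta[%classic (x 0 i)]).
  by apply: (measurable_forall_coord (B := fun=> `[0, delta[%classic)) => i.
by apply/seteqP; split=> x /= h i; have := h i; rewrite in_itv.
Qed.

Lemma ind_coE (delta s : R) : 0 < delta -> ind_co delta s = (s < delta)%R%:R - (s < 0)%R%:R.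
Proof.
move=> d0; rewrite /ind_co; have [s0|s0] /= := leP 0 s; first by rewrite subr0.
by rewrite (lt_trans s0 d0) subrr.
Qed.

Lemma sum_ind_coB (delta s : R) (n : nat) : 0 < delta ->
  - (n%:R * delta) <= s < n%:R * delta ->
  \sum_(j < n.*2) ind_co delta (s - delta * (j%:R - n%:R)) = 1.
Proof.
move=> d0 /andP[s1 s2].
pose f (j : nat) : R := (s - delta * (j%:R - n%:R) < 0)%R%:R.
transitivity (\sum_(0 <= j < n.*2) (f j.+1 - f j)).
  rewrite big_mkord; apply: eq_bigr => j _; rewrite ind_coE// /f; congr (_%:R - _).
  by congr nat_of_bool; rewrite -subr_lt0 -natr1; congr (_ < _); ring.
rewrite telescope_sumr// /f -muln2 natrM.
rewrite (_ : (_ < 0) = true); last by apply/idP; lra.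
by rewrite (_ : (_ < 0) = false) ?subr0//; apply/negP/negP; rewrite -leNgt; lra.
Qed.

(** Adding the shifts instead of subtracting them reverses the half-open range: the tiles now start
    at delta - n delta, whence the loss of one delta here and in [partition_lboxD]. *)
Lemma sum_ind_coD (delta s : R) (n : nat) : 0 < delta ->
  delta - n%:R * delta <= s < n%:R * delta ->
  \sum_(j < n.*2) ind_co delta (s + delta * (j%:R - n%:R)) = 1.
Proof.
move=> d0 /andP[s1 s2].
pose f (j : nat) : R := - (s + delta * (j%:R - n%:R - 1) < 0)%R%:R.
transitivity (\sum_(0 <= j < n.*2) (f j.+1 - f j)).
  rewrite big_mkord; apply: eq_bigr => j _; rewrite ind_coE// /f opprK addrC.
  congr (- _%:R + _%:R); congr nat_of_bool.
    by congr (_ < _); rewrite -natr1; ring.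
  by rewrite -subr_lt0; congr (_ < _); ring.
rewrite telescope_sumr// /f -muln2 natrM opprK addrC.
rewrite (_ : (_ < 0) = true); last by apply/idP; lra.
by rewrite (_ : (_ < 0) = false) ?subr0//; apply/negP/negP; rewrite -leNgt; lra.
Qed.

Lemma big_lbox (n : nat) (F : L -> R) : \sum_(k <- lbox n) F k =
  \sum_(m : {ffun 'I_d -> 'I_(n.*2)}) F (\row_i ((m i : nat)%:Z - n%:Z)).
Proof. by rewrite big_image. Qed.

Lemma size_lbox n : size (lbox n) = (n.*2 ^ d)%N.
Proof. by rewrite size_image card_ffun !card_ord. Qed.

Lemma shift_lboxE (n : nat) (m : {ffun 'I_d -> 'I_(n.*2)}) i :
  (shift_vec (\row_i ((m i : nat)%:Z - n%:Z)) : V) 0 i = (m i)%:R - n%:R.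
Proof. by rewrite !mxE intrB. Qed.

Lemma partition_lboxB (delta : R) (n : nat) (x : V) : 0 < delta -> `|x| < n%:R * delta ->
  \sum_(k <- lbox n) \1_(hcell delta) (x - delta *: shift_vec k) = 1 :> R.
Proof.
move=> d0 xn; rewrite big_lbox; have n0 : 0 < n%:R * delta := le_lt_trans (normr_ge0 x) xn.
transitivity (\sum_(m : {ffun 'I_d -> 'I_(n.*2)}) \prod_i
    ind_co delta (x 0 i - delta * ((m i)%:R - n%:R))).
  apply: eq_bigr => m _; rewrite hcellE; apply: eq_bigr => i _.
  by rewrite -shift_lboxE !mxE.
rewrite -(bigA_distr_bigA (fun i (j : 'I_(n.*2)) => ind_co delta (x 0 i - delta * (j%:R - n%:R)))).
rewrite big1// => i _; apply: sum_ind_coB => //.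
have /(rV_norm_ltP _ n0)/(_ i) := xn; rewrite ltr_norml => /andP[h1 h2].
by rewrite (ltW h1) h2.
Qed.

Lemma partition_lboxD (delta : R) (n : nat) (x : V) : 0 < delta -> `|x| < n%:R * delta - delta ->
  \sum_(k <- lbox n) \1_(hcell delta) (x + delta *: shift_vec k) = 1 :> R.
Proof.
move=> d0 xn; rewrite big_lbox; have n0 := le_lt_trans (normr_ge0 x) xn.
transitivity (\sum_(m : {ffun 'I_d -> 'I_(n.*2)}) \prod_i
    ind_co delta (x 0 i + delta * ((m i)%:R - n%:R))).
  apply: eq_bigr => m _; rewrite hcellE; apply: eq_bigr => i _.
  by rewrite -shift_lboxE !mxE.
rewrite -(bigA_distr_bigA (fun i (j : 'I_(n.*2)) => ind_co delta (x 0 i + delta * (j%:R - n%:R)))).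
rewrite big1// => i _; apply: sum_ind_coD => //.
have /(rV_norm_ltP _ n0)/(_ i) := xn; rewrite ltr_norml => /andP[h1 h2].
by apply/andP; split; lra.
Qed.

(** The analogue of [cell_periodic] for a real period, as produced by rescaling with eps. *)
Definition lperiodic (T : Type) (delta : R) (F : V -> T) :=
  forall k : L, {ae leb, forall y, F (y + delta *: shift_vec k) = F y}.

Definition locL1 (F : V -> R) := measurable_fun setT F /\
  forall r, leb.-integrable setT (EFin \o (fun x => \1_(B_ r) x * F x)).

Definition locL2 (F : V -> R) := measurable_fun setT F /\
  forall r, inL2 leb (fun x => \1_(B_ r) x * F x).

Lemma locL2_locL1 F : locL2 F -> locL1 F.
Proof. by move=> [mF lF]; split => // r; exact: ball_L2_integrable. Qed.

Lemma locL2_sqr_locL1 F : locL2 F -> locL1 (fun x => F x ^+ 2).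
Proof.
move=> [mF lF]; split; first exact: measurable_funX.
move=> r; have := inL2_sqr_integrable (lF r).
apply: eq_integrable => // x _ /=; rewrite exprMn indicE.
by case: (x \in _); rewrite ?expr1n ?expr0n.
Qed.

Lemma bounded_locL1_integrable (F phi : V -> R) (K r : R) : locL1 F ->
  measurable_fun setT phi -> (forall x, `|phi x| <= K) -> (forall x, phi x != 0 -> `|x| <= r) ->
  leb.-integrable setT (EFin \o (fun x => F x * phi x)).
Proof.
move=> [mF iF] mphi phiK phir; have := integrable_boundedM mphi phiK (iF r).
apply: eq_integrable => // x _ /=; congr EFin.
have [->|h] := eqVneq (phi x) 0; first by rewrite mul0r mulr0.
have xB : x \in B_ r by rewrite inE; exact: phir.
by rewrite indicE xB mul1r mulrC.
Qed.

Lemma hcell_norm_le (delta : R) (x : V) : 0 < delta -> hcell delta x -> `|x| <= delta.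
Proof.
move=> d0 hx; apply/(rV_norm_leP x (ltW d0)) => i.
by have /andP[h1 h2] := hx i; rewrite ger0_norm// ltW.
Qed.

Lemma hcell_ind_support (delta : R) (x : V) : 0 < delta -> \1_(hcell delta) x != 0 :> R -> `|x| <= delta.
Proof.
move=> d0; rewrite indicE; case: (boolP (x \in _)); rewrite ?eqxx// inE => h _.
exact: hcell_norm_le.
Qed.

(** Cut the support of phi along the tiling and translate each piece back to the cell, where F is
    unchanged by periodicity. Bounded support leaves finitely many tiles. *)
Lemma integral_unfold (delta : R) (F phi : V -> R) (K : R) (n : nat) : 0 < delta ->
  locL1 F -> lperiodic delta F ->
  measurable_fun setT phi -> (forall x, `|phi x| <= K) ->
  (forall x, phi x != 0 -> `|x| < n%:R * delta) ->
  \int[leb]_x (F x * phi x) =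
  \int[leb]_x (\1_(hcell delta) x * F x * \sum_(k <- lbox n) phi (x + delta *: shift_vec k)).
Proof.
move=> d0 lF pF mphi phiK phin.
have mF := lF.1.
have phir x : phi x != 0 -> `|x| <= n%:R * delta by move=> /phin /ltW.
have iFphi := bounded_locL1_integrable lF mphi phiK phir.
have mQ := measurable_hcell delta.
have m1 : measurable_fun setT (\1_(hcell delta) : V -> R) by exact: measurable_indic.
pose G k (x : V) : R := \1_(hcell delta) (x - delta *: shift_vec k) * (F x * phi x).
have mG1 k : measurable_fun setT (fun x : V => \1_(hcell delta) (x - delta *: shift_vec k) : R).
  exact: (measurable_translate (- (delta *: shift_vec k)) m1).
have iG k : leb.-integrable setT (EFin \o G k).
  by apply: (integrable_boundedM (K := 1)) => // x; exact: ind_le1.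
have E1 : (fun x => F x * phi x) = (fun x => \sum_(k <- lbox n) G k x).
  apply/funext => x; rewrite /G -mulr_suml.
  have [->|h] := eqVneq (phi x) 0; first by rewrite !mulr0.
  by rewrite partition_lboxB ?mul1r//; exact: phin.
pose H k (x : V) : R := \1_(hcell delta) x * F x * phi (x + delta *: shift_vec k).
have mphik k : measurable_fun setT (fun x : V => phi (x + delta *: shift_vec k)).
  exact: measurable_translate.
have iQF : leb.-integrable setT (EFin \o (fun x => \1_(hcell delta) x * F x)).
  have := bounded_locL1_integrable lF m1 (@ind_le1 R d (hcell delta)) (fun x => hcell_ind_support d0).
  by apply: eq_integrable => // x _ /=; rewrite mulrC.
have iH k : leb.-integrable setT (EFin \o H k).
  have := integrable_boundedM (mphik k) (fun x => phiK _) iQF.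
  by apply: eq_integrable => // x _ /=; rewrite mulrC.
have GH k : \int[leb]_x G k x = \int[leb]_x H k x.
  rewrite -(Rintegral_translate (delta *: shift_vec k)); last first.
    exact: measurable_funM (mG1 k) (measurable_funM mF mphi).
  apply: ae_eq_Rintegral => //.
  - exact: (measurable_translate _ (measurable_funM (mG1 k) (measurable_funM mF mphi))).
  - exact: measurable_funM (measurable_funM m1 mF) (mphik k).
  - by apply: filterS (pF k) => x hx _; rewrite /G /H addrK hx mulrA.
have intS (r : seq L) (f : L -> V -> R) : (forall k, leb.-integrable setT (EFin \o f k)) ->
    leb.-integrable setT (EFin \o (fun x => \sum_(k <- r) f k x)) /\
    \int[leb]_x (\sum_(k <- r) f k x) = \sum_(k <- r) \int[leb]_x f k x.
  move=> i_f; elim: r => [|k r [i1 e1]].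
    rewrite big_nil (_ : (fun x => _) = (fun=> 0)); last by apply/funext => x; rewrite big_nil.
    by split; [exact: integrable0|rewrite /Rintegral integral0].
  rewrite big_cons -e1 (_ : (fun x => _) = (fun x => f k x + \sum_(k <- r) f k x)); last first.
    by apply/funext => x; rewrite big_cons.
  by split; [exact: integrable_addr|rewrite RintegralD].
rewrite E1 (intS _ _ iG).2 (eq_bigr _ (fun k _ => GH k)) -(intS _ _ iH).2.
by congr Rintegral; apply/funext => x; rewrite /H mulr_sumr.
Qed.

End lattice.

Section periodic_estimates.
Context {R : realType} {d : nat}.
Local Notation V := 'rV[R]_d.
Local Notation leb := (lebesgue_rV (R := R) d).
Local Notation B_ r := [set x : V | `|x| <= r].
Local Notation L := 'rV[int]_d.

Lemma ex_nat_mul_gt (c delta : R) : 0 < delta ->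
  exists2 n : nat, c < n%:R * delta & n%:R * delta <= Num.max c 0 + delta.
Proof.
move=> d0; exists (Num.truncn (c / delta)).+1.
  by rewrite -ltr_pdivrMr// truncnS_gt.
rewrite -natr1 mulrDl mul1r lerD2r; have [c0|c0] := leP 0 c.
  rewrite -ler_pdivlMr//; have := truncn_itv (divr_ge0 c0 (ltW d0)) => /andP[h _].
  by rewrite (le_trans h)// ler_pM2r ?invr_gt0// le_max lexx.
rewrite (_ : Num.truncn _ = 0%N) ?mul0r ?le_max ?lexx ?orbT//.
by apply/truncn0Pn; rewrite -ltNge (lt_trans _ ltr01)// pmulr_llt0 ?invr_gt0.
Qed.

Section one_period.
Variable delta : R.
Hypothesis d0 : 0 < delta.
Local Notation Q := (hcell (R := R) (d := d) delta).

Lemma measurable_ind_hcell : measurable_fun setT (\1_Q : V -> R).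
Proof. by apply: measurable_indic; exact: measurable_hcell. Qed.

Lemma measurable_subv (y : V) (G : V -> R) : measurable_fun setT G ->
  measurable_fun setT (fun x : V => G (y - x)).
Proof.
move=> mG; have ms : measurable_fun setT (fun x : V => y - x).
  apply: measurable_fun_matrixP => i j.
  rewrite (_ : (fun x => _) = (fun x : V => y i j - x i j)); last first.
    by apply/funext => x; rewrite !mxE.
  by apply: measurable_funB => //; exact: measurable_coord.
exact: measurableT_comp mG ms.
Qed.

(** The cell is reflected here because in [periodic_pairing] the integration variable is the base
    point x of the averaging density at y - x; [integral_periodic_cellD] is the unreflected version,
    used for averages of F itself. *)
Lemma integral_periodic_cellB (F : V -> R) (y : V) : locL1 F -> lperiodic delta F ->
  \int[leb]_x (F x * \1_Q (y - x)) = \int[leb]_x (\1_Q x * F x).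
Proof.
move=> lF pF; have [n hn _] := ex_nat_mul_gt (`|y| + delta) d0.
rewrite (@integral_unfold R d delta F (fun x => \1_Q (y - x)) 1 n d0 lF pF).
- congr Rintegral; apply/funext => x.
  have [xQ|xQ] := boolP (x \in Q); last by rewrite indicE (negbTE xQ) !mul0r.
  rewrite (eq_bigr (fun k => \1_Q (y - x - delta *: shift_vec k) : R)); last first.
    by move=> k _; rewrite opprD addrA.
  rewrite partition_lboxB ?mulr1//; apply: le_lt_trans hn.
  rewrite (le_trans (ler_normB _ _))// lerD2l.
  by apply: hcell_norm_le => //; move: xQ; rewrite inE.
- exact: measurable_subv measurable_ind_hcell.
- by move=> x; exact: ind_le1.
- move=> x /(hcell_ind_support d0) h; apply: le_lt_trans hn.
  rewrite -[x](subKr y) (le_trans (ler_normB _ _))// lerD2l//.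
Qed.

Lemma integral_periodic_cellD (F : V -> R) (y : V) : locL1 F -> lperiodic delta F ->
  \int[leb]_x (F x * \1_Q (x - y)) = \int[leb]_x (\1_Q x * F x).
Proof.
move=> lF pF; have [n hn _] := ex_nat_mul_gt (`|y| + 2 * delta) d0.
rewrite (@integral_unfold R d delta F (fun x => \1_Q (x - y)) 1 n d0 lF pF).
- congr Rintegral; apply/funext => x.
  have [xQ|xQ] := boolP (x \in Q); last by rewrite indicE (negbTE xQ) !mul0r.
  rewrite (eq_bigr (fun k => \1_Q (x - y + delta *: shift_vec k) : R)); last first.
    by move=> k _; rewrite addrAC.
  rewrite partition_lboxD ?mulr1//.
  have xd : `|x| <= delta by apply: hcell_norm_le => //; move: xQ; rewrite inE.
  by apply: (le_lt_trans (ler_normB _ _)); lra.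
- exact: (measurable_translate (- y) measurable_ind_hcell).
- by move=> x; exact: ind_le1.
- move=> x /(hcell_ind_support d0) h.
  have := ler_normD (x - y) y; rewrite subrK => h'.
  by apply: (le_lt_trans h'); have d0' := d0; lra.
Qed.

Lemma ae_hcell : {ae leb, forall x : V,
  \1_Q x = \1_[set x : V | forall i, 0 < x 0 i < delta] x :> R}.
Proof.
have h : {ae leb, forall x : V, forall j, x 0 j != 0}.
  by apply: filter_forall => j; exact: ae_coord_neq.
apply: filterS h => x hx; rewrite !indicE; congr (_%:R); congr nat_of_bool.
apply/idP/idP; rewrite !inE => h i; have /andP[h1 h2] := h i.
  by rewrite h2 lt_neqAle eq_sym hx h1.
by rewrite h2 ltW.
Qed.

Lemma measurable_open_cell : measurable [set x : V | forall i, 0 < x 0 i < delta].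
Proof.
rewrite (_ : mkset _ = [set x : V | forall i, `]0, delta[%classic (x 0 i)]).
  by apply: (measurable_forall_coord (B := fun=> `]0, delta[%classic)) => i.
by apply/seteqP; split=> x /= h i; have := h i; rewrite in_itv.
Qed.

Lemma integral_hcell : \int[leb]_x (\1_Q x) = delta ^+ d.
Proof.
rewrite (@ae_eq_Rintegral _ _ _ leb setT _ (\1_[set x : V | forall i, 0 < x 0 i < delta])) => //.
- rewrite /Rintegral integral_indic ?setIT//; last exact: measurable_open_cell.
  have hb : leb [set x : V | forall i, 0 < x 0 i < delta] = (delta ^+ d)%:E.
    rewrite (@lebesgue_rV_box R d (fun=> 0) (fun=> delta)) => [|i]; last exact: ltW.
    by rewrite (eq_bigr (fun=> delta)) ?prodr_const ?card_ord// => i _; rewrite subr0.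
  by transitivity (fine (delta ^+ d)%:E) => //; congr fine; exact: hb.
- exact: measurable_ind_hcell.
- by apply: measurable_indic; exact: measurable_open_cell.
- by apply: filterS ae_hcell => x ->.
Qed.

Lemma nrm_ind_sqr (A : set V) (F : V -> R) :
  nrm leb (fun x => \1_A x * F x) ^+ 2 = \int[leb]_x (F x ^+ 2 * \1_A x).
Proof.
rewrite sqr_nrm /ip; congr Rintegral; apply/funext => x; rewrite indicE.
by case: (x \in A); rewrite ?mul1r ?mulr1// !mul0r mulr0.
Qed.

Lemma nrm_ball_periodic_le (F : V -> R) (r : R) (n : nat) : locL2 F -> lperiodic delta F ->
  r < n%:R * delta ->
  nrm leb (fun x => \1_(B_ r) x * F x) ^+ 2 <=
  (n.*2 ^ d)%:R * nrm leb (fun x => \1_Q x * F x) ^+ 2.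
Proof.
move=> lF pF rn; have lF2 := locL2_sqr_locL1 lF.
have pF2 : lperiodic delta (fun x => F x ^+ 2).
  by move=> k; apply: filterS (pF k) => x ->.
have m1B : measurable_fun setT (\1_(B_ r) : V -> R).
  by apply: measurable_indic; exact: measurable_norm_le.
have m1Q := measurable_ind_hcell.
have iQ : leb.-integrable setT (EFin \o (fun x => \1_Q x * F x ^+ 2)).
  have := bounded_locL1_integrable lF2 m1Q (@ind_le1 R d Q) (fun x => hcell_ind_support d0).
  by apply: eq_integrable => // x _ /=; rewrite mulrC.
rewrite !nrm_ind_sqr (@integral_unfold R d delta _ (\1_(B_ r)) 1 n d0 lF2 pF2 m1B).
- rewrite (_ : (fun x => F x ^+ 2 * \1_Q x) = (fun x => \1_Q x * F x ^+ 2)); last first.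
    by apply/funext => x; rewrite mulrC.
  rewrite -RintegralZl//.
  pose S (x : V) : R := \sum_(k <- lbox n) \1_(B_ r) (x + delta *: shift_vec k).
  have mS : measurable_fun setT S.
    rewrite /S; elim: (@lbox d n) => [|k s IH].
      by rewrite (_ : (fun x => _) = (fun=> 0))//; apply/funext => x; rewrite big_nil.
    rewrite (_ : (fun x => _) = (fun x : V => \1_(B_ r) (x + delta *: shift_vec k) +
        \sum_(k <- s) \1_(B_ r) (x + delta *: shift_vec k))).
      by apply: measurable_funD => //; exact: (measurable_translate _ m1B).
    by apply/funext => x; rewrite big_cons.
  have S0 x : 0 <= S x by apply: sumr_ge0.
  have SK x : S x <= (n.*2 ^ d)%:R.
    rewrite -(@size_lbox d n) -sum1_size natr_sum /S; apply: ler_sum => k _.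
    by rewrite indicE; case: (_ \in _); rewrite ?lexx ?ler01.
  apply: le_Rintegral => //.
  - have SK' x : `|S x| <= (n.*2 ^ d)%:R by rewrite ger0_norm.
    have := integrable_boundedM mS SK' iQ.
    by apply: eq_integrable => // x _ /=; rewrite mulrC.
  - exact: integrable_scaler.
  - move=> x _; rewrite mulrC; apply: ler_wpM2r; last exact: SK.
    by rewrite mulr_ge0 ?sqr_ge0// indicE; case: (x \in Q).
- by move=> x; exact: ind_le1.
- move=> x; rewrite indicE; case: (boolP (x \in _)); rewrite ?eqxx// inE/= => xr _.
  exact: le_lt_trans rn.
Qed.

End one_period.

(** At most (2n)^d cells cover the ball, of total volume (2 n delta)^d. Choosing n with n delta at
    most r + delta, hence at most r + 1, makes the bound independent of delta. *)
Lemma nrm_ball_periodic (delta C r : R) (F : V -> R) : 0 < delta -> delta <= 1 -> 0 <= r -> 0 <= C ->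
  locL2 F -> lperiodic delta F ->
  nrm leb (fun x => \1_(hcell delta) x * F x) ^+ 2 <= C * delta ^+ d ->
  nrm leb (fun x => \1_(B_ r) x * F x) ^+ 2 <= C * (2 * r + 2) ^+ d.
Proof.
move=> d0 d1 r0 C0 lF pF hC; have [n hn hn'] := ex_nat_mul_gt r d0.
apply: (le_trans (nrm_ball_periodic_le d0 lF pF hn)).
apply: (le_trans (ler_wpM2l _ hC)); first exact: ler0n.
rewrite mulrCA ler_wpM2l// natrX -exprMn lerXn2r ?nnegrE ?mulr_ge0 ?ler0n//; [exact: ltW|lra|].
rewrite -muln2 natrM; move: hn'; rewrite (max_idPl r0) => hn'; nra.
Qed.

Lemma prod_integrable (b : V * V -> R) (K : R) (u v : V -> R) :
  measurable_fun setT b -> (forall z, `|b z| <= K) ->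
  leb.-integrable setT (EFin \o u) -> leb.-integrable setT (EFin \o v) ->
  (leb \x leb)%E.-integrable setT (EFin \o (fun z => b z * (u z.1 * v z.2))).
Proof.
move=> mb bK iu iv.
have mu : measurable_fun setT u by have [/measurable_EFinP] := integrableP _ _ _ iu.
have mv : measurable_fun setT v by have [/measurable_EFinP] := integrableP _ _ _ iv.
have muv : measurable_fun setT (fun z : V * V => u z.1 * v z.2).
  apply: measurable_funM; first exact: (measurableT_comp mu measurable_fst).
  exact: (measurableT_comp mv measurable_snd).
have iuv : (leb \x leb)%E.-integrable setT (EFin \o (fun z => u z.1 * v z.2)).
  have mE : measurable_fun setT (EFin \o (fun z : V * V => u z.1 * v z.2)).
    exact/measurable_EFinP.
  apply: (@integrable12ltyP _ _ _ _ _ leb leb _ mE).2.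
  have inv := integrable_norm iv; have inu := integrable_norm iu.
  have mEv : measurable_fun setT (EFin \o (fun x => `|v x|)) by have [] := integrableP _ _ _ inv.
  have mEu : measurable_fun setT (EFin \o (fun x => `|u x|)) by have [] := integrableP _ _ _ inu.
  set N := \int[leb]_y `|v y|.
  have NE : (\int[leb]_y (`|v y|)%:E)%E = N%:E.
    by rewrite /N fineK//; exact: (integrable_fin_num measurableT inv).
  have N0 : 0 <= N by apply: Rintegral_ge0.
  rewrite (eq_integral (fun x => N%:E * (`|u x|)%:E)%E); last first.
    move=> x _; rewrite muleC -NE -(@ge0_integralZl_EFin _ _ _ leb setT measurableT
      (EFin \o (fun y => `|v y|)) (fun y _ => ltac:(by rewrite lee_fin)) mEv _ (normr_ge0 _)).
    by apply: eq_integral => y _; rewrite /= normrM EFinM.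
  rewrite (@ge0_integralZl_EFin _ _ _ leb setT measurableT
      (EFin \o (fun y => `|u y|)) (fun y _ => ltac:(by rewrite lee_fin)) mEu _ N0).
  have := integrable_fin_num measurableT inu; rewrite /= => h.
  by rewrite -(fineK h) -EFinM ltry.
apply: (integrable_le (G := fun z => K * `|u z.1 * v z.2|)).
- exact: measurable_funM.
- by move=> z; rewrite normrM ler_wpM2r.
- by apply: integrable_scaler; have := integrable_norm iuv.
Qed.

End periodic_estimates.

(** * Pairing of oscillating periodic functions, and the Poincare inequality on a cell *)

Section oscillation.
Context {R : realType} {d : nat}.
Local Notation V := 'rV[R]_d.
Local Notation leb := (lebesgue_rV (R := R) d).
Local Notation B_ r := [set x : V | `|x| <= r].
Local Notation L := 'rV[int]_d.

Definition cell_density (delta : R) (t : V) : R := (delta ^+ d)^-1 * \1_(hcell delta) t.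

Section density.
Variable delta : R.
Hypothesis d0 : 0 < delta.

Lemma measurable_cell_density : measurable_fun setT (cell_density delta).
Proof. by apply: measurable_funM => //; exact: measurable_ind_hcell. Qed.

Lemma cell_density_ge0 t : 0 <= cell_density delta t.
Proof. by rewrite mulr_ge0// invr_ge0 exprn_ge0// ltW. Qed.

Lemma cell_density_le t : `|cell_density delta t| <= (delta ^+ d)^-1.
Proof.
have h : 0 <= (delta ^+ d)^-1 by rewrite invr_ge0 exprn_ge0// ltW.
by rewrite normrM (ger0_norm h) ler_piMr// ind_le1.
Qed.

Lemma cell_density_neq0 t : cell_density delta t != 0 -> hcell delta t.
Proof.
rewrite mulf_eq0 negb_or => /andP[_]; rewrite indicE.
by case: (boolP (t \in _)); rewrite ?eqxx// inE.
Qed.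

Lemma integrable_ind_hcell : leb.-integrable setT (EFin \o (\1_(hcell delta) : V -> R)).
Proof.
apply: (@bounded_support_integrable R d 1 delta).
- exact: measurable_ind_hcell.
- by move=> x; exact: ind_le1.
- by move=> x; exact: hcell_ind_support.
Qed.

Lemma integral_cell_density : \int[leb]_t cell_density delta t = 1.
Proof.
rewrite /cell_density RintegralZl//; last exact: integrable_ind_hcell.
by rewrite integral_hcell// mulVf// expf_neq0// gt_eqF.
Qed.

Lemma avg_cellE (F : V -> R) (x : V) : measurable_fun setT F ->
  avg (cell_density delta) F x = \int[leb]_y (cell_density delta (y - x) * F y).
Proof.
move=> mF; rewrite /avg -(Rintegral_translate (- x)); last first.
  by apply: measurable_funM; [exact: measurable_cell_density|exact: measurable_addvC].
by congr Rintegral; apply/funext => y; rewrite addrCA subrr addr0.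
Qed.

End density.

(** h is compared with its averages [hb] over cells of side delta, which differ from it in norm by
    at most delta times the gradient, while F is orthogonal to [hb]. Averaging spreads supports by
    at most delta, so truncating F to radius r + 1 loses nothing. *)
Lemma periodic_pairing (delta r : R) (F h : V -> R) : 0 < delta -> delta <= 1 ->
  locL2 F -> lperiodic delta F -> \int[leb]_x (\1_(hcell delta) x * F x) = 0 ->
  test_function setT h -> (forall x, h x != 0 -> `|x| <= r) ->
  `|\int[leb]_x (F x * h x)| <=
    delta * nrm leb (fun x => \1_(B_ (r + 1)) x * F x) * \sum_(i < d) nrm leb (partial i h).
Proof.
move=> d0 d1 lF pF F0 th hr.
have mk := measurable_cell_density delta.
have k0 := cell_density_ge0 d0; have kK := cell_density_le d0.
have kr t : cell_density delta t != 0 -> `|t| <= delta.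
  by move=> /cell_density_neq0; exact: hcell_norm_le.
have k1 := integral_cell_density d0.
have lh := test_inL2 th; have ih := test_integrable th.
set hb := avg (cell_density delta) h.
have mh := test_measurable th.
have mhb : measurable_fun setT hb := measurable_avg mk k0 kK kr k1 lh ih.
pose F1 x := \1_(B_ (r + 1)) x * F x.
have lF1 : inL2 leb F1 := lF.2 (r + 1).
have iF1 : leb.-integrable setT (EFin \o F1) := ball_L2_integrable lF1.
have inB x y : `|y| <= r -> `|x - y| <= delta -> x \in B_ (r + 1).
  move=> yr xy; rewrite inE/= -(subrK y x) (le_trans (ler_normD _ _))// addrC lerD//.
  exact: le_trans d1.
have eh : (fun x => F x * h x) = (fun x => F1 x * h x).
  apply/funext => x; have [->|hx] := eqVneq (h x) 0; first by rewrite !mulr0.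
  by rewrite /F1 indicE (inB x x) ?mul1r ?hr// subrr normr0 ltW.
(* F has mean zero on every translate of the cell, so it annihilates averages over such translates *)
have F1hb : \int[leb]_x (F1 x * hb x) = 0.
  pose f (z : V * V) : R := cell_density delta (z.2 - z.1) * (F1 z.1 * h z.2).
  have msub : measurable_fun setT (fun z : V * V => z.2 - z.1).
    apply: measurable_fun_matrixP => i j.
    rewrite (_ : (fun z => _) = (fun z : V * V => z.2 i j - z.1 i j)); last first.
      by apply/funext => z; rewrite !mxE.
    apply: measurable_funB.
      exact: (measurableT_comp (measurable_coord i j) measurable_snd).
    exact: (measurableT_comp (measurable_coord i j) measurable_fst).
  have imf : (leb \x leb)%E.-integrable setT (EFin \o f).
    exact: (prod_integrable (measurableT_comp mk msub) (fun z => kK _) iF1 ih).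
  have i2 (x : V) : leb.-integrable setT (EFin \o (fun y => f (x, y))).
    have mkx : measurable_fun setT (fun y : V => cell_density delta (y - x)).
      exact: measurable_translate.
    have := integrable_boundedM mkx (fun y => kK (y - x)) (integrable_scaler (F1 x) ih).
    by apply: eq_integrable.
  have mky (y : V) : measurable_fun setT (fun x : V => cell_density delta (y - x)).
    exact: measurable_subv.
  have i1 (y : V) : leb.-integrable setT (EFin \o (fun x => f (x, y))).
    have := integrable_boundedM (mky y) (fun x => kK (y - x)) (integrable_scaler (h y) iF1).
    by apply: eq_integrable => // x _ /=; rewrite /f/= [h y * _]mulrC.
  transitivity (\int[leb]_x \int[leb]_y f (x, y)).
    congr Rintegral; apply/funext => x; rewrite /hb avg_cellE//.
    rewrite -RintegralZl//.
      by congr Rintegral; apply/funext => y; rewrite /f mulrCA.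
    have mkx : measurable_fun setT (fun y : V => cell_density delta (y - x)).
      exact: measurable_translate.
    exact: (integrable_boundedM mkx (fun y => kK (y - x)) ih).
  rewrite (Rintegral_fubini imf i2 i1) (_ : (fun y => _) = (fun=> 0)).
    by rewrite /Rintegral integral0.
  apply/funext => y; have [hy|hy] := eqVneq (h y) 0.
    rewrite (_ : (fun x => _) = (fun=> 0)); first by rewrite /Rintegral integral0.
    by apply/funext => x; rewrite /f hy !mulr0.
  rewrite (_ : (fun x => f (x, y)) = (fun x => (h y * (delta ^+ d)^-1) * (F x * \1_(hcell delta) (y - x)))).
    rewrite RintegralZl//.
      by rewrite (integral_periodic_cellB d0 y (locL2_locL1 lF) pF) F0 mulr0.
    apply: (bounded_locL1_integrable (K := 1) (r := `|y| + delta) (locL2_locL1 lF)).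
    - exact: (measurable_subv y (measurable_ind_hcell delta)).
    - by move=> x; exact: ind_le1.
    - move=> x /(hcell_ind_support d0) hx.
      by rewrite -[x](subKr y) (le_trans (ler_normB _ _))// lerD2l.
  apply/funext => x; rewrite /f /cell_density/= /F1.
  have [z0|z0] := eqVneq (\1_(hcell delta) (y - x) : R) 0; first by rewrite z0 !(mulr0, mul0r).
  have /(hcell_ind_support d0) hyx := z0.
  have xB : x \in B_ (r + 1).
    by apply: (inB x y); [exact: hr|rewrite distrC].
  rewrite [\1_(B_ (r + 1)) x]indicE xB mul1r.
  move: (\1_(hcell delta) (y - x)) (delta ^+ d)^-1 => u v; ring.
have [lhb nhb] : inL2 leb (fun x => \1_setT x * (hb x - h x)) /\
    nrm leb (fun x => \1_setT x * (hb x - h x)) <= delta * \sum_(i < d) nrm leb (partial i h).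
  apply: (nrm_avg_le mk k0 kK kr k1 lh ih measurableT).
    by apply: mulr_ge0; [exact: ltW|apply: sumr_ge0 => i _; exact: nrm_ge0].
  move=> t /cell_density_neq0 ht.
  rewrite (_ : (fun x => _) = (fun x : V => h (x + t) - h x)); last first.
    by apply/funext => x; rewrite indicT mul1r.
  apply: test_nrm_increment => //; last exact: ltW.
  by move=> i; have /andP[-> /ltW ->] := ht i.
have eT : (fun x => \1_setT x * (hb x - h x)) = (fun x => hb x - h x).
  by apply/funext => x; rewrite indicT mul1r.
rewrite eT in lhb nhb.
have lhb' : inL2 leb hb.
  by have := inL2D lhb lh; rewrite (_ : (fun x => _) = hb)//; apply/funext => x; rewrite subrK.
rewrite eh (_ : \int[leb]_x _ = - ip leb F1 (fun x => hb x - h x)); last first.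
  by rewrite ipBr// /ip F1hb sub0r opprK.
rewrite normrN (le_trans (ip_le lF1 lhb))//.
by rewrite mulrAC mulrC ler_wpM2r// nrm_ge0.
Qed.

End oscillation.

Section h1loc.
Context {R : realType} {d : nat}.
Local Notation V := 'rV[R]_d.
Local Notation leb := (lebesgue_rV (R := R) d).
Local Notation B_ r := [set x : V | `|x| <= r].

Lemma compact_sub_ball (K : set V) : compact K -> exists2 r, 0 <= r & K `<=` B_ r.
Proof.
move=> /compact_bounded[M [_ hM]]; exists (`|M| + 1); first by rewrite addr_ge0.
by move=> x Kx; apply: (hM (`|M| + 1) _ x Kx); rewrite (le_lt_trans (ler_norm M))// ltrDl.
Qed.

Lemma compact_measurable_rV (K : set V) : compact K -> measurable K.
Proof.
move=> cK; rewrite -[K]setCK; apply: measurableC; apply: open_measurable_rV.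
by apply: closed_openC; exact: (compact_closed (@norm_hausdorff R V) cK).
Qed.

Lemma L2_compactP (u : V -> R) : (forall K, compact K -> L2 K u) <-> locL2 u.
Proof.
have mB r := @measurable_norm_le R d r.
split=> [h|[mu lu] K cK].
  split; last by move=> r; apply: L2_inL2 => //; apply: h; exact: compact_norm_le.
  have -> : [set: V] = \bigcup_n B_ n%:R.
    apply/seteqP; split => // x _.
    have [n hn _] := ex_nat_mul_gt `|x| (@ltr01 R).
    by rewrite mulr1 in hn; exists n => //=; exact: ltW.
  apply/measurable_fun_bigcup => // n.
  by have [] := h _ (@compact_norm_le R d n%:R).
have [r r0 Kr] := compact_sub_ball cK; have mK := compact_measurable_rV cK.
split; first exact: measurable_funS mu.
have mu2 : measurable_fun setT (fun x : V => (u x ^+ 2)%:E).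
  by apply/measurable_EFinP; exact: measurable_funX.
apply: le_lt_trans (_ : (sqL2 (B_ r) u < +oo)%E).
  apply: ge0_subset_integral => //.
  - exact: measurable_funS mu2.
  - by move=> x _; rewrite lee_fin sqr_ge0.
rewrite /sqL2 integral_mkcond; move: (lu r).2; congr (_ < _)%E.
apply: eq_integral => x _; rewrite /patch indicE.
by case: (x \in _); rewrite ?mul1r// mul0r expr0n.
Qed.

Lemma H1locP (N : V -> R) (g : V -> 'cV[R]_d) : H1loc N g <->
  [/\ locL2 N, forall i, locL2 (fun x => g x i 0) & weak_gradient setT N g].
Proof.
split=> [[h1 h2 h3]|[h1 h2 h3]]; split => //.
- exact/L2_compactP.
- by move=> i; apply/L2_compactP => K; exact: h2.
- exact/L2_compactP.
- by move=> K i; apply: (L2_compactP _).2.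
Qed.

(** By periodicity the average of N over x + Q is the mean c for each x in the cell Q, so N - c is a
    deviation from an average and [nrm_avg_le] applies. Points x + t with x and t in the cell stay
    in the ball of radius 2 delta. *)
Lemma periodic_poincare (delta c : R) (N : V -> R) (g : V -> 'cV[R]_d) : 0 < delta ->
  H1loc N g -> lperiodic delta N ->
  c = (delta ^+ d)^-1 * \int[leb]_x (\1_(hcell delta) x * N x) ->
  nrm leb (fun x => \1_(hcell delta) x * (N x - c)) <=
    delta * \sum_(i < d) nrm leb (fun x => \1_(B_ (2 * delta)) x * g x i 0).
Proof.
move=> d0 hN pN cE; have [lN lg _] := (H1locP _ _).1 hN.
have d0' : 0 < 2 * delta by rewrite mulr_gt0.
have mQ := measurable_hcell (d := d) delta.
set Q := hcell delta; set B := B_ (2 * delta).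
have mB : measurable B := @measurable_norm_le R d _.
pose F x := \1_B x * N x.
have lF : inL2 leb F := lN.2 _.
have iF := ball_L2_integrable lF.
have QB x t : Q x -> Q t -> x + t \in B.
  move=> /(hcell_norm_le d0) hx /(hcell_norm_le d0) ht; rewrite inE/=.
  by apply: (le_trans (ler_normD _ _)); rewrite mulrDl mul1r lerD.
have Q0 : Q 0 by move=> i; rewrite mxE lexx.
have FQ x t : Q x -> Q t -> F (x + t) = N (x + t).
  by move=> hx ht; have h := QB _ _ hx ht; rewrite /F indicE h mul1r.
have FQ0 x : Q x -> F x = N x by move=> hx; rewrite -[x]addr0 FQ.
have mk := measurable_cell_density (d := d) delta.
have k0 := cell_density_ge0 (d := d) d0; have kK := cell_density_le (d := d) d0.
have kr (t : V) : cell_density delta t != 0 -> `|t| <= delta.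
  by move=> /cell_density_neq0; exact: hcell_norm_le.
have k1 := integral_cell_density (d := d) d0.
have avgc x : Q x -> avg (cell_density delta) F x = c.
  move=> Qx; rewrite cE -(integral_periodic_cellD d0 x (locL2_locL1 lN) pN).
  rewrite -(@Rintegral_translate _ _ _ x); last first.
    apply: measurable_funM; first exact: lN.1.
    by apply: (@measurable_translate R d (\1_Q) (- x)); exact: measurable_ind_hcell.
  rewrite -RintegralZl//; last first.
    have := integrable_translate x (bounded_locL1_integrable (K := 1) (r := `|x| + delta) (phi := fun y => \1_Q (y - x)) (locL2_locL1 lN) _ _ _).
    apply.
    - by apply: (@measurable_translate R d (\1_Q) (- x)); exact: measurable_ind_hcell.
    - by move=> y; exact: ind_le1.
    - move=> y /(hcell_ind_support d0) hy.
      by rewrite -[y](subrK x) (le_trans (ler_normD _ _))// addrC lerD2l.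
  congr Rintegral; apply/funext => t; rewrite addrK /cell_density -mulrA; congr (_ * _).
  have [Qt|Qt] := boolP (t \in Q); last by rewrite indicE (negbTE Qt) mul0r mulr0.
  by rewrite inE in Qt; rewrite (FQ _ _ Qx Qt) [t + x]addrC; exact: mulrC.
have eta0 : 0 <= delta * \sum_(i < d) nrm leb (fun x => \1_B x * g x i 0).
  by apply: mulr_ge0; [exact: ltW|apply: sumr_ge0 => i _; exact: nrm_ge0].
have [|_] := nrm_avg_le mk k0 kK kr k1 lF iF mQ eta0; last first.
  rewrite -[X in _ -> X <= _]nrmN; congr (nrm _ _ <= _); apply/funext => x.
  have [Qx|Qx] := boolP (x \in Q); last by rewrite indicE (negbTE Qx) !mul0r oppr0.
  by rewrite inE in Qx; rewrite avgc// FQ0// -[RHS]mulrN opprB.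
move=> t /cell_density_neq0 Qt.
apply/ler_addgt0Pr => e e0.
have K0 : 0 < delta * d%:R + 2 by apply: ltr_wpDl => //; apply: mulr_ge0; [exact: ltW|exact: ler0n].
(* Increments are estimated on a smooth approximation p of N: replacing the d gradient components
   costs delta d e1, and replacing N by p at x and at x + t costs 2 e1. *)
pose e1 := e / (delta * d%:R + 2); have e10 : 0 < e1 by rewrite divr_gt0.
have [p [sp lp np lgp ngp]] := H1loc_approx hN d0' e10.
have lB i : inL2 leb (fun x : V => \1_B x * partial i p x).
  have := inL2D (lgp i) ((lg i).2 (2 * delta)); rewrite (_ : (fun x => _) = (fun x : V => \1_B x * partial i p x))//.
  by apply/funext => x; rewrite -mulrDr subrK.
have nB i : nrm leb (fun x : V => \1_B x * partial i p x) <= e1 + nrm leb (fun x => \1_B x * g x i 0).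
  apply: (le_trans _ (lerD (ngp i) (lexx _))).
  apply: (le_trans _ (nrmD_le (lgp i) ((lg i).2 (2 * delta)))).
  by rewrite (_ : (fun x => _ + _) = (fun x : V => \1_B x * partial i p x))//; apply/funext => x; rewrite -mulrDr subrK.
have ABt (x s : V) : Q x -> (forall i, 0 <= s 0 i <= delta) -> B (x + s).
  move=> /(hcell_norm_le d0) hx hs; apply: (le_trans (ler_normD _ _)).
  rewrite mulrDl mul1r lerD//; apply/(rV_norm_leP s (ltW d0)) => i.
  by have /andP[h1 h2] := hs i; rewrite ger0_norm.
have t0 i : 0 <= t 0 i <= delta by have /andP[-> /ltW ->] := Qt i.
have [l1 n1] := nrm_increment sp (ltW d0) t0 mQ mB ABt lB.
pose E x := \1_B x * (p x - N x).
have [lE' nE'] := inL2_translate t lp.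
have [l2 n2] := nrm_indic_le mQ lE'; have [l3 n3] := nrm_indic_le mQ lp.
have -> : (fun x => \1_Q x * (F (x + t) - F x)) = (fun x => \1_Q x * (p (x + t) - p x) -
    (\1_Q x * E (x + t) - \1_Q x * E x)).
  apply/funext => x.
  have [Qx|Qx] := boolP (x \in Q); last by rewrite [\1_Q x]indicE (negbTE Qx) !mul0r !subr0.
  rewrite inE in Qx; rewrite FQ// FQ0// /E.
  have h1 := QB _ _ Qx Qt; have h2 := QB _ _ Qx Q0; rewrite addr0 in h2.
  rewrite [\1_B (x + t)]indicE [\1_B x]indicE h1 h2 !mul1r.
  move: (\1_Q x) (p x) => a b; ring.
apply: (le_trans (nrmB_le l1 (inL2B l2 l3))).
apply: (le_trans (lerD n1 (nrmB_le l2 l3))).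
apply: (le_trans (lerD (lexx _) (lerD n2 n3))); rewrite nE'.
apply: (le_trans (lerD (lexx _) (lerD np np))).
have hs : \sum_(i < d) nrm leb (fun x : V => \1_B x * partial i p x) <=
    d%:R * e1 + \sum_(i < d) nrm leb (fun x => \1_B x * g x i 0).
  apply: (le_trans (ler_sum _ (fun i _ => nB i))).
  by rewrite big_split/= sumr_const card_ord mulr_natl.
apply: (le_trans (lerD (ler_wpM2l (ltW d0) hs) (lexx _))).
have -> : e = (delta * d%:R + 2) * e1 by rewrite /e1 mulrC divfK// gt_eqF.
move: (d%:R : R) (\sum_(i < d) _ : R) => a b; lra.
Qed.

End h1loc.

(** * Sobolev functions and their periodization *)

Section locL2_calculus.
Context {R : realType} {d : nat}.
Local Notation V := 'rV[R]_d.
Local Notation leb := (lebesgue_rV (R := R) d).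
Local Notation B_ r := [set x : V | `|x| <= r].

Lemma locL2D (F G : V -> R) : locL2 F -> locL2 G -> locL2 (fun x => F x + G x).
Proof.
move=> [mF lF] [mG lG]; split; first exact: measurable_funD.
move=> r; have := inL2D (lF r) (lG r); congr (inL2 _ _).
by apply/funext => x; rewrite mulrDr.
Qed.

Lemma locL2Z (k : R) (F : V -> R) : locL2 F -> locL2 (fun x => k * F x).
Proof.
move=> [mF lF]; split; first exact: measurable_funM.
move=> r; have := inL2Z k (lF r); congr (inL2 _ _).
by apply/funext => x; rewrite mulrCA.
Qed.

Lemma locL2B (F G : V -> R) : locL2 F -> locL2 G -> locL2 (fun x => F x - G x).
Proof.
move=> lF lG; have := locL2D lF (locL2Z (-1) lG); congr locL2.
by apply/funext => x; rewrite mulN1r.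
Qed.

Lemma continuous_locL2 (F : V -> R) : continuous F -> locL2 F.
Proof.
move=> cF; have mF := continuous_measurable_rV cF; split => // r.
have mB : measurable_fun setT (\1_(B_ r) : V -> R).
  by apply: measurable_indic; exact: measurable_norm_le.
have : compact (F @` (B_ r)).
  apply: continuous_compact; last exact: compact_norm_le.
  by apply: continuous_subspaceT => x; exact: cF.
move=> /compact_bounded[M [_ hM]].
apply: (@bounded_support_inL2 R d (`|M| + 1) r) => [|x|x].
- exact: measurable_funM.
- rewrite indicE; have [xB|xB] := boolP (x \in B_ r); last by rewrite mul0r normr0 addr_ge0.
  rewrite mul1r; apply: (hM (`|M| + 1)); first by rewrite (le_lt_trans (ler_norm M))// ltrDl.
  by exists x => //; rewrite inE in xB.
- rewrite indicE; have [xB _|xB] := boolP (x \in B_ r); last by rewrite mul0r eqxx.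
  by rewrite inE in xB.
Qed.

Lemma locL2_cst (k : R) : locL2 (fun _ : V => k).
Proof. by apply: continuous_locL2; exact: cst_continuous. Qed.

Lemma locL2_sum (I : Type) (s : seq I) (F : I -> V -> R) :
  (forall i, locL2 (F i)) -> locL2 (fun x => \sum_(i <- s) F i x).
Proof.
move=> lF; elim: s => [|i s IH].
  by rewrite (_ : (fun _ => _) = (fun=> 0)); [exact: locL2_cst|apply/funext => x; rewrite big_nil].
rewrite (_ : (fun _ => _) = (fun x => F i x + \sum_(j <- s) F j x)); first exact: locL2D.
by apply/funext => x; rewrite big_cons.
Qed.

Lemma locL2_bounded (K : R) (b F : V -> R) : measurable_fun setT b ->
  {ae leb, forall x, `|b x| <= K} -> 0 <= K -> locL2 F -> locL2 (fun x => b x * F x).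
Proof.
move=> mb bK K0 [mF lF]; split; first exact: measurable_funM.
move=> r; have := (inL2_bounded mb bK K0 (lF r)).1; congr (inL2 _ _).
by apply/funext => x; rewrite mulrCA.
Qed.

Lemma locL1_test_integrable (F phi : V -> R) : locL1 F -> test_function setT phi ->
  leb.-integrable setT (EFin \o (fun x => F x * phi x)).
Proof.
move=> lF tphi; have [K _ hK] := test_bounded tphi; have [r _ hr] := test_support tphi.
exact: (bounded_locL1_integrable lF (test_measurable tphi) hK hr).
Qed.

Lemma inL2_affine (s : R) (t : V) (F : V -> R) : 0 < s -> inL2 leb F ->
  inL2 leb (fun x => F (s *: x + t)).
Proof.
move=> s0 lF; apply: sqr_integrable_inL2.
  exact: (measurableT_comp lF.1 (measurable_affine s t)).
exact: (integrable_affine t s0 (inL2_sqr_integrable lF)).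
Qed.

Lemma locL2_affine (s : R) (t : V) (F : V -> R) : 0 < s -> locL2 F ->
  locL2 (fun x => F (s *: x + t)).
Proof.
move=> s0 [mF lF]; split.
  exact: (measurableT_comp mF (measurable_affine s t)).
move=> r; apply: (inL2_le _ (inL2_affine t s0 (lF (s * r + `|t|)))).
  apply: measurable_funM; first by apply: measurable_indic; exact: measurable_norm_le.
  exact: (measurableT_comp mF (measurable_affine s t)).
move=> x; have [xB|xB] := boolP (x \in B_ r); last by rewrite indicE (negbTE xB) mul0r normr0.
have h : s *: x + t \in B_ (s * r + `|t|).
  rewrite inE in xB; rewrite inE/= (le_trans (ler_normD _ _))// lerD2r normrZ gtr0_norm//.
  by rewrite ler_pM2l.
by rewrite indicE xB [X in _ <= `|X * _|]indicE h.
Qed.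

Lemma weak_gradient_affine (s : R) (t : V) (N : V -> R) (g : V -> 'cV[R]_d) : 0 < s ->
  locL1 N -> (forall i, locL1 (fun x => g x i 0)) -> weak_gradient setT N g ->
  weak_gradient setT (fun x => N (s *: x + t)) (fun x => s *: g (s *: x + t)).
Proof.
move=> s0 lN lg wg phi tphi i; have s0' : s != 0 by rewrite gt_eqF.
pose psi (y : V) := phi (s^-1 *: y - s^-1 *: t).
have tpsi : test_function setT psi by apply: test_affine => //; rewrite invr_neq0.
have dpsi : partial i psi = fun y => s^-1 * partial i phi (s^-1 *: y - s^-1 *: t).
  by apply: partial_affine; exact/smooth_pderivable/(test_smooth tphi).
have psiE (x : V) : psi (s *: x + t) = phi x.
  by rewrite /psi scalerDr scalerA mulVf// scale1r addrK.
have sd : s ^+ d != 0 by rewrite expf_neq0.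
apply: (mulfI sd).
transitivity (s * \int[leb]_y (N y * partial i psi y)).
  rewrite -(Rintegral_affine t s0); last first.
    by apply: measurable_funM; [exact: lN.1|exact: test_measurable (test_partial i tpsi)].
  rewrite mulrCA; congr (_ * _); rewrite -RintegralZl//.
    congr Rintegral; apply/funext => x; rewrite dpsi scalerDr scalerA mulVf// scale1r addrK.
    by rewrite mulrCA mulVKf.
  apply: (integrable_affine t s0 (F := fun y => N y * partial i psi y)).
  exact: locL1_test_integrable lN (test_partial i tpsi).
rewrite wg// mulrN -(Rintegral_affine t s0); last first.
  by apply: measurable_funM; [exact: (lg i).1|exact: test_measurable tpsi].
rewrite mulrCA -mulrN; congr (_ * _); rewrite -RintegralZl//; last first.
  apply: (integrable_affine t s0 (F := fun y => g y i 0 * psi y)).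
  exact: locL1_test_integrable (lg i) tpsi.
by congr (- _); congr Rintegral; apply/funext => x; rewrite psiE mxE mulrA.
Qed.

Lemma H1loc_affine (s : R) (t : V) (N : V -> R) (g : V -> 'cV[R]_d) : 0 < s ->
  H1loc N g -> H1loc (fun x => N (s *: x + t)) (fun x => s *: g (s *: x + t)).
Proof.
move=> s0 /H1locP[lN lg wg]; apply/H1locP; split.
- exact: locL2_affine.
- move=> i; have := locL2Z s (locL2_affine t s0 (lg i)); congr locL2.
  by apply/funext => x; rewrite mxE.
- by apply: weak_gradient_affine => //; [exact: locL2_locL1|move=> i; exact: locL2_locL1].
Qed.

Lemma H1locD (N N' : V -> R) (g g' : V -> 'cV[R]_d) (k : R) : H1loc N g -> H1loc N' g' ->
  H1loc (fun x => N x + k * N' x) (fun x => g x + k *: g' x).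
Proof.
move=> /H1locP[lN lg wg] /H1locP[lN' lg' wg']; apply/H1locP; split.
- by apply: locL2D => //; exact: locL2Z.
- move=> i; have := locL2D (lg i) (locL2Z k (lg' i)); congr locL2.
  by apply/funext => x; rewrite !mxE.
move=> phi tphi i; have tp := test_partial i tphi.
rewrite (_ : (fun x => _ * partial i phi x) =
    (fun x => N x * partial i phi x + k * (N' x * partial i phi x))); last first.
  by apply/funext => x; rewrite mulrDl mulrA.
rewrite RintegralD//; last 2 first.
- exact: locL1_test_integrable (locL2_locL1 lN) tp.
- by apply: integrable_scaler; exact: locL1_test_integrable (locL2_locL1 lN') tp.
rewrite RintegralZl//; last exact: locL1_test_integrable (locL2_locL1 lN') tp.
rewrite wg// wg'//.
rewrite (_ : (fun x => (g x + k *: g' x) i 0 * phi x) = (fun x => g x i 0 * phi x + k * (g' x i 0 * phi x))); last first.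
  by apply/funext => x; rewrite !mxE mulrDl mulrA.
rewrite RintegralD//; last 2 first.
- exact: locL1_test_integrable (locL2_locL1 (lg i)) tphi.
- by apply: integrable_scaler; exact: locL1_test_integrable (locL2_locL1 (lg' i)) tphi.
rewrite RintegralZl//; last exact: locL1_test_integrable (locL2_locL1 (lg' i)) tphi.
by rewrite mulrN opprD.
Qed.

Lemma H1loc_smooth (p : V -> R) : smooth p -> H1loc p (grad p).
Proof.
move=> sp; apply/H1locP; split.
- exact/continuous_locL2/smooth_continuous.
- move=> i; have -> : (fun x => grad p x i 0) = partial i p by apply/funext => x; rewrite mxE.
  by apply/continuous_locL2/smooth_continuous; exact: smooth_partial.
- move=> phi tphi i; rewrite integration_by_parts_rV//; congr (- Rintegral _ _ _).
  by apply/funext => x; rewrite mxE.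
Qed.

Lemma ae_sqr_eq0 (F : V -> R) : inL2 leb F -> nrm leb F = 0 -> {ae leb, forall x, F x = 0}.
Proof.
move=> lF F0; have := integral_sqrE lF; rewrite F0 expr0n/= => h.
have mF2 : measurable_fun setT (fun x => ((F x) ^+ 2)%:E).
  by apply/measurable_EFinP; apply: measurable_funX; exact: lF.1.
have h0 : (\int[leb]_x `|((F x) ^+ 2)%:E| = 0)%E.
  by rewrite -[RHS]h; apply: eq_integral => x _; rewrite gee0_abs// lee_fin sqr_ge0.
have := (ae_eq_integral_abs leb measurableT mF2).1 h0.
by apply: filterS => x /(_ I)[] /eqP; rewrite sqrf_eq0 => /eqP.
Qed.

Lemma ae_ballP (Q : V -> Prop) : (forall n : nat, {ae leb, forall x, `|x| <= n%:R -> Q x}) ->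
  {ae leb, forall x, Q x}.
Proof.
move=> h; have := ae_foralln h; apply: filterS => x hx.
by have [n hn _] := ex_nat_mul_gt `|x| (@ltr01 R); apply: (hx n); rewrite mulr1 in hn; exact: ltW.
Qed.

(** One would test with chi g_i, which is not smooth. Testing with chi d_i p for smooth p whose
    gradient approximates g shows that the integral of chi g_i^2 is arbitrarily small. *)
Lemma weak_gradient0 (u : V -> R) (g : V -> 'cV[R]_d) : H1loc u g ->
  {ae leb, forall x, u x = 0} -> forall i, {ae leb, forall x, g x i 0 = 0}.
Proof.
move=> hu u0 i; have [lu lg wg] := (H1locP _ _).1 hu.
apply: ae_ballP => n; set r := n.+1%:R : R; have r0 : 0 < r by [].
(* Rescaled and recentred so that the ball of radius n falls strictly inside the unit cube, where
   the bump is positive; taking r = n + 1 gives the strict inclusion. *)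
pose chi (x : V) := cube_bump ((2 * r)^-1 *: x + const_mx 2^-1) : R.
have tchi : test_function setT chi.
  by apply: test_affine; [rewrite gt_eqF// invr_gt0 mulr_gt0|exact: test_cube_bump].
have chi0 x : 0 <= chi x by exact: cube_bump_ge0.
have chi1 (x : V) : `|x| <= n%:R -> 0 < chi x.
  move=> hx; apply: cube_bump_gt0 => j; rewrite !mxE.
  have hj := le_trans (rV_coord_le x j) hx.
  have : `|(2 * r)^-1 * x 0 j| < 2^-1.
    rewrite normrM ger0_norm ?invr_ge0 ?mulr_ge0// mulrC ltr_pdivrMr ?mulr_gt0//.
    by rewrite mulKf// (le_lt_trans hj)// ltr_nat.
  by move: (_ * x 0 j) => a; rewrite ltr_norml => /andP[h1 h2]; apply/andP; split; lra.
have [K K0 hK] := test_bounded tchi; have [rho rho0 hrho] := test_support tchi.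
have rho1 : 0 < rho + 1 by lra.
pose B := B_ (rho + 1).
have chiB x : chi x != 0 -> x \in B by move=> /hrho h; rewrite inE; apply: (le_trans h); rewrite lerDl.
pose G x := \1_B x * g x i 0.
have lG : inL2 leb G := (lg i).2 _.
have mchi : measurable_fun setT chi := test_measurable tchi.
have hK' : {ae leb, forall x, `|chi x| <= K} by apply: aeW => x; exact: hK.
have [lcG ncG] := inL2_bounded mchi hK' (ltW K0) lG.
have G0 : ip leb (fun x => chi x * G x) G = 0.
  apply/normr0_eq0/le_anti; rewrite normr_ge0 andbT.
  apply/ler_addgt0Pr => e e0; rewrite add0r.
  have KG : 0 < K * nrm leb G + 1 by rewrite ltr_wpDl// mulr_ge0 ?nrm_ge0// ltW.
  have e10 : 0 < e / (K * nrm leb G + 1) by rewrite divr_gt0.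
  have [p [sp _ _ /(_ i) lp /(_ i) np]] := H1loc_approx hu rho1 e10.
  have lp' : inL2 leb (fun x : V => \1_B x * partial i p x).
    have := inL2D lp lG; congr (inL2 _ _); apply/funext => x; rewrite /G -mulrDr subrK//.
  have eG : ip leb (fun x => chi x * G x) G = ip leb (fun x => chi x * G x) (fun x : V => \1_B x * partial i p x)
      - ip leb (fun x => chi x * G x) (fun x => \1_B x * (partial i p x - g x i 0)).
    by rewrite -ipBr//; congr ip; apply/funext => x; rewrite /G -mulrBr opprB addrC subrK.
  have tcp : test_function setT (fun x => chi x * partial i p x) := testM tchi (smooth_partial i sp).
  have p0 : ip leb (fun x => chi x * G x) (fun x : V => \1_B x * partial i p x) = 0.
    have := wg _ tcp i; rewrite (@ae_eq_Rintegral _ _ _ leb setT _ (fun=> 0)) => //; last 2 first.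
    - by apply: measurable_funM; [exact: lu.1|exact: test_measurable (test_partial i tcp)].
    - by apply: filterS u0 => x -> _; rewrite mul0r.
    rewrite {1}/Rintegral integral0/= => /esym/eqP; rewrite oppr_eq0 => /eqP h0.
    rewrite -[RHS]h0; congr Rintegral; apply/funext => x; rewrite /G.
    have [->|hx] := eqVneq (chi x) 0; first by rewrite !mul0r mulr0.
    by have xB := chiB _ hx; rewrite indicE xB !mul1r mulrAC mulrC mulrA.
  rewrite eG p0 sub0r normrN; apply: (le_trans (ip_le lcG lp)).
  apply: (le_trans (ler_pM _ _ ncG np)); rewrite ?nrm_ge0// mulrCA ler_piMr//; first exact: ltW.
  by rewrite ler_pdivrMr// mul1r lerDl.
(* Since 0 <= chi <= K, the square of chi G is at most K times chi G^2. *)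
have F0 : nrm leb (fun x => chi x * G x) = 0.
  apply/eqP; rewrite -sqrf_eq0; apply/eqP/le_anti; rewrite sqr_ge0 andbT sqr_nrm.
  rewrite -[leRHS](mulr0 K) -G0 /ip -RintegralZl//; last exact: inL2_integrableM.
  apply: le_Rintegral => //.
  - exact: inL2_integrableM.
  - by apply: integrable_scaler; exact: inL2_integrableM.
  - move=> x _; move: (hK x) (chi0 x) (G x) => + c0 y; rewrite (ger0_norm c0) => cK.
    have := sqr_ge0 y; have := mulr_ge0 c0 (sqr_ge0 y); nra.
have := ae_sqr_eq0 lcG F0; apply: filterS => x + hx.
move=> /eqP; have c0 := chi1 _ hx; rewrite mulf_eq0 (gt_eqF c0)/= /G.
by have xB := chiB _ (lt0r_neq0 c0); rewrite indicE xB mul1r => /eqP.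
Qed.

End locL2_calculus.

Section periodization.
Context {R : realType} {d : nat}.
Local Notation V := 'rV[R]_d.
Local Notation L := 'rV[int]_d.
Local Notation leb := (lebesgue_rV (R := R) d).
Local Notation B_ r := [set x : V | `|x| <= r].

Lemma mem_lbox (n : nat) (k : L) : (forall i, `|k 0 i| < n%:Z) -> k \in lbox n.
Proof.
move=> hk; have h i : (0 <= k 0 i + n%:Z < n.*2%:Z)%R.
  have := hk i; rewrite ltr_norml => /andP[h1 h2]; rewrite -muln2 PoszM; lia.
have hb i : (absz (k 0 i + n%:Z)%R < n.*2)%N by have := h i; lia.
apply/mapP; exists [ffun i => Ordinal (hb i)]; first by rewrite mem_enum.
by apply/rowP => i; rewrite !mxE ffunE/= gez0_abs ?addrK//; have /andP[] := h i.
Qed.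

Lemma uniq_lbox (n : nat) : uniq (lbox (d := d) n).
Proof.
rewrite map_inj_uniq ?enum_uniq// => m m' /rowP h; apply/ffunP => i; apply/val_inj => /=.
by have := h i; rewrite !mxE => /addIr [].
Qed.

(** Summing over the whole lattice gives exact periodicity at every point, which no fixed box would.
    For compactly supported psi the sum is locally finite and [periodizeE] computes it on a box. *)
Definition periodize (delta : R) (psi : V -> R) (x : V) : R :=
  \sum_(k \in [set: L]) psi (x + delta *: shift_vec k).

Section delta.
Variable delta : R.
Hypothesis d0 : 0 < delta.

Lemma periodizeE (psi : V -> R) (r : R) (n : nat) (x : V) :
  (forall x, psi x != 0 -> `|x| <= r) -> `|x| + r < n%:R * delta ->
  periodize delta psi x = \sum_(k <- lbox n) psi (x + delta *: shift_vec k).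
Proof.
move=> hr hn; rewrite (fsbig_seq _ _ (uniq_lbox n)); apply/esym/fsbig_widen => //.
move=> k [_ /=]; apply: contra_notP => /eqP /hr hk; apply: mem_lbox => i.
have h := rV_coord_le (x + delta *: shift_vec k) i; rewrite !mxE in h.
have hx := rV_coord_le x i.
have : `|delta * (k 0 i)%:~R| < n%:R * delta.
  rewrite -[X in `|X|](addKr (x 0 i)) (le_lt_trans (ler_normD _ _))// normrN.
  by apply: le_lt_trans hn; apply: lerD => //; exact: le_trans hk.
rewrite normrM gtr0_norm// [n%:R * _]mulrC ltr_pM2l// -intr_norm.
by rewrite -[n%:R]/((n%:Z)%:~R) ltr_int.
Qed.

Lemma periodize_shift (psi : V -> R) (m : L) (x : V) :
  periodize delta psi (x + delta *: shift_vec m) = periodize delta psi x.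
Proof.
rewrite /periodize [RHS](@reindex_fsbigT _ _ _ _ _ (fun k : L => m + k)); last first.
  by exists (fun k => - m + k) => k; rewrite ?addKr ?addNKr.
apply: eq_fsbigr => k _; congr psi; rewrite -addrA -scalerDr; congr (_ + _ *: _).
by apply/rowP => i; rewrite !mxE intrD.
Qed.

Lemma periodizeE_ball (psi : V -> R) (rho : R) : test_function setT psi -> exists n : nat,
  (forall x, `|x| <= rho -> periodize delta psi x = \sum_(k <- lbox n) psi (x + delta *: shift_vec k)) /\
  (forall i x, `|x| <= rho ->
     periodize delta (partial i psi) x = \sum_(k <- lbox n) partial i psi (x + delta *: shift_vec k)).
Proof.
move=> tpsi; have [r r0 hr] := test_support tpsi.
have [n hn _] := ex_nat_mul_gt (rho + r) d0; exists n.
have le x : `|x| <= rho -> `|x| + r < n%:R * delta.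
  by move=> hx; apply: le_lt_trans hn; rewrite lerD2r.
split=> [x /le hx|i x /le hx]; first exact: (periodizeE hr).
by apply: (periodizeE _ hx) => y /partial_support; exact: closure_norm_le.
Qed.

(** A local criterion suited to periodizations: on each ball they coincide with a finite sum of
    smooth functions, but the sum depends on the ball. *)
Lemma H1loc_local (u : V -> R) (g : V -> 'cV[R]_d) :
  (forall rho, exists p : V -> R, [/\ smooth p, forall x, `|x| <= rho -> u x = p x &
     forall i x, `|x| <= rho -> g x i 0 = partial i p x]) ->
  H1loc u g.
Proof.
move=> h.
have loc (w : V -> R) : (forall rho, exists2 q : V -> R, locL2 q & forall x, `|x| <= rho -> w x = q x) -> locL2 w.
  move=> hw; apply/L2_compactP => K cK; have [rho _ Kr] := compact_sub_ball cK.
  have [q lq wq] := hw rho.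
  have [mq qoo] := (L2_compactP q).2 lq K cK; split.
    by apply: eq_measurable_fun mq => x; rewrite inE => /Kr /wq.
  move: qoo; congr (_ < _)%E; apply: eq_integral => x; rewrite inE => /Kr /wq ->//.
apply/H1locP; split.
- by apply: loc => rho; have [p [sp up _]] := h rho; exists p => //; exact/continuous_locL2/smooth_continuous.
- move=> i; apply: loc => rho; have [p [sp _ gp]] := h rho; exists (partial i p); last exact: gp.
  by apply/continuous_locL2/smooth_continuous; exact: smooth_partial.
- move=> phi tphi i; have [r r0 hr] := test_support tphi; have [p [sp up gp]] := h r.
  have := integration_by_parts_rV i tphi sp; congr (_ = - _); congr Rintegral; apply/funext => x.
    have [->|/partial_support] := eqVneq (partial i phi x) 0; first by rewrite !mulr0.
    by move=> /(closure_norm_le hr) hx; rewrite up.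
  by have [->|/hr hx] := eqVneq (phi x) 0; [rewrite !mulr0|rewrite gp].
Qed.

Lemma H1loc_periodize (psi : V -> R) : test_function setT psi ->
  H1loc (periodize delta psi) (fun x => \col_i periodize delta (partial i psi) x).
Proof.
move=> tpsi; apply: H1loc_local => rho; have [n [h1 h2]] := periodizeE_ball rho tpsi.
have st k : smooth (fun x : V => psi (x + delta *: shift_vec k)).
  exact: smooth_translate (test_smooth tpsi).
exists (fun x : V => \sum_(k <- lbox n) psi (x + delta *: shift_vec k)); split => //.
  exact: smooth_sum.
move=> i x /(h2 i); rewrite mxE partial_sum// => ->; apply: eq_bigr => k _.
by rewrite partial_translate//; exact: test_smooth tpsi.
Qed.

Lemma integral_periodize (F psi : V -> R) : locL1 F -> lperiodic delta F ->
  measurable_fun setT psi -> (exists K, forall x, `|psi x| <= K) ->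
  (exists r, forall x, psi x != 0 -> `|x| <= r) ->
  \int[leb]_x (F x * psi x) = \int[leb]_x (\1_(hcell delta) x * F x * periodize delta psi x).
Proof.
move=> lF pF mpsi [K hK] [r hr]; have [n hn _] := ex_nat_mul_gt (r + delta) d0.
rewrite (@integral_unfold R d delta F psi K n d0 lF pF)//; last first.
  by move=> x /hr hx; apply: (le_lt_trans hx); apply: le_lt_trans hn; rewrite lerDl ltW.
congr Rintegral; apply/funext => x.
have [xQ|xQ] := boolP (x \in hcell delta); last by rewrite indicE (negbTE xQ) !mul0r.
rewrite (periodizeE (n := n) hr)//; apply: le_lt_trans hn; rewrite addrC lerD2l.
by rewrite inE in xQ; exact: hcell_norm_le.
Qed.

(** The difference of N and its translate vanishes almost everywhere, so [weak_gradient0] kills the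
    difference of the gradients. *)
Lemma periodic_gradient (N : V -> R) (g : V -> 'cV[R]_d) i : H1loc N g -> lperiodic delta N ->
  lperiodic delta (fun x => g x i 0).
Proof.
move=> hN pN k; have h := H1locD (-1) (H1loc_affine (delta *: shift_vec k) ltr01 hN) hN.
have h0 : {ae leb, forall x, N (1 *: x + delta *: shift_vec k) + -1 * N x = 0}.
  by apply: filterS (pN k) => x; rewrite scale1r mulN1r => ->; rewrite subrr.
have := weak_gradient0 h h0 i; apply: filterS => x.
by rewrite !mxE scale1r mul1r mulN1r => /eqP; rewrite subr_eq0 => /eqP.
Qed.

(* Convolving a test function with the indicator of the cell gives test functions whose
   periodizations are constant. *)
Lemma kconv_cell_support (eta : V -> R) (r : R) : (forall x, eta x != 0 -> `|x| <= r) ->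
  forall x, kconv eta (\1_(hcell delta)) x != 0 -> `|x| <= r + delta.
Proof.
move=> hr x; apply: contraNT; rewrite -ltNge => hx.
rewrite /kconv (_ : (fun y => _) = (fun=> 0)); first by rewrite /Rintegral integral0.
apply/funext => y; have [->|/hr h] := eqVneq (eta (y - x)) 0; first by rewrite mul0r.
have [->|/(hcell_ind_support d0) hy] := eqVneq (\1_(hcell delta) y : R) 0; first by rewrite mulr0.
have : `|x| <= r + delta by rewrite -[x](subKr y) (le_trans (ler_normB _ _))// addrC lerD.
by rewrite leNgt hx.
Qed.

Lemma periodize_kconv (eta : V -> R) (x : V) : test_function setT eta -> hcell delta x ->
  periodize delta (kconv eta (\1_(hcell delta))) x = \int[leb]_y eta y.
Proof.
move=> teta Qx; have [r r0 hr] := test_support teta.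
have [n hn _] := ex_nat_mul_gt (r + delta + delta + delta) d0.
have hx := hcell_norm_le d0 Qx.
rewrite (periodizeE (n := n) (kconv_cell_support hr)); last first.
  by apply: le_lt_trans hn; have := d0; lra.
have mQ (t : V) : measurable_fun setT (fun y : V => \1_(hcell delta) (y + t) : R).
  by apply: (@measurable_translate R d (\1_(hcell delta))); exact: measurable_ind_hcell.
have lQ (t : V) : inL2 leb (fun y : V => \1_(hcell delta) (y + t)).
  apply: (@bounded_support_inL2 R d 1 (delta + `|t|)) => // y; first exact: ind_le1.
  move=> /(hcell_ind_support d0) hy.
  by rewrite -[y](addrK t) (le_trans (ler_normB _ _))// lerD2r.
transitivity (\sum_(k <- lbox n) ip leb eta (fun y => \1_(hcell delta) (y + (x + delta *: shift_vec k)))).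
  apply: eq_bigr => k _; rewrite /kconv -(Rintegral_translate (x + delta *: shift_vec k)).
    by congr Rintegral; apply/funext => y; rewrite addrK.
  by apply: measurable_funM; [apply: measurable_translate; exact: test_measurable teta|exact: measurable_ind_hcell].
rewrite -ip_sumr//; last exact: test_inL2 teta.
congr Rintegral; apply/funext => y; have [->|/hr hy] := eqVneq (eta y) 0; first by rewrite mul0r.
rewrite (eq_bigr (fun k => \1_(hcell delta) (y + x + delta *: shift_vec k) : R)); last first.
  by move=> k _; rewrite addrA.
rewrite partition_lboxD ?mulr1// (le_lt_trans (ler_normD _ _))//.
by have := d0; lra.
Qed.

(** Test the weak gradient with a bump eta convolved with the indicator of the cell. On the cell its
    periodization is the constant integral of eta, which is positive, while that of its derivative
    is the integral of a derivative, which is 0. *)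
Lemma periodic_gradient_mean0 (N : V -> R) (g : V -> 'cV[R]_d) i : H1loc N g -> lperiodic delta N ->
  \int[leb]_x (\1_(hcell delta) x * g x i 0) = 0.
Proof.
move=> hN pN; have [lN lg wg] := (H1locP _ _).1 hN.
pose eta : V -> R := cube_bump; have teta : test_function setT eta := test_cube_bump.
have [r r0 hr] := test_support teta.
have iQ := integrable_ind_hcell (d := d) d0.
pose psi := kconv eta (\1_(hcell delta)).
have tpsi : test_function setT psi.
  by apply: (test_intro (r := r + delta)); [exact: smooth_conv|exact: kconv_cell_support].
have per (F eta' : V -> R) : locL1 F -> lperiodic delta F -> test_function setT eta' ->
    \int[leb]_x (F x * kconv eta' (\1_(hcell delta)) x) =
    \int[leb]_x (\1_(hcell delta) x * F x) * \int[leb]_x eta' x.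
  move=> lF pF te; have [r' _ hr'] := test_support te.
  have tq : test_function setT (kconv eta' (\1_(hcell delta))).
    by apply: (test_intro (r := r' + delta)); [exact: smooth_conv|exact: kconv_cell_support].
  rewrite integral_periodize//.
  - rewrite mulrC -RintegralZl//; last first.
      have := bounded_locL1_integrable (K := 1) (r := delta) (phi := \1_(hcell delta)) lF
        (measurable_ind_hcell delta) (fun x => ind_le1 _ x) (fun x => hcell_ind_support d0).
      by apply: eq_integrable => // x _ /=; rewrite mulrC.
    congr Rintegral; apply/funext => x.
    have [xQ|xQ] := boolP (x \in hcell delta); last by rewrite indicE (negbTE xQ) !mul0r mulr0.
    by rewrite inE in xQ; rewrite periodize_kconv// mulrC.
  - exact: test_measurable tq.
  - by have [K _ hK] := test_bounded tq; exists K.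
  - by exists (r' + delta); exact: kconv_cell_support.
have tdeta : test_function setT (fun x => - partial i eta x) := testN (test_partial i teta).
have := wg _ tpsi i; rewrite /psi partial_conv// (per N)//; last exact: locL2_locL1.
rewrite (per (fun x => g x i 0))//; [|exact: locL2_locL1|exact: periodic_gradient pN].
rewrite (_ : \int[leb]_x - _ = 0); last first.
  transitivity (\int[leb]_x (-1 * partial i eta x)).
    by congr Rintegral; apply/funext => x; rewrite mulN1r.
  rewrite RintegralZl ?integral_partial ?mulr0//; exact: test_integrable (test_partial i teta).
rewrite mulr0 => /eqP; rewrite eq_sym oppr_eq0 mulf_eq0 => /orP[/eqP//|].
by rewrite (gt_eqF cube_bump_integral_gt0).
Qed.

End delta.
End periodization.

(** * Correctors and the equivalent matrix *)

Section coefficients.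
Context {R : realType} {d : nat}.
Local Notation V := 'rV[R]_d.
Local Notation leb := (lebesgue_rV (R := R) d).
Local Notation B_ r := [set x : V | `|x| <= r].
Implicit Types (b : V -> 'M[R]_d) (F G : 'I_d -> V -> R).

Lemma sqr_sum_le (s : 'I_d -> R) : (\sum_i s i) ^+ 2 <= d%:R * \sum_i s i ^+ 2.
Proof.
rewrite expr2 mulr_suml.
have -> : \sum_i s i * (\sum_j s j) = \sum_i \sum_j s i * s j.
  by apply: eq_bigr => i _; rewrite mulr_sumr.
apply: (@le_trans _ _ (\sum_i \sum_j (s i ^+ 2 + s j ^+ 2) / 2)).
  apply: ler_sum => i _; apply: ler_sum => j _.
  by have := sqr_ge0 (s i - s j); rewrite sqrrB; nra.
rewrite le_eqVlt; apply/orP; left; apply/eqP.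
rewrite (eq_bigr (fun i => d%:R * s i ^+ 2 / 2 + (\sum_j s j ^+ 2) / 2)); last first.
  move=> i _; rewrite -mulr_suml big_split/= sumr_const card_ord mulrDl.
  by rewrite [d%:R * _]mulr_natl.
by rewrite big_split/= sumr_const card_ord -mulr_suml -mulr_sumr -mulr_natl; field.
Qed.

(** The final step of every energy estimate: a quadratic quantity controlled by a linear one. The
    factor d comes from comparing the square of the sum with the sum of squares. *)
Lemma energy_absorb (a K : R) (s : 'I_d -> R) : 0 < a -> 0 <= K -> (forall k, 0 <= s k) ->
  a * \sum_k s k ^+ 2 <= K * \sum_k s k -> \sum_k s k <= d%:R * K / a.
Proof.
move=> a0 K0 s0 h; have := sqr_sum_le s.
have : 0 <= \sum_k s k by apply: sumr_ge0.
rewrite le_eqVlt => /predU1P[<- _|S0 hS]; first by rewrite divr_ge0 ?mulr_ge0// ltW.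
rewrite ler_pdivlMr// -(ler_pM2r S0).
have d0 : 0 <= d%:R :> R by [].
have := ler_wpM2l d0 h; have := ler_wpM2l (ltW a0) hS; nra.
Qed.

Definition act b F k (x : V) : R := \sum_l b x k l * F l x.

Definition coeff (alpha L : R) b := [/\ forall i j, measurable_fun setT (fun x => b x i j : R),
  {ae leb, forall x i j, `|b x i j| <= L} &
  {ae leb, forall x (xi : 'cV[R]_d), alpha * dotv xi xi <= dotv (b x *m xi) xi}].

Section fixed.
Variables (alpha L : R) (b : V -> 'M[R]_d).
Hypothesis cb : coeff alpha L b.
Hypothesis L0 : 0 <= L.

Lemma coeff_ae_le i j : {ae leb, forall x, `|b x i j| <= L}.
Proof. by have [_ h _] := cb; apply: filterS h => x ->. Qed.

Lemma inL2_act F k : (forall l, inL2 leb (F l)) -> inL2 leb (act b F k) /\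
  nrm leb (act b F k) <= L * \sum_l nrm leb (F l).
Proof.
move=> lF; have [mb _ _] := cb.
have h l := inL2_bounded (mb k l) (coeff_ae_le k l) L0 (lF l).
split; first by apply: inL2_sum => l _; exact: (h l).1.
apply: (le_trans (nrm_sum_le _ _)) => [l _|]; first exact: (h l).1.
by rewrite mulr_sumr; apply: ler_sum => l _; exact: (h l).2.
Qed.

Lemma locL2_act F k : (forall l, locL2 (F l)) -> locL2 (act b F k).
Proof.
move=> lF; have [mb _ _] := cb; apply: locL2_sum => l.
exact: (locL2_bounded (mb k l) (coeff_ae_le k l) L0 (lF l)).
Qed.

Lemma ip_dotE F G : (forall k, inL2 leb (F k)) -> (forall k, inL2 leb (G k)) ->
  leb.-integrable setT (EFin \o (fun x => \sum_k F k x * G k x)) /\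
  \int[leb]_x (\sum_k F k x * G k x) = \sum_k ip leb (F k) (G k).
Proof.
move=> lF lG; elim: (index_enum 'I_d) => [|k s [IH1 IH2]].
  rewrite big_nil (_ : (fun x => _) = (fun=> 0)); last by apply/funext => x; rewrite big_nil.
  by split; [exact: integrable0|rewrite /Rintegral integral0].
have e : (fun x => \sum_(k <- k :: s) F k x * G k x) =
    (fun x => F k x * G k x + \sum_(k <- s) F k x * G k x).
  by apply/funext => x; rewrite big_cons.
have ik := inL2_integrableM (lF k) (lG k).
rewrite e big_cons; split; first exact: integrable_addr.
by rewrite RintegralD// IH2.
Qed.

Lemma ellipticity_ip F : (forall k, inL2 leb (F k)) ->
  alpha * \sum_k nrm leb (F k) ^+ 2 <= \sum_k ip leb (act b F k) (F k).
Proof.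
move=> lF; have [mb _ ell] := cb.
have la k := (inL2_act k lF).1.
have [i1 e1] := ip_dotE lF lF; have [i2 e2] := ip_dotE la lF.
rewrite (eq_bigr _ (fun k _ => sqr_nrm leb (F k))) -e1 -e2 -RintegralZl// -subr_ge0.
have i1' := integrable_scaler alpha i1.
rewrite -RintegralB//.
have mh : measurable_fun setT (fun x => \sum_k act b F k x * F k x - alpha * \sum_k F k x * F k x).
  by apply: measurable_funB; apply/measurable_EFinP; [have [] := integrableP _ _ _ i2|have [] := integrableP _ _ _ i1'].
rewrite (@ae_eq_Rintegral _ _ _ leb setT _ (Num.norm \o (fun x => \sum_k act b F k x * F k x - alpha * \sum_k F k x * F k x))) => //.
- by apply: Rintegral_ge0 => x _; exact: normr_ge0.
- exact: measurableT_comp.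
apply: filterS ell => x /(_ (\col_k F k x)) h _ /=; rewrite ger0_norm// subr_ge0.
move: h; congr (_ * _ <= _); apply: eq_bigr => k _; rewrite !mxE//; congr (_ * _).
by apply: eq_bigr => l _; rewrite mxE.
Qed.

End fixed.

Section cell_calculus.
Variable delta : R.
Hypothesis d0 : 0 < delta.
Local Notation Q := (hcell delta).
Local Notation cut F := (fun x => \1_Q x * F x).

(** [corrector] restated with a real period and the half-open cell, a form stable under the
    rescaling by eps. *)
Definition dcorr b (i : 'I_d) (N : V -> R) (g : V -> 'cV[R]_d) :=
  [/\ H1loc N g, lperiodic delta N & forall v h, H1loc v h -> lperiodic delta v ->
    \int[leb]_x (\1_Q x * dotv (b x *m (basis_vec i + g x)) (h x)) = 0].

Definition corr_grad (i : 'I_d) (g : V -> 'cV[R]_d) k x : R := (k == i)%:R + g x k 0.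

Lemma fluxE b i g k x : (b x *m (basis_vec i + g x)) k 0 = act b (corr_grad i g) k x.
Proof. by rewrite mxE; apply: eq_bigr => l _; rewrite !mxE andbT. Qed.

Lemma inL2_cell (F : V -> R) : locL2 F -> inL2 leb (cut F).
Proof.
move=> lF; have := (nrm_indic_le (measurable_hcell delta) (lF.2 delta)).1.
congr (inL2 _ _); apply/funext => x.
have [->|/(hcell_ind_support d0) hx] := eqVneq (\1_Q x : R) 0; first by rewrite !mul0r.
have xB : x \in B_ delta by rewrite inE.
by rewrite [\1_(B_ _) x]indicE xB mul1r.
Qed.

Lemma cut_act b F k : (fun x => \1_Q x * act b F k x) = act b (fun l => cut (F l)) k.
Proof.
by apply/funext => x; rewrite /act mulr_sumr; apply: eq_bigr => l _; rewrite mulrCA.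
Qed.

Lemma cutM (F G : V -> R) x : \1_Q x * (F x * G x) = (\1_Q x * F x) * (\1_Q x * G x) :> R.
Proof.
by rewrite indicE; case: (x \in Q); rewrite ?mul1r// !mul0r.
Qed.

Lemma cell_dotE F G : (forall k, locL2 (F k)) -> (forall k, locL2 (G k)) ->
  \int[leb]_x (\1_Q x * \sum_k F k x * G k x) = \sum_k ip leb (cut (F k)) (cut (G k)).
Proof.
move=> lF lG; have lF' k := inL2_cell (lF k); have lG' k := inL2_cell (lG k).
rewrite -(ip_dotE lF' lG').2; congr Rintegral; apply/funext => x.
by rewrite mulr_sumr; apply: eq_bigr => k _; rewrite cutM.
Qed.

Lemma inL2_cell1 : inL2 leb (\1_Q : V -> R).
Proof.
have := inL2_cell (locL2_cst (d := d) 1); congr (inL2 _ _).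
by apply/funext => x; rewrite mulr1.
Qed.

Lemma ip_cell1 : ip leb (\1_Q : V -> R) \1_Q = delta ^+ d.
Proof.
rewrite -(@integral_hcell R d delta)//; congr Rintegral; apply/funext => x.
by rewrite indicE; case: (x \in Q); rewrite ?mul1r// !mul0r.
Qed.

Section corrector_facts.
Variables (alpha L : R) (b : V -> 'M[R]_d).
Hypotheses (cb : coeff alpha L b) (L0 : 0 <= L) (a0 : 0 < alpha).

Lemma corr_grad_locL2 i N g k : H1loc N g -> locL2 (corr_grad i g k).
Proof. by move=> /H1locP[_ lg _]; apply: locL2D => //; exact: locL2_cst. Qed.

Lemma dcorr_eq i N g v h : dcorr b i N g -> H1loc v h -> lperiodic delta v ->
  \sum_k ip leb (act b (fun l => cut (corr_grad i g l)) k) (cut (fun x => h x k 0)) = 0.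
Proof.
move=> [hN _ eN] hv pv; have [_ lh _] := (H1locP _ _).1 hv.
rewrite -[RHS](eN v h hv pv).
rewrite -(eq_bigr _ (fun k _ => congr1 (fun f => ip leb f _) (cut_act b _ k))).
rewrite -cell_dotE//.
  congr Rintegral; apply/funext => x; congr (_ * _); apply: eq_bigr => k _.
  by rewrite fluxE.
by move=> k; apply: (locL2_act cb L0) => l; exact: corr_grad_locL2 hN.
Qed.

Lemma corr_grad_mean0 i N g k : dcorr b i N g ->
  ip leb (\1_Q : V -> R) (cut (fun x => g x k 0)) = 0.
Proof.
move=> [hN pN _]; rewrite -[RHS](periodic_gradient_mean0 d0 k hN pN).
congr Rintegral; apply/funext => x.
by rewrite indicE; case: (x \in Q); rewrite ?mul1r// !mul0r.
Qed.

(** Test the corrector equation with N itself: ellipticity bounds the gradient by b e_i, whose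
    entries are at most L. *)
Lemma corr_energy i N g : dcorr b i N g ->
  \sum_k nrm leb (cut (fun x => g x k 0)) <= d%:R * (L * nrm leb (\1_Q : V -> R)) / alpha.
Proof.
move=> cN; have [hN pN _] := cN; have [_ lg _] := (H1locP _ _).1 hN.
have lgc k := inL2_cell (lg k).
set D := nrm leb _.
pose e l : V -> R := cut (fun _ => (l == i)%:R).
have le l : inL2 leb (e l) by apply: inL2_cell; exact: locL2_cst.
have nE : \sum_l nrm leb (e l) = D.
  rewrite (bigD1 i)//= big1 ?addr0 => [|l li].
    by congr (nrm _ _); apply/funext => x; rewrite /e eqxx mulr1.
  by rewrite /e (negbTE li) -[RHS](nrm0 leb); congr (nrm _ _); apply/funext => x; rewrite mulr0.
apply: energy_absorb => //; first by rewrite mulr_ge0// nrm_ge0.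
  by move=> k; exact: nrm_ge0.
apply: (le_trans (ellipticity_ip cb L0 lgc)).
have lag k := (inL2_act cb L0 k lgc).1.
have lae k := (inL2_act cb L0 k le).1.
have E k : ip leb (act b (fun l => cut (corr_grad i g l)) k) (cut (fun x => g x k 0)) =
   ip leb (act b e k) (cut (fun x => g x k 0)) +
   ip leb (act b (fun l => cut (fun x => g x l 0)) k) (cut (fun x => g x k 0)).
  rewrite -ipDl//; congr ip; apply/funext => x; rewrite /act -big_split/=.
  by apply: eq_bigr => l _; rewrite -mulrDr -mulrDr.
have := dcorr_eq cN hN pN; rewrite (eq_bigr _ (fun k _ => E k)) big_split/= addrC => /eqP.
rewrite addr_eq0 => /eqP ->; rewrite -sumrN mulr_sumr; apply: ler_sum => k _.
apply: (le_trans (ler_norm _)); rewrite normrN (le_trans (ip_le _ _))// ler_wpM2r ?nrm_ge0//.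
by rewrite -nE; exact: (inL2_act cb L0 k le).2.
Qed.

Section equivalent.
Variables (N : 'I_d -> V -> R) (g : 'I_d -> V -> 'cV[R]_d) (Ahat : 'M[R]_d).
Hypothesis cN : forall i, dcorr b i (N i) (g i).
Hypothesis AhatE : forall i j, delta ^+ d * Ahat i j = \int[leb]_x (\1_Q x *
  ((basis_vec i + g i x)^T *m b x *m (basis_vec j + g j x)) 0 0).

Let hN i : H1loc (N i) (g i). Proof. by have [] := cN i. Qed.
Let lG i k : inL2 leb (cut (corr_grad i (g i) k)).
Proof. by apply: inL2_cell; exact: corr_grad_locL2 (hN i). Qed.
Let laG i k : inL2 leb (act b (fun l => cut (corr_grad i (g i) l)) k).
Proof. exact: (inL2_act cb L0 k (lG i)).1. Qed.

Lemma Ahat_form i j : delta ^+ d * Ahat i j =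
  \sum_k ip leb (act b (fun l => cut (corr_grad j (g j) l)) k) (cut (corr_grad i (g i) k)).
Proof.
rewrite AhatE -(eq_bigr _ (fun k _ => congr1 (fun f => ip leb f _) (cut_act b _ k))).
rewrite -cell_dotE//; last 2 first.
- by move=> k; apply: (locL2_act cb L0) => l; exact: corr_grad_locL2 (hN j).
- by move=> k; exact: corr_grad_locL2 (hN i).
congr Rintegral; apply/funext => x; congr (_ * _); rewrite -mulmxA mxE.
by apply: eq_bigr => k _; rewrite fluxE !mxE andbT mulrC.
Qed.

(** The energy form reduces to the mean of the flux, because the corrector equation for j tested
    with N i removes the gradient part of e_i + grad N_i. The two-scale estimate uses the matrix in
    this form. *)
Lemma Ahat_flux i j : delta ^+ d * Ahat i j =
  ip leb (act b (fun l => cut (corr_grad j (g j) l)) i) \1_Q.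
Proof.
rewrite Ahat_form; have [_ pN _] := cN i.
have := dcorr_eq (cN j) (hN i) pN => h0; rewrite -[RHS]addr0 -[in RHS]h0.
have lgc k : inL2 leb (cut (fun x => g i x k 0)).
  by apply: inL2_cell; have [_ lg _] := (H1locP _ _).1 (hN i).
have lc k : inL2 leb (cut (fun _ : V => (k == i)%:R : R)) by apply: inL2_cell; exact: locL2_cst.
transitivity (\sum_k (ip leb (act b (fun l => cut (corr_grad j (g j) l)) k) (cut (fun _ => (k == i)%:R)) +
    ip leb (act b (fun l => cut (corr_grad j (g j) l)) k) (cut (fun x => g i x k 0)))).
  apply: eq_bigr => k _; rewrite -ipDr//; congr ip; apply/funext => x; exact: mulrDr.
rewrite big_split/=; congr (_ + _); rewrite (bigD1 i)//= big1 ?addr0 => [|k ki].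
  by congr ip; apply/funext => x; rewrite eqxx mulr1.
rewrite (negbTE ki) /ip (_ : (fun x => _) = (fun=> 0)) ?/Rintegral ?integral0//.
by apply/funext => x; rewrite !mulr0.
Qed.

(** Cauchy-Schwarz for the mean flux: in the second factor the 1 comes from e_j and d L / alpha from
    [corr_energy]. *)
Lemma Ahat_bound i j : `|Ahat i j| <= L * (1 + d%:R * L / alpha).
Proof.
have D0 : 0 < delta ^+ d by rewrite exprn_gt0.
rewrite -(ler_pM2l D0) -{1}(gtr0_norm D0) -normrM Ahat_flux.
apply: (le_trans (ip_le (laG j i) inL2_cell1)).
rewrite -ip_cell1 -sqr_nrm; set D := nrm leb \1_Q.
have -> : D ^+ 2 * (L * (1 + d%:R * L / alpha)) = L * ((1 + d%:R * L / alpha) * D) * D by ring.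
rewrite ler_wpM2r ?nrm_ge0//.
apply: (le_trans (inL2_act cb L0 i (lG j)).2); rewrite ler_wpM2l//.
have := corr_energy (cN j); rewrite -/D.
have lgc k : inL2 leb (cut (fun x => g j x k 0)).
  by apply: inL2_cell; have [_ lg _] := (H1locP _ _).1 (hN j).
have lc k : inL2 leb (cut (fun _ : V => (k == j)%:R : R)) by apply: inL2_cell; exact: locL2_cst.
have nE : \sum_l nrm leb (cut (fun _ : V => (l == j)%:R : R)) = D.
  rewrite (bigD1 j)//= big1 ?addr0 => [|l li].
    by congr (nrm _ _); apply/funext => x; rewrite eqxx mulr1.
  by rewrite (negbTE li) -[RHS](nrm0 leb); congr (nrm _ _); apply/funext => x; rewrite mulr0.
move=> hE; apply: (@le_trans _ _ (\sum_l (nrm leb (cut (fun _ : V => (l == j)%:R : R)) + nrm leb (cut (fun x => g j x l 0))))).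
  apply: ler_sum => l _; apply: le_trans (nrmD_le (lc l) (lgc l)).
  by rewrite le_eqVlt; apply/orP; left; apply/eqP; congr (nrm _ _); apply/funext => x; exact: mulrDr.
rewrite big_split/= nE mulrDl mul1r lerD2l (le_trans hE)//.
by rewrite le_eqVlt; apply/orP; left; apply/eqP; ring.
Qed.

(** The field H = sum_i xi_i (e_i + grad N_i) has energy given by Ahat and mean xi on the cell. Its
    fluctuation is orthogonal to constants and can only increase the norm, so the same alpha is
    inherited. *)
Lemma Ahat_coercive (xi : 'cV[R]_d) : alpha * dotv xi xi <= dotv (Ahat *m xi) xi.
Proof.
have D0 : 0 < delta ^+ d by rewrite exprn_gt0.
pose H k : V -> R := fun x => \sum_i xi i 0 * (\1_Q x * corr_grad i (g i) k x).
have lH k : inL2 leb (H k) by apply: inL2_sum => i _; exact: inL2Z.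
have aH k : act b H k = fun x => \sum_j xi j 0 * act b (fun l => cut (corr_grad j (g j) l)) k x.
  apply/funext => x; rewrite /act /H.
  rewrite (eq_bigr (fun l => \sum_i b x k l * (xi i 0 * (\1_Q x * corr_grad i (g i) l x)))); last first.
    by move=> l _; rewrite mulr_sumr.
  rewrite exchange_big/=; apply: eq_bigr => i _; rewrite mulr_sumr; apply: eq_bigr => l _.
  by rewrite mulrCA.
have E1 : delta ^+ d * dotv (Ahat *m xi) xi = \sum_k ip leb (act b H k) (H k).
  rewrite /dotv mulr_sumr.
  transitivity (\sum_i \sum_j xi i 0 * (xi j 0 * (delta ^+ d * Ahat i j))).
    apply: eq_bigr => i _; rewrite mxE mulr_suml mulr_sumr; apply: eq_bigr => j _; ring.
  transitivity (\sum_i \sum_j \sum_k xi i 0 * (xi j 0 *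
      ip leb (act b (fun l => cut (corr_grad j (g j) l)) k) (cut (corr_grad i (g i) k)))).
    apply: eq_bigr => i _; apply: eq_bigr => j _; rewrite Ahat_form !mulr_sumr//.
  under eq_bigr do rewrite exchange_big/=.
  rewrite exchange_big/=; apply: eq_bigr => k _; rewrite aH.
  have h1 i : inL2 leb (fun x => xi i 0 * (\1_Q x * corr_grad i (g i) k x)) := inL2Z _ (lG i k).
  have h2 j : inL2 leb (fun x => xi j 0 * act b (fun l => cut (corr_grad j (g j) l)) k x).
    exact: inL2Z.
  have h3 : inL2 leb (fun x => \sum_j xi j 0 * act b (fun l => cut (corr_grad j (g j) l)) k x).
    by apply: inL2_sum => j _; exact: h2.
  rewrite (ip_sumr _ (fun i _ => h1 i) h3); apply: eq_bigr => i _.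
  rewrite (ipZr _ (lG i k) h3) (ip_suml _ (fun j _ => h2 j) (lG i k)) mulr_sumr.
  by apply: eq_bigr => j _; rewrite (ipZl _ (laG j k) (lG i k)).
rewrite -(ler_pM2l D0) E1; apply: le_trans (ellipticity_ip cb L0 lH).
rewrite mulrCA ler_pM2l// /dotv mulr_sumr; apply: ler_sum => k _.
rewrite sqr_nrm.
have lgc i : inL2 leb (cut (fun x => g i x k 0)).
  by apply: inL2_cell; have [_ lg _] := (H1locP _ _).1 (hN i).
pose ga x : R := \sum_i xi i 0 * (\1_Q x * g i x k 0).
have lga : inL2 leb ga by apply: inL2_sum => i _; exact: inL2Z.
have HE : H k = fun x => xi k 0 * \1_Q x + ga x.
  apply/funext => x; rewrite /H /ga.
  transitivity (\sum_i (xi i 0 * (\1_Q x * (k == i)%:R) + xi i 0 * (\1_Q x * g i x k 0))).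
    by apply: eq_bigr => i _; rewrite -!mulrDr.
  rewrite big_split/=; congr (_ + _); rewrite (bigD1 k)//= eqxx mulr1 big1 ?addr0// => i ik.
  by rewrite eq_sym (negbTE ik) !mulr0.
have l1 := inL2_cell1; have lx := inL2Z (xi k 0) l1.
have g0 : ip leb (\1_Q : V -> R) ga = 0.
  have h1 i : inL2 leb (fun x => xi i 0 * (\1_Q x * g i x k 0)) := inL2Z _ (lgc i).
  by rewrite (ip_sumr _ (fun i _ => h1 i) l1) big1// => i _; rewrite ipZr// (corr_grad_mean0 k (cN i)) mulr0.
rewrite HE ipDl//; last exact: inL2D.
rewrite !ipDr// ipZl// ipZr// ipZl// (ipC leb ga) ipZl// g0 !mulr0 addr0 add0r ip_cell1.
rewrite [leLHS](_ : _ = xi k 0 * (xi k 0 * delta ^+ d)); last by ring.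
by rewrite lerDl ip_ge0.
Qed.

End equivalent.
End corrector_facts.
End cell_calculus.
End coefficients.

(** * Rescaling, divergence-free flux and uniqueness for the cell problem *)

Section scaling.
Context {R : realType} {d : nat}.
Local Notation V := 'rV[R]_d.
Local Notation leb := (lebesgue_rV (R := R) d).
Local Notation cut delta F := (fun x => \1_(hcell delta) x * F x).

Definition mcoeff (b : V -> 'M[R]_d) := forall i j, measurable_fun setT (fun x => b x i j : R).

Lemma measurable_flux (b : V -> 'M[R]_d) i (g h : V -> 'cV[R]_d) : mcoeff b ->
  (forall k, measurable_fun setT (fun x => g x k 0 : R)) ->
  (forall k, measurable_fun setT (fun x => h x k 0 : R)) ->
  measurable_fun setT (fun x => dotv (b x *m (basis_vec i + g x)) (h x)).
Proof.
move=> mb mg mh; apply: measurable_sum => k; apply: measurable_funM => //.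
rewrite (_ : (fun x => _) = act b (corr_grad i g) k); last first.
  by apply/funext => x; rewrite fluxE.
apply: measurable_sum => l; apply: measurable_funM => //.
exact: measurable_funD.
Qed.

Lemma ahat_integrandE (b : V -> 'M[R]_d) i j (g g' : V -> 'cV[R]_d) x :
  ((basis_vec i + g x)^T *m b x *m (basis_vec j + g' x)) 0 0 =
  dotv (b x *m (basis_vec j + g' x)) (basis_vec i + g x).
Proof.
rewrite -mulmxA mxE; apply: eq_bigr => k _; by rewrite mxE mulrC.
Qed.

Lemma measurable_basis_add i (g : V -> 'cV[R]_d) : (forall k, measurable_fun setT (fun x => g x k 0 : R)) ->
  forall k, measurable_fun setT (fun x => (basis_vec i + g x) k 0 : R).
Proof.
move=> mg k; rewrite (_ : (fun x => _) = (fun x => (basis_vec i : 'cV[R]_d) k 0 + g x k 0)).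
  exact: measurable_funD.
by apply/funext => x; rewrite mxE.
Qed.

Lemma cell_hcell (M : nat) (F : V -> R) : (0 < M)%N -> measurable_fun setT F ->
  \int[leb]_(x in cell M) F x = \int[leb]_x (\1_(hcell M%:R) x * F x).
Proof.
move=> M0 mF; have mC : measurable (cell M : set V) := measurable_open_cell M%:R.
rewrite Rintegral_mkcond (_ : F \_ _ = fun x => \1_(cell M) x * F x); last first.
  by apply/funext => x; rewrite /patch indicE; case: (x \in _); rewrite ?mul1r ?mul0r.
apply: ae_eq_Rintegral => //.
- by apply: measurable_funM => //; exact: measurable_indic.
- by apply: measurable_funM => //; exact: measurable_ind_hcell.
- by have := ae_hcell (d := d) (M%:R : R); apply: filterS => x -> _.
Qed.

Lemma cell_volume (M : nat) : fine (leb (cell M)) = M%:R ^+ d.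
Proof.
rewrite (_ : leb (cell M) = (M%:R ^+ d)%:E)//.
rewrite [LHS](@lebesgue_rV_box R d (fun=> 0) (fun=> M%:R)); last by move=> i; exact: ler0n.
by rewrite (eq_bigr (fun=> M%:R)) ?prodr_const ?card_ord// => i _; rewrite subr0.
Qed.

Lemma corrector_dcorr (M : nat) (b : V -> 'M[R]_d) i N g : (0 < M)%N -> mcoeff b ->
  corrector M b i N g -> dcorr M%:R b i N g.
Proof.
move=> M0 mb [hN pN eN]; split => // v h hv pv; rewrite -(eN v h hv pv) cell_hcell//.
have [_ lg _] := (H1locP _ _).1 hN; have [_ lh _] := (H1locP _ _).1 hv.
by apply: measurable_flux => // k; [exact: (lg k).1|exact: (lh k).1].
Qed.

Lemma H1loc0 : H1loc (fun _ : V => 0) (fun _ : V => (0 : 'cV[R]_d)).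
Proof.
have := H1loc_smooth (smooth_cst (d := d) (0 : R)); congr H1loc.
by apply/funext => x; apply/colP => i; rewrite !mxE partial_cst.
Qed.

Lemma ind_hcell_scale (delta r : R) (x : V) : 0 < r ->
  \1_(hcell (r * delta)) (r *: x + 0) = \1_(hcell delta) x :> R.
Proof.
move=> r0; rewrite !indicE; congr (_%:R); congr nat_of_bool; apply/idP/idP; rewrite !inE => h i;
  by have := h i; rewrite !mxE addr0 pmulr_rge0// ltr_pM2l.
Qed.

Lemma lperiodic_scale (T : Type) (delta r : R) (F : V -> T) : 0 < r -> lperiodic delta F ->
  lperiodic (r * delta) (fun x => F (r^-1 *: x + 0)).
Proof.
move=> r0 pF k; have ri : 0 < r^-1 by rewrite invr_gt0.
have := ae_affine 0 ri (pF k); apply: filterS => x <-; congr F.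
by rewrite scalerDr scalerA mulKf ?gt_eqF// addrAC.
Qed.

(** Multiplying N by r compensates the dilation, so the gradient is only rescaled in its argument;
    periodic tests are pulled back with the inverse factor. *)
Lemma dcorr_scale (delta r : R) (b : V -> 'M[R]_d) i N g : 0 < r -> mcoeff b ->
  dcorr delta b i N g ->
  dcorr (r * delta) (fun x => b (r^-1 *: x + 0)) i (fun x => r * N (r^-1 *: x + 0))
    (fun x => g (r^-1 *: x + 0)).
Proof.
move=> r0 mb [hN pN eN]; have ri : 0 < r^-1 by rewrite invr_gt0.
have rn : r != 0 by rewrite gt_eqF.
have [_ lg _] := (H1locP _ _).1 hN.
split.
- have := H1locD r H1loc0 (H1loc_affine 0 ri hN); congr H1loc.
    by apply/funext => x; rewrite add0r.
  by apply/funext => x; rewrite add0r scalerA mulfV// scale1r.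
- by move=> k; have := lperiodic_scale r0 pN k; apply: filterS => x ->.
move=> v h hv pv; have [_ lh _] := (H1locP _ _).1 hv.
have mh k : measurable_fun setT (fun x => h x k 0 : R) := (lh k).1.
have mg k : measurable_fun setT (fun x => g x k 0 : R) := (lg k).1.
have ma (f : V -> R) : measurable_fun setT f -> measurable_fun setT (fun x : V => f (r^-1 *: x + 0)).
  by move=> mf; exact: (measurableT_comp mf (measurable_affine r^-1 0)).
rewrite -(Rintegral_affine 0 r0); last first.
  apply: measurable_funM; first exact: measurable_ind_hcell.
  apply: measurable_flux => //; first by move=> k l; exact: (ma _ (mb k l)).
  by move=> k; exact: (ma _ (mg k)).
have pv' : lperiodic delta (fun x => v (r *: x + 0)).
  by have := lperiodic_scale ri pv; rewrite invrK mulKf.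
(* The summand 0 is there because multiplication by a constant is read off from [H1locD] applied to
   the zero function. *)
have hv' : H1loc (fun x => 0 + r^-1 * v (r *: x + 0)) (fun x => h (r *: x + 0)).
  have := H1locD r^-1 H1loc0 (H1loc_affine 0 r0 hv); congr H1loc.
  by apply/funext => x; rewrite add0r scalerA mulVf// scale1r.
have pv2 : lperiodic delta (fun x => 0 + r^-1 * v (r *: x + 0)).
  by move=> k; apply: filterS (pv' k) => x ->.
rewrite -[RHS](mulr0 (r ^+ d)) -(eN _ _ hv' pv2); congr (_ * _).
congr Rintegral; apply/funext => x.
by rewrite ind_hcell_scale// !addr0 scalerA mulVf// scale1r.
Qed.

Lemma Ahat_scale (delta r : R) (b : V -> 'M[R]_d) (Ahat : 'M[R]_d) (g : 'I_d -> V -> 'cV[R]_d) :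
  0 < r -> mcoeff b -> (forall i k, measurable_fun setT (fun x => g i x k 0 : R)) ->
  (forall i j, delta ^+ d * Ahat i j = \int[leb]_x (\1_(hcell delta) x *
     ((basis_vec i + g i x)^T *m b x *m (basis_vec j + g j x)) 0 0)) ->
  forall i j, (r * delta) ^+ d * Ahat i j = \int[leb]_x (\1_(hcell (r * delta)) x *
     ((basis_vec i + g i (r^-1 *: x + 0))^T *m b (r^-1 *: x + 0) *m (basis_vec j + g j (r^-1 *: x + 0))) 0 0).
Proof.
move=> r0 mb mg hA i j; have rn : r != 0 by rewrite gt_eqF.
rewrite exprMn -mulrA hA -[RHS](Rintegral_affine 0 r0); last first.
  apply: measurable_funM; first exact: measurable_ind_hcell.
  have mf : measurable_fun setT (fun x => ((basis_vec i + g i x)^T *m b x *m (basis_vec j + g j x)) 0 0 : R).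
    rewrite (_ : (fun x => _) = (fun x => dotv (b x *m (basis_vec j + g j x)) (basis_vec i + g i x))).
      apply: measurable_flux => //; exact: measurable_basis_add.
    by apply/funext => x; exact: ahat_integrandE.
  exact: (measurableT_comp mf (measurable_affine r^-1 0)).
congr (_ * _); congr Rintegral; apply/funext => x.
by rewrite ind_hcell_scale// !addr0 scalerA mulVf// scale1r.
Qed.

End scaling.

Section periodic_flux.
Context {R : realType} {d : nat}.
Local Notation V := 'rV[R]_d.
Local Notation leb := (lebesgue_rV (R := R) d).
Variables (delta alpha L : R) (b : V -> 'M[R]_d).
Hypotheses (d0 : 0 < delta) (cb : coeff alpha L b) (L0 : 0 <= L) (a0 : 0 < alpha).
Hypothesis pb : forall i j, lperiodic delta (fun x => b x i j).
Local Notation Q := (hcell delta).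
Local Notation cut F := (fun x => \1_Q x * F x).

Lemma lperiodic_flux i N g k : dcorr delta b i N g -> lperiodic delta (act b (corr_grad i g) k).
Proof.
move=> [hN pN _] m.
have h l : {ae leb, forall y, b (y + delta *: shift_vec m) k l * corr_grad i g l (y + delta *: shift_vec m) =
    b y k l * corr_grad i g l y}.
  have h1 := pb k l m; have h2 := periodic_gradient l hN pN m.
  by apply: filterS2 h1 h2 => y; rewrite /corr_grad => -> ->.
have : {ae leb, forall y, forall l, b (y + delta *: shift_vec m) k l * corr_grad i g l (y + delta *: shift_vec m) =
    b y k l * corr_grad i g l y} by apply: filter_forall.
by apply: filterS => y hy; rewrite /act; apply: eq_bigr => l _; exact: hy.
Qed.

Lemma locL2_flux i N g k : dcorr delta b i N g -> locL2 (act b (corr_grad i g) k).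
Proof. by move=> [hN _ _]; apply: (locL2_act cb L0) => l; exact: corr_grad_locL2 hN. Qed.

(** The corrector equation is stated for periodic tests. Periodizing psi produces one, and unfolding
    turns the cell integral into an integral over the whole space. *)
Lemma flux_divfree i N g psi : dcorr delta b i N g -> test_function setT psi ->
  \sum_k \int[leb]_x (act b (corr_grad i g) k x * partial k psi x) = 0.
Proof.
move=> cN tpsi.
have h0 := dcorr_eq d0 cb L0 cN (H1loc_periodize d0 tpsi) (fun k => aeW _ (periodize_shift _ _ k)).
rewrite -[RHS]h0; apply: eq_bigr => k _; have tk := test_partial k tpsi.
rewrite (integral_periodize d0 (locL2_locL1 (locL2_flux k cN)) (lperiodic_flux k cN) (test_measurable tk)).
- have -> : act b (fun l => cut (corr_grad i g l)) k = cut (act b (corr_grad i g) k) by rewrite cut_act.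
  rewrite /ip; congr Rintegral; apply/funext => x.
  by rewrite -(cutM delta (act b (corr_grad i g) k) (fun x => (\col_i0 periodize delta (partial i0 psi) x) k 0)) mxE mulrA.
- by have [K _ hK] := test_bounded tk; exists K.
- by have [r _ hr] := test_support tk; exists r.
Qed.

End periodic_flux.

Section uniqueness.
Context {R : realType} {d : nat}.
Local Notation V := 'rV[R]_d.
Local Notation leb := (lebesgue_rV (R := R) d).
Variables (delta alpha L : R) (b b' : V -> 'M[R]_d).
Hypotheses (d0 : 0 < delta) (cb : coeff alpha L b) (mb' : mcoeff b') (L0 : 0 <= L) (a0 : 0 < alpha).
Hypothesis bb' : {ae leb, forall x, b x = b' x}.
Local Notation Q := (hcell delta).
Local Notation cut F := (fun x => \1_Q x * F x).

Lemma dcorr_ae i N g : dcorr delta b' i N g -> dcorr delta b i N g.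
Proof.
move=> [hN pN eN]; split => // v h hv pv; rewrite -[RHS](eN v h hv pv).
have [mb _ _] := cb.
have [_ lg _] := (H1locP _ _).1 hN; have [_ lh _] := (H1locP _ _).1 hv.
apply: ae_eq_Rintegral => //.
- by apply: measurable_funM; [exact: measurable_ind_hcell|
    apply: measurable_flux => // k; [exact: (lg k).1|exact: (lh k).1]].
- by apply: measurable_funM; [exact: measurable_ind_hcell|
    apply: measurable_flux => // k; [exact: (lg k).1|exact: (lh k).1]].
- by apply: filterS bb' => x ->.
Qed.

(** Correctors are only known through [equivalent_matrix], possibly chosen differently for two
    realizations of the same field. Ellipticity applied to the difference of two correctors makes
    their gradients, hence the mean fluxes, coincide. *)
Lemma Ahat_unique (N N' : 'I_d -> V -> R) (g g' : 'I_d -> V -> 'cV[R]_d) (A A' : 'M[R]_d) :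
  (forall i, dcorr delta b i (N i) (g i)) -> (forall i, dcorr delta b' i (N' i) (g' i)) ->
  (forall i j, delta ^+ d * A i j = \int[leb]_x (\1_Q x *
    ((basis_vec i + g i x)^T *m b x *m (basis_vec j + g j x)) 0 0)) ->
  (forall i j, delta ^+ d * A' i j = \int[leb]_x (\1_Q x *
    ((basis_vec i + g' i x)^T *m b' x *m (basis_vec j + g' j x)) 0 0)) ->
  A = A'.
Proof.
move=> cN cN' hA hA'; have cN2 i := dcorr_ae (cN' i).
have [mb _ _] := cb.
have lg' i k : locL2 (fun x => g' i x k 0) by have [hN _ _] := cN' i; have [_ ? _] := (H1locP _ _).1 hN.
have lg i k : locL2 (fun x => g i x k 0) by have [hN _ _] := cN i; have [_ ? _] := (H1locP _ _).1 hN.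
have hA2 i j : delta ^+ d * A' i j = \int[leb]_x (\1_Q x *
    ((basis_vec i + g' i x)^T *m b x *m (basis_vec j + g' j x)) 0 0).
  have mI (c : V -> 'M[R]_d) : mcoeff c -> measurable_fun setT (fun x => \1_Q x *
      ((basis_vec i + g' i x)^T *m c x *m (basis_vec j + g' j x)) 0 0 : R).
    move=> mc; apply: measurable_funM; first exact: measurable_ind_hcell.
    rewrite (_ : (fun x => _) = (fun x => dotv (c x *m (basis_vec j + g' j x)) (basis_vec i + g' i x))).
      apply: measurable_flux => //; [by move=> k; exact: (lg' j k).1|].
      by apply: measurable_basis_add => k; exact: (lg' i k).1.
    by apply/funext => x; exact: ahat_integrandE.
  rewrite hA'; apply: ae_eq_Rintegral => //; [exact: mI|exact: mI|].
  by apply: filterS bb' => x ->.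
apply/matrixP => i j; have D0 : delta ^+ d != 0 by rewrite expf_neq0// gt_eqF.
apply: (mulfI D0); rewrite (Ahat_flux d0 cb L0 cN hA) (Ahat_flux d0 cb L0 cN2 hA2).
have [hN pN _] := cN j; have [hN' pN' _] := cN' j.
have hv := H1locD (-1) hN hN'.
have pv : lperiodic delta (fun x => N j x + -1 * N' j x).
  by move=> k; apply: filterS2 (pN k) (pN' k) => x -> ->.
have e1 := dcorr_eq d0 cb L0 (cN j) hv pv; have e2 := dcorr_eq d0 cb L0 (cN2 j) hv pv.
pose D k := cut (fun x => (g j x + -1 *: g' j x) k 0).
have lD k : inL2 leb (D k) by apply: inL2_cell => //; have [_ lh _] := (H1locP _ _).1 hv.
have lG k : inL2 leb (cut (corr_grad j (g j) k)) by apply: inL2_cell => //; exact: corr_grad_locL2 hN.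
have lG' k : inL2 leb (cut (corr_grad j (g' j) k)) by apply: inL2_cell => //; exact: corr_grad_locL2 hN'.
have laG k := (inL2_act cb L0 k lG).1; have laG' k := (inL2_act cb L0 k lG').1.
have aD k : act b D k = fun x => act b (fun l => cut (corr_grad j (g j) l)) k x - act b (fun l => cut (corr_grad j (g' j) l)) k x.
  apply/funext => x; rewrite /act -sumrB; apply: eq_bigr => l _.
  by rewrite /D !mxE /corr_grad; ring.
have S0 : \sum_k ip leb (act b D k) (D k) = 0.
  transitivity (\sum_k (ip leb (act b (fun l => cut (corr_grad j (g j) l)) k) (D k) -
      ip leb (act b (fun l => cut (corr_grad j (g' j) l)) k) (D k))).
    by apply: eq_bigr => k _; rewrite aD ipBl.
  by rewrite sumrB e1 e2 subrr.
have := ellipticity_ip cb L0 lD; rewrite S0 pmulr_rle0// => hs.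
have n0 k : nrm leb (D k) = 0.
  apply/eqP; rewrite -sqrf_eq0 eq_le sqr_ge0 andbT; apply: le_trans hs.
  by rewrite (bigD1 k)//= lerDl sumr_ge0// => l _; exact: sqr_ge0.
have na : nrm leb (act b D i) <= 0.
  by apply: (le_trans (inL2_act cb L0 i lD).2); rewrite big1 ?mulr0.
apply/eqP; rewrite -subr_eq0 -ipBl//; last exact: inL2_cell1.
rewrite -aD -normr_le0 (le_trans (ip_le _ _))//; [exact: (inL2_act cb L0 i lD).1|exact: inL2_cell1|].
by rewrite mulr_le0_ge0// nrm_ge0.
Qed.

End uniqueness.

Section constant.
Context {R : realType} {d : nat}.
Local Notation V := 'rV[R]_d.
Local Notation leb := (lebesgue_rV (R := R) d).
Variables (delta : R) (A : 'M[R]_d).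
Hypothesis d0 : 0 < delta.

(** A constant matrix has zero correctors and is its own mean flux ([flux_cst]), on a cell of any
    size; so the estimate for u^eps also applies to u_0^0. *)
Lemma dcorr_cst i : dcorr delta (fun=> A) i (fun _ : V => 0) (fun _ : V => 0).
Proof.
split; [exact: H1loc0|by move=> k; exact: aeW|move=> v h hv pv].
have [_ lh _] := (H1locP _ _).1 hv.
have -> : (fun x => \1_(hcell delta) x * dotv (A *m (basis_vec i + 0)) (h x)) =
    (fun x => \1_(hcell delta) x * \sum_k A k i * h x k 0).
  apply/funext => x; congr (_ * _); apply: eq_bigr => k _; congr (_ * _).
  rewrite addr0 mxE (bigD1 i)//= !mxE !eqxx mulr1 big1 ?addr0// => l li.
  by rewrite mxE (negbTE li) mulr0.
rewrite (cell_dotE d0 (F := fun k _ => A k i))//; last by move=> k; exact: locL2_cst.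
rewrite big1// => k _.
have l1 := inL2_cell1 (d := d) d0.
rewrite (_ : (fun x => _ * A k i) = (fun x => A k i * \1_(hcell delta) x)); last first.
  by apply/funext => x; rewrite mulrC.
rewrite ipZl//; last exact: inL2_cell.
suff -> : ip leb \1_(hcell delta) (fun x => \1_(hcell delta) x * h x k 0) = 0 by rewrite mulr0.
rewrite -[RHS](periodic_gradient_mean0 d0 k hv pv) /ip; congr Rintegral; apply/funext => x.
by rewrite indicE; case: (x \in _); rewrite ?mul1r// !mul0r.
Qed.

Lemma flux_cst i j : delta ^+ d * A i j =
  ip leb (act (fun=> A) (fun l => (fun x => \1_(hcell delta) x * corr_grad j (fun=> 0) l x)) i) \1_(hcell delta).
Proof.
rewrite -ip_cell1// [LHS]mulrC -ipZl; [|exact: inL2_cell1|exact: inL2_cell1].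
congr ip; apply/funext => x; rewrite /act (bigD1 j)//= big1 ?addr0 => [|l lj].
  by rewrite /corr_grad eqxx mxE addr0 mulr1.
by rewrite /corr_grad (negbTE lj) mxE addr0 !mulr0.
Qed.

End constant.

(** * Bounds on correctors and fluxes, uniform in the period *)

Section uniform_bounds.
Context {R : realType} {d : nat}.
Local Notation V := 'rV[R]_d.
Local Notation leb := (lebesgue_rV (R := R) d).
Local Notation B_ r := [set x : V | `|x| <= r].

(** The square root of (2 r + 2)^d is replaced by the number itself, which is at least 1. *)
Lemma nrm_ball_periodic_sqrt (delta c r : R) (F : V -> R) : 0 < delta -> delta <= 1 -> 0 <= r -> 0 <= c ->
  locL2 F -> lperiodic delta F ->
  nrm leb (fun x => \1_(hcell delta) x * F x) <= c * nrm leb (\1_(hcell delta) : V -> R) ->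
  nrm leb (fun x => \1_(B_ r) x * F x) <= c * (2 * r + 2) ^+ d.
Proof.
move=> d0 d1 r0 c0 lF pF h.
have h2 : nrm leb (fun x => \1_(hcell delta) x * F x) ^+ 2 <= c ^+ 2 * delta ^+ d.
  have <- : nrm leb (\1_(hcell delta) : V -> R) ^+ 2 = delta ^+ d by rewrite sqr_nrm ip_cell1.
  rewrite -exprMn; apply: lerXn2r => //; rewrite nnegrE ?nrm_ge0//.
  by rewrite mulr_ge0// nrm_ge0.
have h3 := nrm_ball_periodic d0 d1 r0 (sqr_ge0 c) lF pF h2.
have X1 : 1 <= (2 * r + 2) ^+ d by apply: exprn_ege1; lra.
rewrite -(@ler_pXn2r _ 2)// ?nnegrE ?nrm_ge0 ?mulr_ge0//; last by apply: le_trans X1.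
apply: (le_trans h3); rewrite exprMn ler_wpM2l ?sqr_ge0//.
by rewrite expr2 ler_peMr// (le_trans ler01).
Qed.

Section corr.
Variables (delta alpha L r : R) (b : V -> 'M[R]_d).
Hypotheses (d0 : 0 < delta) (d1 : delta <= 1) (cb : coeff alpha L b) (L0 : 0 <= L) (a0 : 0 < alpha).
Hypothesis r0 : 0 <= r.
Hypothesis pb : forall i j, lperiodic delta (fun x => b x i j).
Local Notation Q := (hcell delta).

(** 6^d counts the cells covering the ball of radius 2 delta from [periodic_poincare] (n = 3, as 2
    delta < 3 delta); d L / alpha is the energy bound; the last factor passes from the cell to the
    ball of radius r. *)
Definition corr_const := (6 ^ d)%:R * (d%:R * L / alpha) * (2 * r + 2) ^+ d.

Lemma corr_ball_bound i N g c : dcorr delta b i N g ->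
  c = (delta ^+ d)^-1 * \int[leb]_x (\1_Q x * N x) ->
  nrm leb (fun x => \1_(B_ r) x * (N x - c)) <= delta * corr_const.
Proof.
move=> cN cE; have [hN pN _] := cN; have [lN lg _] := (H1locP _ _).1 hN.
have lNc : locL2 (fun x => N x - c) by apply: locL2B => //; exact: locL2_cst.
have pNc : lperiodic delta (fun x => N x - c) by move=> k; apply: filterS (pN k) => x ->.
have K0 : 0 <= delta * ((6 ^ d)%:R * (d%:R * L / alpha)).
  by rewrite !mulr_ge0 ?invr_ge0// ltW.
have -> : delta * corr_const = delta * ((6 ^ d)%:R * (d%:R * L / alpha)) * (2 * r + 2) ^+ d.
  by rewrite /corr_const !mulrA.
apply: (nrm_ball_periodic_sqrt d0) => //.
apply: (le_trans (periodic_poincare d0 hN pN cE)); rewrite -mulrA ler_pM2l//.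
have := corr_energy d0 cb L0 a0 cN; set D := nrm leb \1_Q => hE.
apply: (@le_trans _ _ ((6 ^ d)%:R * \sum_(k < d) nrm leb (fun x => \1_Q x * g x k 0))); last first.
  rewrite -mulrA ler_wpM2l// (le_trans hE)//.
  by rewrite le_eqVlt; apply/orP; left; apply/eqP; ring.
rewrite mulr_sumr; apply: ler_sum => k _.
have d3 : 2 * delta < 3%:R * delta by rewrite ltr_pM2r// ltr_nat.
have := nrm_ball_periodic_le d0 (lg k) (periodic_gradient k hN pN) d3.
have X1 : 1 <= (6 ^ d)%:R :> R by rewrite ler1n expn_gt0.
rewrite -(@ler_pXn2r _ 2)// ?nnegrE ?nrm_ge0 ?mulr_ge0 ?nrm_ge0// => h.
apply: (le_trans h); rewrite exprMn ler_wpM2r ?sqr_ge0//.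
by rewrite expr2 ler_peMr.
Qed.

(** The first summand bounds the flux by its energy, the second L the mean subtracted from it; the
    radius r + 1 is the one required by [periodic_pairing]. *)
Definition flux_const := (L * (1 + d%:R * L / alpha) + L) * (2 * (r + 1) + 2) ^+ d.

Lemma flux_ball_bound i N g k a : dcorr delta b i N g -> `|a| <= L ->
  nrm leb (fun x => \1_(B_ (r + 1)) x * (act b (corr_grad i g) k x - a)) <= flux_const.
Proof.
move=> cN aL; have [hN pN _] := cN; have [_ lg _] := (H1locP _ _).1 hN.
have lf := locL2_flux cb L0 k cN.
have l1 := inL2_cell1 (d := d) d0.
have lG l : inL2 leb (fun x => \1_Q x * corr_grad i g l x).
  by apply: inL2_cell => //; exact: corr_grad_locL2 hN.
have lgc l := inL2_cell d0 (lg l).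
have lc l : inL2 leb (fun x : V => \1_Q x * (l == i)%:R) by apply: inL2_cell => //; exact: locL2_cst.
have c0 : 0 <= L * (1 + d%:R * L / alpha) + L.
  by rewrite addr_ge0// mulr_ge0// addr_ge0// !mulr_ge0// invr_ge0 ltW.
apply: (nrm_ball_periodic_sqrt d0) => //; first exact: addr_ge0.
- by apply: locL2B => //; exact: locL2_cst.
- by move=> m; have := lperiodic_flux pb k cN m; apply: filterS => x ->.
rewrite (_ : (fun x => _) = (fun x => act b (fun l x => \1_Q x * corr_grad i g l x) k x - a * \1_Q x)); last first.
  by apply/funext => x; rewrite -cut_act mulrBr [a * _]mulrC.
have [la na] := inL2_act cb L0 k lG.
apply: (le_trans (nrmB_le la (inL2Z a l1))); rewrite nrmZ// mulrDl lerD//; last first.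
  by rewrite ler_wpM2r// nrm_ge0.
apply: (le_trans na); rewrite -mulrA ler_wpM2l//.
set D := nrm leb \1_Q.
have nE : \sum_l nrm leb (fun x : V => \1_Q x * (l == i)%:R) = D.
  rewrite (bigD1 i)//= big1 ?addr0 => [|l li].
    by congr (nrm _ _); apply/funext => x; rewrite eqxx mulr1.
  by rewrite (negbTE li) -[RHS](nrm0 leb); congr (nrm _ _); apply/funext => x; rewrite mulr0.
apply: (@le_trans _ _ (\sum_l (nrm leb (fun x : V => \1_Q x * (l == i)%:R) + nrm leb (fun x => \1_Q x * g x l 0)))).
  apply: ler_sum => l _; apply: le_trans (nrmD_le (lc l) (lgc l)).
  by rewrite le_eqVlt; apply/orP; left; apply/eqP; congr (nrm _ _); apply/funext => x; exact: mulrDr.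
rewrite big_split/= nE mulrDl mul1r lerD2l (le_trans (corr_energy d0 cb L0 a0 cN))//.
by rewrite le_eqVlt; apply/orP; left; apply/eqP; rewrite -/D; ring.
Qed.

Lemma flux_pairing i N g k a h : dcorr delta b i N g -> `|a| <= L ->
  delta ^+ d * a = ip leb (act b (fun l x => \1_Q x * corr_grad i g l x) k) \1_Q ->
  test_function setT h -> (forall x, h x != 0 -> `|x| <= r) ->
  `|\int[leb]_x ((act b (corr_grad i g) k x - a) * h x)| <=
    delta * flux_const * \sum_(l < d) nrm leb (partial l h).
Proof.
move=> cN aL aE th hr; have [hN pN _] := cN.
have lf := locL2_flux cb L0 k cN.
have l1 := inL2_cell1 (d := d) d0.
have lG l : inL2 leb (fun x => \1_Q x * corr_grad i g l x).
  by apply: inL2_cell => //; exact: corr_grad_locL2 hN.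
apply: (@le_trans _ _ (delta * nrm leb (fun x => \1_(B_ (r + 1)) x * (act b (corr_grad i g) k x - a)) *
    \sum_(l < d) nrm leb (partial l h))); last first.
  apply: ler_wpM2r; first by apply: sumr_ge0 => l _; exact: nrm_ge0.
  by rewrite (ler_pM2l d0); exact: (flux_ball_bound k cN aL).
apply: periodic_pairing => //.
- by apply: locL2B => //; exact: locL2_cst.
- by move=> m; have := lperiodic_flux pb k cN m; apply: filterS => x ->.
transitivity (ip leb (fun x => act b (fun l x => \1_Q x * corr_grad i g l x) k x - a * \1_Q x) (\1_Q)).
  congr Rintegral; apply/funext => x; rewrite -cut_act/=.
  by rewrite indicE; case: (x \in Q); rewrite ?mul1r ?mulr1// !(mul0r, mulr0).
have [la _] := inL2_act cb L0 k lG.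
by rewrite (ipBl la (inL2Z a l1) l1) (ipZl a l1 l1) ip_cell1// -aE [a * _]mulrC subrr.
Qed.

End corr.
End uniform_bounds.

(** * Weak solutions in D and their approximation by test functions *)

Section solutions.
Context {R : realType} {d : nat}.
Local Notation V := 'rV[R]_d.
Local Notation leb := (lebesgue_rV (R := R) d).
Variable D : set V.
Hypothesis mD : measurable D.
Local Notation cut F := (fun x => \1_D x * F x).

Lemma inL2_L2 (F : V -> R) : inL2 leb F -> L2 D F.
Proof.
move=> [mF Foo]; split; first exact: measurable_funS mF.
apply: le_lt_trans Foo; apply: ge0_subset_integral => //.
- by apply/measurable_EFinP; exact: measurable_funX.
- by move=> x _; rewrite lee_fin sqr_ge0.
Qed.

Lemma sqL2_nrm (F : V -> R) : L2 D F -> sqL2 D F = (nrm leb (cut F) ^+ 2)%:E.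
Proof.
move=> hF; have <- := integral_sqrE (L2_inL2 mD hF).
apply/esym; rewrite [RHS]integral_mkcond; apply: eq_integral => x _.
by rewrite /patch indicE; case: (x \in D); rewrite ?mul1r// mul0r expr0n.
Qed.

Lemma test_cut (w : V -> R) : test_function D w -> cut w = w.
Proof.
move=> tw; apply/funext => x; have [->|/(test_in tw) Dx] := eqVneq (w x) 0; first by rewrite mulr0.
by rewrite indicE mem_set ?mul1r.
Qed.

Lemma H10_test (w : V -> R) : test_function D w -> H10 D w (grad w).
Proof.
move=> tw; have lw := test_inL2 tw.
have gE i : (fun x => grad w x i 0) = partial i w by apply/funext => x; rewrite mxE.
split; first split.
- exact: inL2_L2.
- by move=> i; rewrite gE; apply/inL2_L2/(test_inL2 (test_partial i tw)).
- move=> phi tphi i; rewrite [LHS]Rintegral_mkcond [X in - X]Rintegral_mkcond.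
  have := integration_by_parts_rV i (test_setT tphi) (test_smooth tw); congr (_ = - _);
    congr Rintegral; apply/funext => x; rewrite /patch; case: ifPn => // /negP xD.
  + have [->|h] := eqVneq (partial i phi x) 0; first by rewrite mulr0.
    by exfalso; apply: xD; rewrite inE; exact: (test_in (test_partial i tphi) h).
  + by rewrite -(_ : grad w x i 0 = partial i w x) ?mxE.
  + have [->|h] := eqVneq (phi x) 0; first by rewrite mulr0.
    by exfalso; apply: xD; rewrite inE; exact: (test_in tphi h).
exists (fun=> w) => //; have -> : sqH1 D (fun x => w x - w x) (fun x => grad w x - grad w x) = 0%E.
  have z (F : V -> R) : (forall x, F x = 0) -> sqL2 D F = 0%E.
    move=> F0; rewrite /sqL2 integral0_eq// => x _; by rewrite F0 expr0n.
  rewrite /sqH1 z ?add0e; last by move=> x; rewrite subrr.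
  by rewrite big1// => i _; apply: z => x; rewrite subrr mxE.
exact: cvg_cst.
Qed.

Lemma H10_approx u g (eta : R) : H10 D u g -> 0 < eta -> exists W : V -> R,
  [/\ test_function D W, nrm leb (cut (fun x => W x - u x)) <= eta &
      forall k, nrm leb (cut (fun x => partial k W x - g x k 0)) <= eta].
Proof.
move=> [[hu hg _] [phi tphi cphi]] e0.
have e2 : (0 < (eta ^+ 2)%:E)%E by rewrite lte_fin exprn_gt0.
have [n _ hn] := cphi _ (open_ereal_lt' e2); have {hn} := hn n (leqnn n) => /= hn.
have tn := tphi n; exists (phi n).
have s0 (F : V -> R) : (0 <= sqL2 D F)%E by apply: integral_ge0 => x _; rewrite lee_fin sqr_ge0.
have hu1 : (sqL2 D (fun x => phi n x - u x)%R < (eta ^+ 2)%:E)%E.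
  by apply: le_lt_trans hn; rewrite leeDl// sume_ge0.
have hg1 k : (sqL2 D (fun x => (grad (phi n) x - g x) k 0)%R < (eta ^+ 2)%:E)%E.
  by apply: le_lt_trans hn; rewrite /sqH1 (bigD1 k)//= addeCA leeDl//; apply: adde_ge0 => //; exact: sume_ge0.
have lu : L2 D (fun x => phi n x - u x).
  split; last exact: lt_trans hu1 (ltry _).
  by apply: measurable_funB; [exact: measurable_funS (test_measurable tn)|exact: hu.1].
have lg k : L2 D (fun x => (grad (phi n) x - g x) k 0).
  split; last exact: lt_trans (hg1 k) (ltry _).
  rewrite (_ : (fun x => _) = (fun x => partial k (phi n) x - g x k 0)); last first.
    by apply/funext => x; rewrite !mxE.
  by apply: measurable_funB; [exact: measurable_funS (test_measurable (test_partial k tn))|exact: (hg k).1].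
have le1 (x : R) : 0 <= x -> ((x ^+ 2)%:E < (eta ^+ 2)%:E)%E -> x <= eta.
  move=> x0; rewrite lte_fin => h; rewrite -(@ler_pXn2r _ 2)// ?nnegrE//; exact: ltW.
split => //.
  apply: le1; first exact: nrm_ge0.
  by rewrite -sqL2_nrm.
move=> k; apply: le1; first exact: nrm_ge0.
rewrite (_ : (fun x => _) = cut (fun x => (grad (phi n) x - g x) k 0)); last first.
  by apply/funext => x; rewrite !mxE.
by rewrite -sqL2_nrm.
Qed.

Lemma solution_eq (alpha L : R) (b : V -> 'M[R]_d) f u g w : coeff alpha L b -> 0 <= L -> L2 D f ->
  H10 D u g ->
  (forall v h, H10 D v h -> \int[leb]_(x in D) dotv (b x *m g x) (h x) = \int[leb]_(x in D) (f x * v x)) ->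
  test_function D w ->
  \sum_k ip leb (act b (fun l => cut (fun x => g x l 0)) k) (partial k w) = ip leb (cut f) w.
Proof.
move=> cb L0 lf [[hu hg _] _] eg tw.
have lg l : inL2 leb (cut (fun x => g x l 0)) by exact: L2_inL2.
have lk k := test_inL2 (test_partial k tw).
rewrite -(ip_dotE (fun k => (inL2_act cb L0 k lg).1) lk).2.
have := eg w _ (H10_test tw); rewrite [X in X = _]Rintegral_mkcond [X in _ = X -> _]Rintegral_mkcond.
have -> : (fun x => f x * w x) \_ D = (fun x => \1_D x * f x * w x).
  by apply/funext => x; rewrite /patch indicE; case: (x \in D); rewrite ?mul1r ?mul0r.
move=> h; rewrite /ip -h; congr Rintegral; apply/funext => x; rewrite /patch /act indicE; case: (x \in D).
  apply: eq_bigr => k _; rewrite mxE /grad mxE; congr (_ * _); apply: eq_bigr => l _.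
  by rewrite mul1r.
by rewrite big1// => k _; rewrite big1 ?mul0r// => l _; rewrite mul0r mulr0.
Qed.

End solutions.

(** * The two-scale estimate *)

Section main.
Context {R : realType} {d : nat}.
Local Notation V := 'rV[R]_d.
Local Notation leb := (lebesgue_rV (R := R) d).
Local Notation B_ r := [set x : V | `|x| <= r].
Variables (D : set V) (r alpha L : R) (i0 : 'I_d).
Hypotheses (mD : measurable D) (r0 : 0 < r) (DB : D `<=` B_ r) (a0 : 0 < alpha) (L0 : 0 <= L).
Local Notation cutD F := (fun x => \1_D x * F x).

Lemma partial_mul i (u v : V -> R) : pderivable u -> pderivable v ->
  partial i (fun x => u x * v x) = (fun x => partial i u x * v x + u x * partial i v x).
Proof.
by move=> du dv; rewrite partialM//; apply/funext => x; rewrite addrC [v x * _]mulrC.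
Qed.

Lemma fin_bound (I : finType) (F : I -> V -> R) : (forall i, exists2 K, 0 < K & forall x, `|F i x| <= K) ->
  exists2 K, 0 <= K & forall i x, `|F i x| <= K.
Proof.
move=> h; have /choice[K hK] : forall i, exists K, 0 < K /\ forall x, `|F i x| <= K.
  by move=> i; have [K] := h i; exists K.
exists (\sum_i K i) => [|i x]; first by apply: sumr_ge0 => i _; exact/ltW/(hK i).1.
apply: (le_trans ((hK i).2 x)); rewrite (bigD1 i)//= lerDl.
by apply: sumr_ge0 => j _; exact/ltW/(hK j).1.
Qed.

Lemma test_mul (K : R) (phi F : V -> R) : test_function D phi -> 0 <= K -> (forall x, `|phi x| <= K) ->
  inL2 leb (fun x => \1_(B_ r) x * F x) ->
  inL2 leb (fun x => phi x * F x) /\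
  nrm leb (fun x => phi x * F x) <= K * nrm leb (fun x => \1_(B_ r) x * F x).
Proof.
move=> tphi K0 hK lF.
have -> : (fun x => phi x * F x) = (fun x => phi x * (\1_(B_ r) x * F x)).
  apply/funext => x; have [->|/(test_in tphi)/DB xB] := eqVneq (phi x) 0; first by rewrite !mul0r.
  by rewrite indicE mem_set ?mul1r.
by apply: inL2_bounded => //; [exact: test_measurable tphi|exact: aeW].
Qed.

Lemma nrm_sum_const (c : R) (F : 'I_d -> V -> R) : (forall i, inL2 leb (F i)) ->
  (forall i, nrm leb (F i) <= c) -> nrm leb (fun x => \sum_i F i x) <= d%:R * c.
Proof.
move=> lF nF; apply: (le_trans (nrm_sum_le _ _)) => [i _|]; first exact: lF.
apply: (le_trans (ler_sum _ (fun i _ => nF i))).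
by rewrite sumr_const card_ord mulr_natl.
Qed.

Lemma sum_const_le (c : R) (s : 'I_d -> R) : (forall i, s i <= c) -> \sum_i s i <= d%:R * c.
Proof.
move=> h; apply: (le_trans (ler_sum _ (fun i _ => h i))).
by rewrite sumr_const card_ord mulr_natl.
Qed.

(** Rearrangement of sums for [main_estimate], stated for abstract families so that the integrals
    are never unfolded. *)
Lemma sum_split3 (a t0 t1 : 'I_d -> R) (t2 t3 t4 : 'I_d -> 'I_d -> R) (s0 : R) :
  (forall k, a k = t0 k + t1 k - \sum_j t2 k j) ->
  (forall k, \sum_j t2 k j = \sum_j t3 k j + \sum_j t4 j k) -> \sum_k t0 k = s0 ->
  \sum_k a k = s0 + \sum_k t1 k - (\sum_k \sum_j t3 k j + \sum_j \sum_k t4 j k).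
Proof.
move=> h1 h2 <-; rewrite (eq_bigr _ (fun k _ => h1 k)) sumrB big_split/=; congr (_ - _).
by rewrite (eq_bigr _ (fun k _ => h2 k)) big_split/=; congr (_ + _); exact: exchange_big.
Qed.

(** The flux minus a constant vector is divergence free; tested with w d_j U, it moves the
    derivative from w to d_j U. The result pairs the mean-zero flux with an undifferentiated w. *)
Lemma flux_remainder (delta : R) (b : V -> 'M[R]_d) (N : V -> R) (g : V -> 'cV[R]_d) j
    (a : 'I_d -> R) (U w : V -> R) :
  0 < delta -> coeff alpha L b -> (forall i l, lperiodic delta (fun x => b x i l)) ->
  dcorr delta b j N g -> test_function D U -> test_function D w ->
  \sum_k ip leb (fun x => partial j U x * (act b (corr_grad j g) k x - a k)) (partial k w) =
  - \sum_k \int[leb]_x ((act b (corr_grad j g) k x - a k) * (partial k (partial j U) x * w x)).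
Proof.
move=> d0 cb pb cN tU tw; have tj := test_partial j tU.
pose psi x := partial j U x * w x.
have tpsi : test_function setT psi by apply: test_setT; apply: testM tj (test_smooth tw).
have dpsi k : partial k psi = fun x => partial k (partial j U) x * w x + partial j U x * partial k w x.
  by apply: partial_mul; apply: smooth_pderivable; [exact: test_smooth tj|exact: test_smooth tw].
have lf k : locL1 (act b (corr_grad j g) k) := locL2_locL1 (locL2_flux cb L0 k cN).
have lq k : locL1 (fun x => act b (corr_grad j g) k x - a k).
  exact: (locL2_locL1 (locL2B (locL2_flux cb L0 k cN) (locL2_cst (a k)))).
have t1 k : test_function setT (fun x => partial k (partial j U) x * w x).
  exact: test_setT (testM (test_partial k tj) (test_smooth tw)).
have t2 k : test_function setT (fun x => partial j U x * partial k w x).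
  exact: test_setT (testM tj (smooth_partial k (test_smooth tw))).
have z : \sum_k \int[leb]_x ((act b (corr_grad j g) k x - a k) * partial k psi x) = 0.
  rewrite -[RHS](flux_divfree d0 cb L0 pb cN tpsi); apply: eq_bigr => k _.
  have tk := test_partial k tpsi.
  transitivity (\int[leb]_x (act b (corr_grad j g) k x * partial k psi x - a k * partial k psi x)).
    by congr Rintegral; apply/funext => x; rewrite mulrBl.
  rewrite RintegralB//; [|exact: locL1_test_integrable|by apply: integrable_scaler; exact: test_integrable tk].
  by rewrite RintegralZl ?integral_partial ?mulr0 ?subr0//; exact: test_integrable tk.
apply/eqP; rewrite -addr_eq0 addrC -big_split/= -[X in _ == X]z; apply/eqP/eq_bigr => k _.
rewrite /ip -RintegralD//; [|exact: locL1_test_integrable (lq k) (t1 k)|].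
  by congr Rintegral; apply/funext => x; rewrite dpsi; ring.
have := locL1_test_integrable (lq k) (t2 k); apply: eq_integrable => // x _ /=.
by congr EFin; ring.
Qed.

(** The order of quantifiers is the point: [CU] depends on U but on neither the period, the
    coefficients nor the solution. U need only solve the homogenized equation up to eta, with a
    matrix Ak within tau of Ahat, so one U serves a whole class of matrices. *)
Lemma main_estimate (U : V -> R) : test_function D U -> exists2 CU, 0 <= CU &
  forall delta b f u N g (Ahat Ak : 'M[R]_d) eta tau SU,
  \sum_l nrm leb (partial l U) <= SU ->
  0 < delta -> delta <= 1 -> coeff alpha L b -> (forall i j, lperiodic delta (fun x => b x i j)) ->
  (forall i, dcorr delta b i (N i) (g i)) -> (forall i j, `|Ahat i j| <= L) ->
  (forall i j, delta ^+ d * Ahat i j =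
     ip leb (act b (fun l x => \1_(hcell delta) x * corr_grad j (g j) l x) i) \1_(hcell delta)) ->
  (forall i j, `|Ahat i j - Ak i j| <= tau) -> 0 <= eta -> 0 <= tau ->
  L2 D f -> dirichlet_solution D b f u ->
  (forall w, test_function D w ->
     `|ip leb (cutD f) w - \sum_k \sum_l Ak k l * ip leb (partial l U) (partial k w)| <=
     eta * \sum_k nrm leb (partial k w)) ->
  nrm leb (cutD (fun x => u x - U x)) <=
    (2 * r + 1) * (d%:R / alpha) * (eta + tau * SU) + CU * delta.
Proof.
move=> tU; have tU1 j := test_partial j tU; have tU2 k j := test_partial k (tU1 j).
have tU3 i k j := test_partial i (tU2 k j).
have [K1 K10 hK1] := fin_bound (fun j => test_bounded (tU1 j)).
have [K2 K20 hK2] := fin_bound (fun p : 'I_d * 'I_d => test_bounded (tU2 p.1 p.2)).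
(* Third derivatives appear because [flux_pairing] takes the gradient of h = w d_k d_j U. *)
have [K3 K30 hK3] := fin_bound (fun p : 'I_d * 'I_d * 'I_d => test_bounded (tU3 p.1.1 p.1.2 p.2)).
pose K := K1 + K2 + K3; have K0 : 0 <= K by rewrite !addr_ge0.
have {}hK1 j x : `|partial j U x| <= K by apply: (le_trans (hK1 j x)); rewrite /K; lra.
have {}hK2 k j x : `|partial k (partial j U) x| <= K by apply: (le_trans (hK2 (k, j) x)); rewrite /K; lra.
have {}hK3 i k j x : `|partial i (partial k (partial j U)) x| <= K.
  by apply: (le_trans (hK3 (i, k, j) x)); rewrite /K; lra.
(* The added 1 pays for replacing the corrector by a smooth P_j within delta. *)
pose cN := corr_const (d := d) alpha L r + 1; pose Cq := flux_const (d := d) alpha L r.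
have r0' := r0; pose PC := 2 * r + 1; have PC0 : 0 <= PC by rewrite /PC; lra.
have dR0 : 0 <= d%:R :> R by [].
have dLa : 0 <= d%:R * L / alpha by rewrite !mulr_ge0// invr_ge0 ltW.
have cN0 : 0 <= cN.
  rewrite /cN /corr_const; apply: addr_ge0 => //.
  by apply: mulr_ge0; [exact: mulr_ge0|apply: exprn_ge0; lra].
have Cq0 : 0 <= Cq.
  rewrite /Cq /flux_const; apply: mulr_ge0; last by apply: exprn_ge0; lra.
  by apply: addr_ge0 => //; apply: mulr_ge0 => //; exact: addr_ge0.
(* In [CE]: 1 for u against W, d K for the gradients of the P_j, d K cN for the terms P_j d_l d_j U.
   In [CF]: sums over j and k, and the gradient of w d_k d_j U with w bounded by PC times its
   gradient. *)
pose CE := d%:R * (1 + d%:R * K + d%:R * (K * cN)).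
pose CF := d%:R * (d%:R * (Cq * (d%:R * (K * PC) + K))).
have CE0 : 0 <= CE by repeat first [apply: mulr_ge0 => // | apply: addr_ge0 => //].
have CF0 : 0 <= CF by repeat first [apply: mulr_ge0 => // | apply: addr_ge0 => //].
have da0 : 0 <= d%:R / alpha by rewrite divr_ge0// ltW.
exists (1 + PC * (d%:R / alpha) * (L * CE + CF) + d%:R * (K * cN)).
  apply: addr_ge0; last by rewrite !mulr_ge0.
  by apply: addr_ge0 => //; apply: mulr_ge0; [exact: mulr_ge0|apply: addr_ge0 => //; exact: mulr_ge0].
move=> delta b f u N g Ahat Ak eta tau SU hSU d0 d1 cb pb cNg AL AE AAk eta0 tau0 lf [gu hu eg] hU.
have hN j : H1loc (N j) (g j) by have [] := cNg j.
have lg j k : locL2 (fun x => g j x k 0) by have [_ ? _] := (H1locP _ _).1 (hN j).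
(* All approximations are taken within delta itself, so their cost merges with the expected
   error. *)
have [W [tW nW ngW]] := H10_approx mD hu d0.
(* Correctors are defined up to a constant; only after subtracting the mean are they O(delta). *)
pose c j := (delta ^+ d)^-1 * \int[leb]_x (\1_(hcell delta) x * N j x).
have H1c j : H1loc (fun x => N j x - c j) (g j).
  have := H1locD (- c j) (hN j) (H1loc_smooth (smooth_cst (d := d) (1 : R))); congr H1loc.
    by apply/funext => x; rewrite mulr1.
  by apply/funext => x; apply/colP => k; rewrite !mxE partial_cst mulr0 addr0.
have /choice[P hP] : forall j, exists P : V -> R, [/\ smooth P,
    inL2 leb (fun x => \1_(B_ r) x * (P x - (N j x - c j))),
    nrm leb (fun x => \1_(B_ r) x * (P x - (N j x - c j))) <= delta,
    forall i, inL2 leb (fun x => \1_(B_ r) x * (partial i P x - g j x i 0)) &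
    forall i, nrm leb (fun x => \1_(B_ r) x * (partial i P x - g j x i 0)) <= delta].
  by move=> j; exact: H1loc_approx (H1c j) r0 d0.
have sP j : smooth (P j) by have [] := hP j.
have lNc j : inL2 leb (fun x => \1_(B_ r) x * (N j x - c j)).
  by have [h _ _] := (H1locP _ _).1 (H1c j); exact: h.2.
have lP j : inL2 leb (fun x => \1_(B_ r) x * P j x).
  have [_ h _ _ _] := hP j; have := inL2D h (lNc j); congr (inL2 _ _).
  by apply/funext => x; rewrite -mulrDr subrK.
have nP j : nrm leb (fun x => \1_(B_ r) x * P j x) <= delta * cN.
  have [_ h h' _ _] := hP j.
  have -> : (fun x => \1_(B_ r) x * P j x) =
      (fun x => \1_(B_ r) x * (P j x - (N j x - c j)) + \1_(B_ r) x * (N j x - c j)).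
    by apply/funext => x; rewrite -mulrDr subrK.
  apply: (le_trans (nrmD_le h (lNc j))); rewrite /cN mulrDr mulr1 addrC lerD//.
  exact: (corr_ball_bound d0 d1 cb L0 a0 (ltW r0) (cNg j) erefl).
(* The two-scale remainder. Being a test function of D, it is admissible both in the equation for u
   and in the approximate equation for U. *)
pose w x := W x - U x - \sum_j partial j U x * P j x.
have tUP j : test_function D (fun x => partial j U x * P j x) := testM (tU1 j) (sP j).
have tw : test_function D w by apply: testB; [exact: testB|exact: test_sum].
have sw := test_smooth tw.
have dw k : partial k w = fun x => partial k W x - partial k U x -
    \sum_j (partial k (partial j U) x * P j x + partial j U x * partial k (P j) x).
  have p1 : pderivable W := smooth_pderivable (test_smooth tW).
  have p2 : pderivable U := smooth_pderivable (test_smooth tU).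
  have p3 : pderivable (fun x => W x - U x) := smooth_pderivable (test_smooth (testB tW tU)).
  have p4 : pderivable (fun x => \sum_j partial j U x * P j x).
    by apply: smooth_pderivable; apply: test_smooth (test_sum _ tUP).
  rewrite /w partialB// partialB// partial_sum; last by move=> j; exact: test_smooth (tUP j).
  have e j : partial k (fun x => partial j U x * P j x) =
      fun x => partial k (partial j U) x * P j x + partial j U x * partial k (P j) x.
    by apply: partial_mul; [exact: smooth_pderivable (test_smooth (tU1 j))|exact: smooth_pderivable (sP j)].
  by apply/funext => x; rewrite (eq_bigr _ (fun j _ => congr1 (fun f => f x) (e j))).
pose S := \sum_k nrm leb (partial k w).
have S0 : 0 <= S by apply: sumr_ge0 => k _; exact: nrm_ge0.
have ldw k := test_inL2 (test_partial k tw).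
pose G l := cutD (fun x => gu x l 0).
have lG l : inL2 leb (G l) by have [[_ h _] _] := hu; exact: L2_inL2.
(* The gradient of w is that of u, plus E, minus the sum of d_j U (e_j + grad N_j); E gathers the
   three small errors. *)
pose E1 l x := \1_D x * (partial l W x - gu x l 0).
pose E2 l x := \sum_j partial j U x * (partial l (P j) x - g j x l 0).
pose E3 l x := \sum_j partial l (partial j U) x * P j x.
pose E l x := E1 l x - E2 l x - E3 l x.
have hE1 l : inL2 leb (E1 l).
  have := inL2B (test_inL2 (test_partial l tW)) (lG l); congr (inL2 _ _); apply/funext => x.
  by rewrite /E1 mulrBr; congr (_ - _); rewrite -[LHS](congr1 (fun f => f x) (test_cut (test_partial l tW))).
have hE2 l j := test_mul (tU1 j) K0 (hK1 j) (let: And5 _ _ _ h _ := hP j in h l).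
have hE3 l j := test_mul (tU2 l j) K0 (hK2 l j) (lP j).
have lE2 l : inL2 leb (E2 l) by apply: inL2_sum => j _; exact: (hE2 l j).1.
have lE3 l : inL2 leb (E3 l) by apply: inL2_sum => j _; exact: (hE3 l j).1.
have lE l : inL2 leb (E l) by apply: inL2B => //; exact: inL2B.
have nE2 l : nrm leb (E2 l) <= d%:R * (K * delta).
  apply: (@nrm_sum_const (K * delta) (fun j x => partial j U x * (partial l (P j) x - g j x l 0))).
    by move=> j; exact: (hE2 l j).1.
  move=> j; apply: (le_trans (hE2 l j).2); apply: ler_wpM2l => //.
  by have [_ _ _ _ h] := hP j; exact: h.
have nE3 l : nrm leb (E3 l) <= d%:R * (K * (delta * cN)).
  apply: (@nrm_sum_const (K * (delta * cN)) (fun j x => partial l (partial j U) x * P j x)).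
    by move=> j; exact: (hE3 l j).1.
  by move=> j; apply: (le_trans (hE3 l j).2); apply: ler_wpM2l.
have nE : \sum_l nrm leb (E l) <= delta * CE.
  have -> : delta * CE = d%:R * (delta + d%:R * (K * delta) + d%:R * (K * (delta * cN))).
    by rewrite /CE; ring.
  apply: sum_const_le => l.
  apply: (le_trans (nrmB_le (inL2B (hE1 l) (lE2 l)) (lE3 l))).
  apply: lerD (nE3 l); apply: (le_trans (nrmB_le (hE1 l) (lE2 l))).
  by apply: lerD (nE2 l); exact: ngW.
pose flux j k := act b (corr_grad j (g j)) k.
have lflux j k : inL2 leb (fun x => partial j U x * flux j k x).
  by apply: (test_mul (tU1 j) K0 (hK1 j) _).1; exact: (locL2_flux cb L0 k (cNg j)).2.
have dwE l x : partial l w x = G l x + E l x - \sum_j partial j U x * corr_grad j (g j) l x.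
  rewrite dw /E /E1 /E2 /E3 /G /corr_grad.
  have -> : \sum_j partial j U x * ((l == j)%:R + g j x l 0) = partial l U x + \sum_j partial j U x * g j x l 0.
    transitivity (\sum_j (partial j U x * (l == j)%:R + partial j U x * g j x l 0)).
      by apply: eq_bigr => j _; rewrite mulrDr.
    rewrite big_split/=; congr (_ + _); rewrite (bigD1 l)//= eqxx mulr1 big1 ?addr0// => j jl.
    by rewrite eq_sym (negbTE jl) mulr0.
  have -> : \sum_j partial j U x * (partial l (P j) x - g j x l 0) =
      \sum_j partial j U x * partial l (P j) x - \sum_j partial j U x * g j x l 0.
    by rewrite -sumrB; apply: eq_bigr => j _; rewrite mulrBr.
  have -> : partial l W x = \1_D x * partial l W x.
    by rewrite (congr1 (fun f => f x) (test_cut (test_partial l tW))).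
  rewrite big_split/=; move: (\sum_j _ * P j x) (\sum_j _ * partial l _ x) (\sum_j _ * g j x l 0) => s1 s2 s3.
  have e1 : \1_D x * (\1_D x * partial l W x) = \1_D x * partial l W x :> R.
    by rewrite indicE; case: (x \in D); rewrite ?mul1r// !mul0r.
  rewrite [\1_D x * (_ - _)]mulrBr e1; move: (\1_D x * _) (\1_D x * _) => s4 s5; ring.
have actE k x : act b (fun k => partial k w) k x = act b G k x + act b E k x - \sum_j partial j U x * flux j k x.
  rewrite /flux /act.
  have -> : \sum_j partial j U x * (\sum_l b x k l * corr_grad j (g j) l x) =
      \sum_l b x k l * \sum_j partial j U x * corr_grad j (g j) l x.
    under eq_bigr do rewrite mulr_sumr.
    rewrite exchange_big/=; apply: eq_bigr => l _; rewrite mulr_sumr; apply: eq_bigr => j _.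
    by rewrite mulrCA.
  rewrite -big_split -sumrB/=; apply: eq_bigr => l _; rewrite dwE; ring.
have laG k := (inL2_act cb L0 k lG).1; have laE k := (inL2_act cb L0 k lE).1.
have lsum k : inL2 leb (fun x => \sum_j partial j U x * flux j k x) by apply: inL2_sum => j _; exact: lflux.
have ipE k : ip leb (act b (fun k => partial k w) k) (partial k w) =
    ip leb (act b G k) (partial k w) + ip leb (act b E k) (partial k w) -
    \sum_j ip leb (fun x => partial j U x * flux j k x) (partial k w).
  rewrite -(ip_suml _ (fun j _ => lflux j k) (ldw k)) -ipDl// -ipBl//; last exact: inL2D.
  by congr ip; apply/funext => x; exact: actE.
have T1 : \sum_k ip leb (act b E k) (partial k w) <= L * (delta * CE) * S.
  rewrite /S mulr_sumr; apply: ler_sum => k _; apply: (le_trans (ler_norm _)).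
  apply: (le_trans (ip_le (laE k) (ldw k))); rewrite ler_wpM2r ?nrm_ge0//.
  by apply: (le_trans (inL2_act cb L0 k lE).2); rewrite ler_wpM2l.
have wB x : w x != 0 -> `|x| <= r by move=> /(test_in tw)/DB.
have pw : nrm leb w <= PC * S := poincare i0 (test_setT tw) (ltW r0) wB.
(* Splitting the flux into its mean and q: the means reproduce the homogenized form, and q is left
   to [flux_remainder]. *)
pose q j k x := flux j k x - Ahat k j.
have lq j k : inL2 leb (fun x => partial j U x * q j k x).
  apply: (test_mul (tU1 j) K0 (hK1 j) _).1.
  by apply: (locL2B (locL2_flux cb L0 k (cNg j)) (locL2_cst _)).2.
have T3 j : `|\sum_k ip leb (fun x => partial j U x * q j k x) (partial k w)| <=
    delta * (d%:R * (Cq * (d%:R * (K * PC) + K))) * S.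
  rewrite /q (flux_remainder (fun k => Ahat k j) d0 cb pb (cNg j) tU tw) normrN.
  apply: (le_trans (ler_norm_sum _ _ _)).
  have -> : delta * (d%:R * (Cq * (d%:R * (K * PC) + K))) * S =
      d%:R * (delta * Cq * (d%:R * (K * (PC * S)) + K * S)) by ring.
  apply: sum_const_le => k.
  have th : test_function D (fun x => partial k (partial j U) x * w x) := testM (tU2 k j) sw.
  have hB x : partial k (partial j U) x * w x != 0 -> `|x| <= r by move=> /(test_in th)/DB.
  apply: (le_trans (flux_pairing d0 d1 cb L0 a0 (ltW r0) pb (cNg j) (AL k j) (AE k j) (test_setT th) hB)).
  apply: ler_wpM2l; first by apply: mulr_ge0 => //; exact: ltW.
  apply: (@le_trans _ _ (\sum_l (K * (PC * S) + K * nrm leb (partial l w)))); last first.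
    by rewrite big_split/= sumr_const card_ord -[X in X + _]mulr_natl -mulr_sumr.
  apply: ler_sum => l _; rewrite partial_mul; last 2 first.
  - exact: smooth_pderivable (test_smooth (tU2 k j)).
  - exact: smooth_pderivable sw.
  have bw (F : V -> R) : inL2 leb F -> inL2 leb (fun x => \1_(B_ r) x * F x) /\
      nrm leb (fun x => \1_(B_ r) x * F x) <= nrm leb F.
    by move=> lF; exact: nrm_indic_le (@measurable_norm_le R d r) lF.
  have [b1 b2] := bw _ (test_inL2 tw); have [b3 b4] := bw _ (ldw l).
  have [c1 c2] := test_mul (tU3 l k j) K0 (hK3 l k j) b1.
  have [c3 c4] := test_mul (tU2 k j) K0 (hK2 k j) b3.
  apply: (le_trans (nrmD_le c1 c3)); apply: lerD.
    by apply: (le_trans c2); rewrite ler_wpM2l// (le_trans b2).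
  by apply: (le_trans c4); rewrite ler_wpM2l.
have lU l := test_inL2 (tU1 l).
have T2 : `|\sum_k \sum_l (Ak k l - Ahat k l) * ip leb (partial l U) (partial k w)| <= tau * SU * S.
  apply: (le_trans (ler_norm_sum _ _ _)); rewrite /S mulr_sumr; apply: ler_sum => k _.
  apply: (le_trans (ler_norm_sum _ _ _)); apply: (@le_trans _ _ (\sum_l (tau * (nrm leb (partial l U) * nrm leb (partial k w))))).
    apply: ler_sum => l _; rewrite normrM; apply: ler_pM => //; first by rewrite distrC.
    exact: ip_le.
  rewrite -mulr_sumr -mulr_suml mulrA ler_wpM2r ?nrm_ge0// ler_wpM2l//.
have fluxq k : \sum_j ip leb (fun x => partial j U x * flux j k x) (partial k w) =
    \sum_j Ahat k j * ip leb (partial j U) (partial k w) +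
    \sum_j ip leb (fun x => partial j U x * q j k x) (partial k w).
  rewrite -big_split/=; apply: eq_bigr => j _.
  rewrite -(ipZl _ (lU j) (ldw k)) -(ipDl (inL2Z _ (lU j)) (lq j k) (ldw k)); congr ip.
  by apply/funext => x; rewrite /q; ring.
have s_eq : \sum_k ip leb (act b G k) (partial k w) = ip leb (cutD f) w :=
  solution_eq mD cb L0 lf hu eg tw.
have tot_eq : \sum_k ip leb (act b (fun k => partial k w) k) (partial k w) =
    ip leb (cutD f) w + \sum_k ip leb (act b E k) (partial k w) -
    (\sum_k \sum_l Ahat k l * ip leb (partial l U) (partial k w) +
     \sum_j \sum_k ip leb (fun x => partial j U x * q j k x) (partial k w)).
  exact: (@sum_split3 _ (fun k => ip leb (act b G k) (partial k w))
    (fun k => ip leb (act b E k) (partial k w))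
    (fun k j => ip leb (fun x => partial j U x * flux j k x) (partial k w))
    (fun k j => Ahat k j * ip leb (partial j U) (partial k w))
    (fun j k => ip leb (fun x => partial j U x * q j k x) (partial k w)) _ ipE fluxq s_eq).
have total : alpha * \sum_k nrm leb (partial k w) ^+ 2 <=
    (eta + tau * SU + L * (delta * CE) + delta * CF) * S.
  apply: (le_trans (ellipticity_ip cb L0 ldw)); rewrite tot_eq.
  have hw : _ <= eta * S := hU w tw.
  have hT2 := T2; rewrite (eq_bigr (fun k => \sum_l Ak k l * ip leb (partial l U) (partial k w) -
     \sum_l Ahat k l * ip leb (partial l U) (partial k w))) in hT2; last first.
    by move=> k _; rewrite -sumrB; apply: eq_bigr => l _; rewrite mulrBl.
  rewrite sumrB in hT2.
  have hT3 : `|\sum_j \sum_k ip leb (fun x => partial j U x * q j k x) (partial k w)| <= delta * CF * S.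
    apply: (le_trans (ler_norm_sum _ _ _)).
    have -> : delta * CF * S = d%:R * (delta * (d%:R * (Cq * (d%:R * (K * PC) + K))) * S).
      by rewrite /CF -!mulrA mulrCA.
    exact: sum_const_le.
  move: hw hT2 hT3 T1; rewrite !ler_norml.
  move: (ip leb (cutD f) w) (\sum_k \sum_l Ak k l * _) (\sum_k \sum_l Ahat k l * _)
    (\sum_j \sum_k ip leb _ _) (\sum_k ip leb (act b E k) _) => s1 s2 s3 s4 s5.
  move=> /andP[p1 p2] /andP[p3 p4] /andP[p5 p6] p7; rewrite !mulrDl; lra.
have X0 : 0 <= eta + tau * SU + L * (delta * CE) + delta * CF.
  have SU0 : 0 <= SU by apply: le_trans hSU; apply: sumr_ge0 => k _; exact: nrm_ge0.
  have d0' := ltW d0; apply: addr_ge0; last exact: mulr_ge0.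
  apply: addr_ge0; first by apply: addr_ge0 => //; exact: mulr_ge0.
  by apply: mulr_ge0 => //; exact: mulr_ge0.
(* Every right-hand term is linear in S, so the energy inequality bounds S itself, and Poincare then
   bounds w. *)
have hS : S <= _ := energy_absorb a0 X0 (fun k => nrm_ge0 leb _) total.
have lu : inL2 leb (cutD u) by have [[h _ _] _] := hu; exact: L2_inL2.
have l1 : inL2 leb (cutD (fun x => W x - u x)).
  have := inL2B (test_inL2 tW) lu; congr (inL2 _ _); apply/funext => x.
  by rewrite mulrBr (congr1 (fun f => f x) (test_cut tW)).
have l2 : inL2 leb (fun x => \sum_j partial j U x * P j x) := test_inL2 (test_sum _ tUP).
have n2 : nrm leb (fun x => \sum_j partial j U x * P j x) <= d%:R * (K * cN) * delta.
  rewrite -mulrA; apply: nrm_sum_const => j; first exact: test_inL2 (tUP j).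
  apply: (le_trans (test_mul (tU1 j) K0 (hK1 j) (lP j)).2).
  by rewrite -mulrA ler_wpM2l// mulrC.
have -> : cutD (fun x => u x - U x) = (fun x => w x + \sum_j partial j U x * P j x -
    \1_D x * (W x - u x)).
  apply/funext => x; rewrite /w mulrBr mulrBr (congr1 (fun f => f x) (test_cut tW)).
  by rewrite (congr1 (fun f => f x) (test_cut tU)); ring.
have lw := test_inL2 tw.
apply: (le_trans (nrmB_le (inL2D lw l2) l1)).
apply: (le_trans (lerD (nrmD_le lw l2) nW)).
apply: (le_trans (lerD (lerD pw n2) (lexx _))).
apply: (le_trans (lerD (lerD (ler_wpM2l PC0 hS) (lexx _)) (lexx _))).
rewrite le_eqVlt; apply/orP; left; apply/eqP; rewrite -/PC; ring.
Qed.

End main.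

(** * Null sets, mixing and determinism *)

Import HBNNSimple.

Section null_sets.
Context {R : realType}.

(** Tonelli for the indicator of S: either order of the quantifiers says that S is null for the
    product measure. *)
Lemma ae_swap d1 d2 (T1 : measurableType d1) (T2 : measurableType d2)
  (m1 : {sigma_finite_measure set T1 -> \bar R}) (m2 : {sigma_finite_measure set T2 -> \bar R})
  (S : set (T1 * T2)) : measurable S ->
  {ae m1, forall x, {ae m2, forall y, ~ S (x, y)}} -> {ae m2, forall y, {ae m1, forall x, ~ S (x, y)}}.
Proof.
move=> mS h; pose f (z : T1 * T2) : \bar R := (\1_S z)%:E.
have mf : measurable_fun setT f by apply/measurable_EFinP; exact: measurable_indic.
have f0 z : (0 <= f z)%E by rewrite lee_fin.
have sec1 x : measurable_fun setT (fun y => f (x, y)).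
  by apply: (measurableT_comp mf); apply/measurable_fun_pairP; split; [exact: measurable_cst|exact: measurable_id].
have sec2 y : measurable_fun setT (fun x => f (x, y)).
  by apply: (measurableT_comp mf); apply/measurable_fun_pairP; split; [exact: measurable_id|exact: measurable_cst].
have fS z : f z = 0%E -> ~ S z by rewrite /f indicE => -[] + Sz; rewrite mem_set// => /eqP; rewrite oner_eq0.
have Sf z : ~ S z -> f z = 0%E by move=> nS; rewrite /f indicE memNset.
have absE d (T : measurableType d) (m : {measure set T -> \bar R}) (g : T -> \bar R) :
    (forall x, (0 <= g x)%E) -> (\int[m]_x `|g x| = \int[m]_x g x)%E.
  by move=> g0; apply: eq_integral => x _; rewrite gee0_abs.
have mF : measurable_fun setT (fun x => \int[m2]_y f (x, y))%E.
  exact: (@measurable_fun_fubini_tonelli_F _ _ _ _ _ m2 f).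
have mG : measurable_fun setT (fun y => \int[m1]_x f (x, y))%E.
  exact: (@measurable_fun_fubini_tonelli_G _ _ _ _ _ m1 f).
have F0 : (\int[m1]_x \int[m2]_y f (x, y) = 0)%E.
  rewrite -absE => [|x]; last exact: integral_ge0.
  apply/(ae_eq_integral_abs m1 measurableT mF); apply: filterS h => x hx _.
  rewrite -absE//; apply/(ae_eq_integral_abs m2 measurableT (sec1 x)).
  by apply: filterS hx => y /Sf.
have G0 : (\int[m2]_y `|\int[m1]_x f (x, y)| = 0)%E.
  rewrite absE => [|y]; last exact: integral_ge0.
  by rewrite -(@fubini_tonelli _ _ _ _ _ m1 m2 f).
have := (ae_eq_integral_abs m2 measurableT mG).1 G0; apply: filterS => y /(_ I) hy.
have : (\int[m1]_x `|f (x, y)| = 0)%E by rewrite absE.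
by move=> /(ae_eq_integral_abs m1 measurableT (sec2 y)); apply: filterS => x /(_ I) /fS.
Qed.

Section probability.
Context {dO : measure_display} {Omega : measurableType dO} (P : probability Omega R).

(** Meant for an f of unknown measurability, such as the squared error as a function of the random
    parameter: its integral is a supremum over simple functions below f, each almost surely at most
    c. *)
Lemma ge0_integral_ae_le (f : Omega -> \bar R) (c : R) : (forall w, 0 <= f w)%E -> 0 <= c ->
  {ae P, forall w, (f w <= c%:E)%E} -> (\int[P]_w f w <= c%:E)%E.
Proof.
move=> f0 c0 fc; rewrite ge0_integralTE//; apply: ge_ereal_sup => _ [h /= hf <-].
rewrite -integralT_nnsfun; apply: (@le_trans _ _ (\int[P]_w c%:E)%E).
  apply: ae_ge0_le_integral.
  - exact: measurableT.
  - by move=> x _; rewrite lee_fin; exact: fun_ge0.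
  - by apply/measurable_EFinP; exact: measurable_funPT.
  - by move=> x _; rewrite lee_fin.
  - exact: measurable_cst.
  - by apply: filterS fc => w hw _; exact: le_trans (hf w) hw.
by rewrite (integral_cst P measurableT c%:E) [X in (_ * X <= _)%E](_ : _ = 1%E) ?mule1//; exact: probability_setT.
Qed.

(** The simple function c times the indicator of the complement of the exceptional null set lies
    below f everywhere. *)
Lemma ge0_integral_ae_ge (f : Omega -> \bar R) (c : R) : (forall w, 0 <= f w)%E -> 0 <= c ->
  {ae P, forall w, (c%:E <= f w)%E} -> (c%:E <= \int[P]_w f w)%E.
Proof.
move=> f0 c0 [N [mN N0 cN]]; have mA := measurableC mN.
rewrite ge0_integralTE//; pose h := scale_nnsfun (indic_nnsfun R mA) c0.
have hE w : h w = c * \1_(~` N) w by [].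
have -> : c%:E = sintegral P h.
  rewrite -integralT_nnsfun; under eq_integral do rewrite hE EFinM.
  rewrite ge0_integralZl_EFin//; last by apply/measurable_EFinP; exact: measurable_indic.
  have pA : P (~` N) = 1%E by rewrite probability_setC// N0 sube0.
  by rewrite integral_indic// setIT [X in (_ * X)%E](_ : _ = 1%E) ?mule1.
apply: ereal_sup_ubound; exists h => // w; suff : ((c * \1_(~` N) w)%:E <= f w)%E by [].
rewrite indicE.
have [wN|/negP wN] := boolP (w \in ~` N); last by rewrite mulr0.
rewrite mulr1; apply: contrapT => nc; move: wN; rewrite inE; apply; apply: cN; exact: nc.
Qed.

(** The entries of [Ahat] are not known to be measurable, so the two one-sided bounds are applied to
    the positive and negative parts. *)
Lemma expectation_ae_cst (f : Omega -> R) (c : R) : {ae P, forall w, f w = c} -> 'E_P[f]%E = c%:E.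
Proof.
have key (g : Omega -> \bar R) (a : R) : (forall w, 0 <= g w)%E -> 0 <= a ->
    {ae P, forall w, g w = a%:E} -> (\int[P]_w g w = a%:E)%E.
  move=> g0 a0 ga; apply/eqP; rewrite eq_le; apply/andP; split.
    by apply: ge0_integral_ae_le => //; apply: filterS ga => w ->.
  by apply: ge0_integral_ae_ge => //; apply: filterS ga => w ->.
move=> fc; rewrite unlock integralE.
rewrite (key _ (Num.max c 0)) ?(key _ (Num.max (- c) 0))//.
- rewrite -EFinB; congr EFin; have [c0|c0] := leP c 0.
    have -> : Num.max (- c) 0 = - c by apply/max_idPl; rewrite oppr_ge0.
    by rewrite sub0r opprK.
  have -> : Num.max (- c) 0 = 0 by apply/max_idPr; rewrite oppr_le0 ltW.
  by rewrite subr0.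
- by rewrite le_max lexx orbT.
- by apply: filterS fc => w fw; first [rewrite funenegE|rewrite funeneg.unlock]; rewrite /= fw -EFin_max.
- by rewrite le_max lexx orbT.
- by apply: filterS fc => w fw; first [rewrite funeposE|rewrite funepos.unlock]; rewrite /= fw -EFin_max.
Qed.

Lemma ae_measure (E F : set Omega) : measurable E -> measurable F ->
  {ae P, forall w, E w <-> F w} -> P E = P F.
Proof.
move=> mE mF h.
have e (G : set Omega) : measurable G -> P G = (\int[P]_w (\1_G w)%:E)%E.
  by move=> mG; rewrite integral_indic// setIT.
rewrite !e//; apply: ae_eq_integral => //.
- by apply/measurable_EFinP; exact: measurable_indic.
- by apply/measurable_EFinP; exact: measurable_indic.
apply: filterS h => w [h1 h2] _; congr EFin; rewrite !indicE; congr (_%:R); congr nat_of_bool.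
by apply/idP/idP; rewrite !inE.
Qed.

Lemma ae_and (Q Q' : Omega -> Prop) : {ae P, forall w, Q w} -> {ae P, forall w, Q' w} ->
  {ae P, forall w, Q w /\ Q' w}.
Proof. by apply: filterS2 => w h h'; split. Qed.

Lemma ae_nonempty (Q : Omega -> Prop) : {ae P, forall w, Q w} -> exists w, Q w.
Proof.
move=> [N [mN N0 QN]]; apply: contrapT => h.
have NT : N = setT by apply/seteqP; split => // w _; apply: QN => q; apply: h; exists w.
by move: N0; rewrite NT probability_setT => /eqP; rewrite eqe oner_eq0.
Qed.

End probability.

Lemma powR_decay (c theta e : R) : 0 < c -> 0 < theta -> 0 < e ->
  exists n : nat, c * (1 + n%:R) `^ (- theta) < e.
Proof.
move=> c0 t0 e0; have x0 : 0 < c / e by rewrite divr_gt0.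
have [n hn _] := ex_nat_mul_gt ((c / e) `^ theta^-1) (@ltr01 R).
rewrite mulr1 in hn; exists n.
have n1 : 0 < 1 + n%:R :> R by rewrite ltr_pwDl.
have : c / e < (1 + n%:R) `^ theta.
  have <- : ((c / e) `^ theta^-1) `^ theta = c / e by rewrite -powRrM mulVf ?gt_eqF// powRr1// ltW.
  apply: (gt0_ltr_powR t0); [by rewrite nnegrE powR_ge0|by rewrite nnegrE ltW|].
  by apply: (lt_trans hn); rewrite ltrDr.
by rewrite powRN ltr_pdivrMr// => h; rewrite ltr_pdivrMr ?powR_gt0// mulrC.
Qed.

(** The bound tends to 0, forcing p = p^2. It is used at 1 + n because the mixing rate is given for
    positive distances. *)
Lemma zero_one (p c theta : R) : 0 < c -> 0 < theta ->
  (forall n : nat, `|p - p * p| <= c * (1 + n.+1%:R) `^ (- theta)) -> p = 0 \/ p = 1.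
Proof.
move=> c0 t0 h; have : `|p - p * p| <= 0.
  apply/ler_addgt0Pr => e e0; rewrite add0r; have [n hn] := powR_decay c0 t0 e0.
  apply: (le_trans (h n)); apply: le_trans (ltW hn); rewrite ler_pM2l// !powRN.
  rewrite lef_pV2 ?posrE ?powR_gt0//.
  apply: (ge0_ler_powR (ltW t0)); [by rewrite nnegrE addr_ge0|by rewrite nnegrE addr_ge0|].
  by rewrite lerD2l ler_nat.
rewrite normr_le0 => /eqP h0; have : p * (1 - p) = 0 by rewrite mulrBr mulr1.
move=> /eqP; rewrite mulf_eq0 subr_eq0 => /orP[/eqP->|/eqP<-]; [by left|by right].
Qed.
End null_sets.

Section mixing.
Context {R : realType} {d : nat} {dO : measure_display}
  {Omega : measurableType dO} (P : probability Omega R).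
Local Notation V := 'rV[R]_d.
Local Notation leb := (lebesgue_rV (R := R) d).
Variables (A : V -> Omega -> 'M[R]_d) (M : nat) (c theta : R) (i0 : 'I_d).
Hypothesis M0 : (0 < M)%N.
Hypotheses (c0 : 0 < c) (theta0 : 0 < theta).
Hypothesis mA : measurable_fun setT (fun p : V * Omega => A p.1 p.2).
Hypothesis mixA : forall s : R, 0 < s ->
  (mixing_coefficient P A s <= (c * (1 + s) `^ (- theta))%:E)%E.
Hypothesis perA : {ae P, forall w, cell_periodic M (fun y => A y w)}.

(** Rational thresholds: countably many events determine the matrix, so null sets can be
    collected. *)
Let T i j (q : rat) : set (V * Omega) := [set p | A p.1 p.2 i j < ratr q].
Let dir (n : nat) : 'rV[int]_d := \row_i (if i == i0 then n%:Z else 0).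

Lemma measurable_entry i j : measurable_fun setT (fun p : V * Omega => A p.1 p.2 i j : R).
Proof. exact: (measurableT_comp (measurable_coord i j) mA). Qed.

Let mT i j q : measurable (T i j q).
Proof.
rewrite (_ : T i j q = (fun p => A p.1 p.2 i j) @^-1` `]-oo, ratr q[).
  by rewrite -[X in measurable X]setTI; exact: measurable_entry.
by apply/seteqP; split => p; rewrite /T /= in_itv.
Qed.

Lemma measurable_section_w (w : Omega) i j : measurable_fun setT (fun y : V => A y w i j : R).
Proof.
apply: (measurableT_comp (f := fun p : V * Omega => A p.1 p.2 i j) (g := fun y => (y, w))).
  exact: measurable_entry.
by apply/measurable_fun_pairP; split; [exact: measurable_id|exact: measurable_cst].
Qed.

Lemma measurable_section_y (y : V) i j : measurable_fun setT (fun w : Omega => A y w i j : R).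
Proof.
apply: (measurableT_comp (f := fun p : V * Omega => A p.1 p.2 i j) (g := fun w => (y, w))).
  exact: measurable_entry.
by apply/measurable_fun_pairP; split; [exact: measurable_cst|exact: measurable_id].
Qed.

(** Periodicity is given almost surely for almost every y, but the mixing coefficient speaks of
    events at a fixed y. Exchanging the null sets yields one exceptional set of points, common to
    all shifts in the direction i0. *)
Lemma ae_periodic_swap : {ae leb, forall y, forall n : nat, {ae P, forall w,
  A (y + M%:R *: shift_vec (dir n)) w = A y w}}.
Proof.
apply: ae_foralln => n; set v := M%:R *: shift_vec (dir n).
pose D i j (p : Omega * V) : R := A (p.2 + v) p.1 i j - A p.2 p.1 i j.
have mD i j : measurable_fun setT (D i j).
  apply: measurable_funB.
    apply: (measurableT_comp (f := fun p : V * Omega => A p.1 p.2 i j) (g := fun p : Omega * V => (p.2 + v, p.1))).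
      exact: measurable_entry.
    apply/measurable_fun_pairP; split; last exact: measurable_fst.
    apply: measurable_fun_matrixP => a b.
    rewrite (_ : (fun p => _) = (fun p : Omega * V => p.2 a b + v a b)); last by apply/funext => p; rewrite !mxE.
    by apply: measurable_funD => //; exact: (measurableT_comp (measurable_coord a b) measurable_snd).
  apply: (measurableT_comp (f := fun p : V * Omega => A p.1 p.2 i j) (g := fun p : Omega * V => (p.2, p.1))).
    exact: measurable_entry.
  by apply/measurable_fun_pairP; split; [exact: measurable_snd|exact: measurable_fst].
have key i j : {ae leb, forall y, {ae P, forall w, A (y + v) w i j = A y w i j}}.
  have mS : measurable (D i j @^-1` (~` [set 0])).
    by rewrite -[X in measurable X]setTI; apply: mD => //; exact: measurableC.
  have := ae_swap (m1 := P) (m2 := leb) mS _; set H := (X in (X -> _) -> _).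
  have hH : H.
    apply: filterS perA => w /(_ (dir n)); apply: filterS => y hy /=; apply.
    by rewrite /D /= -/v hy subrr.
  move=> /(_ hH); apply: filterS => y; apply: filterS => w /= hw.
  by apply/eqP; rewrite -subr_eq0; apply/eqP; apply: contrapT => h; exact: hw.
have : {ae leb, forall y, forall i, forall j, {ae P, forall w, A (y + v) w i j = A y w i j}}.
  by apply: filter_forall => i; apply: filter_forall => j; exact: key.
apply: filterS => y hy.
have : {ae P, forall w, forall i, forall j, A (y + v) w i j = A y w i j}.
  by apply: filter_forall => i; apply: filter_forall => j; exact: hy.
by apply: filterS => w hw; apply/matrixP => i j; exact: hw.
Qed.

(** The events at y and at y + M (n + 1) e_i0 agree almost surely, yet belong to sigma-algebras of
    distant points; hence p - p^2 is bounded by the mixing coefficient at n + 1. *)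
Lemma mixing_zero_one (y : V) i j (q : rat) :
  (forall n : nat, {ae P, forall w, A (y + M%:R *: shift_vec (dir n)) w = A y w}) ->
  P (xsection (T i j q) y) = 0%E \/ P (xsection (T i j q) y) = 1%E.
Proof.
move=> hy; pose E v : set Omega := [set w | A v w i j < ratr q].
have -> : xsection (T i j q) y = E y by apply/seteqP; split => w; rewrite /xsection /= inE.
have mE v : measurable (E v).
  rewrite (_ : E v = (fun w => A v w i j) @^-1` `]-oo, ratr q[).
    by rewrite -[X in measurable X]setTI; exact: measurable_section_y.
  by apply/seteqP; split => p; rewrite /E /= in_itv.
have fE v : P (E v) \is a fin_num by exact: fin_num_measure.
have fieldE v : field_sigma_algebra A [set v] (E v).
  apply: sub_sigma_algebra; exists v, [set m : 'M[R]_d | m i j < ratr q]; split => //.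
  rewrite (_ : mkset _ = (fun m : 'M[R]_d => m i j) @^-1` `]-oo, ratr q[).
    by rewrite -[X in measurable X]setTI; exact: measurable_coord.
  by apply/seteqP; split => m; rewrite /= in_itv.
have [] : fine (P (E y)) = 0 \/ fine (P (E y)) = 1; last 2 first.
- by move=> h; left; rewrite -(fineK (fE y)) h.
- by move=> h; right; rewrite -(fineK (fE y)) h.
apply: (zero_one c0 theta0) => n; have s0 : 0 < n.+1%:R :> R by [].
set v := y + M%:R *: shift_vec (dir n.+1).
have aeE : {ae P, forall w, E v w <-> E y w}.
  by apply: filterS (hy n.+1) => w; rewrite /E /= -/v => ->.
have PE : P (E v) = P (E y).
  by apply: ae_measure; last exact: aeE.
have PI : P (E y `&` E v) = P (E y).
  apply: ae_measure => //; first exact: measurableI.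
  by apply: filterS aeE => w [h1 h2]; split => [[]//|h]; split => //; exact: h2.
have := le_trans _ (mixA s0); move=> /(_ (`|P (E y `&` E v) - P (E y) * P (E v)|)%E).
rewrite PI PE -(fineK (fE y)) -EFinM -EFinB abse_EFin lee_fin; apply.
apply: ereal_sup_ubound; exists [set y], [set v], (E y), (E v); split => //; last first.
  by rewrite PI PE -(fineK (fE y)) -EFinM -EFinB abse_EFin.
(* The two points are at distance M (n + 1), which is at least n + 1 as M is positive. *)
apply: le_ereal_inf_tmp => _ [[a b] [/= -> ->] <-]; rewrite lee_fin.
rewrite /enorm /v opprD addrA subrr add0r.
apply: (@le_trans _ _ (Num.sqrt ((M%:R * n.+1%:R) ^+ 2))).
  by rewrite sqrtr_sqr ger0_norm ?mulr_ge0// ler_peMl// ler1n.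
rewrite ler_sqrt; last by apply: sumr_ge0 => k _; exact: sqr_ge0.
rewrite (bigD1 i0)//= !mxE eqxx sqrrN lerDl; apply: sumr_ge0 => k _; exact: sqr_ge0.
Qed.

(** Determinism is expressed by the probabilities of the threshold events, which depend on y only;
    no deterministic field has to be constructed, and two realizations satisfying this agree by
    [deterministic_eq]. *)
Lemma coefficient_deterministic : {ae P, forall w, {ae leb, forall y, forall i j (q : rat),
  (A y w i j < ratr q)%R%:R = fine (P (xsection (T i j q) y))}}.
Proof.
have key i j q : {ae P, forall w, {ae leb, forall y,
    (A y w i j < ratr q)%R%:R = fine (P (xsection (T i j q) y))}}.
  pose D (p : V * Omega) : R := \1_(T i j q) p - fine (P (xsection (T i j q) p.1)).
  have mD : measurable_fun setT D.
    apply: measurable_funB; first exact: measurable_indic.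
    apply: (measurableT_comp (f := fun y => fine (P (xsection (T i j q) y))) (g := fst)).
      exact: (measurableT_comp (fine_measurable measurableT) (measurable_fun_xsection P (mT i j q))).
    exact: measurable_fst.
  have mS : measurable (D @^-1` (~` [set 0])).
    by rewrite -[X in measurable X]setTI; apply: mD => //; exact: measurableC.
  have indE y w : \1_(T i j q) (y, w) = (A y w i j < ratr q)%R%:R :> R.
    by rewrite indicE; congr (_%:R); congr nat_of_bool; apply/idP/idP; rewrite inE.
  have := ae_swap (m1 := leb) (m2 := P) mS _; set H := (X in (X -> _) -> _).
  have hH : H.
    apply: filterS ae_periodic_swap => y hy.
    have msec : measurable (xsection (T i j q) y) by exact: measurable_xsection.
    (* The exceptional null set is the event itself when its probability is 0, and its complement
       when it is 1. *)
    have [p0|p1] := mixing_zero_one i j q hy.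
      exists (xsection (T i j q) y); split => // w /= /contrapT h; rewrite /xsection /= mem_set//.
      apply: contrapT => nT; apply: h; rewrite /D /= indicE memNset// p0 /= subrr//.
    exists (~` xsection (T i j q) y); split; first exact: measurableC.
      have pc : P (~` xsection (T i j q) y) = 0%E by rewrite probability_setC// p1 subee.
      exact: pc.
    move=> w /= /contrapT h; rewrite /xsection /= => Tw; apply: h.
    rewrite inE in Tw; by rewrite /D /= indicE mem_set// p1 /= subrr.
  move=> /(_ hH); apply: filterS => w; apply: filterS => y /= hw.
  rewrite -indE; apply/eqP; rewrite -subr_eq0; apply/eqP; apply: contrapT => h; exact: hw.
(* Rationals are enumerated through [unpickle], so that the countable intersection of almost sure
   events applies. *)
have : {ae P, forall w, forall n : nat, forall i j, {ae leb, forall y,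
    (A y w i j < ratr (odflt 0 (unpickle n : option rat)))%R%:R =
    fine (P (xsection (T i j (odflt 0 (unpickle n))) y))}}.
  by apply: ae_foralln => n; apply: filter_forall => i; apply: filter_forall => j; exact: key.
apply: filterS => w hw.
have : {ae leb, forall y, forall n : nat, forall i j,
    (A y w i j < ratr (odflt 0 (unpickle n : option rat)))%R%:R =
    fine (P (xsection (T i j (odflt 0 (unpickle n))) y))}.
  by apply: ae_foralln => n; apply: filter_forall => i; apply: filter_forall => j; exact: hw.
by apply: filterS => y hy i j q; have := hy (pickle q) i j; rewrite pickleK.
Qed.

Lemma deterministic_eq w w' :
  {ae leb, forall y, forall i j (q : rat), (A y w i j < ratr q)%R%:R = fine (P (xsection (T i j q) y))} ->
  {ae leb, forall y, forall i j (q : rat), (A y w' i j < ratr q)%R%:R = fine (P (xsection (T i j q) y))} ->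
  {ae leb, forall y, A y w = A y w'}.
Proof.
apply: filterS2 => y h h'; apply/matrixP => i j.
have key (q : rat) : (A y w i j < ratr q) = (A y w' i j < ratr q).
  have : (A y w i j < ratr q)%R%:R = (A y w' i j < ratr q)%R%:R :> R by rewrite h h'.
  by move=> /eqP; rewrite eqr_nat; case: (_ < _); case: (_ < _).
have [lt1|lt1|//] := ltgtP (A y w i j) (A y w' i j).
  have [q] := rat_in_itvoo lt1; rewrite in_itv/= => /andP[h1 h2].
  by move: (key q); rewrite h1 => /esym h3; have := lt_trans h3 h2; rewrite ltxx.
have [q] := rat_in_itvoo lt1; rewrite in_itv/= => /andP[h1 h2].
by move: (key q); rewrite h1 => h3; have := lt_trans h3 h2; rewrite ltxx.
Qed.

End mixing.

(** * Cell data of a realization, and the approximate homogenized solution *)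

Section cell_data.
Context {R : realType} {d : nat}.
Local Notation V := 'rV[R]_d.
Local Notation leb := (lebesgue_rV (R := R) d).
Variables (alpha L : R).
Hypotheses (a0 : 0 < alpha) (L0 : 0 <= L).

Definition flux_mean (delta : R) (b : V -> 'M[R]_d) (g : 'I_d -> V -> 'cV[R]_d) (X : 'M[R]_d) :=
  forall i j, delta ^+ d * X i j =
    ip leb (act b (fun l x => \1_(hcell delta) x * corr_grad j (g j) l x) i) \1_(hcell delta).

Lemma equivalent_dcorr (M : nat) (A : V -> 'M[R]_d) (X : 'M[R]_d) : (0 < M)%N -> mcoeff A ->
  equivalent_matrix M A X -> exists (N : 'I_d -> V -> R) (g : 'I_d -> V -> 'cV[R]_d),
  [/\ forall i, dcorr M%:R A i (N i) (g i), forall i k, measurable_fun setT (fun x => g i x k 0 : R) &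
  forall i j, M%:R ^+ d * X i j = \int[leb]_x (\1_(hcell M%:R) x *
     ((basis_vec i + g i x)^T *m A x *m (basis_vec j + g j x)) 0 0)].
Proof.
move=> M0 mb [N [g [cN XE]]]; exists N, g.
have mg i k : measurable_fun setT (fun x => g i x k 0 : R).
  by have [hN _ _] := cN i; have [_ lg _] := (H1locP _ _).1 hN; exact: (lg k).1.
split => // [i|i j]; first exact: corrector_dcorr.
rewrite XE cell_volume mulrA mulfV ?mul1r ?expf_neq0 ?pnatr_eq0 -?lt0n//.
apply: cell_hcell => //.
rewrite (_ : (fun x => _) = (fun x => dotv (A x *m (basis_vec j + g j x)) (basis_vec i + g i x))).
  by apply: measurable_flux => //; exact: measurable_basis_add.
by apply/funext => x; exact: ahat_integrandE.
Qed.

Lemma equivalent_unique (M : nat) (A A' : V -> 'M[R]_d) (X X' : 'M[R]_d) : (0 < M)%N ->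
  coeff alpha L A -> mcoeff A' -> {ae leb, forall x, A x = A' x} ->
  equivalent_matrix M A X -> equivalent_matrix M A' X' -> X = X'.
Proof.
move=> M0 cA mA' AA' hX hX'; have [mA _ _] := cA; have M0' : 0 < M%:R :> R by rewrite ltr0n.
have [N [g [h1 _ h3]]] := equivalent_dcorr M0 mA hX.
have [N' [g' [h1' _ h3']]] := equivalent_dcorr M0 mA' hX'.
exact: (Ahat_unique M0' cA mA' L0 a0 AA' h1 h1' h3 h3').
Qed.

Lemma cell_data (M : nat) (eps : R) (A : V -> 'M[R]_d) (X : 'M[R]_d) : (0 < M)%N -> 0 < eps ->
  coeff alpha L A -> cell_periodic M A -> equivalent_matrix M A X ->
  [/\ coeff alpha L (fun x => A (eps^-1 *: x)),
      forall i j, lperiodic (eps * M%:R) (fun x => A (eps^-1 *: x) i j),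
      exists (N : 'I_d -> V -> R) (g : 'I_d -> V -> 'cV[R]_d),
        (forall i, dcorr (eps * M%:R) (fun x => A (eps^-1 *: x)) i (N i) (g i)) /\
        flux_mean (eps * M%:R) (fun x => A (eps^-1 *: x)) g X,
      forall i j, `|X i j| <= L * (1 + d%:R * L / alpha) &
      forall xi : 'cV[R]_d, alpha * dotv xi xi <= dotv (X *m xi) xi].
Proof.
move=> M0 e0 cA pA hX; have M0' : 0 < M%:R :> R by rewrite ltr0n.
have [mA bA eA] := cA; have ei : 0 < eps^-1 by rewrite invr_gt0.
have [N [g [cN mg XE]]] := equivalent_dcorr M0 mA hX.
have -> : (fun x => A (eps^-1 *: x)) = (fun x => A (eps^-1 *: x + 0)).
  by apply/funext => x; rewrite addr0.
have de0 : 0 < eps * M%:R by rewrite mulr_gt0.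
have cb : coeff alpha L (fun x => A (eps^-1 *: x + 0)).
  split; [|exact: (ae_affine 0 ei bA)|exact: (ae_affine 0 ei eA)].
  by move=> i j; exact: (measurableT_comp (mA i j) (measurable_affine eps^-1 0)).
have cN' i := dcorr_scale e0 mA (cN i).
have XE' := Ahat_scale e0 mA mg XE.
split => //.
- move=> i j; have pAij : lperiodic M%:R (fun x => A x i j : R).
    by move=> k; apply: filterS (pA k) => x ->.
  have := lperiodic_scale e0 pAij; congr (lperiodic _ _).
  by apply/funext => x; rewrite addr0.
- exists (fun i x => eps * N i (eps^-1 *: x + 0)), (fun i x => g i (eps^-1 *: x + 0)); split => //.
  by move=> i j; exact: (Ahat_flux de0 cb L0 cN' XE').
- exact: (Ahat_bound de0 cb L0 a0 cN' XE').
- move=> xi; exact: (Ahat_coercive de0 cb L0 a0 cN' XE' xi).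
Qed.

Lemma coeff_cst (X : 'M[R]_d) : (forall i j, `|X i j| <= L) ->
  (forall xi : 'cV[R]_d, alpha * dotv xi xi <= dotv (X *m xi) xi) -> coeff alpha L (fun _ : V => X).
Proof.
move=> h1 h2; split; [by move=> i j; exact: measurable_cst|by apply: aeW => x i j|by apply: aeW => x xi].
Qed.

Lemma coeffW (L' : R) (A : V -> 'M[R]_d) : L <= L' -> coeff alpha L A -> coeff alpha L' A.
Proof.
move=> LL' [h1 h2 h3]; split => //; apply: filterS h2 => x hx i j; exact: le_trans (hx i j) LL'.
Qed.

(** The solution for Ak is replaced by a test function U that solves the same equation up to a
    functional small in the gradient. The gradient bound involves Ak only through alpha and L, which
    makes it uniform over the class of matrices. *)
Lemma approx_target (D : set V) (r e1 : R) (i0 : 'I_d) (f uk : V -> R) (Ak : 'M[R]_d) :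
  measurable D -> 0 < r -> D `<=` [set x | `|x| <= r] -> 0 < e1 -> L2 D f ->
  coeff alpha L (fun=> Ak) -> dirichlet_solution D (fun=> Ak) f uk ->
  exists U : V -> R, [/\ test_function D U,
    forall w, test_function D w ->
      `|ip leb (fun x => \1_D x * f x) w - \sum_k \sum_l Ak k l * ip leb (partial l U) (partial k w)| <=
      L * (d%:R * e1) * \sum_k nrm leb (partial k w) &
    \sum_l nrm leb (partial l U) <=
      d%:R * (nrm leb (fun x => \1_D x * f x) * (2 * r + 1) + L * (d%:R * e1)) / alpha].
Proof.
move=> mD r0 DB e10 lf cA [gk hk ek]; have [U [tU _ nU]] := H10_approx mD hk e10; exists U.
pose G l x := \1_D x * gk x l 0; pose E l x := \1_D x * (partial l U x - gk x l 0).
have lG l : inL2 leb (G l) by have [[_ h _] _] := hk; exact: L2_inL2.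
have lU l := test_inL2 (test_partial l tU).
have EE l : partial l U = fun x => G l x + E l x.
  apply/funext => x; rewrite /G /E -mulrDr addrC subrK.
  by rewrite (congr1 (fun f => f x) (test_cut (test_partial l tU))).
have lE l : inL2 leb (E l).
  have := inL2B (lU l) (lG l); congr (inL2 _ _); apply/funext => x; rewrite {1}EE /=; ring.
have nE : \sum_l nrm leb (E l) <= d%:R * e1 by apply: sum_const_le => l; exact: nU.
have actU k : act (fun _ : V => Ak) (fun l => partial l U) k =
    fun x => act (fun _ : V => Ak) G k x + act (fun _ : V => Ak) E k x.
  apply/funext => x; rewrite /act -big_split/=; apply: eq_bigr => l _.
  by rewrite -mulrDr EE.
have laG k := (inL2_act cA L0 k lG).1; have laE k := (inL2_act cA L0 k lE).1.
have formU w k : inL2 leb (partial k w) -> \sum_l Ak k l * ip leb (partial l U) (partial k w) =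
    ip leb (act (fun _ : V => Ak) (fun l => partial l U) k) (partial k w).
  move=> lw; rewrite /act (ip_suml _ (fun l _ => inL2Z (Ak k l) (lU l)) lw).
  by apply: eq_bigr => l _; rewrite (ipZl _ (lU l) lw).
have hU w : test_function D w ->
      `|ip leb (fun x => \1_D x * f x) w - \sum_k \sum_l Ak k l * ip leb (partial l U) (partial k w)| <=
      L * (d%:R * e1) * \sum_k nrm leb (partial k w).
  move=> tw; have lw k := test_inL2 (test_partial k tw).
  have s_eq : \sum_k ip leb (act (fun _ : V => Ak) G k) (partial k w) = ip leb (fun x => \1_D x * f x) w :=
    solution_eq mD cA L0 lf hk ek tw.
  rewrite -s_eq -sumrB (eq_bigr (fun k => - ip leb (act (fun _ : V => Ak) E k) (partial k w))); last first.
    move=> k _; rewrite (formU w k (lw k)) actU (ipDl (laG k) (laE k) (lw k)).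
    by rewrite opprD addrA subrr add0r.
  rewrite sumrN normrN; apply: (le_trans (ler_norm_sum _ _ _)); rewrite mulr_sumr.
  apply: ler_sum => k _; apply: (le_trans (ip_le (laE k) (lw k))).
  rewrite ler_wpM2r ?nrm_ge0//; apply: (le_trans (inL2_act cA L0 k lE).2).
  by rewrite ler_wpM2l.
split => //.
have PC0 : 0 <= 2 * r + 1 by have := r0; lra.
apply: energy_absorb => //.
- by rewrite addr_ge0// !mulr_ge0 ?nrm_ge0// ltW.
- by move=> k; exact: nrm_ge0.
apply: (le_trans (ellipticity_ip cA L0 lU)).
have -> : \sum_k ip leb (act (fun _ : V => Ak) (fun l => partial l U) k) (partial k U) =
    \sum_k \sum_l Ak k l * ip leb (partial l U) (partial k U).
  by apply: eq_bigr => k _; rewrite (formU U k (lU k)).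
have h1 := hU U tU; have h2 := ip_le (L2_inL2 mD lf) (test_inL2 tU).
have UB x : U x != 0 -> `|x| <= r by move=> /(test_in tU)/DB.
have h3 := poincare i0 (test_setT tU) (ltW r0) UB.
have h4 := ler_wpM2l (nrm_ge0 leb (fun x => \1_D x * f x)) h3.
move: h1 h2 h4; rewrite !ler_norml => /andP[p1 p2] /andP[p3 p4] p5; rewrite mulrDl -mulrA; lra.
Qed.

End cell_data.

(** * Classes of matrices, deterministic homogenized data, and the limit *)

Section final.
Context {R : realType} {d : nat}.
Local Notation V := 'rV[R]_d.
Local Notation leb := (lebesgue_rV (R := R) d).

Lemma delta_small (C sigma t : R) : 0 < C -> sigma < 1 -> 0 < t ->
  exists2 rho, 0 < rho & forall eps M, cell_size C sigma eps M -> eps < rho -> eps * M%:R <= t.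
Proof.
move=> C0 s1 t0; have s0 : 0 < 1 - sigma by rewrite subr_gt0.
have tC : 0 < t / C by rewrite divr_gt0.
exists ((t / C) `^ (1 - sigma)^-1); first exact: powR_gt0.
move=> eps M [e0 _ ->] lt.
have -> : eps * (C * eps `^ (- sigma)) = C * eps `^ (1 - sigma).
  by rewrite powRD ?gt_eqF ?implybT// powRr1 ?ltW// mulrCA.
have : eps `^ (1 - sigma) < ((t / C) `^ (1 - sigma)^-1) `^ (1 - sigma).
  by apply: gt0_ltr_powR => //; rewrite nnegrE ?powR_ge0// ltW.
rewrite -powRrM mulVf ?gt_eqF// powRr1; last exact: ltW.
by rewrite ltr_pdivlMr// mulrC => /ltW.
Qed.

Lemma truncn_close (x y : R) : 0 <= x -> 0 <= y -> Num.truncn x = Num.truncn y -> `|x - y| <= 1.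
Proof.
move=> x0 y0 e; have /andP[h1 h2] := truncn_itv x0; have /andP[h3 h4] := truncn_itv y0.
rewrite e in h1 h2; rewrite -natr1 in h2; rewrite -natr1 in h4.
by rewrite ler_norml; apply/andP; split; lra.
Qed.

(** Each entry is sorted into a bucket of length tau by the integer part of (X + B)/tau. [inord]
    gives an arbitrary bucket to entries out of range, which are never compared. *)
Lemma finite_classes (B tau : R) : 0 <= B -> 0 < tau -> exists (T : finType) (cl : 'M[R]_d -> T),
  forall X Y : 'M[R]_d, (forall i j, `|X i j| <= B) -> (forall i j, `|Y i j| <= B) ->
  cl X = cl Y -> forall i j, `|X i j - Y i j| <= tau.
Proof.
move=> B0 t0; pose n := (Num.truncn (2 * B / tau)).+1.
exists {ffun 'I_d * 'I_d -> 'I_n.+1},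
  (fun X => [ffun p => inord (Num.truncn ((X p.1 p.2 + B) / tau))]) => X Y hX hY /ffunP h i j.
have ge0 (Z : 'M[R]_d) : (forall i j, `|Z i j| <= B) -> 0 <= (Z i j + B) / tau <= 2 * B / tau.
  move=> /(_ i j); rewrite ler_norml => /andP[h1 h2]; apply/andP; split.
    by apply: divr_ge0; [lra|exact: ltW].
  by rewrite ler_pM2r ?invr_gt0//; lra.
have /andP[x0 x1] := ge0 _ hX; have /andP[y0 y1] := ge0 _ hY.
have lt (z : R) : 0 <= z -> z <= 2 * B / tau -> (Num.truncn z < n.+1)%N.
  move=> z0 z1; rewrite /n ltnS; apply: leqW; exact: le_truncn.
have := congr1 val (h (i, j)); rewrite !ffunE /= !inordK ?lt// => /(truncn_close x0 y0).
rewrite -mulrBl opprD addrACA subrr addr0 normrM (gtr0_norm (x := tau^-1)) ?invr_gt0//.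
by rewrite ler_pdivrMr// mul1r.
Qed.

Lemma sqL2_difference (D : set V) (v1 v2 U : V -> R) (X : R) : measurable D ->
  L2 D v1 -> L2 D v2 -> test_function D U -> 0 <= X ->
  nrm leb (fun x => \1_D x * (v1 x - U x)) <= X ->
  nrm leb (fun x => \1_D x * (v2 x - U x)) <= X ->
  (sqL2 D (fun x => v1 x - v2 x)%R <= ((2 * X) ^+ 2)%:E)%E.
Proof.
move=> mD l1 l2 tU X0 n1 n2.
have i1 := L2_inL2 mD l1; have i2 := L2_inL2 mD l2; have iU := test_inL2 tU.
have e (v : V -> R) : inL2 leb (fun x => \1_D x * v x) -> inL2 leb (fun x => \1_D x * (v x - U x)).
  move=> iv; have := inL2B iv iU; congr (inL2 _ _); apply/funext => x.
  by rewrite mulrBr (congr1 (fun f => f x) (test_cut tU)).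
have d12 : (fun x => \1_D x * (v1 x - v2 x)) =
    (fun x => \1_D x * (v1 x - U x) - \1_D x * (v2 x - U x)).
  by apply/funext => x; rewrite -mulrBr opprB addrA subrK.
have l12 : inL2 leb (fun x => \1_D x * (v1 x - v2 x)) by rewrite d12; apply: inL2B; exact: e.
have -> : sqL2 D (fun x => v1 x - v2 x)%R = (nrm leb (fun x => \1_D x * (v1 x - v2 x)) ^+ 2)%:E.
  rewrite -integral_sqrE// [LHS]integral_mkcond; apply: eq_integral => x _.
  by rewrite /patch indicE; case: (x \in D); rewrite ?mul1r// mul0r expr0n.
rewrite lee_fin; apply: lerXn2r; rewrite ?nnegrE ?nrm_ge0 ?mulr_ge0//.
rewrite d12; apply: (le_trans (nrmB_le (e _ i1) (e _ i2))); rewrite mulrDl mul1r; exact: lerD.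
Qed.

(** The absolute value of L supplies the sign condition that the estimates require. *)
Lemma coeff_random dO (Omega : measurableType dO) (P : probability Omega R) (alpha beta L : R)
    (A : V -> Omega -> 'M[R]_d) : random_coefficient P L A -> elliptic P alpha beta A ->
  {ae P, forall w, coeff alpha `|L| (fun y => A y w)}.
Proof.
move=> [mA _ bA] eA; apply: filterS2 bA eA => w b e; split.
- by move=> i j; exact: measurable_section_w mA w i j.
- by apply: filterS b => y h i j; exact: le_trans (h i j) (ler_norm L).
- by apply: filterS e => y h xi; have /andP[] := h xi.
Qed.

End final.

Lemma homogenized_data (R : realType) (d : nat) (D : set 'rV[R]_d) (dO : measure_display)
  (Omega : measurableType dO) (P : probability Omega R) (C sigma alpha beta L c theta : R)
  (f : 'rV[R]_d -> R) (i0 : 'I_d) (A : R -> 'rV[R]_d -> Omega -> 'M[R]_d) (Ahat : R -> Omega -> 'M[R]_d)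
  (u : R -> Omega -> 'rV[R]_d -> R) (eps : R) (M : nat) :
  0 < alpha -> 0 < c -> 0 < theta ->
  (cell_size C sigma eps M -> random_coefficient P L (A eps)) ->
  (cell_size C sigma eps M -> elliptic P alpha beta (A eps)) ->
  (cell_size C sigma eps M -> forall s : R, 0 < s ->
     (mixing_coefficient P (A eps) s <= (c * (1 + s) `^ (- theta))%:E)%E) ->
  (cell_size C sigma eps M -> {ae P, forall w, cell_periodic M (fun y => A eps y w)}) ->
  (cell_size C sigma eps M -> {ae P, forall w, equivalent_matrix M (fun y => A eps y w) (Ahat eps w)}) ->
  (cell_size C sigma eps M -> {ae P, forall w,
     dirichlet_solution D (fun x => A eps (eps^-1 *: x) w) f (u eps w)}) ->
  cell_size C sigma eps M ->
    [/\ forall i j, `|expected_matrix P (Ahat eps) i j| <= `|L| * (1 + d%:R * `|L| / alpha),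
      forall xi : 'cV[R]_d, alpha * dotv xi xi <= dotv (expected_matrix P (Ahat eps) *m xi) xi &
    {ae P, forall w, [/\ dirichlet_solution D (fun x => A eps (eps^-1 *: x) w) f (u eps w),
      coeff alpha `|L| (fun x => A eps (eps^-1 *: x) w),
      forall i j, lperiodic (eps * M%:R) (fun x => A eps (eps^-1 *: x) w i j) &
      exists (N : 'I_d -> 'rV[R]_d -> R) (g : 'I_d -> 'rV[R]_d -> 'cV[R]_d),
        (forall i, dcorr (eps * M%:R) (fun x => A eps (eps^-1 *: x) w) i (N i) (g i)) /\
        flux_mean (eps * M%:R) (fun x => A eps (eps^-1 *: x) w) g (expected_matrix P (Ahat eps))]}].
Proof.
move=> a0 c0 t0 rA eA mixA pA hA hu hs; have [e0 M0 _] := hs.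
have [mA _ _] := rA hs; have L0 : 0 <= `|L| by exact: normr_ge0.
have cw := coeff_random (rA hs) (eA hs).
have gp := coefficient_deterministic i0 M0 c0 t0 mA (mixA hs) (pA hs).
have ms w : mcoeff (fun y => A eps y w) by move=> i j; exact: measurable_section_w mA w i j.
have p1 := pA hs; have u1 := hu hs; have q1 := hA hs.
have good := ae_and cw (ae_and p1 (ae_and u1 (ae_and q1 gp))).
(* One good realization serves as reference: almost every other has the same coefficients, hence the
   same [Ahat], whose expectation is thus its value at w0. *)
have [w0 [cw0 [p0 [_ [q0 g0]]]]] := ae_nonempty good.
have EA w : equivalent_matrix M (fun y => A eps y w) (Ahat eps w) ->
    {ae lebesgue_rV d, forall y, A eps y w0 = A eps y w} -> Ahat eps w = Ahat eps w0.
  by move=> q ae; apply/esym; exact: (equivalent_unique a0 L0 M0 cw0 (ms w) ae q0 q).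
have EE : expected_matrix P (Ahat eps) = Ahat eps w0.
  apply/matrixP => i j; rewrite mxE (@expectation_ae_cst _ _ _ P _ (Ahat eps w0 i j))//.
  apply: filterS good => w [cw' [_ [_ [q g]]]]; rewrite (EA w) //; exact: deterministic_eq g0 g.
have [_ _ _ b1 b2] := cell_data a0 L0 M0 e0 cw0 p0 q0.
rewrite EE; split => //; apply: filterS good => w [cw' [p [su [q g]]]].
have [k1 k2 k3 _ _] := cell_data a0 L0 M0 e0 cw' p q.
have Ew : Ahat eps w = Ahat eps w0 by apply: EA => //; exact: deterministic_eq g0 g.
by split => //; rewrite -Ew.
Qed.

Unset Implicit Arguments.
Set Strict Implicit.
Set Printing Implicit Defensive.

Theorem theorem4p6 (R : realType) (d : nat) (hd : (1 <= d <= 3)%N)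
  (D : set 'rV[R]_d)
  (D_open : open D) (D_connected : connected D)
  (D_nonempty : D !=set0) (D_bounded : bounded_set D)
  (dO : measure_display) (Omega : measurableType dO) (P : probability Omega R)
  (tau : 'rV[int]_d -> Omega -> Omega) (tau_ergodic : ergodic_action P tau)
  (C sigma : R) (C_gt0 : 0 < C) (sigma_gt0 : 0 < sigma) (sigma_lt1 : sigma < 1)
  (f : 'rV[R]_d -> R) (f_L2 : L2 D f)
  (alpha beta L c theta : R)
  (alpha_gt0 : 0 < alpha) (alpha_le_beta : alpha <= beta)
  (c_gt0 : 0 < c) (theta_gt0 : 0 < theta)
  (* The period M tends to infinity as eps tends to 0, so the coefficient     *)
  (* field is indexed by eps; the constants do not depend on eps.             *)
  (A : R -> 'rV[R]_d -> Omega -> 'M[R]_d)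
  (Ahat : R -> Omega -> 'M[R]_d)
  (u : R -> Omega -> 'rV[R]_d -> R) (u0 : R -> 'rV[R]_d -> R)
  (A_random : forall eps M, cell_size C sigma eps M ->
     random_coefficient P L (A eps))
  (A_elliptic : forall eps M, cell_size C sigma eps M ->
     elliptic P alpha beta (A eps))
  (A_stationary : forall eps M, cell_size C sigma eps M ->
     stationary P tau (A eps))
  (A_mixing : forall eps M, cell_size C sigma eps M ->
     forall s : R, 0 < s ->
       (mixing_coefficient P (A eps) s <= (c * (1 + s) `^ (- theta))%:E)%E)
  (A_periodic : forall eps M, cell_size C sigma eps M ->
     {ae P, forall w, cell_periodic M (fun y => A eps y w)})
  (Ahat_equivalent : forall eps M, cell_size C sigma eps M ->
     {ae P, forall w, equivalent_matrix M (fun y => A eps y w) (Ahat eps w)})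
  (u_solution : forall eps M, cell_size C sigma eps M ->
     {ae P, forall w,
       dirichlet_solution D (fun x => A eps (eps^-1 *: x) w) f (u eps w)})
  (u0_solution : forall eps M, cell_size C sigma eps M ->
     dirichlet_solution D (fun=> expected_matrix P (Ahat eps)) f (u0 eps)) :
  (\int[P]_w sqL2 D (fun x => u eps w x - u0 eps x)%R)%E
    @[eps --> within [set eps | exists M, cell_size C sigma eps M] (nbhs 0)]
    --> 0%E.
Proof.
have d1 : (0 < d)%N by case/andP: hd.
pose i0 : 'I_d := Ordinal d1.
have [r r0 DB] : exists2 r : R, 0 < r & D `<=` [set x | `|x| <= r].
  have [B [_ hB]] := D_bounded; exists (`|B| + 1); first by rewrite ltr_pwDr.
  by move=> x Dx; apply: (hB (`|B| + 1) _ x Dx); rewrite (le_lt_trans (ler_norm B))// ltrDl.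
have mD : measurable D := open_measurable_rV D_open.
pose L1 := `|L|; have L10 : 0 <= L1 by exact: normr_ge0.
pose LA := L1 * (1 + d%:R * L1 / alpha).
have dR0 : 0 <= d%:R :> R by [].
have LA0 : 0 <= LA.
  by apply: mulr_ge0 => //; apply: addr_ge0 => //; apply: divr_ge0; [exact: mulr_ge0|exact: ltW].
(* A common bound for the oscillating coefficients and for the homogenized matrices, since
   [main_estimate] takes one constant for both and is applied to both problems. *)
pose L2c := L1 + LA; have L20 : 0 <= L2c by exact: addr_ge0.
have LAL : LA <= L2c by rewrite lerDr.
have L1L : L1 <= L2c by rewrite lerDl.
pose E eps := expected_matrix P (Ahat eps).
have key eps M : cell_size C sigma eps M ->
    [/\ forall i j, `|E eps i j| <= LA, forall xi : 'cV[R]_d, alpha * dotv xi xi <= dotv (E eps *m xi) xi &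
    {ae P, forall w, [/\ dirichlet_solution D (fun x => A eps (eps^-1 *: x) w) f (u eps w),
      coeff alpha L1 (fun x => A eps (eps^-1 *: x) w),
      forall i j, lperiodic (eps * M%:R) (fun x => A eps (eps^-1 *: x) w i j) &
      exists (N : 'I_d -> 'rV[R]_d -> R) (g : 'I_d -> 'rV[R]_d -> 'cV[R]_d),
        (forall i, dcorr (eps * M%:R) (fun x => A eps (eps^-1 *: x) w) i (N i) (g i)) /\
        flux_mean (eps * M%:R) (fun x => A eps (eps^-1 *: x) w) g (E eps)]}].
  exact: (homogenized_data i0 alpha_gt0 c_gt0 theta_gt0 (A_random _ _) (A_elliptic _ _)
    (A_mixing _ _) (A_periodic _ _) (Ahat_equivalent _ _) (u_solution _ _)).
pose F eps : \bar R := (\int[P]_w sqL2 D (fun x => u eps w x - u0 eps x)%R)%E.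
have s0 eps w : (0 <= sqL2 D (fun x => u eps w x - u0 eps x)%R)%E.
  by apply: integral_ge0 => x _; rewrite lee_fin sqr_ge0.
have F0 eps : (0 <= F eps)%E by apply: integral_ge0 => w _; exact: s0.
(* Nonnegative extended reals eventually below each eta: finiteness comes from eta = 1, the limit
   from the rest. *)
suff H (eta : R) : 0 < eta ->
    \forall eps \near within [set eps | exists M, cell_size C sigma eps M] (nbhs (0 : R)), (F eps <= eta%:E)%E.
  apply/fine_cvgP; split.
    apply: filterS (H 1 ltr01) => eps h.
    by rewrite ge0_fin_numE; [exact: le_lt_trans h (ltry _)|exact: F0].
  apply/cvgrPdist_le => e e0; apply: filterS (H e e0) => eps h /=.
  have fF : F eps \is a fin_num by rewrite ge0_fin_numE; [exact: le_lt_trans h (ltry _)|exact: F0].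
  rewrite sub0r normrN ger0_norm; last by apply: fine_ge0; exact: F0.
  by rewrite -lee_fin (fineK fF).
(* Both u^eps and u_0^0 will be within e/2 of the same U, so the squared distance is at most e^2 =
   eta. The budget e/2 is split as e/8 for the defect of U, e/8 for the size of the classes and e/4
   for the period. *)
move=> eta0; pose e := Num.sqrt eta; have e0 : 0 < e by rewrite sqrtr_gt0.
pose K0 := (2 * r + 1) * (d%:R / alpha).
have PC0 : 0 <= 2 * r + 1 by lra.
have K00 : 0 <= K0 by apply: mulr_ge0 => //; apply: divr_ge0 => //; exact: ltW.
pose FN := nrm (lebesgue_rV d) (fun x => \1_D x * f x).
have FN0 : 0 <= FN by exact: nrm_ge0.
pose m := Num.min 1 (e / (8 * (K0 + 1))).
have K1 : 0 < 8 * (K0 + 1) by lra.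
have m0 : 0 < m by rewrite lt_min ltr01 divr_gt0.
have Ld0 : 0 <= L2c * d%:R by exact: mulr_ge0.
have Ld1 : 0 < L2c * d%:R + 1 by lra.
pose e1 := m / (L2c * d%:R + 1); have e10 : 0 < e1 by rewrite divr_gt0.
pose eta1 := L2c * (d%:R * e1).
have eta10 : 0 <= eta1 by apply: mulr_ge0 => //; apply: mulr_ge0 => //; exact: ltW.
have eta1m : eta1 <= m.
  rewrite /eta1 /e1 !mulrA ler_pdivrMr// mulrC; have := ltW m0; nra.
have eta11 : eta1 <= 1 by apply: (le_trans eta1m); rewrite ge_min lexx.
have eta12 : eta1 <= e / (8 * (K0 + 1)) by apply: (le_trans eta1m); rewrite ge_min lexx orbT.
(* The gradient bound of [approx_target] with its defect replaced by 1. Fixing it before U is chosen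
   avoids a circle: the class size [tau1] depends on [SU], and U depends on the class. *)
pose SU := d%:R * (FN * (2 * r + 1) + 1) / alpha.
have SU0 : 0 <= SU.
  apply: divr_ge0; last exact: ltW.
  by apply: mulr_ge0 => //; apply: addr_ge0 => //; exact: mulr_ge0.
have KS0 : 0 <= K0 * SU by exact: mulr_ge0.
pose tau1 := e / (8 * (K0 * SU + 1)).
have tau10 : 0 < tau1 by rewrite divr_gt0// mulr_gt0//; lra.
have [T [cl hcl]] := @finite_classes R d LA tau1 LA0 tau10.
suff Hk (k : T) : \forall eps \near within [set eps | exists M, cell_size C sigma eps M] (nbhs (0 : R)),
    cl (E eps) = k -> (F eps <= eta%:E)%E.
  have Hall : \forall eps \near within [set eps | exists M, cell_size C sigma eps M] (nbhs (0 : R)),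
      forall k, cl (E eps) = k -> (F eps <= eta%:E)%E by apply: filter_forall.
  by apply: filterS Hall => eps h; exact: (h _ erefl).
(* A class met by no admissible eps is vacuous. Otherwise any eps in it, not necessarily small,
   supplies the matrix for which U is built. *)
have [[eK [MK [hsK clK]]]|no] := pselect (exists eps M, cell_size C sigma eps M /\ cl (E eps) = k); last first.
  suff : nbhs (0 : R) [set eps | (exists M, cell_size C sigma eps M) ->
      cl (E eps) = k -> (F eps <= eta%:E)%E] by [].
  apply: (filterS _ (nbhsx_ballx (0 : R) 1 ltr01)) => eps _ [M hs] ck.
  by exfalso; apply: no; exists eps, M.
have [b1 b2 _] := key _ _ hsK.
have cAk : coeff alpha L2c (fun _ : 'rV[R]_d => E eK).
  by apply: coeff_cst => // i j; exact: le_trans (b1 i j) LAL.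
have [U [tU hU nU]] := approx_target alpha_gt0 L20 i0 mD r0 DB e10 f_L2 cAk (u0_solution _ _ hsK).
have nU' : \sum_l nrm (lebesgue_rV d) (partial l U) <= SU.
  apply: (le_trans nU); rewrite /SU ler_pM2r ?invr_gt0// ler_wpM2l// lerD2l; exact: eta11.
have [CU CU0 est] := main_estimate i0 mD r0 DB alpha_gt0 L20 tU.
pose t := Num.min 1 (e / (4 * (CU + 1))).
have CU1 : 0 < 4 * (CU + 1) by lra.
have t0 : 0 < t by rewrite lt_min ltr01 divr_gt0.
have [rho rho0 hrho] := delta_small C_gt0 sigma_lt1 t0.
suff : nbhs (0 : R) [set eps | (exists M, cell_size C sigma eps M) ->
    cl (E eps) = k -> (F eps <= eta%:E)%E] by [].
apply: (filterS _ (nbhsx_ballx (0 : R) rho rho0)) => eps.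
rewrite -ball_normE /= sub0r normrN => he [M hs] ck.
have [ep0 M0 _] := hs; have [h1 h2 h3] := key _ _ hs.
pose delta := eps * M%:R.
have d0 : 0 < delta by rewrite mulr_gt0// ltr0n.
have dt : delta <= t by apply: hrho => //; exact: le_lt_trans (ler_norm _) he.
have dl1 : delta <= 1 by apply: (le_trans dt); rewrite ge_min lexx.
have dl2 : delta <= e / (4 * (CU + 1)) by apply: (le_trans dt); rewrite ge_min lexx orbT.
have absorb (a x k' : R) : 0 <= a -> 0 <= x -> 0 < k' -> x <= e / (k' * (a + 1)) -> a * x <= e / k'.
  move=> a' x0 k0'; have a1 : 0 < a + 1 by lra.
  rewrite !ler_pdivlMr ?mulr_gt0// => hx; nra.
have Xb : K0 * (eta1 + tau1 * SU) + CU * delta <= e / 2.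
  have q1 := absorb K0 eta1 8 K00 eta10 ltac:(by []) eta12.
  have q2 := absorb (K0 * SU) tau1 8 KS0 (ltW tau10) ltac:(by []) (lexx _).
  have q3 := absorb CU delta 4 CU0 (ltW d0) ltac:(by []) dl2.
  have -> : K0 * (eta1 + tau1 * SU) + CU * delta = K0 * eta1 + K0 * SU * tau1 + CU * delta by ring.
  lra.
have Eb i j : `|E eps i j| <= L2c by exact: le_trans (h1 i j) LAL.
have Ec i j : `|E eps i j - E eK i j| <= tau1 by apply: hcl => //; rewrite ck clK.
(* The same estimate for u_0^0: constant coefficients, zero correctors, and the cell of side
   delta. *)
have n0 := est delta (fun=> E eps) f (u0 eps) (fun _ _ => 0) (fun _ _ => 0) (E eps) (E eK) eta1 tau1 SU nU'
  d0 dl1 (coeff_cst Eb h2) (fun i j k => aeW _ (fun x => erefl)) (dcorr_cst (E eps) d0) Eb (flux_cst (E eps) d0) Ec eta10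
  (ltW tau10) f_L2 (u0_solution _ _ hs) hU.
have L2u v b : dirichlet_solution D b f v -> L2 D v by move=> [g [[]]].
have e20 : 0 <= e / 2 by lra.
have -> : eta = (2 * (e / 2)) ^+ 2 by rewrite mulrCA mulfV ?mulr1 ?sqr_sqrtr// ltW.
apply: ge0_integral_ae_le; [by move=> w; exact: s0|exact: sqr_ge0|].
apply: filterS h3 => w [sw cw pw [N [g [cN fN]]]].
apply: (sqL2_difference mD (L2u _ _ sw) (L2u _ _ (u0_solution _ _ hs)) tU e20); last exact: le_trans n0 Xb.
apply: le_trans Xb.
exact: (est delta _ f _ N g (E eps) (E eK) eta1 tau1 SU nU' d0 dl1 (coeffW L1L cw) pw cN Eb fN Ec eta10
  (ltW tau10) f_L2 sw hU).
Qed.
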